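(* For $A=\begin{pmatrix}a&b\\c&d\end{pmatrix}\in\mathrm{SL}_2(\mathbb Z)$, $z\in\mathbb C$ and $\tau\in\mathcal D_A$, $$\sigma_A(z,\tau)\sigma_A(-z,\tau)=\psi^2(A)\,\frac{e\!\big(\frac{z}{2(c\tau+d)}\big)-e\!\big(-\frac{z}{2(c\tau+d)}\big)}{e(\frac z2)-e(-\frac z2)}\,e\!\Big(\frac{\tau-A\cdot\tau}{12}+\frac{cz^2}{2(c\tau+d)}\Big).$$
   Context: $e(z)=e^{2\pi iz}$; $A\cdot\tau=\frac{a\tau+b}{c\tau+d}$; $\varpi(z,\tau)=\prod_{k\ge0}(1-e(z+k\tau))$ for $\tau$ in the upper half plane $\mathbb H$. $\sigma_A(z,\tau)=\varpi(\frac{z}{c\tau+d},A\cdot\tau)/\varpi(z,\tau)$ on $\mathbb C\times\mathbb H$, meromorphically continued to $\mathbb C\times\mathcal D_A$, where $\mathcal D_A=\mathbb C\setminus(-\infty,-d/c]$ if $c>0$; $\mathbb C$ if $c=0,d>0$; $\mathbb H$ if $c=0,d<0$; $\mathbb C\setminus[-d/c,\infty)$ if $c<0$. With $\eta(\tau)=e(\tau/24)\prod_{k\ge1}(1-e(k\tau))$, $\psi^2(A)$ is the constant with $\eta(A\cdot\tau)^2=\psi^2(A)(c\tau+d)\eta(\tau)^2$. *)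

(* Defs.v *)
From Stdlib Require Import Reals ZArith.
From Coquelicot Require Import Coquelicot.
Open Scope R_scope.

(* e(w) = exp(2 pi i w); writing w = x + i y, 2 pi i w = -2 pi y + i 2 pi x. *)
Definition e (w : C) : C :=
  (exp (- (2 * PI * Im w)) * cos (2 * PI * Re w),
   exp (- (2 * PI * Im w)) * sin (2 * PI * Re w)).

Definition inH (tau : C) : Prop := 0 < Im tau.

Fixpoint pprod (f : nat -> C) (n : nat) : C :=
  match n with
  | O => RtoC 1
  | S m => Cmult (pprod f m) (f m)
  end.

Definition infprod (f : nat -> C) : C :=
  @lim C_CompleteNormedModule (filtermap (pprod f) eventually).

Definition varpi (z tau : C) : C :=
  infprod (fun k => Cminus (RtoC 1) (e (Cplus z (Cmult (RtoC (INR k)) tau)))).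

Definition eta (tau : C) : C :=
  Cmult (e (Cdiv tau (RtoC 24)))
        (infprod (fun k => Cminus (RtoC 1) (e (Cmult (RtoC (INR (S k))) tau)))).

Definition mobius (a b c d : Z) (tau : C) : C :=
  Cdiv (Cplus (Cmult (RtoC (IZR a)) tau) (RtoC (IZR b)))
       (Cplus (Cmult (RtoC (IZR c)) tau) (RtoC (IZR d))).

Definition jac (c d : Z) (tau : C) : C := Cplus (Cmult (RtoC (IZR c)) tau) (RtoC (IZR d)).

Definition inD (c d : Z) (tau : C) : Prop :=
  ((c > 0)%Z /\ ~ (Im tau = 0 /\ Re tau <= - IZR d / IZR c)) \/
  (c = 0%Z /\ (d > 0)%Z) \/
  (c = 0%Z /\ (d < 0)%Z /\ 0 < Im tau) \/
  ((c < 0)%Z /\ ~ (Im tau = 0 /\ Re tau >= - IZR d / IZR c)).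

Definition connected2 (Om : C * C -> Prop) : Prop :=
  forall U V : C * C -> Prop, open U -> open V ->
    (forall p, Om p -> U p \/ V p) ->
    (forall p, Om p -> U p -> V p -> False) ->
    (exists p, Om p /\ U p) -> (exists p, Om p /\ V p) -> False.

Definition holo2 (Om : C * C -> Prop) (S : C -> C -> C) : Prop :=
  open Om /\
  forall p : C * C, Om p ->
    continuous (fun q : C * C => S (fst q) (snd q)) p /\
    @ex_derive C_AbsRing C_NormedModule (fun w => S w (snd p)) (fst p) /\
    @ex_derive C_AbsRing C_NormedModule (fun w => S (fst p) w) (snd p).

Definition sigma_continuation (a b c d : Z) (Om : C * C -> Prop) (S : C -> C -> C) : Prop :=
  (forall p, Om p -> inD c d (snd p)) /\
  connected2 Om /\
  holo2 Om S /\
  (exists p, Om p /\ inH (snd p)) /\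
  (forall z tau, Om (z, tau) -> inH tau -> varpi z tau <> RtoC 0 ->
     S z tau = Cdiv (varpi (Cdiv z (jac c d tau)) (mobius a b c d tau)) (varpi z tau)).

(* Main.v *)
Require Import Defs.
From Stdlib Require Import Reals ZArith Lra Lia Classical FunctionalExtensionality.
From Coquelicot Require Import Coquelicot.
Open Scope R_scope.

(** Factoring [varpi z t] row by row over the lattice points [m + n t] expresses it through the double
    product [Ffun z t] over [m, n >= 1], which still converges for [t] in the slit plane.  Since
    [Ffun (z / t) (/ t) = Ffun z t], the quotient [varpi (z / t) (- / t) / varpi z t] equals, up to a factor
    free of [z], a ratio [F / G] of functions holomorphic on C times the slit plane: the quadratic exponent is
    found from the quasi-periodicity of [sn (z / t) * varpi z t * varpi (- z) t / sn z], the linear one by evaluating at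
    [z = 1/2] and [z = t/2].  Writing [A = A' S T^k] with a smaller lower left entry, one gets for every [A]
    a pair [F, G] on C times D_A with [sigma_A = u F / G], [u] depending on [tau] only, and
    [F z * F (- z) * sn z = G z * G (- z) * sn (z / w) * e (c z^2 / (2 w))], where [w = c tau + d] and
    [sn z = e (z / 2) - e (- (z / 2))].  Letting [z -> 0] on the upper half plane gives
    [u^2 = psi2 * e ((tau - A tau) / 12)], and the identity theorem carries [S * G = u * F] to all of [Om].
    The detour through [F] and [G] is needed because [Om] need not be symmetric under [z -> - z], so that the
    product [S z tau * S (- z) tau] cannot be continued inside [Om]. *)

(** * Limits, continuity and complex derivatives *)

(** The product [varpi] diverges for real tau, so numerator and denominator of sigma cannot be
    continued separately. The lattice points m + n t with n >= 1 split by the sign of m into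
    products [Ffun (- z) t] and [Ffun z (- t)] and, for m = 0, a gamma type factor [bfun]. The
    factor [Ffun z (- t)], which breaks down on the positive reals, also occurs in
    [varpi (z / t) (- / t)] and cancels in the quotient; the rest converges as long as no nontrivial
    combination of 1 and t with nonnegative coefficients vanishes, that is, off the nonpositive
    reals. Convergence over a quadrant needs factors 1 + O(|m + n t|^-3), hence (1 - x) exp(x +
    x^2/2), and these corrections create the quadratic polynomial in the exponent. Its linear
    coefficient q is a series on the upper half plane only. The points z = 1/2 and z = t/2 yield exp
    q and exp(t q) as expressions valid on the slit plane, and q is the logarithmic derivative of
    the second minus t times that of the first, which involves no branch of the logarithm. The
    factor u is known only through its square; its sign is constant near one point, which suffices
    for the identity theorem. *)

Notation cderiv f z l := (@is_derive C_AbsRing C_NormedModule f z l).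
Notation cdiff f z := (@ex_derive C_AbsRing C_NormedModule f z).

(** Limits are measured with [Cmod], whereas the uniform structure of C is the product one, whose
    balls are squares. [filterlim_cvg] translates between the two. *)
Definition cvg {T : Type} (F : (T -> Prop) -> Prop) (f : T -> C) (l : C) : Prop :=
  forall eps, 0 < eps -> F (fun t => Cmod (f t - l)%C < eps).

Lemma Cmod_sub_comm (x y : C) : Cmod (x - y)%C = Cmod (y - x)%C.
Proof. rewrite <- Cmod_opp. f_equal. ring. Qed.

Lemma Cmod_triangle_sub (x y z : C) : Cmod (x - z)%C <= Cmod (x - y)%C + Cmod (y - z)%C.
Proof. replace (x - z)%C with ((x - y) + (y - z))%C by ring. apply Cmod_triangle. Qed.

Lemma Cmod_triangle_inv (x y : C) : Cmod x - Cmod y <= Cmod (x - y)%C.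
Proof.
  pose proof (Cmod_triangle (x - y)%C y) as H.
  replace (x - y + y)%C with x in H by ring. lra.
Qed.

Lemma im_le_Cmod (c : C) : Rabs (Im c) <= Cmod c.
Proof. apply Rle_trans with (2 := Rmax_Cmod c), Rmax_r. Qed.

Lemma Cmod_le_Re_Im (c : C) : Cmod c <= Rabs (Re c) + Rabs (Im c).
Proof.
  assert (E : c = (RtoC (Re c) + Ci * RtoC (Im c))%C)
    by (apply injective_projections; unfold Re, Im; simpl; ring).
  rewrite E at 1. apply Rle_trans with (1 := Cmod_triangle _ _).
  rewrite Cmod_mult, Cmod_Ci, !Cmod_R. lra.
Qed.

Lemma C_eq (x y : C) : Re x = Re y -> Im x = Im y -> x = y.
Proof. destruct x, y; unfold Re, Im; simpl; intros -> ->; reflexivity. Qed.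

Lemma locally_Cmod (z : C) (P : C -> Prop) :
  locally z P <-> exists d, 0 < d /\ forall w, Cmod (w - z)%C < d -> P w.
Proof.
  split.
  - intros [d Hd]. exists d. split; [apply cond_pos|]. intros w Hw.
    apply Hd. apply C_NormedModule_mixin_compat1. exact Hw.
  - intros (d & Hd & H).
    assert (Hd2 : 0 < d / 2) by lra.
    (* A square ball of radius r lies in the disc of radius sqrt 2 * r, and sqrt 2 < 2, so half the
       radius suffices. *)
    exists (mkposreal _ Hd2). intros w Hw. apply H.
    apply C_NormedModule_mixin_compat2 in Hw. simpl in Hw.
    apply Rlt_trans with (1 := Hw).
    assert (0 < sqrt 2) by (apply sqrt_lt_R0; lra).
    assert (sqrt 2 < 2) by (rewrite <- (sqrt_square 2) at 2 by lra; apply sqrt_lt_1; lra).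
    nra.
Qed.

Lemma locally_Cmod2 (p : C * C) (P : C * C -> Prop) :
  locally p P <-> exists d, 0 < d /\
    forall z t, Cmod (z - fst p)%C < d -> Cmod (t - snd p)%C < d -> P (z, t).
Proof.
  destruct p as [z0 t0]. split.
  - intros [d Hd]. exists d. split; [apply cond_pos|]. intros z t Hz Ht.
    apply Hd. split; apply C_NormedModule_mixin_compat1; assumption.
  - intros (d & Hd & H).
    assert (Hd2 : 0 < d / 2) by lra.
    exists (mkposreal _ Hd2). intros [z t] [Hz Ht].
    apply C_NormedModule_mixin_compat2 in Hz. apply C_NormedModule_mixin_compat2 in Ht.
    simpl in *.
    assert (0 < sqrt 2) by (apply sqrt_lt_R0; lra).
    assert (sqrt 2 < 2) by (rewrite <- (sqrt_square 2) at 2 by lra; apply sqrt_lt_1; lra).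
    apply H; simpl.
    + apply Rlt_trans with (1 := Hz). nra.
    + apply Rlt_trans with (1 := Ht). nra.
Qed.

Lemma filterlim_cvg {T} (F : (T -> Prop) -> Prop) {FF : Filter F} (f : T -> C) (l : C) :
  filterlim f F (locally l) <-> cvg F f l.
Proof.
  split.
  - intros H eps He. apply (H (fun w => Cmod (w - l)%C < eps)). apply locally_Cmod. exists eps. split; auto.
  - intros H P HP. apply locally_Cmod in HP. destruct HP as (d & Hd & HP).
    unfold filtermap. generalize (H d Hd). apply filter_imp. auto.
Qed.

Section CvgRules.
Context {T : Type} (F : (T -> Prop) -> Prop) {FF : Filter F}.

Lemma cvg_const (c : C) : cvg F (fun _ => c) c.
Proof.
  intros eps He. apply filter_forall. intros _.
  replace (c - c)%C with (RtoC 0) by ring. rewrite Cmod_0. exact He.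
Qed.

Lemma cvg_ext_loc (f g : T -> C) (l : C) :
  F (fun t => f t = g t) -> cvg F f l -> cvg F g l.
Proof.
  intros H Hf eps He. generalize (filter_and _ _ H (Hf eps He)). apply filter_imp.
  intros t [<- Ht]. exact Ht.
Qed.

Lemma cvg_ext (f g : T -> C) (l : C) : (forall t, f t = g t) -> cvg F f l -> cvg F g l.
Proof. intros H. apply cvg_ext_loc, filter_forall, H. Qed.

Lemma cvg_plus (f g : T -> C) (l m : C) :
  cvg F f l -> cvg F g m -> cvg F (fun t => f t + g t)%C (l + m)%C.
Proof.
  intros Hf Hg eps He.
  assert (He2 : 0 < eps / 2) by lra.
  generalize (filter_and _ _ (Hf _ He2) (Hg _ He2)).
  apply filter_imp. intros t [H1 H2]; cbv beta in H1, H2.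
  replace (f t + g t - (l + m))%C with ((f t - l) + (g t - m))%C by ring.
  apply Rle_lt_trans with (1 := Cmod_triangle _ _). lra.
Qed.

Lemma cvg_mult (f g : T -> C) (l m : C) :
  cvg F f l -> cvg F g m -> cvg F (fun t => f t * g t)%C (l * m)%C.
Proof.
  intros Hf Hg eps He.
  pose proof (Cmod_ge_0 l) as Hl. pose proof (Cmod_ge_0 m) as Hm.
  set (d := Rmin 1 (eps / (1 + Cmod l + Cmod m))).
  assert (H0 : 0 < eps / (1 + Cmod l + Cmod m)) by (apply Rdiv_lt_0_compat; lra).
  assert (Hd : 0 < d) by (apply Rmin_glb_lt; lra).
  generalize (filter_and _ _ (Hf d Hd) (Hg d Hd)).
  apply filter_imp. intros t [H1 H2]; cbv beta in H1, H2.
  replace (f t * g t - l * m)%C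
    with ((f t - l) * (g t - m) + ((f t - l) * m + l * (g t - m)))%C by ring.
  apply Rle_lt_trans with (1 := Cmod_triangle _ _).
  apply Rle_lt_trans with (1 := Rplus_le_compat_l _ _ _ (Cmod_triangle _ _)).
  rewrite !Cmod_mult.
  pose proof (Cmod_ge_0 (f t - l)) as A1. pose proof (Cmod_ge_0 (g t - m)) as A2.
  assert (D1 : d <= 1) by apply Rmin_l.
  assert (D2 : d * (1 + Cmod l + Cmod m) <= eps).
  { replace eps with (eps / (1 + Cmod l + Cmod m) * (1 + Cmod l + Cmod m)) by (field; lra).
    apply Rmult_le_compat_r; [lra|apply Rmin_r]. }
  nra.
Qed.

Lemma cvg_opp (f : T -> C) (l : C) : cvg F f l -> cvg F (fun t => - f t)%C (- l)%C.
Proof.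
  intros Hf eps He. generalize (Hf eps He). apply filter_imp. intros t Ht.
  rewrite <- Cmod_opp. replace (- (- f t - - l))%C with (f t - l)%C by ring. exact Ht.
Qed.

Lemma cvg_minus (f g : T -> C) (l m : C) :
  cvg F f l -> cvg F g m -> cvg F (fun t => f t - g t)%C (l - m)%C.
Proof. intros Hf Hg. apply cvg_plus; [exact Hf|apply cvg_opp, Hg]. Qed.

Lemma cvg_inv (f : T -> C) (l : C) : l <> RtoC 0 -> cvg F f l -> cvg F (fun t => / f t)%C (/ l)%C.
Proof.
  intros Hl Hf eps He.
  assert (Pl : 0 < Cmod l) by (apply Cmod_gt_0, Hl).
  set (d := Rmin (Cmod l / 2) (eps * (Cmod l * Cmod l / 2))).
  assert (P2 : 0 < Cmod l * Cmod l) by nra.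
  assert (Hd : 0 < d) by (apply Rmin_glb_lt; nra).
  generalize (Hf d Hd). apply filter_imp. intros t H1; cbv beta in H1.
  assert (D1 : d <= Cmod l / 2) by apply Rmin_l.
  assert (D2 : d <= eps * (Cmod l * Cmod l / 2)) by apply Rmin_r.
  pose proof (Cmod_triangle_inv l (f t)) as H2. rewrite Cmod_sub_comm in H2.
  assert (H3 : Cmod l / 2 < Cmod (f t)) by lra.
  assert (H4 : f t <> RtoC 0) by (apply Cmod_gt_0; lra).
  replace (/ f t - / l)%C with ((l - f t) / (f t * l))%C by (field; auto).
  rewrite Cmod_div by (apply Cmult_neq_0; auto).
  rewrite Cmod_mult, Cmod_sub_comm.
  apply Rmult_lt_reg_r with (Cmod (f t) * Cmod l); [nra|].
  unfold Rdiv. rewrite Rmult_assoc, Rinv_l, Rmult_1_r by nra. nra.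
Qed.

Lemma cvg_div (f g : T -> C) (l m : C) :
  m <> RtoC 0 -> cvg F f l -> cvg F g m -> cvg F (fun t => f t / g t)%C (l / m)%C.
Proof. intros Hm Hf Hg. apply cvg_mult; [exact Hf|apply cvg_inv; assumption]. Qed.

Lemma cvg_comp (f : T -> C) (g : C -> C) (l : C) :
  cvg F f l -> cvg (locally l) g (g l) -> cvg F (fun t => g (f t)) (g l).
Proof.
  intros Hf Hg eps He. specialize (Hg eps He). apply locally_Cmod in Hg.
  destruct Hg as (d & Hd & H). generalize (Hf d Hd). apply filter_imp. intros t Ht. auto.
Qed.

Lemma cvg_near_neq (f : T -> C) (l m : C) : cvg F f l -> l <> m -> F (fun t => f t <> m).
Proof.
  intros Hf Hl.
  assert (P : 0 < Cmod (l - m)%C).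
  { apply Cmod_gt_0. intros E. apply Hl. replace l with ((l - m) + m)%C by ring. rewrite E. ring. }
  generalize (Hf _ P). apply filter_imp. intros t Ht E. rewrite E, Cmod_sub_comm in Ht. lra.
Qed.

End CvgRules.

Lemma cvg_unique {T} (F : (T -> Prop) -> Prop) {FF : ProperFilter F} (f : T -> C) (l m : C) :
  cvg F f l -> cvg F f m -> l = m.
Proof.
  intros Hl Hm.
  destruct (Ceq_dec l m) as [E|E]; [exact E|exfalso].
  assert (P : 0 < Cmod (l - m)%C).
  { apply Cmod_gt_0. intros E'. apply E. replace l with ((l - m) + m)%C by ring. rewrite E'. ring. }
  assert (P2 : 0 < Cmod (l - m)%C / 2) by lra.
  destruct (filter_ex _ (filter_and _ _ (Hl _ P2) (Hm _ P2))) as [t [H1 H2]]; cbv beta in H1, H2.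
  pose proof (Cmod_triangle_sub l (f t) m) as H. rewrite Cmod_sub_comm in H1. lra.
Qed.

Lemma cvg_Cmod_le {T} (F : (T -> Prop) -> Prop) {FF : ProperFilter F} (f : T -> C) (l : C) (M : R) :
  cvg F f l -> F (fun t => Cmod (f t) <= M) -> Cmod l <= M.
Proof.
  intros Hl HM. apply Rnot_lt_le. intros H.
  assert (P : 0 < Cmod l - M) by lra.
  destruct (filter_ex _ (filter_and _ _ (Hl _ P) HM)) as [t [H1 H2]]; cbv beta in H1, H2.
  pose proof (Cmod_triangle_inv l (f t)) as H3. rewrite Cmod_sub_comm in H3. lra.
Qed.

Lemma cvg_eventually (u : nat -> C) (l : C) :
  cvg eventually u l <-> forall eps, 0 < eps -> exists N, forall n, (N <= n)%nat -> Cmod (u n - l)%C < eps.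
Proof. split; intros H eps He; exact (H eps He). Qed.

Notation ccont f z := (cvg (locally z) f (f z)).

Lemma ccont_id (z : C) : ccont (fun w => w) z.
Proof. intros eps He. apply locally_Cmod. exists eps. split; auto. Qed.

(** The filter inside [is_derive] is that of C as a valued ring, not that of the product structure;
    [locally_C] identifies the two. Estimates of derivatives below use this form. *)
Lemma cderiv_eps (f : C -> C) (z l : C) :
  cderiv f z l <-> forall eps, 0 < eps ->
    locally z (fun w => Cmod (f w - f z - l * (w - z))%C <= eps * Cmod (w - z)%C).
Proof.
  split.
  - intros [_ H] eps He.
    assert (Hz : is_filter_lim (@locally C_UniformSpace z) z) by (intros P HP; exact HP).
    specialize (H z).
    assert (Hz' : is_filter_lim (@locally (AbsRing_UniformSpace C_AbsRing) z) z) by (intros P HP; exact HP).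
    specialize (H Hz' (mkposreal eps He)). simpl in H.
    apply locally_C. generalize H. apply filter_imp. intros w Hw.
    replace (f w - f z - l * (w - z))%C with (f w + - f z + - ((w + - z) * l))%C by ring.
    exact Hw.
  - intros H. split.
    + apply is_linear_scal_l.
    + intros x Hx eps.
      assert (E : z = x).
      { apply (is_filter_lim_locally_unique (K:=C_AbsRing) (V:=AbsRing_NormedModule C_AbsRing)) in Hx. exact Hx. }
      subst x. apply locally_C.
      generalize (H eps (cond_pos eps)). apply filter_imp. intros w Hw.
      replace (f w - f z - l * (w - z))%C with (f w + - f z + - ((w + - z) * l))%C in Hw by ring.
      exact Hw.
Qed.

Lemma ccont_const (c z : C) : ccont (fun _ => c) z.
Proof. apply cvg_const. apply locally_filter. Qed.
Lemma ccont_plus (f g : C -> C) (z : C) : ccont f z -> ccont g z -> ccont (fun w => f w + g w)%C z.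
Proof. apply cvg_plus. apply locally_filter. Qed.
Lemma ccont_minus (f g : C -> C) (z : C) : ccont f z -> ccont g z -> ccont (fun w => f w - g w)%C z.
Proof. apply cvg_minus. apply locally_filter. Qed.
Lemma ccont_mult (f g : C -> C) (z : C) : ccont f z -> ccont g z -> ccont (fun w => f w * g w)%C z.
Proof. apply cvg_mult. apply locally_filter. Qed.
Lemma cderiv_ext_loc (f g : C -> C) (z l : C) :
  locally z (fun w => f w = g w) -> cderiv f z l -> cderiv g z l.
Proof.
  intros H Hf. apply cderiv_eps. intros eps He.
  pose proof (proj1 (cderiv_eps _ _ _) Hf eps He) as H1.
  generalize (filter_and _ _ H H1). apply filter_imp. intros w [Hw1 Hw2].
  rewrite <- Hw1, <- (locally_singleton _ _ H). exact Hw2.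
Qed.

Lemma cderiv_ext (f g : C -> C) (z l : C) : (forall w, f w = g w) -> cderiv f z l -> cderiv g z l.
Proof. intros H. apply cderiv_ext_loc, filter_forall, H. Qed.

Lemma cdiff_ext_loc (f g : C -> C) (z : C) :
  locally z (fun w => f w = g w) -> cdiff f z -> cdiff g z.
Proof. intros H [l Hl]. exists l. exact (cderiv_ext_loc _ _ _ _ H Hl). Qed.

Lemma cderiv_const (c z : C) : cderiv (fun _ => c) z (RtoC 0).
Proof. exact (@is_derive_const C_AbsRing C_NormedModule c z). Qed.

(** The rules for identity, product and composition involve C as a module over itself, with a normed
    module structure other than [C_NormedModule]; the derivative is the same for both. *)
Lemma is_derive_AbsRing_C (f : C -> C) (z l : C) :
  @is_derive C_AbsRing (AbsRing_NormedModule C_AbsRing) f z l <-> cderiv f z l.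
Proof.
  split; (intros [_ H]; split; [apply is_linear_scal_l|exact H]).
Qed.

Lemma cderiv_id (z : C) : cderiv (fun w => w) z (RtoC 1).
Proof. apply is_derive_AbsRing_C, (@is_derive_id C_AbsRing z). Qed.

Lemma cderiv_plus (f g : C -> C) (z l m : C) :
  cderiv f z l -> cderiv g z m -> cderiv (fun w => f w + g w)%C z (l + m)%C.
Proof. exact (@is_derive_plus C_AbsRing C_NormedModule f g z l m). Qed.

Lemma cderiv_opp (f : C -> C) (z l : C) : cderiv f z l -> cderiv (fun w => - f w)%C z (- l)%C.
Proof. exact (@is_derive_opp C_AbsRing C_NormedModule f z l). Qed.

Lemma cderiv_minus (f g : C -> C) (z l m : C) :
  cderiv f z l -> cderiv g z m -> cderiv (fun w => f w - g w)%C z (l - m)%C.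
Proof. intros Hf Hg. apply cderiv_plus; [exact Hf|apply cderiv_opp, Hg]. Qed.

Lemma cderiv_mult (f g : C -> C) (z l m : C) :
  cderiv f z l -> cderiv g z m -> cderiv (fun w => f w * g w)%C z (l * g z + f z * m)%C.
Proof.
  intros Hf Hg. apply is_derive_AbsRing_C.
  apply is_derive_AbsRing_C in Hf. apply is_derive_AbsRing_C in Hg.
  exact (@is_derive_mult C_AbsRing f g z l m Hf Hg Cmult_comm).
Qed.

Lemma cderiv_comp (f g : C -> C) (z l m : C) :
  cderiv f (g z) l -> cderiv g z m -> cderiv (fun w => f (g w)) z (m * l)%C.
Proof.
  intros Hf Hg. apply is_derive_AbsRing_C in Hg.
  exact (@is_derive_comp C_AbsRing C_NormedModule f g z l m Hf Hg).
Qed.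

Lemma cdiff_ccont (f : C -> C) (z : C) : cdiff f z -> ccont f z.
Proof.
  intros [l Hl] eps He.
  pose proof (proj1 (cderiv_eps _ _ _) Hl 1 Rlt_0_1) as H.
  pose proof (Cmod_ge_0 l) as P.
  assert (Hd : 0 < eps / (2 + Cmod l)) by (apply Rdiv_lt_0_compat; lra).
  pose proof (ccont_id z _ Hd) as H2.
  generalize (filter_and _ _ H H2). apply filter_imp. intros w [H3 H4]; cbv beta in H3, H4.
  replace (f w - f z)%C with ((f w - f z - l * (w - z)) + l * (w - z))%C by ring.
  apply Rle_lt_trans with (1 := Cmod_triangle _ _). rewrite Cmod_mult.
  pose proof (Cmod_ge_0 (w - z)) as P2.
  apply Rle_lt_trans with ((1 + Cmod l) * Cmod (w - z)%C); [nra|].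
  apply Rmult_lt_compat_l with (r := 2 + Cmod l) in H4; [|lra].
  replace ((2 + Cmod l) * (eps / (2 + Cmod l))) with eps in H4 by (field; lra). nra.
Qed.

Lemma cderiv_inv (f : C -> C) (z l : C) :
  f z <> RtoC 0 -> cderiv f z l -> cderiv (fun w => / f w)%C z (- l / (f z * f z))%C.
Proof.
  intros Hz Hf.
  assert (K : cderiv Cinv (f z) (- / (f z * f z))%C).
  { set (x := f z) in *. apply cderiv_eps. intros eps He.
    assert (Px : 0 < Cmod x) by (apply Cmod_gt_0, Hz).
    set (d := Rmin (Cmod x / 2) (eps * (Cmod x * Cmod x * Cmod x / 2))).
    assert (P2 : 0 < Cmod x * Cmod x) by nra.
    assert (P3 : 0 < Cmod x * Cmod x * Cmod x) by nra.
    assert (Hd : 0 < d) by (apply Rmin_glb_lt; nra).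
    apply locally_Cmod. exists d. split; [exact Hd|]. intros w Hw.
    assert (D1 : d <= Cmod x / 2) by apply Rmin_l.
    assert (D2 : d <= eps * (Cmod x * Cmod x * Cmod x / 2)) by apply Rmin_r.
    pose proof (Cmod_triangle_inv x w) as H2. rewrite Cmod_sub_comm in H2.
    assert (H3 : Cmod x / 2 < Cmod w) by lra.
    assert (H4 : w <> RtoC 0) by (apply Cmod_gt_0; lra).
    replace (/ w - / x - - / (x * x) * (w - x))%C
      with ((w - x) * ((w - x) / (w * x * x)))%C by (field; auto).
    rewrite Cmod_mult, Rmult_comm.
    apply Rmult_le_compat_r; [apply Cmod_ge_0|].
    assert (P : (w * x * x)%C <> RtoC 0) by (repeat apply Cmult_neq_0; auto).
    rewrite Cmod_div by exact P. rewrite !Cmod_mult.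
    assert (Q : Cmod x / 2 * (Cmod x * Cmod x) <= Cmod w * (Cmod x * Cmod x)) by nra.
    apply Rmult_le_reg_r with (Cmod w * Cmod x * Cmod x); [nra|].
    unfold Rdiv at 1. rewrite Rmult_assoc, Rinv_l, Rmult_1_r by nra. nra. }
  replace (- l / (f z * f z))%C with (l * - / (f z * f z))%C by (field; exact Hz).
  exact (cderiv_comp Cinv f z _ _ K Hf).
Qed.

Lemma cdiff_const (c z : C) : cdiff (fun _ => c) z.
Proof. eexists. apply cderiv_const. Qed.
Lemma cdiff_id (z : C) : cdiff (fun w => w) z.
Proof. eexists. apply cderiv_id. Qed.
Lemma cdiff_plus (f g : C -> C) (z : C) : cdiff f z -> cdiff g z -> cdiff (fun w => f w + g w)%C z.
Proof. intros [l Hl] [m Hm]. eexists. apply cderiv_plus; eassumption. Qed.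
Lemma cdiff_opp (f : C -> C) (z : C) : cdiff f z -> cdiff (fun w => - f w)%C z.
Proof. intros [l Hl]. eexists. apply cderiv_opp; eassumption. Qed.
Lemma cdiff_minus (f g : C -> C) (z : C) : cdiff f z -> cdiff g z -> cdiff (fun w => f w - g w)%C z.
Proof. intros [l Hl] [m Hm]. eexists. apply cderiv_minus; eassumption. Qed.
Lemma cdiff_mult (f g : C -> C) (z : C) : cdiff f z -> cdiff g z -> cdiff (fun w => f w * g w)%C z.
Proof. intros [l Hl] [m Hm]. eexists. apply cderiv_mult; eassumption. Qed.
Lemma cdiff_inv (f : C -> C) (z : C) : f z <> RtoC 0 -> cdiff f z -> cdiff (fun w => / f w)%C z.
Proof. intros Hz [l Hl]. eexists. apply cderiv_inv; eassumption. Qed.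
Lemma cdiff_div (f g : C -> C) (z : C) :
  g z <> RtoC 0 -> cdiff f z -> cdiff g z -> cdiff (fun w => f w / g w)%C z.
Proof. intros Hz Hf Hg. apply cdiff_mult; [exact Hf|apply cdiff_inv; assumption]. Qed.
Lemma cdiff_comp (f g : C -> C) (z : C) : cdiff f (g z) -> cdiff g z -> cdiff (fun w => f (g w)) z.
Proof. intros [l Hl] [m Hm]. eexists. apply cderiv_comp; eassumption. Qed.

(** * The complex exponential and the function e *)

Definition Cexp (x : C) : C := (exp (Re x) * cos (Im x), exp (Re x) * sin (Im x)).

Lemma Cexp_plus (x y : C) : Cexp (x + y)%C = (Cexp x * Cexp y)%C.
Proof.
  unfold Cexp. apply C_eq; unfold Re, Im; simpl;
    rewrite exp_plus, ?cos_plus, ?sin_plus; ring.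
Qed.

Lemma Cexp_0 : Cexp (RtoC 0) = RtoC 1.
Proof. apply C_eq; unfold Cexp, Re, Im; simpl; rewrite exp_0, ?cos_0, ?sin_0; ring. Qed.

Lemma Cexp_opp (x : C) : (Cexp x * Cexp (- x))%C = RtoC 1.
Proof. rewrite <- Cexp_plus, <- Cexp_0. f_equal. ring. Qed.

Lemma Cexp_neq_0 (x : C) : Cexp x <> RtoC 0.
Proof.
  intros H. pose proof (Cexp_opp x) as H1. rewrite H, Cmult_0_l in H1.
  apply C1_nz. auto.
Qed.

Lemma Cmod_Cexp (x : C) : Cmod (Cexp x) = exp (Re x).
Proof.
  transitivity (sqrt (exp (Re x) * exp (Re x))).
  - unfold Cmod, Cexp; simpl. f_equal.
    pose proof (sin2_cos2 (Im x)) as H. unfold Rsqr in H.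
    transitivity (exp (Re x) * exp (Re x) * (sin (Im x) * sin (Im x) + cos (Im x) * cos (Im x))).
    + ring.
    + rewrite H. ring.
  - apply sqrt_square. left. apply exp_pos.
Qed.

Lemma Cmod_Cexp_le (x : C) : Cmod (Cexp x) <= exp (Cmod x).
Proof.
  rewrite Cmod_Cexp. pose proof (re_le_Cmod x) as H. pose proof (Rle_abs (Re x)) as H1.
  destruct (Rle_lt_or_eq_dec (Re x) (Cmod x) ltac:(lra)) as [L|L].
  - left. apply exp_increasing, L.
  - rewrite L. lra.
Qed.

(** The mean value theorem is applied to the real and the imaginary part separately, which accounts
    for the factor 2. *)
Lemma Cmod_increment_le (f f' : R -> C) (M : R) :
  (forall t, 0 <= t <= 1 -> is_derive (fun t => Re (f t)) t (Re (f' t)) /\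
     is_derive (fun t => Im (f t)) t (Im (f' t)) /\ Cmod (f' t) <= M) ->
  Cmod (f 1 - f 0)%C <= 2 * M.
Proof.
  intros H.
  assert (K : forall g g' : R -> R, (forall t, 0 <= t <= 1 -> is_derive g t (g' t) /\ Rabs (g' t) <= M) ->
    Rabs (g 1 - g 0) <= M).
  { intros g g' Hg. destruct (MVT_gen g 0 1 g') as (c & Hc & E).
    - intros x Hx. rewrite Rmin_left, Rmax_right in Hx by lra. apply Hg. lra.
    - intros x Hx. rewrite Rmin_left, Rmax_right in Hx by lra.
      apply continuity_pt_filterlim, (ex_derive_continuous g). eexists. apply Hg. lra.
    - rewrite Rmin_left, Rmax_right in Hc by lra. rewrite E.
      replace (g' c * (1 - 0)) with (g' c) by ring. apply Hg, Hc. }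
  apply Rle_trans with (1 := Cmod_le_Re_Im _).
  assert (H1 := K (fun t => Re (f t)) (fun t => Re (f' t))).
  assert (H2 := K (fun t => Im (f t)) (fun t => Im (f' t))).
  change (Re (f 1 - f 0)%C) with (Re (f 1) - Re (f 0)).
  change (Im (f 1 - f 0)%C) with (Im (f 1) - Im (f 0)).
  cbv beta in H1, H2.
  assert (Rabs (Re (f 1) - Re (f 0)) <= M).
  { apply H1. intros t Ht. destruct (H t Ht) as (A & B & D). split; [exact A|].
    apply Rle_trans with (2 := D), re_le_Cmod. }
  assert (Rabs (Im (f 1) - Im (f 0)) <= M).
  { apply H2. intros t Ht. destruct (H t Ht) as (A & B & D). split; [exact B|].
    apply Rle_trans with (2 := D), im_le_Cmod. }
  lra.
Qed.

Lemma exp_le_mono (x y : R) : x <= y -> exp x <= exp y.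
Proof. intros [H|H]; [left; apply exp_increasing, H|rewrite H; lra]. Qed.

Lemma Cmod_scale_le (t : R) (x : C) : 0 <= t <= 1 -> Cmod (RtoC t * x)%C <= Cmod x.
Proof.
  intros Ht. rewrite Cmod_mult, Cmod_R, Rabs_pos_eq by lra. pose proof (Cmod_ge_0 x). nra.
Qed.

Lemma Cexp_bound1 (x : C) : Cmod (Cexp x - 1)%C <= 2 * Cmod x * exp (Cmod x).
Proof.
  pose proof (Cmod_increment_le (fun t => Cexp (RtoC t * x)) (fun t => x * Cexp (RtoC t * x))%C
    (Cmod x * exp (Cmod x))) as H.
  cbv beta in H.
  rewrite Cmult_1_l, Cmult_0_l, Cexp_0 in H. rewrite Rmult_assoc. apply H.
  intros t Ht. split; [|split].
  - destruct x as [a b]. unfold Cexp, Re, Im; simpl. auto_derive; [auto|unfold Rminus; ring].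
  - destruct x as [a b]. unfold Cexp, Re, Im; simpl. auto_derive; [auto|unfold Rminus; ring].
  - rewrite Cmod_mult. apply Rmult_le_compat_l; [apply Cmod_ge_0|].
    apply Rle_trans with (1 := Cmod_Cexp_le _). apply exp_le_mono, Cmod_scale_le, Ht.
Qed.

(** The path t -> exp(t x) - t x has derivative x (exp(t x) - 1), so [Cmod_increment_le] turns the
    preceding bound into this one, and this one into the next. Each application doubles the
    constant. *)
Lemma Cexp_bound2 (x : C) : Cmod (Cexp x - 1 - x)%C <= 4 * Cmod x ^ 2 * exp (Cmod x).
Proof.
  pose proof (Cmod_increment_le (fun t => Cexp (RtoC t * x) - RtoC t * x)%C
    (fun t => x * (Cexp (RtoC t * x) - 1))%C
    (Cmod x * (2 * Cmod x * exp (Cmod x)))) as H.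
  cbv beta in H.
  rewrite Cmult_1_l, Cmult_0_l, Cexp_0 in H.
  replace (Cexp x - 1 - x)%C with (Cexp x - x - (1 - 0))%C by ring.
  replace (4 * Cmod x ^ 2 * exp (Cmod x)) with (2 * (Cmod x * (2 * Cmod x * exp (Cmod x)))) by ring.
  apply H.
  intros t Ht. split; [|split].
  - destruct x as [a b]. unfold Cexp, Re, Im; simpl. auto_derive; [auto|unfold Rminus; ring].
  - destruct x as [a b]. unfold Cexp, Re, Im; simpl. auto_derive; [auto|unfold Rminus; ring].
  - rewrite Cmod_mult. apply Rmult_le_compat_l; [apply Cmod_ge_0|].
    apply Rle_trans with (1 := Cexp_bound1 _).
    pose proof (Cmod_scale_le t x Ht) as A. pose proof (exp_le_mono _ _ A) as B.
    pose proof (exp_pos (Cmod (RtoC t * x)%C)). pose proof (Cmod_ge_0 (RtoC t * x)%C).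
    apply Rmult_le_compat; nra.
Qed.

Lemma Cexp_bound3 (x : C) :
  Cmod (Cexp x - 1 - x - x * x / 2)%C <= 8 * Cmod x ^ 3 * exp (Cmod x).
Proof.
  pose proof (Cmod_increment_le
    (fun t => Cexp (RtoC t * x) - RtoC t * x - (RtoC t * x) * (RtoC t * x) / 2)%C
    (fun t => x * (Cexp (RtoC t * x) - 1 - RtoC t * x))%C
    (Cmod x * (4 * Cmod x ^ 2 * exp (Cmod x)))) as H.
  cbv beta in H.
  rewrite Cmult_1_l, Cmult_0_l, Cexp_0 in H.
  replace (Cexp x - 1 - x - x * x / 2)%C with (Cexp x - x - x * x / 2 - (1 - 0 - 0 * 0 / 2))%C by field.
  replace (8 * Cmod x ^ 3 * exp (Cmod x)) with (2 * (Cmod x * (4 * Cmod x ^ 2 * exp (Cmod x)))) by ring.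
  apply H.
  intros t Ht. split; [|split].
  - destruct x as [a b]. unfold Cexp, Re, Im; simpl. auto_derive; [auto|unfold Rminus, Rdiv; field].
  - destruct x as [a b]. unfold Cexp, Re, Im; simpl. auto_derive; [auto|unfold Rminus, Rdiv; field].
  - rewrite Cmod_mult. apply Rmult_le_compat_l; [apply Cmod_ge_0|].
    apply Rle_trans with (1 := Cexp_bound2 _).
    pose proof (Cmod_scale_le t x Ht) as A. pose proof (exp_le_mono _ _ A) as B.
    pose proof (exp_pos (Cmod (RtoC t * x)%C)). pose proof (Cmod_ge_0 (RtoC t * x)%C).
    apply Rmult_le_compat; nra.
Qed.

Lemma cderiv_Cexp (x : C) : cderiv Cexp x (Cexp x).
Proof.
  apply cderiv_eps. intros eps He. apply locally_Cmod.
  set (K := Cmod (Cexp x) * (4 * exp 1)).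
  assert (PK : 0 < K).
  { apply Rmult_lt_0_compat; [apply Cmod_gt_0, Cexp_neq_0|]. pose proof (exp_pos 1). lra. }
  exists (Rmin 1 (eps / K)).
  assert (0 < eps / K) by (apply Rdiv_lt_0_compat; lra).
  split; [apply Rmin_glb_lt; lra|]. intros w Hw.
  assert (H1 : Cmod (w - x)%C < 1) by (apply Rlt_le_trans with (1 := Hw), Rmin_l).
  assert (H2 : Cmod (w - x)%C < eps / K) by (apply Rlt_le_trans with (1 := Hw), Rmin_r).
  set (h := (w - x)%C) in *.
  replace w with (x + h)%C by (unfold h; ring). rewrite Cexp_plus.
  replace (Cexp x * Cexp h - Cexp x - Cexp x * h)%C with (Cexp x * (Cexp h - 1 - h))%C by ring.
  rewrite Cmod_mult. pose proof (Cexp_bound2 h) as B.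
  pose proof (exp_le_mono (Cmod h) 1 ltac:(lra)) as B2.
  pose proof (Cmod_ge_0 h) as P. pose proof (Cmod_ge_0 (Cexp x)) as P2.
  pose proof (exp_pos 1).
  apply Rle_trans with (Cmod (Cexp x) * (4 * Cmod h ^ 2 * exp 1)).
  { apply Rmult_le_compat_l; [exact P2|]. apply Rle_trans with (1 := B).
    apply Rmult_le_compat_l; [nra|exact B2]. }
  replace (Cmod (Cexp x) * (4 * Cmod h ^ 2 * exp 1)) with (K * Cmod h * Cmod h) by (unfold K; ring).
  apply Rmult_le_compat_r; [exact P|].
  apply Rmult_le_reg_l with (/ K); [apply Rinv_0_lt_compat, PK|].
  rewrite <- Rmult_assoc, Rinv_l, Rmult_1_l by lra. unfold Rdiv in H2. lra.
Qed.

(** The number 2 pi i; the factor i is included in spite of the name. *)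
Definition C2pi : C := (0, 2 * PI).

Lemma e_Cexp (w : C) : e w = Cexp (C2pi * w)%C.
Proof.
  unfold e, Cexp. f_equal; unfold C2pi, Re, Im; simpl; f_equal; f_equal; ring.
Qed.

Lemma e_plus (x y : C) : e (x + y)%C = (e x * e y)%C.
Proof. rewrite !e_Cexp, <- Cexp_plus. f_equal. ring. Qed.

Lemma e_0 : e (RtoC 0) = RtoC 1.
Proof. rewrite e_Cexp, Cmult_0_r. apply Cexp_0. Qed.

Lemma e_neq_0 (x : C) : e x <> RtoC 0.
Proof. rewrite e_Cexp. apply Cexp_neq_0. Qed.

Lemma e_opp (x : C) : (e x * e (- x))%C = RtoC 1.
Proof. rewrite <- e_plus, <- e_0. f_equal. ring. Qed.

Lemma e_opp_inv (x : C) : e (- x)%C = (/ e x)%C.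
Proof.
  pose proof (e_opp x) as H. pose proof (e_neq_0 x) as H1.
  replace (e (- x))%C with (e x * e (- x) / e x)%C by (field; exact H1).
  rewrite H. field. exact H1.
Qed.

Lemma cderiv_e (x : C) : cderiv e x (C2pi * e x)%C.
Proof.
  apply cderiv_ext with (fun w => Cexp (C2pi * w)%C).
  - intros w. symmetry. apply e_Cexp.
  - rewrite e_Cexp.
    apply (cderiv_comp Cexp (fun w => C2pi * w)%C); [apply cderiv_Cexp|].
    pose proof (cderiv_mult (fun _ => C2pi) (fun w => w) x _ _ (cderiv_const C2pi x) (cderiv_id x)) as H.
    cbv beta in H.
    replace (0 * x + C2pi * 1)%C with C2pi in H by ring. exact H.
Qed.

Lemma Cmod_e (w : C) : Cmod (e w) = exp (- (2 * PI * Im w)).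
Proof. rewrite e_Cexp, Cmod_Cexp. f_equal. unfold C2pi, Re, Im; simpl. ring. Qed.

Lemma e_IZR (n : Z) : e (RtoC (IZR n)) = RtoC 1.
Proof.
  assert (N : forall k : nat, e (RtoC (INR k)) = RtoC 1).
  { intros k. induction k as [|k IH]; [apply e_0|].
    rewrite S_INR, RtoC_plus, e_plus, IH.
    unfold e, RtoC, Re, Im; simpl. apply C_eq; unfold Re, Im; simpl;
    rewrite ?Rmult_0_r, ?Ropp_0, exp_0, ?Rmult_1_r, ?cos_2PI, ?sin_2PI; ring. }
  destruct (Z_le_gt_dec 0 n) as [H|H].
  - rewrite <- (Z2Nat.id n H), <- INR_IZR_INZ. apply N.
  - replace n with (- (Z.of_nat (Z.to_nat (- n))))%Z by lia.
    rewrite opp_IZR, <- INR_IZR_INZ, RtoC_opp, e_opp_inv, N. field.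
Qed.

Lemma e_plus_IZR (x : C) (n : Z) : e (x + RtoC (IZR n))%C = e x.
Proof. rewrite e_plus, e_IZR. ring. Qed.

Lemma e_eq_1_Im (x : C) : e x = RtoC 1 -> Im x = 0.
Proof.
  intros H. pose proof (Cmod_e x) as H1. rewrite H, Cmod_1 in H1.
  symmetry in H1. rewrite <- exp_0 in H1. apply exp_inv in H1.
  pose proof PI_RGT_0. nra.
Qed.

Lemma cdiff_e (x : C) : cdiff e x.
Proof. eexists. apply cderiv_e. Qed.

Lemma cdiff_Cexp (x : C) : cdiff Cexp x.
Proof. eexists. apply cderiv_Cexp. Qed.

Lemma RtoC_neq_0 (x : R) : x <> 0 -> RtoC x <> RtoC 0.
Proof. intros H E. apply H. exact (f_equal Re E). Qed.

Create HintDb holo.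
#[export] Hint Resolve cdiff_e cdiff_Cexp e_neq_0 Cexp_neq_0 Cmult_neq_0 : holo.
#[export] Hint Extern 1 (RtoC _ <> RtoC 0) => apply RtoC_neq_0; lra : holo.

(** Recursion on the shape of the function. Nonvanishing of denominators and differentiability of
    named functions are left to the hint database and the context. *)
Ltac holo :=
  cbv beta;
  lazymatch goal with
  | |- ex_derive (fun _ => ?c) _ => apply cdiff_const
  | |- ex_derive (fun hole => hole) _ => apply cdiff_id
  | |- ex_derive (fun hole => (@?f hole + @?g hole)%C) _ => apply (cdiff_plus f g); holo
  | |- ex_derive (fun hole => (@?f hole - @?g hole)%C) _ => apply (cdiff_minus f g); holo
  | |- ex_derive (fun hole => (- @?f hole)%C) _ => apply (cdiff_opp f); holo
  | |- ex_derive (fun hole => (@?f hole * @?g hole)%C) _ => apply (cdiff_mult f g); holo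
  | |- ex_derive (fun hole => (@?f hole / @?g hole)%C) _ => apply (cdiff_div f g); [cbv beta; auto with holo|holo|holo]
  | |- ex_derive (fun hole => (/ @?f hole)%C) _ => apply (cdiff_inv f); [cbv beta; auto with holo|holo]
  | H : ?G |- ?G => exact H
  | |- _ => match goal with
    | |- ex_derive (fun hole => ?h (@?f hole) ?t) _ => apply (cdiff_comp (fun y => h y t) f); [cbv beta; auto with holo|holo]
    | |- ex_derive (fun hole => ?h (@?f hole)) _ => apply (cdiff_comp h f); [cbv beta; auto with holo|holo]
    | |- _ => auto with holo
    end
  end.

Ltac cont := lazymatch goal with |- cvg _ ?f _ => apply (cdiff_ccont f); holo end.

(** * Cauchy's theorem and Taylor expansion *)

Notation Cint f a b := (@RInt C_R_CompleteNormedModule f a b).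
Notation is_Cint f a b l := (@is_RInt C_R_NormedModule f a b l).

Lemma is_Cint_Cint (f : R -> C) (a b : R) (l : C) : is_Cint f a b l -> Cint f a b = l.
Proof. apply (@is_RInt_unique C_R_CompleteNormedModule). Qed.

Lemma is_Cint_pair (f : R -> C) (a b : R) (l : C) :
  is_RInt (fun t => Re (f t)) a b (Re l) -> is_RInt (fun t => Im (f t)) a b (Im l) -> is_Cint f a b l.
Proof.
  intros H1 H2. rewrite (surjective_pairing l).
  apply (@is_RInt_fct_extend_pair R_NormedModule R_NormedModule); assumption.
Qed.

Lemma is_Cint_Re (f : R -> C) (a b : R) (l : C) :
  is_Cint f a b l -> is_RInt (fun t => Re (f t)) a b (Re l).
Proof. apply (@is_RInt_fct_extend_fst R_NormedModule R_NormedModule). Qed.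

Lemma is_Cint_Im (f : R -> C) (a b : R) (l : C) :
  is_Cint f a b l -> is_RInt (fun t => Im (f t)) a b (Im l).
Proof. apply (@is_RInt_fct_extend_snd R_NormedModule R_NormedModule). Qed.

Lemma is_Cint_plus (f g : R -> C) (a b : R) (l m : C) :
  is_Cint f a b l -> is_Cint g a b m -> is_Cint (fun t => f t + g t)%C a b (l + m)%C.
Proof. exact (@is_RInt_plus C_R_NormedModule f g a b l m). Qed.

(** The integral is that of C as a real normed module, so a complex scalar has to be moved through
    real and imaginary parts. *)
Lemma is_Cint_scal (k : C) (f : R -> C) (a b : R) (l : C) :
  is_Cint f a b l -> is_Cint (fun t => k * f t)%C a b (k * l)%C.
Proof.
  intros H. pose proof (is_Cint_Re _ _ _ _ H) as H1. pose proof (is_Cint_Im _ _ _ _ H) as H2.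
  apply is_Cint_pair.
  - exact (@is_RInt_minus R_NormedModule _ _ a b _ _
      (@is_RInt_scal R_NormedModule _ a b (Re k) _ H1) (@is_RInt_scal R_NormedModule _ a b (Im k) _ H2)).
  - exact (@is_RInt_plus R_NormedModule _ _ a b _ _
      (@is_RInt_scal R_NormedModule _ a b (Re k) _ H2) (@is_RInt_scal R_NormedModule _ a b (Im k) _ H1)).
Qed.

Definition rcont (f : R -> C) (t : R) : Prop := cvg (locally t) f (f t).

Lemma ex_Cint (f : R -> C) (a b : R) :
  a <= b -> (forall t, a <= t <= b -> rcont f t) -> is_Cint f a b (Cint f a b).
Proof.
  intros Hab H. apply (@RInt_correct C_R_CompleteNormedModule).
  apply (@ex_RInt_continuous C_R_CompleteNormedModule).
  rewrite Rmin_left, Rmax_right by exact Hab. intros t Ht.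
  apply filterlim_cvg; [apply filter_filter|]. apply H, Ht.
Qed.

Lemma Cint_Chasles (f : R -> C) (a m b : R) :
  a <= m <= b -> (forall t, a <= t <= b -> rcont f t) ->
  Cint f a b = (Cint f a m + Cint f m b)%C.
Proof.
  intros Hm H. symmetry. apply (@RInt_Chasles C_R_CompleteNormedModule).
  - eexists. apply ex_Cint; [lra|]. intros; apply H; lra.
  - eexists. apply ex_Cint; [lra|]. intros; apply H; lra.
Qed.

Lemma Cint_bound (f : R -> C) (a b M : R) :
  a <= b -> (forall t, a <= t <= b -> rcont f t) -> (forall t, a <= t <= b -> Cmod (f t) <= M) ->
  Cmod (Cint f a b) <= (b - a) * M.
Proof.
  intros Hab H HM.
  pose proof (@norm_RInt_le_const C_R_NormedModule f a b (Cint f a b) M Hab) as K.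
  assert (E : forall x : C, @norm R_AbsRing C_R_NormedModule x = Cmod x).
  { intros x. unfold norm; simpl. unfold prod_norm, Cmod. f_equal. unfold norm; simpl.
    unfold abs; simpl. rewrite !Rmult_1_r, <- !Rabs_mult, !Rabs_pos_eq by nra. reflexivity. }
  rewrite E in K. apply K.
  - intros x Hx. rewrite E. apply HM, Hx.
  - apply ex_Cint; assumption.
Qed.

Lemma Cint_plus (f g : R -> C) (a b : R) :
  a <= b -> (forall t, a <= t <= b -> rcont f t) -> (forall t, a <= t <= b -> rcont g t) ->
  Cint (fun t => f t + g t)%C a b = (Cint f a b + Cint g a b)%C.
Proof. intros Hab Hf Hg. apply is_Cint_Cint, is_Cint_plus; apply ex_Cint; assumption. Qed.

Lemma Cint_scal (k : C) (f : R -> C) (a b : R) :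
  a <= b -> (forall t, a <= t <= b -> rcont f t) ->
  Cint (fun t => k * f t)%C a b = (k * Cint f a b)%C.
Proof. intros Hab Hf. apply is_Cint_Cint, is_Cint_scal, ex_Cint; assumption. Qed.

(** * Counterclockwise integrals over boundaries of rectangles *)

Definition rectI (f : C -> C) (a b c d : R) : C :=
  (Cint (fun x => f (x, c)) a b + Ci * Cint (fun y => f (b, y)) c d
   - Cint (fun x => f (x, d)) a b - Ci * Cint (fun y => f (a, y)) c d)%C.

(** Continuity is asked for on the boundary only, because the integrands of Cauchy's formula are
    singular inside. *)
Definition rcontf (f : C -> C) (a b c d : R) : Prop :=
  forall x y, a <= x <= b -> c <= y <= d -> x = a \/ x = b \/ y = c \/ y = d -> ccont f ((x, y) : C).

Lemma rcont_hor (f : C -> C) (x y : R) : ccont f ((x, y) : C) -> rcont (fun t => f (t, y)) x.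
Proof.
  intros H eps He. specialize (H eps He). apply locally_Cmod in H. destruct H as (d & Hd & H).
  exists (mkposreal d Hd). intros t Ht. apply H.
  match goal with |- Cmod ?X < _ => replace X with (RtoC (t - x)) end;
    [|apply C_eq; unfold Re, Im; simpl; ring].
  rewrite Cmod_R. exact Ht.
Qed.

Lemma rcont_ver (f : C -> C) (x y : R) : ccont f ((x, y) : C) -> rcont (fun t => f (x, t)) y.
Proof.
  intros H eps He. specialize (H eps He). apply locally_Cmod in H. destruct H as (d & Hd & H).
  exists (mkposreal d Hd). intros t Ht. apply H.
  match goal with |- Cmod ?X < _ => replace X with (Ci * RtoC (t - y))%C end;
    [|apply C_eq; unfold Re, Im; simpl; ring].
  rewrite Cmod_mult, Cmod_Ci, Cmod_R, Rmult_1_l. exact Ht.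
Qed.

Ltac rc := intros; first [apply rcont_hor | apply rcont_ver];
  match goal with H : rcontf _ _ _ _ _ |- _ => apply H; [lra|lra|auto] end.

Lemma rectI_split_x (f : C -> C) (a m b c d : R) :
  a <= m <= b -> c <= d -> rcontf f a b c d ->
  rectI f a b c d = (rectI f a m c d + rectI f m b c d)%C.
Proof.
  intros Hm Hcd H. unfold rectI.
  rewrite (Cint_Chasles (fun x => f (x, c)) a m b), (Cint_Chasles (fun x => f (x, d)) a m b);
    [ring|lra|rc|lra|rc].
Qed.

Lemma rectI_split_y (f : C -> C) (a b c m d : R) :
  a <= b -> c <= m <= d -> rcontf f a b c d ->
  rectI f a b c d = (rectI f a b c m + rectI f a b m d)%C.
Proof.
  intros Hm Hcd H. unfold rectI.
  rewrite (Cint_Chasles (fun y => f (b, y)) c m d), (Cint_Chasles (fun y => f (a, y)) c m d);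
    [ring|lra|rc|lra|rc].
Qed.

Lemma rectI_bound (f : C -> C) (a b c d M : R) :
  a <= b -> c <= d -> rcontf f a b c d ->
  (forall x y, a <= x <= b -> c <= y <= d -> (x = a \/ x = b \/ y = c \/ y = d) -> Cmod (f (x, y)) <= M) ->
  Cmod (rectI f a b c d) <= 2 * ((b - a) + (d - c)) * M.
Proof.
  intros Hab Hcd H HM. unfold rectI.
  assert (B1 : Cmod (Cint (fun x => f (x, c)) a b) <= (b - a) * M).
  { apply Cint_bound; [lra|rc|]. intros; apply HM; try lra; auto. }
  assert (B2 : Cmod (Cint (fun x => f (x, d)) a b) <= (b - a) * M).
  { apply Cint_bound; [lra|rc|]. intros; apply HM; try lra; auto. }
  assert (B3 : Cmod (Cint (fun y => f (a, y)) c d) <= (d - c) * M).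
  { apply Cint_bound; [lra|rc|]. intros; apply HM; try lra; auto. }
  assert (B4 : Cmod (Cint (fun y => f (b, y)) c d) <= (d - c) * M).
  { apply Cint_bound; [lra|rc|]. intros; apply HM; try lra; auto. }
  unfold Cminus.
  eapply Rle_trans; [apply Cmod_triangle|].
  eapply Rle_trans; [apply Rplus_le_compat_r, Cmod_triangle|].
  eapply Rle_trans; [apply Rplus_le_compat_r, Rplus_le_compat_r, Cmod_triangle|].
  rewrite !Cmod_opp, !Cmod_mult, Cmod_Ci. lra.
Qed.

Lemma rectI_plus (f g : C -> C) (a b c d : R) :
  a <= b -> c <= d -> rcontf f a b c d -> rcontf g a b c d ->
  rectI (fun w => f w + g w)%C a b c d = (rectI f a b c d + rectI g a b c d)%C.
Proof.
  intros Hab Hcd Hf Hg. unfold rectI.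
  rewrite (Cint_plus (fun x => f (x, c)) (fun x => g (x, c))),
    (Cint_plus (fun x => f (x, d)) (fun x => g (x, d))),
    (Cint_plus (fun y => f (a, y)) (fun y => g (a, y))),
    (Cint_plus (fun y => f (b, y)) (fun y => g (b, y)));
    try lra; try (intros; first [apply rcont_hor | apply rcont_ver]; first [apply Hf|apply Hg]; auto; lra).
  ring.
Qed.

Lemma rectI_scal (k : C) (f : C -> C) (a b c d : R) :
  a <= b -> c <= d -> rcontf f a b c d ->
  rectI (fun w => k * f w)%C a b c d = (k * rectI f a b c d)%C.
Proof.
  intros Hab Hcd Hf. unfold rectI.
  rewrite (Cint_scal k (fun x => f (x, c))), (Cint_scal k (fun x => f (x, d))),
    (Cint_scal k (fun y => f (a, y))), (Cint_scal k (fun y => f (b, y))); try lra; try rc.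
  ring.
Qed.

Lemma rectI_ext (f g : C -> C) (a b c d : R) :
  a <= b -> c <= d ->
  (forall x y, a <= x <= b -> c <= y <= d -> (x = a \/ x = b \/ y = c \/ y = d) -> f (x, y) = g (x, y)) ->
  rectI f a b c d = rectI g a b c d.
Proof.
  intros Hab Hcd H. unfold rectI.
  rewrite (@RInt_ext C_R_CompleteNormedModule (fun x => f (x, c)) (fun x => g (x, c))),
    (@RInt_ext C_R_CompleteNormedModule (fun x => f (x, d)) (fun x => g (x, d))),
    (@RInt_ext C_R_CompleteNormedModule (fun y => f (a, y)) (fun y => g (a, y))),
    (@RInt_ext C_R_CompleteNormedModule (fun y => f (b, y)) (fun y => g (b, y))); [reflexivity|..];
  intros t; rewrite Rmin_left, Rmax_right by lra; intros; apply H; try lra; auto.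
Qed.

Lemma is_RInt_linear (p q a b : R) :
  is_RInt (fun x => p + q * x) a b (p * (b - a) + q * (b * b - a * a) / 2).
Proof.
  replace (p * (b - a) + q * (b * b - a * a) / 2)
    with (minus (p * b + q * (b * b) / 2) (p * a + q * (a * a) / 2))
    by (unfold minus, plus, opp; simpl; field).
  apply (is_RInt_derive (fun x => p * x + q * (x * x) / 2)).
  - intros x _. auto_derive; [auto|field].
  - intros x _. apply (ex_derive_continuous (fun x => p + q * x)). auto_derive. auto.
Qed.

(** The case with an obvious primitive, checked by computing the four integrals. It allows the
    linear approximation to be subtracted from f in [goursat_open]. *)
Lemma rectI_affine (k l : C) (a b c d : R) : rectI (fun w => k + l * w)%C a b c d = RtoC 0.
Proof.
  unfold rectI. destruct k as [k1 k2], l as [l1 l2].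
  assert (H : forall y, Cint (fun x => (k1, k2) + (l1, l2) * ((x, y) : C))%C a b =
    ((k1 - l2 * y) * (b - a) + l1 * (b * b - a * a) / 2,
     (k2 + l1 * y) * (b - a) + l2 * (b * b - a * a) / 2)).
  { intros y. apply is_Cint_Cint, is_Cint_pair; unfold Re, Im; simpl.
    - apply is_RInt_ext with (fun x => (k1 - l2 * y) + l1 * x); [intros; simpl; ring|apply is_RInt_linear].
    - apply is_RInt_ext with (fun x => (k2 + l1 * y) + l2 * x); [intros; simpl; ring|apply is_RInt_linear]. }
  assert (V : forall x, Cint (fun y => (k1, k2) + (l1, l2) * ((x, y) : C))%C c d =
    ((k1 + l1 * x) * (d - c) + (- l2) * (d * d - c * c) / 2,
     (k2 + l2 * x) * (d - c) + l1 * (d * d - c * c) / 2)).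
  { intros x. apply is_Cint_Cint, is_Cint_pair; unfold Re, Im; simpl.
    - apply is_RInt_ext with (fun y => (k1 + l1 * x) + (- l2) * y); [intros; simpl; ring|apply is_RInt_linear].
    - apply is_RInt_ext with (fun y => (k2 + l2 * x) + l1 * y); [intros; simpl; ring|apply is_RInt_linear]. }
  rewrite !H, !V. apply C_eq; unfold Re, Im; simpl; field.
Qed.

(** * Cauchy's theorem for rectangles by repeated bisection *)

Section Bisection.
Variables (f : C -> C) (x0 y0 p q : R).

Let size (s : R) (n : nat) : R := s / 2 ^ n.

Let boxI (n : nat) (v : R * R) : C :=
  rectI f (fst v) (fst v + size p n) (snd v) (snd v + size q n).

(** Chooses a quarter whose boundary integral has at least a fourth of the modulus of the whole. The
    last quarter is the default; the triangle inequality in [bisect_large] justifies it. *)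
Let next (n : nat) (v : R * R) : R * R :=
  let q1 := v in
  let q2 := (fst v + size p (S n), snd v) in
  let q3 := (fst v, snd v + size q (S n)) in
  let q4 := (fst v + size p (S n), snd v + size q (S n)) in
  let M := Cmod (boxI n v) / 4 in
  if Rle_dec M (Cmod (boxI (S n) q1)) then q1 else
  if Rle_dec M (Cmod (boxI (S n) q2)) then q2 else
  if Rle_dec M (Cmod (boxI (S n) q3)) then q3 else q4.

Fixpoint bisect (n : nat) : R * R :=
  match n with O => (x0, y0) | S m => next m (bisect m) end.

Hypothesis (hp : 0 < p) (hq : 0 < q).
Hypothesis hf : forall x y, x0 <= x <= x0 + p -> y0 <= y <= y0 + q -> ccont f ((x, y) : C).

Let size_pos (s : R) (n : nat) : 0 < s -> 0 < size s n.
Proof. intros. apply Rdiv_lt_0_compat; [assumption|apply pow_lt; lra]. Qed.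

Let size_S (s : R) (n : nat) : size s n = 2 * size s (S n).
Proof. unfold size. simpl. field. apply pow_nonzero. lra. Qed.

Lemma bisect_step (n : nat) :
  fst (bisect n) <= fst (bisect (S n)) /\
  fst (bisect (S n)) + p / 2 ^ S n <= fst (bisect n) + p / 2 ^ n /\
  snd (bisect n) <= snd (bisect (S n)) /\
  snd (bisect (S n)) + q / 2 ^ S n <= snd (bisect n) + q / 2 ^ n.
Proof.
  fold (size p (S n)) (size p n) (size q n) (size q (S n)).
  rewrite (size_S p n), (size_S q n).
  pose proof (size_pos p (S n) hp). pose proof (size_pos q (S n) hq).
  change (bisect (S n)) with (next n (bisect n)). unfold next.
  destruct Rle_dec; simpl; [lra|]. destruct Rle_dec; simpl; [lra|].
  destruct Rle_dec; simpl; lra.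
Qed.

Lemma bisect_mono (n k : nat) :
  fst (bisect n) <= fst (bisect (n + k)) /\
  fst (bisect (n + k)) + p / 2 ^ (n + k) <= fst (bisect n) + p / 2 ^ n /\
  snd (bisect n) <= snd (bisect (n + k)) /\
  snd (bisect (n + k)) + q / 2 ^ (n + k) <= snd (bisect n) + q / 2 ^ n.
Proof.
  induction k as [|k IH]; [rewrite Nat.add_0_r; lra|].
  rewrite Nat.add_succ_r. pose proof (bisect_step (n + k)). lra.
Qed.

Lemma bisect_large (n : nat) : Cmod (rectI f x0 (x0 + p) y0 (y0 + q)) <= 4 ^ n * Cmod (boxI n (bisect n)).
Proof.
  induction n as [|n IH].
  - unfold boxI, size; simpl. replace (p / 1) with p by field. replace (q / 1) with q by field. lra.
  - apply Rle_trans with (1 := IH).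
    replace (4 ^ S n) with (4 ^ n * 4) by (simpl; ring). rewrite Rmult_assoc.
    apply Rmult_le_compat_l; [apply pow_le; lra|].
    pose proof (bisect_mono 0 n) as Hm. simpl in Hm.
    replace (p / 1) with p in Hm by field. replace (q / 1) with q in Hm by field.
    change (bisect (S n)) with (next n (bisect n)).
    set (v := bisect n) in *.
    fold (size p n) (size q n) in Hm.
    pose proof (size_pos p (S n) hp) as P1. pose proof (size_pos q (S n) hq) as P2.
    assert (Hc : forall x y, fst v <= x <= fst v + size p n -> snd v <= y <= snd v + size q n -> ccont f ((x, y) : C)).
    { intros x y Hx Hy. apply hf; lra. }
    assert (Split : boxI n v = (boxI (S n) v + boxI (S n) ((fst v + size p (S n))%R, snd v)
      + (boxI (S n) (fst v, (snd v + size q (S n))%R)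
      + boxI (S n) ((fst v + size p (S n))%R, (snd v + size q (S n))%R)))%C).
    { unfold boxI; simpl fst; simpl snd.
      rewrite (size_S p n), (size_S q n) in Hc. rewrite (size_S p n), (size_S q n).
      rewrite (rectI_split_y f _ _ _ (snd v + size q (S n))); [|lra|lra|intros x y Hx Hy _; apply Hc; lra].
      replace (snd v + 2 * size q (S n)) with (snd v + size q (S n) + size q (S n)) in * by ring.
      rewrite (rectI_split_x f _ (fst v + size p (S n)) _ (snd v)); [|lra|lra|intros x y Hx Hy _; apply Hc; lra].
      rewrite (rectI_split_x f _ (fst v + size p (S n)) _ (snd v + size q (S n)));
        [|lra|lra|intros x y Hx Hy _; apply Hc; lra].
      replace (fst v + 2 * size p (S n)) with (fst v + size p (S n) + size p (S n)) by ring.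
      reflexivity. }
    unfold next.
    destruct Rle_dec as [H1|H1]; [lra|]. destruct Rle_dec as [H2|H2]; [lra|].
    destruct Rle_dec as [H3|H3]; [lra|].
    apply Rnot_le_lt in H1. apply Rnot_le_lt in H2. apply Rnot_le_lt in H3.
    assert (T : Cmod (boxI n v) <= Cmod (boxI (S n) v) + Cmod (boxI (S n) (fst v + size p (S n), snd v))
      + (Cmod (boxI (S n) (fst v, snd v + size q (S n)))
      + Cmod (boxI (S n) (fst v + size p (S n), snd v + size q (S n))))).
    { rewrite Split at 1. eapply Rle_trans; [apply Cmod_triangle|].
      apply Rplus_le_compat; apply Cmod_triangle. }
    lra.
Qed.

(** Nested intervals: each coordinate is the supremum of the left end points, which every right end
    point bounds. *)
Lemma bisect_limit : exists x y : R, forall n,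
  fst (bisect n) <= x <= fst (bisect n) + p / 2 ^ n /\
  snd (bisect n) <= y <= snd (bisect n) + q / 2 ^ n.
Proof.
  assert (K : forall (u : nat -> R) s, 0 < s ->
    (forall n k, u n <= u (n + k)%nat /\ u (n + k)%nat + s / 2 ^ (n + k) <= u n + s / 2 ^ n) ->
    exists x, forall n, u n <= x <= u n + s / 2 ^ n).
  { intros u s Hs Hu.
    assert (Hu2 : forall m n, u m <= u n + s / 2 ^ n).
    { intros m n. pose proof (size_pos s m Hs) as P. pose proof (size_pos s n Hs) as P'.
      unfold size in P, P'. destruct (le_ge_dec m n) as [L|L].
      - destruct (Hu m (n - m)%nat) as [A _]. replace (m + (n - m))%nat with n in A by lia. lra.
      - destruct (Hu n (m - n)%nat) as [_ A]. replace (n + (m - n))%nat with m in A by lia. lra. }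
    destruct (completeness (fun x => exists n, x = u n)) as [x [Hx1 Hx2]].
    - exists (u 0%nat + s / 2 ^ 0). intros x [n ->]. apply Hu2.
    - exists (u 0%nat), 0%nat. reflexivity.
    - exists x. intros n. split.
      + apply Hx1. exists n. reflexivity.
      + apply Hx2. intros y [m ->]. apply Hu2. }
  destruct (K (fun n => fst (bisect n)) p hp) as [x Hx].
  { intros n k. pose proof (bisect_mono n k). lra. }
  destruct (K (fun n => snd (bisect n)) q hq) as [y Hy].
  { intros n k. pose proof (bisect_mono n k). lra. }
  exists x, y. auto.
Qed.

(** On the n-th box f differs from an affine function, whose integral is 0, by at most eps times the
    distance to the limit point. The integral over it is therefore at most a constant times eps /
    4^n, while [bisect_large] keeps it above a fixed multiple of 1 / 4^n. *)
Lemma goursat_open :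
  (forall x y, x0 <= x <= x0 + p -> y0 <= y <= y0 + q -> cdiff f ((x, y) : C)) ->
  rectI f x0 (x0 + p) y0 (y0 + q) = RtoC 0.
Proof.
  intros Hd. destruct bisect_limit as (x & y & Hxy).
  set (w0 := (x, y) : C).
  assert (Hw0 : cdiff f w0).
  { pose proof (Hxy 0%nat) as H. simpl in H. apply Hd; lra. }
  destruct Hw0 as [l Hl].
  apply Cmod_eq_0. apply Rle_antisym; [|apply Cmod_ge_0].
  apply Rnot_lt_le. intros Hpos.
  set (D := p + q). assert (HD : 0 < D) by (unfold D; lra).
  set (I := Cmod (rectI f x0 (x0 + p) y0 (y0 + q))) in *.
  (* The boxes have perimeter 2 D / 2^n and diameter at most D / 2^n, which leads to I <= 2 * eps *
     D * D; this choice makes the right side I / 2. *)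
  set (eps := I / (4 * D * D)).
  assert (He : 0 < eps) by (apply Rdiv_lt_0_compat; nra).
  pose proof (proj1 (cderiv_eps _ _ _) Hl eps He) as H1.
  apply locally_Cmod in H1. destruct H1 as (d & Hdp & H1).
  destruct (pow_lt_1_zero (/ 2) ltac:(rewrite Rabs_pos_eq; lra) (d / D)) as [n Hn].
  { apply Rdiv_lt_0_compat; lra. }
  specialize (Hn n (Nat.le_refl n)). rewrite Rabs_pos_eq in Hn by (apply pow_le; lra).
  assert (P2 : 0 < 2 ^ n) by (apply pow_lt; lra).
  rewrite pow_inv in Hn.
  assert (Hsz : D / 2 ^ n < d).
  { unfold Rdiv. apply Rmult_lt_compat_l with (r := D) in Hn; [|exact HD].
    replace (D * (d / D)) with d in Hn by (field; lra). exact Hn. }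
  pose proof (bisect_large n) as HL. fold I in HL.
  destruct (Hxy n) as [Hx Hy].
  pose proof (bisect_mono 0 n) as Hm. simpl in Hm.
  replace (p / 1) with p in Hm by field. replace (q / 1) with q in Hm by field.
  unfold boxI in HL. set (v := bisect n) in *.
  pose proof (size_pos p n hp) as Q1. pose proof (size_pos q n hq) as Q2.
  fold (size p n) (size q n) in Hm, Hx, Hy.
  assert (HDn : size p n + size q n = D / 2 ^ n) by (unfold size, D; field; lra).
  set (g := fun w => (f w - f w0 - l * (w - w0))%C).
  assert (Hc : rcontf f (fst v) (fst v + size p n) (snd v) (snd v + size q n)).
  { intros a b Ha Hb _. apply hf; lra. }
  assert (Hg : rcontf g (fst v) (fst v + size p n) (snd v) (snd v + size q n)).
  { intros a b Ha Hb Hbd. unfold g.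
    apply (ccont_minus (fun w => f w - f w0)%C (fun w => l * (w - w0))%C).
    - apply (ccont_minus f (fun _ => f w0)); [apply Hc; assumption|apply ccont_const].
    - apply (ccont_mult (fun _ => l) (fun w => w - w0)%C); [apply ccont_const|].
      apply (ccont_minus (fun w => w) (fun _ => w0)); [apply ccont_id|apply ccont_const]. }
  assert (Haff : rcontf (fun w => (f w0 - l * w0) + l * w)%C (fst v) (fst v + size p n) (snd v) (snd v + size q n)).
  { intros a b Ha Hb _. apply (ccont_plus (fun _ => f w0 - l * w0)%C (fun w => l * w)%C); [apply ccont_const|].
    apply (ccont_mult (fun _ => l) (fun w => w)); [apply ccont_const|apply ccont_id]. }
  assert (E : rectI f (fst v) (fst v + size p n) (snd v) (snd v + size q n) =
    rectI g (fst v) (fst v + size p n) (snd v) (snd v + size q n)).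
  { rewrite (rectI_ext f (fun w => g w + ((f w0 - l * w0) + l * w))%C); try lra.
    - rewrite rectI_plus by (assumption || lra). rewrite rectI_affine. ring.
    - intros a b _ _ _. unfold g. ring. }
  rewrite E in HL.
  assert (B : Cmod (rectI g (fst v) (fst v + size p n) (snd v) (snd v + size q n)) <=
    2 * ((fst v + size p n - fst v) + (snd v + size q n - snd v)) * (eps * (D / 2 ^ n))).
  { apply rectI_bound; try lra; [exact Hg|].
    intros a b Ha Hb _.
    assert (Hab : Cmod ((a, b) - w0)%C <= D / 2 ^ n).
    { apply Rle_trans with (1 := Cmod_le_Re_Im _). rewrite <- HDn.
      unfold w0, Re, Im; simpl. apply Rplus_le_compat; apply Rabs_le; lra. }
    unfold g. apply Rle_trans with (eps * Cmod ((a, b) - w0)%C).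
    - apply H1. lra.
    - apply Rmult_le_compat_l; [lra|exact Hab]. }
  replace (fst v + size p n - fst v + (snd v + size q n - snd v)) with (D / 2 ^ n) in B
    by (rewrite <- HDn; ring).
  assert (F : 4 ^ n = 2 ^ n * 2 ^ n) by (rewrite <- Rpow_mult_distr; f_equal; ring).
  assert (HL2 : I <= 4 ^ n * (2 * (D / 2 ^ n) * (eps * (D / 2 ^ n)))).
  { apply Rle_trans with (1 := HL). apply Rmult_le_compat_l; [apply pow_le; lra|exact B]. }
  rewrite F in HL2.
  replace (2 ^ n * 2 ^ n * (2 * (D / 2 ^ n) * (eps * (D / 2 ^ n)))) with (2 * eps * D * D) in HL2
    by (field; lra).
  unfold eps in HL2. replace (2 * (I / (4 * D * D)) * D * D) with (I / 2) in HL2 by (field; lra).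
  lra.
Qed.

End Bisection.

Lemma Cint_point (f : R -> C) (a : R) : Cint f a a = RtoC 0.
Proof. exact (@RInt_point C_R_CompleteNormedModule a f). Qed.

Theorem goursat (f : C -> C) (a b c d : R) :
  a <= b -> c <= d -> (forall x y, a <= x <= b -> c <= y <= d -> cdiff f ((x, y) : C)) ->
  rectI f a b c d = RtoC 0.
Proof.
  intros Hab Hcd H.
  destruct (Req_dec a b) as [E|E].
  { subst b. unfold rectI. rewrite !Cint_point. ring. }
  destruct (Req_dec c d) as [E2|E2].
  { subst d. unfold rectI. rewrite !Cint_point. ring. }
  replace b with (a + (b - a)) by ring. replace d with (c + (d - c)) by ring.
  apply goursat_open; try lra.
  - intros x y Hx Hy. apply cdiff_ccont, H; lra.
  - intros x y Hx Hy. apply H; lra.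
Qed.

(** The four strips around the inner rectangle are cut off one at a time, each with integral 0 by
    [goursat]. *)
Lemma rectI_frame (f : C -> C) (a a1 b1 b c c1 d1 d : R) :
  a <= a1 -> a1 <= b1 -> b1 <= b -> c <= c1 -> c1 <= d1 -> d1 <= d ->
  (forall x y, a <= x <= b -> c <= y <= d -> ~ (a1 < x < b1 /\ c1 < y < d1) -> cdiff f ((x, y) : C)) ->
  rectI f a b c d = rectI f a1 b1 c1 d1.
Proof.
  intros Ha Hab Hb Hc Hcd Hd H.
  assert (G : forall p q s t, a <= p -> p <= q -> q <= b -> c <= s -> s <= t -> t <= d ->
    (q <= a1 \/ b1 <= p \/ t <= c1 \/ d1 <= s) -> rectI f p q s t = RtoC 0).
  { intros p q s t P1 P2 P3 P4 P5 P6 P7. apply goursat; try lra.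
    intros x y Hx Hy. apply H; lra. }
  rewrite (rectI_split_x f a a1 b c d); [|lra|lra|intros x y Hx Hy Hb'; apply cdiff_ccont, H; lra].
  rewrite (G a a1 c d) by lra.
  rewrite (rectI_split_x f a1 b1 b c d); [|lra|lra|intros x y Hx Hy Hb'; apply cdiff_ccont, H; lra].
  rewrite (G b1 b c d) by lra.
  rewrite (rectI_split_y f a1 b1 c c1 d); [|lra|lra|intros x y Hx Hy Hb'; apply cdiff_ccont, H; lra].
  rewrite (G a1 b1 c c1) by lra.
  rewrite (rectI_split_y f a1 b1 c1 d1 d); [|lra|lra|intros x y Hx Hy Hb'; apply cdiff_ccont, H; lra].
  rewrite (G a1 b1 d1 d) by lra. ring.
Qed.

(** * Cauchy's formula and Taylor expansion on squares *)

Definition sqI (f : C -> C) (c : C) (r : R) : C :=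
  rectI f (Re c - r) (Re c + r) (Im c - r) (Im c + r).

(** The boundary of the square with centre c and half side r takes the place of a circle, since
    Cauchy's theorem has been obtained for rectangles. It lies outside the open disc of radius r and
    inside the closed disc of radius 2 r. *)
Definition sqbd (c : C) (r : R) (w : C) : Prop :=
  Re c - r <= Re w <= Re c + r /\ Im c - r <= Im w <= Im c + r /\
  (Re w = Re c - r \/ Re w = Re c + r \/ Im w = Im c - r \/ Im w = Im c + r).

Lemma sqbd_ge (c : C) (r : R) (w : C) : 0 < r -> sqbd c r w -> r <= Cmod (w - c)%C.
Proof.
  intros Hr (H1 & H2 & H3).
  pose proof (re_le_Cmod (w - c)%C) as A. pose proof (im_le_Cmod (w - c)%C) as B.
  change (Re (w - c)%C) with (Re w - Re c) in A. change (Im (w - c)%C) with (Im w - Im c) in B.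
  pose proof (Rle_abs (Re w - Re c)). pose proof (Rle_abs (- (Re w - Re c))) as A2. rewrite Rabs_Ropp in A2.
  pose proof (Rle_abs (Im w - Im c)). pose proof (Rle_abs (- (Im w - Im c))) as B2. rewrite Rabs_Ropp in B2.
  lra.
Qed.

Lemma sq_le (c : C) (r : R) (w : C) :
  Re c - r <= Re w <= Re c + r -> Im c - r <= Im w <= Im c + r -> Cmod (w - c)%C <= 2 * r.
Proof.
  intros H1 H2. apply Rle_trans with (1 := Cmod_le_Re_Im _).
  change (Re (w - c)%C) with (Re w - Re c). change (Im (w - c)%C) with (Im w - Im c).
  assert (Rabs (Re w - Re c) <= r) by (apply Rabs_le; lra).
  assert (Rabs (Im w - Im c) <= r) by (apply Rabs_le; lra). lra.
Qed.

Lemma sqI_ext (f g : C -> C) (c : C) (r : R) :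
  0 < r -> (forall w, sqbd c r w -> f w = g w) -> sqI f c r = sqI g c r.
Proof.
  intros Hr H. unfold sqI. apply rectI_ext; try lra. intros x y Hx Hy Hb. apply H. unfold sqbd; simpl. auto.
Qed.

Lemma sqI_plus (f g : C -> C) (c : C) (r : R) :
  0 < r -> (forall w, sqbd c r w -> ccont f w) -> (forall w, sqbd c r w -> ccont g w) ->
  sqI (fun w => f w + g w)%C c r = (sqI f c r + sqI g c r)%C.
Proof.
  intros Hr Hf Hg. unfold sqI. apply rectI_plus; try lra.
  - intros x y Hx Hy Hb. apply Hf. unfold sqbd; simpl. auto.
  - intros x y Hx Hy Hb. apply Hg. unfold sqbd; simpl. auto.
Qed.

Lemma sqI_scal (k : C) (f : C -> C) (c : C) (r : R) :
  0 < r -> (forall w, sqbd c r w -> ccont f w) ->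
  sqI (fun w => k * f w)%C c r = (k * sqI f c r)%C.
Proof.
  intros Hr Hf. unfold sqI. apply rectI_scal; try lra.
  intros x y Hx Hy Hb. apply Hf. unfold sqbd; simpl. auto.
Qed.

Lemma sqI_bound (f : C -> C) (c : C) (r M : R) :
  0 < r -> (forall w, sqbd c r w -> ccont f w) -> (forall w, sqbd c r w -> Cmod (f w) <= M) ->
  Cmod (sqI f c r) <= 8 * r * M.
Proof.
  intros Hr Hf HM. apply Rle_trans with (2 * ((Re c + r - (Re c - r)) + (Im c + r - (Im c - r))) * M).
  - unfold sqI. apply rectI_bound; try lra.
    + intros x y Hx Hy Hb. apply Hf. unfold sqbd; simpl. auto.
    + intros x y Hx Hy Hb. apply HM. unfold sqbd; simpl. auto.
  - apply Req_le. ring.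
Qed.

Lemma Re_diff_bound (z c : C) : Re c - Cmod (z - c)%C <= Re z <= Re c + Cmod (z - c)%C.
Proof.
  pose proof (re_le_Cmod (z - c)%C) as A. change (Re (z - c)%C) with (Re z - Re c) in A.
  apply Rabs_le_between in A. lra.
Qed.

Lemma Im_diff_bound (z c : C) : Im c - Cmod (z - c)%C <= Im z <= Im c + Cmod (z - c)%C.
Proof.
  pose proof (im_le_Cmod (z - c)%C) as A. change (Im (z - c)%C) with (Im z - Im c) in A.
  apply Rabs_le_between in A. lra.
Qed.

Lemma sqI_shrink (f : C -> C) (c z : C) (r s : R) :
  0 < s -> Cmod (z - c)%C + s <= r ->
  (forall w, Re c - r <= Re w <= Re c + r -> Im c - r <= Im w <= Im c + r -> s <= Cmod (w - z)%C -> cdiff f w) ->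
  sqI f c r = sqI f z s.
Proof.
  intros Hs Hr H. pose proof (Re_diff_bound z c) as A. pose proof (Im_diff_bound z c) as B.
  unfold sqI. apply rectI_frame; try lra.
  intros x y Hx Hy Hn. apply H; try assumption.
  apply Rnot_lt_le. intros L. apply Hn.
  pose proof (Re_diff_bound (x, y) z) as A'. pose proof (Im_diff_bound (x, y) z) as B'.
  simpl in A', B'. lra.
Qed.

Lemma C_sub_neq_0 (x y : C) : x <> y -> (x - y)%C <> RtoC 0.
Proof. intros H E. apply H. replace x with (x - y + y)%C by ring. rewrite E. ring. Qed.

Lemma Cmod_sub_pos_neq (x y : C) : 0 < Cmod (x - y)%C -> x <> y.
Proof.
  intros H E. subst. replace (y - y)%C with (RtoC 0) in H by ring. rewrite Cmod_0 in H. lra.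
Qed.

Lemma cdiff_inv_sub (z w : C) : w <> z -> cdiff (fun v => / (v - z))%C w.
Proof.
  intros H. apply (cdiff_inv (fun v => v - z)%C).
  - apply C_sub_neq_0, H.
  - apply (cdiff_minus (fun v => v) (fun _ => z)); [apply cdiff_id|apply cdiff_const].
Qed.

Lemma ccont_inv_sub (z w : C) : w <> z -> ccont (fun v => / (v - z))%C w.
Proof. intros H. apply (cdiff_ccont (fun v => / (v - z))%C), cdiff_inv_sub, H. Qed.

(** Phrased for a quantity that does not depend on eps, such as an integral that stays the same when
    the contour changes its size. *)
Lemma is_lim_zero (x : C) (K r0 : R) :
  (forall eps, 0 < eps -> eps < r0 -> Cmod x <= K * eps) -> 0 < r0 -> x = RtoC 0.
Proof.
  intros H Hr. apply Cmod_eq_0, Rle_antisym; [|apply Cmod_ge_0].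
  apply Rnot_lt_le. intros P.
  set (K' := Rabs K + 1). assert (PK : 0 < K') by (pose proof (Rabs_pos K); unfold K'; lra).
  set (eps := Rmin (r0 / 2) (Cmod x / (2 * K'))).
  assert (0 < Cmod x / (2 * K')) by (apply Rdiv_lt_0_compat; lra).
  assert (He : 0 < eps) by (apply Rmin_glb_lt; lra).
  assert (He2 : eps < r0) by (apply Rle_lt_trans with (1 := Rmin_l _ _); lra).
  specialize (H eps He He2).
  assert (He3 : eps <= Cmod x / (2 * K')) by apply Rmin_r.
  assert (K <= K') by (pose proof (Rle_abs K); unfold K'; lra).
  assert (K' * eps <= Cmod x / 2).
  { replace (Cmod x / 2) with (K' * (Cmod x / (2 * K'))) by (field; lra).
    apply Rmult_le_compat_l; lra. }
  nra.
Qed.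

(** The difference of the two integrands decays like |w|^-2, so its integral over a square of half
    side R0 is O(1 / R0); but that integral does not depend on R0. *)
Lemma winding_const (c z : C) (r : R) :
  0 < r -> Cmod (z - c)%C < r ->
  sqI (fun w => / (w - z))%C c r = sqI (fun w => / (w - c))%C c r.
Proof.
  intros Hr Hz.
  set (g := fun w => (/ (w - z) + RtoC (-1) * / (w - c))%C).
  assert (Hz1 : forall R0 w, r <= R0 -> sqbd c R0 w -> w <> z /\ w <> c).
  { intros R0 w HR Hw. pose proof (sqbd_ge c R0 w ltac:(lra) Hw) as H. split.
    - apply Cmod_sub_pos_neq. pose proof (Cmod_triangle_sub w z c). lra.
    - apply Cmod_sub_pos_neq. lra. }
  assert (Z : sqI g c r = RtoC 0).
  { apply is_lim_zero with (16 * Cmod (z - c)%C) (/ (2 * r)); [|apply Rinv_0_lt_compat; lra].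
    intros eps He He2.
    set (R0 := / eps).
    assert (HR : 2 * r < R0).
    { unfold R0. rewrite <- (Rinv_inv (2 * r)). apply Rinv_lt_contravar; [|exact He2].
      apply Rmult_lt_0_compat; [exact He|apply Rinv_0_lt_compat; lra]. }
    assert (E : sqI g c R0 = sqI g c r).
    { apply sqI_shrink; [exact Hr| |].
      - replace (c - c)%C with (RtoC 0) by ring. rewrite Cmod_0. lra.
      - intros w _ _ Hw. unfold g.
        apply (cdiff_plus (fun w => / (w - z))%C (fun w => RtoC (-1) * / (w - c))%C).
        + apply cdiff_inv_sub, Cmod_sub_pos_neq. pose proof (Cmod_triangle_sub w z c). lra.
        + apply (cdiff_mult (fun _ => RtoC (-1)) (fun w => / (w - c))%C); [apply cdiff_const|].
          apply cdiff_inv_sub, Cmod_sub_pos_neq. lra. }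
    rewrite <- E.
    replace (16 * Cmod (z - c)%C * eps) with (8 * R0 * (Cmod (z - c)%C * / (R0 * (R0 / 2))))
      by (unfold R0; field; lra).
    apply sqI_bound; [lra| |].
    - intros w Hw. destruct (Hz1 R0 w ltac:(lra) Hw) as [W1 W2].
      apply cdiff_ccont. unfold g. apply (cdiff_plus (fun w => / (w - z))%C (fun w => RtoC (-1) * / (w - c))%C).
      + apply cdiff_inv_sub, W1.
      + apply (cdiff_mult (fun _ => RtoC (-1)) (fun w => / (w - c))%C); [apply cdiff_const|].
        apply cdiff_inv_sub, W2.
    - intros w Hw. destruct (Hz1 R0 w ltac:(lra) Hw) as [W1 W2].
      pose proof (sqbd_ge c R0 w ltac:(lra) Hw) as H.
      pose proof (Cmod_triangle_sub w z c) as T.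
      apply C_sub_neq_0 in W1. apply C_sub_neq_0 in W2.
      unfold g. replace (/ (w - z) + RtoC (-1) * / (w - c))%C with ((z - c) * / ((w - c) * (w - z)))%C
        by (field; auto).
      rewrite Cmod_mult. apply Rmult_le_compat_l; [apply Cmod_ge_0|].
      rewrite Cmod_inv by (apply Cmult_neq_0; auto). rewrite Cmod_mult.
      apply Rinv_le_contravar; [apply Rmult_lt_0_compat; lra|].
      apply Rmult_le_compat; lra. }
  assert (S : sqI g c r = (sqI (fun w => / (w - z))%C c r + RtoC (-1) * sqI (fun w => / (w - c))%C c r)%C).
  { unfold g. rewrite sqI_plus; [rewrite sqI_scal; [reflexivity|exact Hr|]|exact Hr| |].
    - intros w Hw. destruct (Hz1 r w ltac:(lra) Hw) as [W1 W2]. apply ccont_inv_sub, W2.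
    - intros w Hw. destruct (Hz1 r w ltac:(lra) Hw) as [W1 W2]. apply ccont_inv_sub, W1.
    - intros w Hw. destruct (Hz1 r w ltac:(lra) Hw) as [W1 W2].
      apply (ccont_mult (fun _ => RtoC (-1)) (fun w => / (w - c))%C); [apply ccont_const|].
      apply ccont_inv_sub, W2. }
  rewrite Z in S. symmetry in S.
  replace (sqI (fun w => / (w - z))%C c r) with
    (sqI (fun w => / (w - z))%C c r + RtoC (-1) * sqI (fun w => / (w - c))%C c r
     + sqI (fun w => / (w - c))%C c r)%C by ring.
  rewrite S. ring.
Qed.

Lemma Cint_Re_ge (k : C) (f : R -> C) (a b m : R) :
  a <= b -> (forall t, a <= t <= b -> rcont f t) -> (forall t, a <= t <= b -> m <= Re (k * f t)%C) ->
  (b - a) * m <= Re (k * Cint f a b)%C.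
Proof.
  intros Hab Hf Hm.
  pose proof (is_Cint_Re _ _ _ _ (is_Cint_scal k _ _ _ _ (ex_Cint f a b Hab Hf))) as H.
  replace ((b - a) * m) with (@scal R_Ring R_ModuleSpace (b - a) m) by reflexivity.
  apply (is_RInt_le (fun _ => m) (fun t => Re (k * f t)%C) a b _ _ Hab (is_RInt_const a b m) H).
  intros x Hx. apply Hm. lra.
Qed.

Lemma sum_sq_neq_0 (x y r : R) : 0 < r -> (Rabs x = r \/ Rabs y = r) -> x * x + y * y <> 0.
Proof.
  intros Hr H E. pose proof (Rle_0_sqr x) as H1. pose proof (Rle_0_sqr y) as H2. unfold Rsqr in *.
  assert (x = 0) by nra. assert (y = 0) by nra. subst. rewrite Rabs_R0 in H. lra.
Qed.

(** After multiplication by - i, each side of the square contributes an integrand with real part r /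
    (s^2 + r^2) >= 1 / (2 r) over a length 2 r, hence at least 1. This secures division by the
    integral. *)
Lemma winding_lower (c : C) (r : R) : 0 < r -> 4 <= Cmod (sqI (fun w => / (w - c))%C c r).
Proof.
  intros Hr.
  assert (Q : 4 <= Re (- Ci * sqI (fun w => / (w - c))%C c r)%C).
  { destruct c as [x0 y0]. unfold sqI, rectI.
    change (Re (x0, y0)) with x0. change (Im (x0, y0)) with y0.
    set (f := fun w : C => (/ (w - (x0, y0)))%C).
    set (I1 := (Cint (fun x => f (x, y0 - r)) (x0 - r) (x0 + r)) : C).
    set (I2 := (Cint (fun y => f (x0 + r, y)) (y0 - r) (y0 + r)) : C).
    set (I3 := (Cint (fun x => f (x, y0 + r)) (x0 - r) (x0 + r)) : C).
    set (I4 := (Cint (fun y => f (x0 - r, y)) (y0 - r) (y0 + r)) : C).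
    assert (E : (Ci * Ci)%C = (- RtoC 1)%C) by (apply C_eq; unfold Re, Im; simpl; ring).
    change (4 <= Re (- Ci * (I1 + Ci * I2 - I3 - Ci * I4))%C).
    replace (- Ci * (I1 + Ci * I2 - I3 - Ci * I4))%C with
      (- Ci * I1 + (RtoC 1 * I2 + (Ci * I3 + - RtoC 1 * I4)))%C by ring [E].
    change (4 <= Re (- Ci * I1)%C + (Re (RtoC 1 * I2)%C + (Re (Ci * I3)%C + Re (- RtoC 1 * I4)%C))).
    assert (Hf : forall x y, (x <> x0 \/ y <> y0) -> ccont f (x, y)).
    { intros x y H. apply ccont_inv_sub. intros E'. injection E'. intros -> ->.
      destruct H as [H|H]; apply H; reflexivity. }
    assert (Hb : forall a, - r <= a <= r -> / (2 * r) <= r / (a * a + r * r)).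
    { intros a Ha. assert (Pa : 0 < a * a + r * r) by nra.
      apply Rmult_le_reg_r with (2 * r * (a * a + r * r)); [apply Rmult_lt_0_compat; lra|].
      replace (/ (2 * r) * (2 * r * (a * a + r * r))) with (a * a + r * r) by (field; lra).
      replace (r / (a * a + r * r) * (2 * r * (a * a + r * r))) with (2 * r * r) by (field; lra).
      nra. }
    assert (Hs : (x0 + r - (x0 - r)) * / (2 * r) = 1) by (field; lra).
    assert (Hs' : (y0 + r - (y0 - r)) * / (2 * r) = 1) by (field; lra).
    assert (J1 : 1 <= Re (- Ci * I1)%C).
    { rewrite <- Hs. apply Cint_Re_ge; [lra| |].
      - intros t _. apply rcont_hor, Hf. right. lra.
      - intros t Ht. apply Rle_trans with (1 := Hb (t - x0) ltac:(lra)). apply Req_le.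
        unfold f, Re, Cinv, Im; simpl. field.
        repeat split; try (apply Rgt_not_eq; exact Hr).
        apply sum_sq_neq_0 with r; [exact Hr|right; rewrite Rabs_left; lra]. }
    assert (J2 : 1 <= Re (RtoC 1 * I2)%C).
    { rewrite <- Hs'. apply Cint_Re_ge; [lra| |].
      - intros t _. apply rcont_ver, Hf. left. lra.
      - intros t Ht. apply Rle_trans with (1 := Hb (t - y0) ltac:(lra)). apply Req_le.
        unfold f, Re, Cinv, Im; simpl. field.
        repeat split; try (apply Rgt_not_eq; exact Hr).
        apply sum_sq_neq_0 with r; [exact Hr|left; rewrite Rabs_right; lra]. }
    assert (J3 : 1 <= Re (Ci * I3)%C).
    { rewrite <- Hs. apply Cint_Re_ge; [lra| |].
      - intros t _. apply rcont_hor, Hf. right. lra.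
      - intros t Ht. apply Rle_trans with (1 := Hb (t - x0) ltac:(lra)). apply Req_le.
        unfold f, Re, Cinv, Im; simpl. field.
        repeat split; try (apply Rgt_not_eq; exact Hr).
        apply sum_sq_neq_0 with r; [exact Hr|right; rewrite Rabs_right; lra]. }
    assert (J4 : 1 <= Re (- RtoC 1 * I4)%C).
    { rewrite <- Hs'. apply Cint_Re_ge; [lra| |].
      - intros t _. apply rcont_ver, Hf. left. lra.
      - intros t Ht. apply Rle_trans with (1 := Hb (t - y0) ltac:(lra)). apply Req_le.
        unfold f, Re, Cinv, Im; simpl. field.
        repeat split; try (apply Rgt_not_eq; exact Hr).
        apply sum_sq_neq_0 with r; [exact Hr|left; rewrite Rabs_left; lra]. }
    lra. }
  apply Rle_trans with (1 := Q). apply Rle_trans with (1 := Rle_abs _).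
  apply Rle_trans with (1 := re_le_Cmod _). rewrite Cmod_mult, Cmod_opp, Cmod_Ci. lra.
Qed.

(** The difference quotient of f at z is bounded near z, so its integral over shrinking squares
    tends to 0, and the contour may be shrunk to z because the quotient is differentiable
    elsewhere. *)
Lemma cauchy_formula (f : C -> C) (c z : C) (r : R) :
  0 < r -> Cmod (z - c)%C < r -> (forall w, Cmod (w - c)%C <= 2 * r -> cdiff f w) ->
  sqI (fun w => f w / (w - z))%C c r = (f z * sqI (fun w => / (w - c))%C c r)%C.
Proof.
  intros Hr Hz Hf.
  assert (Hz1 : forall w, sqbd c r w -> w <> z /\ cdiff f w).
  { intros w Hw. pose proof (sqbd_ge c r w Hr Hw) as H. split.
    - apply Cmod_sub_pos_neq. pose proof (Cmod_triangle_sub w z c). lra.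
    - apply Hf. apply sq_le; apply Hw. }
  set (g := fun w => ((f w - f z) / (w - z))%C).
  assert (Hg : forall w, w <> z -> cdiff f w -> cdiff g w).
  { intros w W1 W2. apply (cdiff_mult (fun w => f w - f z)%C (fun w => / (w - z))%C).
    - apply (cdiff_minus f (fun _ => f z)); [exact W2|apply cdiff_const].
    - apply cdiff_inv_sub, W1. }
  assert (Z : sqI g c r = RtoC 0).
  { destruct (Hf z ltac:(lra)) as [l0 Hl]. set (l := l0 : C) in *.
    pose proof (proj1 (cderiv_eps f z l) Hl 1 Rlt_0_1) as H1.
    apply locally_Cmod in H1. destruct H1 as (d & Hd & H1).
    apply is_lim_zero with (8 * (1 + Cmod l)) (Rmin (d / 2) (r - Cmod (z - c)%C)).
    2: { apply Rmin_glb_lt; lra. }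
    intros eps He He2.
    assert (He3 : eps < d / 2) by (apply Rlt_le_trans with (1 := He2), Rmin_l).
    assert (He4 : eps < r - Cmod (z - c)%C) by (apply Rlt_le_trans with (1 := He2), Rmin_r).
    rewrite (sqI_shrink g c z r eps); [|exact He|lra|].
    - replace (8 * (1 + Cmod l) * eps) with (8 * eps * (1 + Cmod l)) by ring.
      apply sqI_bound; [exact He| |].
      + intros w Hw. pose proof (sqbd_ge z eps w He Hw) as H.
        pose proof (sq_le z eps w (proj1 Hw) (proj1 (proj2 Hw))) as H'.
        apply cdiff_ccont, Hg; [apply Cmod_sub_pos_neq; lra|].
        apply Hf. pose proof (Cmod_triangle_sub w z c). pose proof (Cmod_ge_0 (z - c)%C). lra.
      + intros w Hw. pose proof (sqbd_ge z eps w He Hw) as H.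
        pose proof (sq_le z eps w (proj1 Hw) (proj1 (proj2 Hw))) as H'.
        assert (W : w <> z) by (apply Cmod_sub_pos_neq; lra).
        specialize (H1 w ltac:(lra)). apply C_sub_neq_0 in W.
        unfold g. replace ((f w - f z) / (w - z))%C with ((f w - f z - l * (w - z)) / (w - z) + l)%C
          by (field; exact W).
        apply Rle_trans with (1 := Cmod_triangle _ _). apply Rplus_le_compat_r.
        rewrite Cmod_div by exact W.
        apply Rmult_le_reg_r with (Cmod (w - z)%C); [lra|].
        unfold Rdiv. rewrite Rmult_assoc, Rinv_l, Rmult_1_r by lra. exact H1.
    - intros w W1 W2 W3. apply Hg; [apply Cmod_sub_pos_neq; lra|].
      apply Hf. apply sq_le; assumption. }
  rewrite (sqI_ext _ (fun w => g w + f z * / (w - z))%C); [|exact Hr|].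
  - rewrite sqI_plus; [|exact Hr| |].
    + rewrite sqI_scal; [|exact Hr|].
      * rewrite Z, winding_const by assumption. ring.
      * intros w Hw. apply ccont_inv_sub, Hz1, Hw.
    + intros w Hw. apply cdiff_ccont, Hg; apply Hz1, Hw.
    + intros w Hw. apply (ccont_mult (fun _ => f z) (fun w => / (w - z))%C); [apply ccont_const|].
      apply ccont_inv_sub, Hz1, Hw.
  - intros w Hw. destruct (Hz1 w Hw) as [W _]. apply C_sub_neq_0 in W. unfold g. field. exact W.
Qed.

Fixpoint csum (u : nat -> C) (n : nat) : C :=
  match n with O => RtoC 0 | S m => (csum u m + u m)%C end.

(** The identity 1 / (w - z) = 1 / (w - c) + (z - c) / ((w - c) (w - z)) is iterated inside Cauchy's
    formula. The remainder integral is at most 16 M / r^N, and the lower bound 4 for the winding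
    integral [K] leaves the factor 4. *)
Theorem taylor (f : C -> C) (c : C) (r M : R) :
  0 < r -> (forall w, Cmod (w - c)%C <= 2 * r -> cdiff f w) ->
  (forall w, sqbd c r w -> Cmod (f w) <= M) ->
  exists a : nat -> C, forall N z, Cmod (z - c)%C <= r / 2 ->
    Cmod (f z - csum (fun n => a n * (z - c) ^ n)%C N)%C <= 4 * M * (Cmod (z - c)%C / r) ^ N.
Proof.
  intros Hr Hf HM.
  set (K := sqI (fun w => / (w - c))%C c r).
  assert (HK : 4 <= Cmod K) by (apply winding_lower, Hr).
  assert (HK0 : K <> RtoC 0) by (apply Cmod_gt_0; lra).
  assert (PM : 0 <= M).
  { apply Rle_trans with (1 := Cmod_ge_0 (f (Re c - r, Im c - r))), HM.
    unfold sqbd; simpl; lra. }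
  set (A := fun n => sqI (fun w => f w / (w - c) ^ S n)%C c r).
  exists (fun n => A n / K)%C.
  intros N z Hz.
  assert (Hw1 : forall w, sqbd c r w -> r <= Cmod (w - c)%C /\ r / 2 <= Cmod (w - z)%C /\
    (w - c)%C <> RtoC 0 /\ (w - z)%C <> RtoC 0 /\ cdiff f w /\ Cmod (f w) <= M).
  { intros w Hw. pose proof (sqbd_ge c r w Hr Hw) as H.
    pose proof (Cmod_triangle_sub w z c) as T.
    split; [exact H|split; [lra|split; [|split; [|split]]]].
    - apply Cmod_gt_0. lra.
    - apply Cmod_gt_0. lra.
    - apply Hf, sq_le; apply Hw.
    - apply HM, Hw. }
  assert (Cn : forall n w, sqbd c r w -> cdiff (fun w => / (w - c) ^ n)%C w).
  { intros n w Hw. destruct (Hw1 w Hw) as (W1 & W2 & W3 & W4 & W5 & W6).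
    apply (cdiff_inv (fun w => (w - c) ^ n)%C); [apply Cpow_nz, W3|].
    induction n as [|n IH]; simpl; [apply cdiff_const|].
    apply (cdiff_mult (fun w => w - c)%C (fun w => (w - c) ^ n)%C); [|exact IH].
    apply (cdiff_minus (fun w => w) (fun _ => c)); [apply cdiff_id|apply cdiff_const]. }
  set (rem := fun n w => (f w * (/ (w - c) ^ n * / (w - z)))%C).
  assert (Crem : forall n w, sqbd c r w -> ccont (rem n) w).
  { intros n w Hw. destruct (Hw1 w Hw) as (W1 & W2 & W3 & W4 & W5 & W6). apply cdiff_ccont.
    apply (cdiff_mult f (fun w => / (w - c) ^ n * / (w - z))%C); [exact W5|].
    apply (cdiff_mult (fun w => / (w - c) ^ n)%C (fun w => / (w - z))%C); [apply Cn, Hw|].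
    apply cdiff_inv_sub. apply Cmod_sub_pos_neq. lra. }
  assert (Ca : forall n w, sqbd c r w -> ccont (fun w => f w / (w - c) ^ S n)%C w).
  { intros n w Hw. destruct (Hw1 w Hw) as (W1 & W2 & W3 & W4 & W5 & W6).
    exact (cdiff_ccont _ _ (cdiff_mult f (fun w => / (w - c) ^ S n)%C w W5 (Cn (S n) w Hw))). }
  assert (Exp : forall n, (f z * K)%C =
    (csum (fun n => A n * (z - c) ^ n) n
     + (z - c) ^ n * sqI (rem n) c r)%C).
  { intros n. induction n as [|n IH].
    - simpl. unfold K. rewrite <- cauchy_formula by (assumption || lra).
      rewrite (sqI_ext (rem 0%nat) (fun w => f w / (w - z))%C); [ring|exact Hr|].
      intros w Hw. unfold rem. simpl. destruct (Hw1 w Hw) as (W1 & W2 & W3 & W4 & W5 & W6). field. exact W4.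
    - rewrite IH. cbn [csum].
      rewrite (sqI_ext (rem n) (fun w => f w / (w - c) ^ S n + (z - c) * rem (S n) w)%C); [|exact Hr|].
      + rewrite sqI_plus; [rewrite sqI_scal|..]; try exact Hr; try (intros; apply Ca; assumption);
          try (intros; apply Crem; assumption).
        * unfold A. cbn [Cpow]. ring.
        * intros w Hw. apply (ccont_mult (fun _ => z - c)%C (rem (S n))); [apply ccont_const|apply Crem, Hw].
      + intros w Hw. unfold rem. destruct (Hw1 w Hw) as (W1 & W2 & W3 & W4 & W5 & W6).
        simpl. field. split; [exact W4|split; [apply Cpow_nz, W3|exact W3]]. }
  assert (Sum : csum (fun n => A n / K * (z - c) ^ n)%C N = (csum (fun n => A n * (z - c) ^ n)%C N / K)%C).
  { clear Exp. induction N as [|N IH]; cbn [csum]; [field; exact HK0|]. rewrite IH. field. exact HK0. }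
  rewrite Sum.
  replace (f z - csum (fun n => A n * (z - c) ^ n) N / K)%C
    with ((z - c) ^ N * sqI (rem N) c r / K)%C.
  2: { replace (f z) with (f z * K / K)%C by (field; exact HK0). rewrite (Exp N). field. exact HK0. }
  rewrite Cmod_div by exact HK0. rewrite Cmod_mult, Cmod_pow.
  assert (B : Cmod (sqI (rem N) c r) <= 8 * r * (M * (/ r ^ N * / (r / 2)))).
  { apply sqI_bound; [exact Hr|apply Crem|].
    intros w Hw. destruct (Hw1 w Hw) as (W1 & W2 & W3 & W4 & W5 & W6). unfold rem.
    rewrite !Cmod_mult, !Cmod_inv by (assumption || apply Cpow_nz, W3). rewrite Cmod_pow.
    assert (0 < r ^ N) by (apply pow_lt, Hr).
    assert (r ^ N <= Cmod (w - c)%C ^ N) by (apply pow_incr; lra).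
    apply Rmult_le_compat; [apply Cmod_ge_0| |exact W6|].
    - apply Rmult_le_pos; left; apply Rinv_0_lt_compat; lra.
    - apply Rmult_le_compat; try (left; apply Rinv_0_lt_compat; lra).
      + apply Rinv_le_contravar; lra.
      + apply Rinv_le_contravar; lra. }
  assert (0 < r ^ N) by (apply pow_lt, Hr).
  replace (8 * r * (M * (/ r ^ N * / (r / 2)))) with (16 * M / r ^ N) in B by (field; lra).
  unfold Rdiv at 2. rewrite Rpow_mult_distr, pow_inv.
  assert (Pz : 0 <= Cmod (z - c)%C ^ N) by (apply pow_le, Cmod_ge_0).
  apply Rmult_le_reg_r with (Cmod K); [lra|].
  unfold Rdiv. rewrite Rmult_assoc, Rinv_l, Rmult_1_r by lra.
  apply Rle_trans with (Cmod (z - c)%C ^ N * (16 * M / r ^ N)).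
  - apply Rmult_le_compat_l; assumption.
  - assert (0 <= M * (Cmod (z - c)%C ^ N * / r ^ N)).
    { apply Rmult_le_pos; [exact PM|]. apply Rmult_le_pos; [exact Pz|]. left. apply Rinv_0_lt_compat; assumption. }
    unfold Rdiv. nra.
Qed.

(** * Identity theorem and locally uniform limits *)

Lemma segment_bounded (g : R -> C) (a b : R) :
  a <= b -> (forall t, a <= t <= b -> rcont g t) -> exists M, forall t, a <= t <= b -> Cmod (g t) <= M.
Proof.
  intros Hab H.
  destruct (continuity_ab_maj (fun t => Cmod (g t)) a b Hab) as (m & Hm & _).
  - intros t Ht. apply continuity_pt_filterlim. intros P [eps HP].
    specialize (H t Ht eps (cond_pos eps)). unfold filtermap. generalize H. apply filter_imp.
    intros s Hs. apply HP. unfold ball; simpl. unfold AbsRing_ball, abs, minus, plus, opp; simpl.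
    apply Rabs_def1.
    + pose proof (Cmod_triangle_inv (g s) (g t)). lra.
    + pose proof (Cmod_triangle_inv (g t) (g s)) as K. rewrite Cmod_sub_comm in K. lra.
  - exists (Cmod (g m)). exact Hm.
Qed.

Lemma sqbd_bounded (f : C -> C) (c : C) (r : R) :
  0 < r -> (forall w, sqbd c r w -> ccont f w) -> exists M, forall w, sqbd c r w -> Cmod (f w) <= M.
Proof.
  intros Hr Hf.
  destruct (segment_bounded (fun t => f (t, Im c - r)) (Re c - r) (Re c + r)) as [M1 H1]; [lra| |].
  { intros t Ht. apply rcont_hor, Hf. unfold sqbd; simpl; lra. }
  destruct (segment_bounded (fun t => f (t, Im c + r)) (Re c - r) (Re c + r)) as [M2 H2]; [lra| |].
  { intros t Ht. apply rcont_hor, Hf. unfold sqbd; simpl; lra. }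
  destruct (segment_bounded (fun t => f (Re c - r, t)) (Im c - r) (Im c + r)) as [M3 H3]; [lra| |].
  { intros t Ht. apply rcont_ver, Hf. unfold sqbd; simpl; lra. }
  destruct (segment_bounded (fun t => f (Re c + r, t)) (Im c - r) (Im c + r)) as [M4 H4]; [lra| |].
  { intros t Ht. apply rcont_ver, Hf. unfold sqbd; simpl; lra. }
  exists (Rmax (Rmax M1 M2) (Rmax M3 M4)).
  pose proof (Rmax_l (Rmax M1 M2) (Rmax M3 M4)). pose proof (Rmax_r (Rmax M1 M2) (Rmax M3 M4)).
  pose proof (Rmax_l M1 M2). pose proof (Rmax_r M1 M2).
  pose proof (Rmax_l M3 M4). pose proof (Rmax_r M3 M4).
  intros [x y] (Hx & Hy & [E|[E|[E|E]]]); simpl in *; subst.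
  - apply Rle_trans with (1 := H3 y Hy). lra.
  - apply Rle_trans with (1 := H4 y Hy). lra.
  - apply Rle_trans with (1 := H1 x Hx). lra.
  - apply Rle_trans with (1 := H2 x Hx). lra.
Qed.

(** All Taylor coefficients vanish: once those below n do, evaluation at c + eps bounds |a n| eps^n
    by a multiple of eps^(n + 1). The remainder then tends to 0 on the smaller disc. *)
Lemma identity_disc (f : C -> C) (c : C) (r : R) :
  0 < r -> (forall w, Cmod (w - c)%C <= 2 * r -> cdiff f w) ->
  locally c (fun w => f w = RtoC 0) -> forall z, Cmod (z - c)%C <= r / 2 -> f z = RtoC 0.
Proof.
  intros Hr Hf H0.
  destruct (sqbd_bounded f c r Hr) as [M HM].
  { intros w Hw. apply cdiff_ccont, Hf, sq_le; apply Hw. }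
  destruct (taylor f c r M Hr Hf HM) as [a Ha].
  apply locally_Cmod in H0. destruct H0 as (d & Hd & H0).
  assert (A0 : forall n, (forall k, (k < n)%nat -> a k = RtoC 0)).
  { intros n. induction n as [|n IH]; [lia|].
    intros k Hk. destruct (Nat.eq_dec k n) as [->|Hk']; [|apply IH; lia].
    apply is_lim_zero with (4 * M * (/ r) ^ S n) (Rmin d (r / 2)); [|apply Rmin_glb_lt; lra].
    intros eps He He2.
    pose proof (Rlt_le_trans _ _ _ He2 (Rmin_l _ _)) as E1.
    pose proof (Rlt_le_trans _ _ _ He2 (Rmin_r _ _)) as E2.
    assert (Hz : Cmod (c + RtoC eps - c)%C = eps).
    { replace (c + RtoC eps - c)%C with (RtoC eps) by ring. rewrite Cmod_R. apply Rabs_pos_eq. lra. }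
    specialize (Ha (S n) (c + RtoC eps)%C). rewrite Hz in Ha. specialize (Ha ltac:(lra)).
    rewrite H0 in Ha by (rewrite Hz; exact E1).
    assert (S0 : forall m, (m <= n)%nat -> csum (fun k => a k * (c + RtoC eps - c) ^ k)%C m = RtoC 0).
    { intros m. induction m as [|m IHm]; intros Hm; [reflexivity|].
      simpl. rewrite IHm, IH by lia. ring. }
    simpl csum in Ha. rewrite S0 in Ha by lia.
    replace (0 - (0 + a n * (c + RtoC eps - c) ^ n))%C with (- (a n * (c + RtoC eps - c) ^ n))%C in Ha by ring.
    rewrite Cmod_opp, Cmod_mult, Cmod_pow, Hz in Ha.
    assert (0 < eps ^ n) by (apply pow_lt, He).
    apply Rmult_le_reg_r with (eps ^ n); [assumption|].
    apply Rle_trans with (1 := Ha). unfold Rdiv. rewrite Rpow_mult_distr. simpl. right. ring. }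
  intros z Hz.
  apply is_lim_zero with 1 1; [|lra]. intros eps He _.
  assert (PM : 0 <= M).
  { apply Rle_trans with (1 := Cmod_ge_0 (f (Re c - r, Im c - r))), HM.
    unfold sqbd; simpl; lra. }
  destruct (pow_lt_1_zero (/ 2) ltac:(rewrite Rabs_pos_eq; lra) (eps / (4 * M + 1))) as [N HN].
  { apply Rdiv_lt_0_compat; lra. }
  specialize (HN N (Nat.le_refl N)). rewrite Rabs_pos_eq in HN by (apply pow_le; lra).
  specialize (Ha N z Hz).
  assert (S0 : forall m, csum (fun k => a k * (z - c) ^ k)%C m = RtoC 0).
  { intros m. induction m as [|m IHm]; [reflexivity|]. simpl. rewrite IHm, (A0 (S m)) by lia. ring. }
  rewrite S0 in Ha. replace (f z - 0)%C with (f z) in Ha by ring.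
  apply Rle_trans with (1 := Ha).
  assert (Q : (Cmod (z - c)%C / r) ^ N <= (/ 2) ^ N).
  { apply pow_incr. split.
    - apply Rmult_le_pos; [apply Cmod_ge_0|left; apply Rinv_0_lt_compat, Hr].
    - apply Rmult_le_reg_r with r; [exact Hr|]. unfold Rdiv. rewrite Rmult_assoc, Rinv_l, Rmult_1_r by lra. lra. }
  assert (Q2 : (4 * M + 1) * (/ 2) ^ N < eps).
  { apply Rmult_lt_compat_l with (r := 4 * M + 1) in HN; [|lra].
    replace ((4 * M + 1) * (eps / (4 * M + 1))) with eps in HN by (field; lra). exact HN. }
  assert (0 <= (/ 2) ^ N) by (apply pow_le; lra).
  nra.
Qed.

(** Both estimates depend on f only through the bound M on the square. This uniformity is what
    allows derivatives to pass to the limit in [weierstrass]. *)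
Lemma second_order (f : C -> C) (c : C) (r M : R) :
  0 < r -> (forall w, Cmod (w - c)%C <= 2 * r -> cdiff f w) ->
  (forall w, sqbd c r w -> Cmod (f w) <= M) ->
  Cmod (C_derive f c) <= 6 * M / r /\
  forall z, Cmod (z - c)%C <= r / 2 ->
    Cmod (f z - f c - C_derive f c * (z - c))%C <= 4 * M / (r * r) * (Cmod (z - c)%C * Cmod (z - c)%C).
Proof.
  intros Hr Hf HM. destruct (taylor f c r M Hr Hf HM) as [a Ha].
  assert (PM : 0 <= M).
  { apply Rle_trans with (1 := Cmod_ge_0 (f (Re c - r, Im c - r))), HM.
    unfold sqbd; simpl; lra. }
  assert (Hcc : Cmod (c - c)%C = 0).
  { replace (c - c)%C with (RtoC 0) by ring. apply Cmod_0. }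
  assert (E0 : a 0%nat = f c).
  { specialize (Ha 1%nat c). rewrite Hcc in Ha. specialize (Ha ltac:(lra)). simpl in Ha.
    replace (0 / r * 1) with 0 in Ha by (field; lra). rewrite Rmult_0_r in Ha.
    assert (Z : (f c - (0 + a 0%nat * 1))%C = RtoC 0)
      by (apply Cmod_eq_0, Rle_antisym; [exact Ha|apply Cmod_ge_0]).
    replace (a 0%nat) with (f c - (f c - (0 + a 0%nat * 1)))%C by ring. rewrite Z. ring. }
  assert (B : forall z, Cmod (z - c)%C <= r / 2 ->
    Cmod (f z - f c - a 1%nat * (z - c))%C <= 4 * M / (r * r) * (Cmod (z - c)%C * Cmod (z - c)%C)).
  { intros z Hz. specialize (Ha 2%nat z Hz). simpl in Ha. rewrite E0 in Ha.
    replace (f z - f c - a 1%nat * (z - c))%C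
      with (f z - (0 + f c * 1 + a 1%nat * ((z - c) * 1)))%C by ring.
    apply Rle_trans with (1 := Ha). right. field. lra. }
  assert (D : cderiv f c (a 1%nat)).
  { apply cderiv_eps. intros eps He.
    set (K := 4 * M / (r * r)) in *.
    assert (PK : 0 <= K) by (apply Rmult_le_pos; [lra|left; apply Rinv_0_lt_compat; nra]).
    apply locally_Cmod. exists (Rmin (r / 2) (eps / (K + 1))). split.
    - apply Rmin_glb_lt; [lra|apply Rdiv_lt_0_compat; lra].
    - intros w Hw. pose proof (Rlt_le_trans _ _ _ Hw (Rmin_l _ _)) as W1.
      pose proof (Rlt_le_trans _ _ _ Hw (Rmin_r _ _)) as W2.
      apply Rle_trans with (1 := B w ltac:(lra)). rewrite <- Rmult_assoc.
      apply Rmult_le_compat_r; [apply Cmod_ge_0|].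
      apply Rmult_lt_compat_l with (r := K + 1) in W2; [|lra].
      replace ((K + 1) * (eps / (K + 1))) with eps in W2 by (field; lra).
      pose proof (Cmod_ge_0 (w - c)%C). nra. }
  rewrite (is_C_derive_unique f c _ D). split; [|exact B].
  (* At distance r / 2 the remainders after one and two terms are at most 2 M and M, so the
     derivative is at most 3 M / (r / 2). *)
  set (z := (c + RtoC (r / 2))%C).
  assert (Hz : Cmod (z - c)%C = r / 2).
  { unfold z. replace (c + RtoC (r / 2) - c)%C with (RtoC (r / 2)) by ring.
    rewrite Cmod_R. apply Rabs_pos_eq. lra. }
  assert (B2 := B z ltac:(lra)). assert (B1 := Ha 1%nat z ltac:(lra)). simpl in B1. rewrite E0, Hz in B1.
  rewrite Hz in B2.
  assert (T : Cmod (a 1%nat * (z - c))%C <= 4 * M * (r / 2 / r * 1) + 4 * M / (r * r) * (r / 2 * (r / 2))).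
  { replace (a 1%nat * (z - c))%C with ((f z - (0 + f c * 1)) + - (f z - f c - a 1%nat * (z - c)))%C by ring.
    apply Rle_trans with (1 := Cmod_triangle _ _). rewrite Cmod_opp. lra. }
  rewrite Cmod_mult, Hz in T.
  apply Rmult_le_reg_r with (r / 2); [lra|]. apply Rle_trans with (1 := T). right. field. lra.
Qed.

Lemma C_cauchy_cvg (u : nat -> C) :
  (forall eps, 0 < eps -> exists N, forall n m, (N <= n)%nat -> (N <= m)%nat -> Cmod (u n - u m)%C < eps) ->
  exists l, cvg eventually u l.
Proof.
  intros H.
  destruct (proj1 (@filterlim_locally_cauchy nat C_CompleteNormedModule eventually _ u)) as [l Hl].
  - intros eps. destruct (H eps (cond_pos eps)) as [N HN].
    exists (fun n => (N <= n)%nat). split; [exists N; auto|].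
    intros n m Hn Hm. apply C_NormedModule_mixin_compat1. apply HN; assumption.
  - exists l. apply filterlim_cvg; [apply filter_filter|exact Hl].
Qed.

(** By [second_order] applied to differences, the derivatives at c form a Cauchy sequence; by
    [second_order] applied to f n, the quadratic remainder bound survives the limit and shows that g
    has the limit of the derivatives as its derivative. *)
Lemma weierstrass (f : nat -> C -> C) (g : C -> C) (c : C) (r : R) :
  0 < r -> (forall n w, Cmod (w - c)%C <= 2 * r -> cdiff (f n) w) ->
  (forall eps, 0 < eps -> exists N, forall n w, (N <= n)%nat -> Cmod (w - c)%C <= 2 * r ->
    Cmod (f n w - g w)%C <= eps) ->
  cdiff g c.
Proof.
  intros Hr Hf Hu.
  assert (Hin : forall w, sqbd c r w -> Cmod (w - c)%C <= 2 * r) by (intros w Hw; apply sq_le; apply Hw).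
  assert (Hdd : forall n m, C_derive (fun w => f n w - f m w)%C c = (C_derive (f n) c - C_derive (f m) c)%C).
  { intros n m. apply is_C_derive_unique. apply cderiv_minus; apply C_derive_correct; try exact c;
    apply Hf; replace (c - c)%C with (RtoC 0) by ring; rewrite Cmod_0; lra. }
  destruct (C_cauchy_cvg (fun n => C_derive (f n) c)) as [l Hl].
  { intros eps He. destruct (Hu (r * eps / 24)) as [N HN].
    { apply Rdiv_lt_0_compat; [apply Rmult_lt_0_compat; assumption|lra]. }
    exists N. intros n m Hn Hm. rewrite <- Hdd.
    destruct (second_order (fun w => f n w - f m w)%C c r (r * eps / 12) Hr) as [B _].
    - intros w Hw. apply cdiff_minus; apply Hf, Hw.
    - intros w Hw. apply Rle_trans with (1 := Cmod_triangle_sub _ (g w) _).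
      pose proof (HN n w Hn (Hin w Hw)). pose proof (HN m w Hm (Hin w Hw)) as H2.
      rewrite Cmod_sub_comm in H2. lra.
    - apply Rle_lt_trans with (1 := B). replace (6 * (r * eps / 12) / r) with (eps / 2) by (field; lra). lra. }
  destruct (Hu 1 Rlt_0_1) as [N0 HN0].
  destruct (sqbd_bounded (f N0) c r Hr) as [M HM].
  { intros w Hw. apply cdiff_ccont, Hf, Hin, Hw. }
  assert (B : forall n z, (N0 <= n)%nat -> Cmod (z - c)%C <= r / 2 ->
    Cmod (f n z - f n c - C_derive (f n) c * (z - c))%C <= 4 * (M + 2) / (r * r) * (Cmod (z - c)%C * Cmod (z - c)%C)).
  { intros n z Hn Hz. destruct (second_order (f n) c r (M + 2) Hr) as [_ B].
    - intros w Hw. apply Hf, Hw.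
    - intros w Hw. pose proof (HN0 n w Hn (Hin w Hw)) as H1. pose proof (HN0 N0 w (Nat.le_refl _) (Hin w Hw)) as H2.
      pose proof (HM w Hw). rewrite Cmod_sub_comm in H2.
      pose proof (Cmod_triangle_inv (f n w) (f N0 w)). pose proof (Cmod_triangle_sub (f n w) (g w) (f N0 w)). lra.
    - apply B, Hz. }
  assert (Hlim : forall z, Cmod (z - c)%C <= 2 * r -> cvg eventually (fun n => f n z) (g z)).
  { intros z Hz eps He. destruct (Hu (eps / 2) ltac:(lra)) as [N HN]. exists N. intros n Hn.
    pose proof (HN n z Hn Hz). lra. }
  assert (B' : forall z, Cmod (z - c)%C <= r / 2 ->
    Cmod (g z - g c - l * (z - c))%C <= 4 * (M + 2) / (r * r) * (Cmod (z - c)%C * Cmod (z - c)%C)).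
  { intros z Hz.
    apply (cvg_Cmod_le eventually (fun n => f n z - f n c - C_derive (f n) c * (z - c))%C).
    - apply cvg_minus; [apply eventually_filter| |].
      + apply cvg_minus; [apply eventually_filter| |]; apply Hlim; [lra|].
        replace (c - c)%C with (RtoC 0) by ring. rewrite Cmod_0. lra.
      + apply cvg_mult; [apply eventually_filter|exact Hl|apply cvg_const, eventually_filter].
    - exists N0. intros n Hn. apply B; assumption. }
  exists l. apply cderiv_eps. intros eps He.
  assert (PM : 0 <= M).
  { apply Rle_trans with (1 := Cmod_ge_0 (f N0 (Re c - r, Im c - r))), HM.
    unfold sqbd; simpl; lra. }
  set (K := 4 * (M + 2) / (r * r)) in *.
  assert (PK : 0 <= K) by (apply Rmult_le_pos; [lra|left; apply Rinv_0_lt_compat; nra]).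
  apply locally_Cmod. exists (Rmin (r / 2) (eps / (K + 1))). split.
  - apply Rmin_glb_lt; [lra|apply Rdiv_lt_0_compat; lra].
  - intros w Hw. pose proof (Rlt_le_trans _ _ _ Hw (Rmin_l _ _)) as W1.
    pose proof (Rlt_le_trans _ _ _ Hw (Rmin_r _ _)) as W2.
    apply Rle_trans with (1 := B' w ltac:(lra)). rewrite <- Rmult_assoc.
    apply Rmult_le_compat_r; [apply Cmod_ge_0|].
    apply Rmult_lt_compat_l with (r := K + 1) in W2; [|lra].
    replace ((K + 1) * (eps / (K + 1))) with eps in W2 by (field; lra).
    pose proof (Cmod_ge_0 (w - c)%C). nra.
Qed.

(** The difference quotients with step [h n] converge to the derivative uniformly near c, so
    [weierstrass] applies. It is used for [q1], which is built from derivatives. *)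
Lemma C_derive_cdiff (f : C -> C) (c : C) :
  locally c (fun w => cdiff f w) -> cdiff (C_derive f) c.
Proof.
  intros H.
  pose proof (cdiff_ccont _ _ (locally_singleton _ _ H) 1 Rlt_0_1) as Hc.
  apply locally_Cmod in H. destruct H as (d & Hd & H).
  apply locally_Cmod in Hc. destruct Hc as (d2 & Hd2 & Hc).
  set (M := Cmod (f c) + 1).
  assert (HM : forall w, Cmod (w - c)%C < d2 -> Cmod (f w) <= M).
  { intros w Hw. specialize (Hc w Hw). pose proof (Cmod_triangle_inv (f w) (f c)). unfold M. lra. }
  set (r := Rmin d d2 / 8).
  assert (Pd : 0 < Rmin d d2) by (apply Rmin_glb_lt; assumption).
  assert (Hr : 0 < r) by (unfold r; lra).
  assert (R1 : 8 * r <= d) by (unfold r; pose proof (Rmin_l d d2); lra).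
  assert (R2 : 8 * r <= d2) by (unfold r; pose proof (Rmin_r d d2); lra).
  set (h := fun n : nat => r / 2 / (INR n + 1)).
  assert (Hh : forall n, 0 < h n <= r / 2).
  { intros n. pose proof (pos_INR n). split.
    - apply Rdiv_lt_0_compat; lra.
    - apply Rmult_le_reg_r with (INR n + 1); [lra|]. unfold h.
      replace (r / 2 / (INR n + 1) * (INR n + 1)) with (r / 2) by (field; lra). nra. }
  apply (weierstrass (fun n w => (f (w + RtoC (h n)) - f w) / RtoC (h n))%C _ c r Hr).
  - intros n w Hw. assert (Hn : RtoC (h n) <> RtoC 0).
    { intros E. apply (f_equal Re) in E. simpl in E. pose proof (Hh n). lra. }
    apply (cdiff_mult (fun w => f (w + RtoC (h n)) - f w)%C (fun _ => / RtoC (h n))%C); [|apply cdiff_const].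
    apply (cdiff_minus (fun w => f (w + RtoC (h n)))%C f); [|apply H; lra].
    apply (cdiff_comp f (fun w => w + RtoC (h n))%C).
    + apply H. replace (w + RtoC (h n) - c)%C with ((w - c) + RtoC (h n))%C by ring.
      apply Rle_lt_trans with (1 := Cmod_triangle _ _). rewrite Cmod_R, Rabs_pos_eq; pose proof (Hh n); lra.
    + apply (cdiff_plus (fun w => w) (fun _ => RtoC (h n))); [apply cdiff_id|apply cdiff_const].
  - intros eps He.
    assert (PM : 0 < M) by (unfold M; pose proof (Cmod_ge_0 (f c)); lra).
    destruct (nfloor_ex (2 * M / r / eps)) as [N [_ HN]].
    { apply Rmult_le_pos; [apply Rmult_le_pos; [lra|]|]; left; apply Rinv_0_lt_compat; lra. }
    exists N. intros n w Hn Hw.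
    destruct (second_order f w r M Hr) as [_ B].
    + intros v Hv. apply H. pose proof (Cmod_triangle_sub v w c). lra.
    + intros v Hv. apply HM. pose proof (sq_le _ _ _ (proj1 Hv) (proj1 (proj2 Hv))).
      pose proof (Cmod_triangle_sub v w c). lra.
    + assert (Hn0 : RtoC (h n) <> RtoC 0).
      { intros E. apply (f_equal Re) in E. simpl in E. pose proof (Hh n). lra. }
      assert (Hm : Cmod (RtoC (h n)) = h n) by (rewrite Cmod_R; apply Rabs_pos_eq; pose proof (Hh n); lra).
      specialize (B (w + RtoC (h n))%C).
      replace (w + RtoC (h n) - w)%C with (RtoC (h n)) in B by ring. rewrite Hm in B.
      specialize (B (proj2 (Hh n))).
      replace ((f (w + RtoC (h n)) - f w) / RtoC (h n) - C_derive f w)%C with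
        ((f (w + RtoC (h n)) - f w - C_derive f w * RtoC (h n)) / RtoC (h n))%C by (field; exact Hn0).
      rewrite Cmod_div, Hm by exact Hn0.
      apply Rmult_le_reg_r with (h n); [apply Hh|].
      unfold Rdiv at 1. rewrite Rmult_assoc, Rinv_l, Rmult_1_r by (pose proof (Hh n); lra).
      apply Rle_trans with (1 := B). rewrite <- Rmult_assoc. apply Rmult_le_compat_r; [left; apply Hh|].
      assert (HN' : 2 * M / r / eps <= INR n + 1).
      { apply le_INR in Hn. lra. }
      unfold h. pose proof (pos_INR n).
      apply Rmult_le_reg_r with ((INR n + 1) / eps); [apply Rdiv_lt_0_compat; lra|].
      replace (4 * M / (r * r) * (r / 2 / (INR n + 1)) * ((INR n + 1) / eps)) with (2 * M / r / eps) by (field; lra).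
      replace (eps * ((INR n + 1) / eps)) with (INR n + 1) by (field; lra). exact HN'.
Qed.

(** * Holomorphy in two variables *)

Lemma cvg_pair {T} (F : (T -> Prop) -> Prop) {FF : Filter F} (f g : T -> C) (h : C -> C -> C) (l m : C) :
  cvg F f l -> cvg F g m ->
  cvg (locally ((l, m) : C * C)) (fun q => h (fst q) (snd q)) (h l m) ->
  cvg F (fun t => h (f t) (g t)) (h l m).
Proof.
  intros Hf Hg Hh eps He. specialize (Hh eps He). apply locally_Cmod2 in Hh.
  destruct Hh as (d & Hd & H). generalize (filter_and _ _ (Hf d Hd) (Hg d Hd)).
  apply filter_imp. intros t [H1 H2]. apply (H (f t) (g t)); assumption.
Qed.

(* Holomorphy in two variables in a form that is stable under composition without any use of Hartogs' theorem:
   continuity, and holomorphy along every holomorphic curve. *)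
Definition chol_at (f : C -> C -> C) (p : C * C) : Prop :=
  cvg (locally p) (fun q => f (fst q) (snd q)) (f (fst p) (snd p)) /\
  forall (phi psi : C -> C) (t0 : C), phi t0 = fst p -> psi t0 = snd p ->
    locally t0 (fun t => cdiff phi t /\ cdiff psi t) -> cdiff (fun t => f (phi t) (psi t)) t0.

Lemma chol_at_const (c : C) (p : C * C) : chol_at (fun _ _ => c) p.
Proof.
  split.
  - apply cvg_const, locally_filter.
  - intros. apply cdiff_const.
Qed.

Lemma chol_at_fst (p : C * C) : chol_at (fun z _ => z) p.
Proof.
  split.
  - intros eps He. apply locally_Cmod2. exists eps. split; auto.
  - intros phi psi t0 _ _ H. apply locally_singleton in H. apply H.
Qed.

Lemma chol_at_snd (p : C * C) : chol_at (fun _ t => t) p.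
Proof.
  split.
  - intros eps He. apply locally_Cmod2. exists eps. split; auto.
  - intros phi psi t0 _ _ H. apply locally_singleton in H. apply H.
Qed.

Lemma chol_at_plus (f g : C -> C -> C) (p : C * C) :
  chol_at f p -> chol_at g p -> chol_at (fun z t => f z t + g z t)%C p.
Proof.
  intros [F1 F2] [G1 G2]. split.
  - apply cvg_plus; [apply locally_filter|assumption..].
  - intros phi psi t0 H1 H2 H3. apply cdiff_plus; auto.
Qed.

Lemma chol_at_opp (f : C -> C -> C) (p : C * C) :
  chol_at f p -> chol_at (fun z t => - f z t)%C p.
Proof.
  intros [F1 F2]. split.
  - apply cvg_opp; [apply locally_filter|assumption..].
  - intros phi psi t0 H1 H2 H3. apply cdiff_opp; auto.
Qed.

Lemma chol_at_minus (f g : C -> C -> C) (p : C * C) :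
  chol_at f p -> chol_at g p -> chol_at (fun z t => f z t - g z t)%C p.
Proof. intros Hf Hg. apply chol_at_plus; [exact Hf|apply chol_at_opp, Hg]. Qed.

Lemma chol_at_mult (f g : C -> C -> C) (p : C * C) :
  chol_at f p -> chol_at g p -> chol_at (fun z t => f z t * g z t)%C p.
Proof.
  intros [F1 F2] [G1 G2]. split.
  - apply cvg_mult; [apply locally_filter|assumption..].
  - intros phi psi t0 H1 H2 H3. apply cdiff_mult; auto.
Qed.

Lemma chol_at_inv (f : C -> C -> C) (p : C * C) :
  f (fst p) (snd p) <> RtoC 0 -> chol_at f p -> chol_at (fun z t => / f z t)%C p.
Proof.
  intros H0 [F1 F2]. split.
  - apply cvg_inv; [apply locally_filter|assumption..].
  - intros phi psi t0 H1 H2 H3. apply (cdiff_inv (fun t => f (phi t) (psi t))); [|auto].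
    rewrite H1, H2. exact H0.
Qed.

Lemma chol_at_div (f g : C -> C -> C) (p : C * C) :
  g (fst p) (snd p) <> RtoC 0 -> chol_at f p -> chol_at g p -> chol_at (fun z t => f z t / g z t)%C p.
Proof. intros H0 Hf Hg. apply chol_at_mult; [exact Hf|apply chol_at_inv; assumption]. Qed.

Lemma chol_at_comp1 (g : C -> C) (f : C -> C -> C) (p : C * C) :
  cdiff g (f (fst p) (snd p)) -> chol_at f p -> chol_at (fun z t => g (f z t)) p.
Proof.
  intros Hg [F1 F2]. split.
  - apply (cvg_comp (locally p) (fun q => f (fst q) (snd q)) g); [exact F1|apply cdiff_ccont, Hg].
  - intros phi psi t0 H1 H2 H3. apply (cdiff_comp g (fun t => f (phi t) (psi t))); [|auto].
    rewrite H1, H2. exact Hg.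
Qed.

(** The inner functions must satisfy [chol_at] on a neighbourhood of p, because the curves they
    produce have to be holomorphic around the parameter and not at it alone. *)
Lemma chol_at_comp2 (f a b : C -> C -> C) (p : C * C) :
  chol_at f (a (fst p) (snd p), b (fst p) (snd p)) ->
  locally p (chol_at a) -> locally p (chol_at b) ->
  chol_at (fun z t => f (a z t) (b z t)) p.
Proof.
  intros [F1 F2] Ha Hb.
  pose proof (locally_singleton _ _ Ha) as [A1 A2]. pose proof (locally_singleton _ _ Hb) as [B1 B2].
  split.
  - apply (cvg_pair (locally p) (fun q => a (fst q) (snd q)) (fun q => b (fst q) (snd q)) f); assumption.
  - intros phi psi t0 H1 H2 H3.
    apply (F2 (fun t => a (phi t) (psi t)) (fun t => b (phi t) (psi t)) t0); simpl.
    + rewrite H1, H2. reflexivity.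
    + rewrite H1, H2. reflexivity.
    + apply locally_Cmod2 in Ha. destruct Ha as (d1 & D1 & Ha).
      apply locally_Cmod2 in Hb. destruct Hb as (d2 & D2 & Hb).
      pose proof (locally_singleton _ _ H3) as [C1 C2].
      apply cdiff_ccont in C1. apply cdiff_ccont in C2. rewrite H1 in C1. rewrite H2 in C2.
      assert (Dm : 0 < Rmin d1 d2) by (apply Rmin_glb_lt; assumption).
      specialize (C1 _ Dm). specialize (C2 _ Dm).
      apply locally_locally in H3.
      generalize (filter_and _ _ H3 (filter_and _ _ C1 C2)). apply filter_imp.
      intros t (T1 & T2 & T3).
      pose proof (Rmin_l d1 d2). pose proof (Rmin_r d1 d2).
      split.
      * refine (proj2 (Ha (phi t) (psi t) _ _) phi psi t eq_refl eq_refl T1); lra.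
      * refine (proj2 (Hb (phi t) (psi t) _ _) phi psi t eq_refl eq_refl T1); lra.
Qed.

Lemma chol_at_fix_snd (f : C -> C -> C) (z t : C) : chol_at f (z, t) -> cdiff (fun w => f w t) z.
Proof.
  intros [_ F]. apply (F (fun w => w) (fun _ => t) z); try reflexivity.
  apply filter_forall. intros w. split; [apply cdiff_id|apply cdiff_const].
Qed.

Lemma chol_at_fix_fst (f : C -> C -> C) (z t : C) : chol_at f (z, t) -> cdiff (fun w => f z w) t.
Proof.
  intros [_ F]. apply (F (fun _ => z) (fun w => w) t); try reflexivity.
  apply filter_forall. intros w. split; [apply cdiff_const|apply cdiff_id].
Qed.

Ltac holo2 :=
  cbv beta;
  lazymatch goal with
  | |- chol_at (fun _ _ => ?c) _ => apply chol_at_const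
  | |- chol_at (fun z _ => z) _ => apply chol_at_fst
  | |- chol_at (fun _ t => t) _ => apply chol_at_snd
  | |- chol_at (fun hole1 hole2 => (@?f hole1 hole2 + @?g hole1 hole2)%C) _ => apply (chol_at_plus f g); holo2
  | |- chol_at (fun hole1 hole2 => (@?f hole1 hole2 - @?g hole1 hole2)%C) _ => apply (chol_at_minus f g); holo2
  | |- chol_at (fun hole1 hole2 => (- @?f hole1 hole2)%C) _ => apply (chol_at_opp f); holo2
  | |- chol_at (fun hole1 hole2 => (@?f hole1 hole2 * @?g hole1 hole2)%C) _ => apply (chol_at_mult f g); holo2
  | |- chol_at (fun hole1 hole2 => (@?f hole1 hole2 / @?g hole1 hole2)%C) _ =>
      apply (chol_at_div f g); [cbn [fst snd]; auto with holo|holo2|holo2]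
  | H : ?G |- ?G => exact H
  | |- chol_at (fun hole1 hole2 => ?h (@?f hole1 hole2)) _ => apply (chol_at_comp1 h f); [cbn [fst snd]; auto with holo|holo2]
  | |- _ => auto with holo
  end.

Definition chol (Om : C * C -> Prop) (f : C -> C -> C) : Prop := forall p, Om p -> chol_at f p.

(** Along a holomorphic curve the functions f n converge uniformly near the parameter, so
    [weierstrass] gives the second clause of [chol_at]. *)
Lemma chol_limit (Om : C * C -> Prop) (f : nat -> C -> C -> C) (g : C -> C -> C) :
  open Om -> (forall n, chol Om (f n)) ->
  (forall p, Om p -> exists d, 0 < d /\ forall eps, 0 < eps -> exists N, forall n z t, (N <= n)%nat ->
      Cmod (z - fst p)%C < d -> Cmod (t - snd p)%C < d -> Cmod (f n z t - g z t)%C <= eps) ->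
  chol Om g.
Proof.
  intros Hop Hf Hu [z0 t0] Hp. destruct (Hu _ Hp) as (d & Hd & Hd'). simpl fst in *. simpl snd in *.
  split.
  - intros eps He. destruct (Hd' (eps / 4) ltac:(lra)) as [N HN].
    pose proof (proj1 (Hf N _ Hp) (eps / 4) ltac:(lra)) as Hc.
    apply locally_Cmod2 in Hc. destruct Hc as (d2 & Hd2 & Hc). simpl in Hc.
    apply locally_Cmod2. exists (Rmin d d2). split; [apply Rmin_glb_lt; assumption|].
    pose proof (Rmin_l d d2). pose proof (Rmin_r d d2).
    simpl. intros z t Hz Ht.
    specialize (Hc z t ltac:(lra) ltac:(lra)). simpl in Hc.
    pose proof (HN N z t (Nat.le_refl N) ltac:(lra) ltac:(lra)) as K1.
    pose proof (HN N z0 t0 (Nat.le_refl N)) as K2.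
    replace (z0 - z0)%C with (RtoC 0) in K2 by ring.
    replace (t0 - t0)%C with (RtoC 0) in K2 by ring. rewrite Cmod_0 in K2.
    specialize (K2 Hd Hd).
    pose proof (Cmod_triangle_sub (g z t) (f N z t) (g z0 t0)) as T1.
    pose proof (Cmod_triangle_sub (f N z t) (f N z0 t0) (g z0 t0)) as T2.
    rewrite (Cmod_sub_comm (g z t) (f N z t)) in T1. lra.
  - intros phi psi s0 H1 H2 H3. simpl in H1, H2.
    pose proof (Hop _ Hp) as Ho. apply locally_Cmod2 in Ho. destruct Ho as (d2 & Hd2 & Ho). simpl in Ho.
    pose proof (locally_singleton _ _ H3) as [C1 C2].
    apply cdiff_ccont in C1. apply cdiff_ccont in C2. rewrite H1 in C1. rewrite H2 in C2.
    assert (Dm : 0 < Rmin d d2) by (apply Rmin_glb_lt; assumption).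
    specialize (C1 _ Dm). specialize (C2 _ Dm).
    apply locally_locally in H3.
    pose proof (filter_and _ _ H3 (filter_and _ _ C1 C2)) as HH.
    apply locally_Cmod in HH. destruct HH as (r & Hr & HH).
    pose proof (Rmin_l d d2). pose proof (Rmin_r d d2).
    apply (weierstrass (fun n t => f n (phi t) (psi t)) _ s0 (r / 4)); [lra| |].
    + intros n w Hw. destruct (HH w ltac:(lra)) as (K1 & K2 & K3).
      refine (proj2 (Hf n (phi w, psi w) _) phi psi w eq_refl eq_refl K1).
      apply Ho; lra.
    + intros eps He. destruct (Hd' eps He) as [N HN]. exists N. intros n w Hn Hw.
      destruct (HH w ltac:(lra)) as (K1 & K2 & K3). apply HN; [exact Hn|lra|lra].
Qed.

(** The points near which f vanishes form an open set U. The theorem in one variable, applied in the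
    z direction and then in the t direction, shows that U is closed in Om as well, and connectedness
    concludes. *)
Lemma identity_domain (Om : C * C -> Prop) (f : C -> C -> C) :
  open Om -> connected2 Om ->
  (forall z t, Om (z, t) -> cdiff (fun w => f w t) z /\ cdiff (fun w => f z w) t) ->
  (exists p, Om p /\ locally p (fun q => f (fst q) (snd q) = RtoC 0)) ->
  forall z t, Om (z, t) -> f z t = RtoC 0.
Proof.
  intros Hop Hcon Hf Hex.
  set (U := fun p : C * C => locally p (fun q => f (fst q) (snd q) = RtoC 0)).
  assert (HU : open U).
  { intros p Hp. unfold U. apply locally_locally. exact Hp. }
  assert (Key : forall p, Om p -> exists r, 0 < r /\
    forall z1 t1, Cmod (z1 - fst p)%C < r -> Cmod (t1 - snd p)%C < r -> Om (z1, t1) /\ (U (z1, t1) -> U p)).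
  { intros [z0 t0] Hp. pose proof (Hop _ Hp) as Ho. apply locally_Cmod2 in Ho. destruct Ho as (R0 & HR & Ho).
    simpl in Ho. exists (R0 / 100). split; [lra|]. simpl. intros z1 t1 Hz1 Ht1.
    split; [apply Ho; lra|]. intros HUq.
    apply locally_Cmod2 in HUq. destruct HUq as (h & Hh & HUq). simpl in HUq.
    set (h' := Rmin h (R0 / 100)).
    assert (Hh' : 0 < h') by (apply Rmin_glb_lt; lra).
    assert (L1 : h' <= h) by apply Rmin_l. assert (L2 : h' <= R0 / 100) by apply Rmin_r.
    (* On each line t = const close to t1 the zeros spread from a small disc around z1 to one that
       contains a neighbourhood of z0. *)
    assert (V1 : forall z t, Cmod (t - t1)%C < h' -> Cmod (z - z1)%C <= R0 / 8 -> f z t = RtoC 0).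
    { intros z t Ht Hz. apply (identity_disc (fun w => f w t) z1 (R0 / 4)); [lra| | |lra].
      - intros w Hw. apply Hf, Ho.
        + pose proof (Cmod_triangle_sub w z1 z0). lra.
        + pose proof (Cmod_triangle_sub t t1 t0). lra.
      - apply locally_Cmod. exists h'. split; [exact Hh'|]. intros w Hw. apply HUq; lra. }
    apply locally_Cmod2. exists (R0 / 100). split; [lra|]. simpl. intros z t Hz Ht.
    apply (identity_disc (fun w => f z w) t1 (R0 / 4)); [lra| | |].
    - intros w Hw. apply Hf, Ho; [lra|]. pose proof (Cmod_triangle_sub w t1 t0). lra.
    - apply locally_Cmod. exists h'. split; [exact Hh'|]. intros w Hw. apply V1; [exact Hw|].
      pose proof (Cmod_triangle_sub z z0 z1). rewrite (Cmod_sub_comm z0 z1) in *. lra.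
    - pose proof (Cmod_triangle_sub t t0 t1). rewrite (Cmod_sub_comm t0 t1) in *. lra. }
  set (V := fun p => Om p /\ ~ U p).
  assert (HV : open V).
  { intros p [Hp HnU]. destruct (Key p Hp) as (r & Hr & HK). apply locally_Cmod2. exists r.
    split; [exact Hr|]. intros z1 t1 Hz Ht. destruct (HK z1 t1 Hz Ht) as [A B]. split; auto. }
  intros z t Hzt.
  destruct (classic (U (z, t))) as [H|H]; [exact (locally_singleton _ _ H)|exfalso].
  apply (Hcon U V HU HV).
  - intros p Hp. destruct (classic (U p)); [left; assumption|right; split; assumption].
  - intros p _ H1 [_ H2]. auto.
  - exact Hex.
  - exists (z, t). split; [exact Hzt|split; assumption].
Qed.

(** The condition under which f can be cancelled from an identity between continuous functions, even
    at a point where f vanishes; the cancellation is [dense_eq]. *)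
Definition dense_neq0 (f : C -> C) : Prop :=
  forall z0 d, 0 < d -> exists z, Cmod (z - z0)%C < d /\ f z <> RtoC 0.

Lemma entire_dense_neq0 (f : C -> C) (z1 : C) :
  (forall z, cdiff f z) -> f z1 <> RtoC 0 -> dense_neq0 f.
Proof.
  intros Hf H1 z0 d Hd. apply NNPP. intros Hn. apply H1.
  (* This radius is chosen so that z1 lies within half of it. *)
  apply (identity_disc f z0 (2 * Cmod (z1 - z0)%C + 1)).
  - pose proof (Cmod_ge_0 (z1 - z0)%C). lra.
  - intros w _. apply Hf.
  - apply locally_Cmod. exists d. split; [exact Hd|]. intros w Hw.
    apply NNPP. intros H0. apply Hn. exists w. auto.
  - lra.
Qed.

Lemma dense_neq0_mult (f g : C -> C) :
  (forall z, ccont f z) -> dense_neq0 f -> dense_neq0 g -> dense_neq0 (fun z => f z * g z)%C.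
Proof.
  intros Hc Hf Hg z0 d Hd. destruct (Hf z0 (d / 2) ltac:(lra)) as (z1 & H1 & H2).
  pose proof (cvg_near_neq _ f (f z1) (RtoC 0) (Hc z1) H2) as H3. apply locally_Cmod in H3.
  destruct H3 as (h & Hh & H3).
  destruct (Hg z1 (Rmin h (d / 2))) as (z2 & H4 & H5); [apply Rmin_glb_lt; lra|].
  pose proof (Rmin_l h (d / 2)). pose proof (Rmin_r h (d / 2)).
  exists z2. split.
  - pose proof (Cmod_triangle_sub z2 z1 z0). lra.
  - apply Cmult_neq_0; [apply H3; lra|exact H5].
Qed.

Lemma dense_eq (N X Y : C -> C) (z0 : C) :
  dense_neq0 N -> ccont X z0 -> ccont Y z0 ->
  locally z0 (fun z => (N z * X z)%C = (N z * Y z)%C) -> X z0 = Y z0.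
Proof.
  intros HN HX HY H. apply NNPP. intros Hne.
  pose proof (ccont_minus X Y z0 HX HY) as Hc.
  pose proof (cvg_near_neq _ (fun z => X z - Y z)%C _ (RtoC 0) Hc (C_sub_neq_0 _ _ Hne)) as H1.
  pose proof (filter_and _ _ H H1) as H2. apply locally_Cmod in H2. destruct H2 as (d & Hd & H2).
  destruct (HN z0 d Hd) as (z & Hz & Hz'). destruct (H2 z Hz) as [H3 H4].
  apply (Cmult_neq_0 _ _ Hz' H4). replace (N z * (X z - Y z))%C with (N z * X z - N z * Y z)%C by ring.
  rewrite H3. ring.
Qed.

(** * Infinite products *)

Fixpoint rsum (u : nat -> R) (n : nat) : R :=
  match n with O => 0 | S m => rsum u m + u m end.

Lemma rsum_le (u v : nat -> R) (n : nat) : (forall k, (k < n)%nat -> u k <= v k) -> rsum u n <= rsum v n.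
Proof.
  induction n as [|n IH]; intros H; simpl; [lra|].
  apply Rplus_le_compat; [apply IH; intros; apply H; lia|apply H; lia].
Qed.

(** Telescoping, since 1 / (x + 1)^2 <= 2 / (x + 1) - 2 / (x + 2). *)
Lemma rsum_inv_sq (n m : nat) : rsum (fun k => / (INR (n + k) + 1) ^ 2) m <= 2 / (INR n + 1).
Proof.
  assert (K : rsum (fun k => / (INR (n + k) + 1) ^ 2) m <= 2 / (INR n + 1) - 2 / (INR (n + m) + 1)).
  { induction m as [|m IH]; cbn [rsum].
    - rewrite Nat.add_0_r. lra.
    - apply Rle_trans with (1 := Rplus_le_compat_r _ _ _ IH).
      cbv beta. rewrite Nat.add_succ_r, S_INR. pose proof (pos_INR (n + m)) as P.
      set (x := INR (n + m)) in *.
      assert (/ (x + 1) ^ 2 <= 2 / (x + 1) - 2 / (x + 1 + 1)); [|lra].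
      replace (2 / (x + 1) - 2 / (x + 1 + 1)) with (2 * / ((x + 1) * (x + 2))) by (field; lra).
      replace (/ (x + 1) ^ 2) with (2 * / (2 * (x + 1) ^ 2)) by (field; lra).
      apply Rmult_le_compat_l; [lra|]. apply Rinv_le_contravar; nra. }
  apply Rle_trans with (1 := K).
  assert (0 < 2 / (INR (n + m) + 1)) by (apply Rdiv_lt_0_compat; pose proof (pos_INR (n + m)); lra). lra.
Qed.

Lemma rsum_scal (a : R) (u : nat -> R) (n : nat) : rsum (fun k => a * u k) n = a * rsum u n.
Proof. induction n as [|n IH]; simpl; [ring|rewrite IH; ring]. Qed.

Lemma pprod_ext (f g : nat -> C) (n : nat) :
  (forall k, (k < n)%nat -> f k = g k) -> pprod f n = pprod g n.
Proof.
  induction n as [|n IH]; intros H; simpl; [reflexivity|].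
  rewrite IH by (intros; apply H; lia). rewrite H by lia. reflexivity.
Qed.

Lemma pprod_mult (f g : nat -> C) (n : nat) :
  pprod (fun k => f k * g k)%C n = (pprod f n * pprod g n)%C.
Proof. induction n as [|n IH]; simpl; [ring|rewrite IH; ring]. Qed.

Lemma pprod_one (n : nat) : pprod (fun _ => RtoC 1) n = RtoC 1.
Proof. induction n as [|n IH]; simpl; [ring|rewrite IH; ring]. Qed.

Lemma pprod_add (f : nat -> C) (n m : nat) :
  pprod f (n + m) = (pprod f n * pprod (fun k => f (n + k)%nat) m)%C.
Proof.
  induction m as [|m IH]; simpl; [rewrite Nat.add_0_r; ring|].
  rewrite Nat.add_succ_r. simpl. rewrite IH. ring.
Qed.

Lemma pprod_S_first (f : nat -> C) (n : nat) :
  pprod f (S n) = (f 0%nat * pprod (fun k => f (S k)) n)%C.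
Proof. replace (S n) with (1 + n)%nat by lia. rewrite pprod_add. simpl. ring. Qed.

Lemma pprod_neq_0 (f : nat -> C) (n : nat) :
  (forall k, (k < n)%nat -> f k <> RtoC 0) -> pprod f n <> RtoC 0.
Proof.
  induction n as [|n IH]; intros H; simpl; [apply C1_nz|].
  apply Cmult_neq_0; [apply IH; intros; apply H; lia|apply H; lia].
Qed.

Lemma pprod_exchange (f : nat -> nat -> C) (n m : nat) :
  pprod (fun i => pprod (fun j => f i j) m) n = pprod (fun j => pprod (fun i => f i j) n) m.
Proof.
  induction n as [|n IH]; simpl; [symmetry; apply pprod_one|].
  rewrite IH, <- pprod_mult. reflexivity.
Qed.

Lemma Cmod_pprod_le (f : nat -> C) (n : nat) :
  Cmod (pprod f n - 1)%C <= exp (rsum (fun k => Cmod (f k - 1)%C) n) - 1.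
Proof.
  induction n as [|n IH]; simpl.
  - replace (1 - 1)%C with (RtoC 0) by ring. rewrite Cmod_0, exp_0. lra.
  - replace (pprod f n * f n - 1)%C with ((pprod f n - 1) * (f n - 1) + ((pprod f n - 1) + (f n - 1)))%C by ring.
    apply Rle_trans with (1 := Cmod_triangle _ _).
    apply Rle_trans with (1 := Rplus_le_compat_l _ _ _ (Cmod_triangle _ _)).
    rewrite Cmod_mult, exp_plus.
    set (x := Cmod (pprod f n - 1)%C) in *. set (y := Cmod (f n - 1)%C).
    set (E := exp (rsum (fun k => Cmod (f k - 1)%C) n)) in *.
    assert (0 <= y) by apply Cmod_ge_0. assert (0 <= x) by apply Cmod_ge_0.
    pose proof (exp_ineq1_le y). nra.
Qed.

Lemma Cmod_pprod_le' (f : nat -> C) (n : nat) :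
  Cmod (pprod f n) <= exp (rsum (fun k => Cmod (f k - 1)%C) n).
Proof.
  pose proof (Cmod_pprod_le f n). pose proof (Cmod_triangle_inv (pprod f n) 1) as H1.
  rewrite Cmod_1 in H1. lra.
Qed.

Lemma exp_sub_1_le (x : R) : 0 <= x -> exp x - 1 <= x * exp x.
Proof.
  intros Hx. pose proof (exp_ineq1_le (- x)) as H. rewrite exp_Ropp in H.
  pose proof (exp_pos x) as P.
  apply Rmult_le_compat_l with (r := exp x) in H; [|lra].
  rewrite Rinv_r in H by lra. nra.
Qed.

(** Summability of the deviations from 1 in explicit form, so that one B makes all estimates
    uniform. The restriction to k < n covers finite products whose factors change with their length,
    as in [tannery]. *)
Definition near1 (B : R) (f : nat -> C) (n : nat) : Prop :=
  forall k, (k < n)%nat -> Cmod (f k - 1)%C <= B * / (INR k + 1) ^ 2.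

Lemma near1_tail_sum (B : R) (f : nat -> C) (n m : nat) :
  0 <= B -> near1 B f (n + m) ->
  rsum (fun k => Cmod (f (n + k)%nat - 1)%C) m <= 2 * B / (INR n + 1).
Proof.
  intros HB H.
  apply Rle_trans with (rsum (fun k => B * / (INR (n + k) + 1) ^ 2) m).
  - apply rsum_le. intros k Hk. apply H. lia.
  - rewrite rsum_scal. replace (2 * B / (INR n + 1)) with (B * (2 / (INR n + 1)))
      by (field; pose proof (pos_INR n); lra).
    apply Rmult_le_compat_l; [exact HB|apply rsum_inv_sq].
Qed.

Lemma pprod_near1_bound (B : R) (f : nat -> C) (n : nat) :
  0 <= B -> near1 B f n -> Cmod (pprod f n) <= exp (2 * B) /\ Cmod (pprod f n - 1)%C <= 2 * B * exp (2 * B).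
Proof.
  intros HB H. pose proof (near1_tail_sum B f 0 n HB H) as T. simpl in T.
  replace (2 * B / (0 + 1)) with (2 * B) in T by field.
  split.
  - apply Rle_trans with (1 := Cmod_pprod_le' f n). apply exp_le_mono. exact T.
  - apply Rle_trans with (1 := Cmod_pprod_le f n).
    apply Rle_trans with (2 := exp_sub_1_le (2 * B) ltac:(lra)).
    pose proof (exp_le_mono _ _ T). lra.
Qed.

Definition prate (B : R) : R := exp (2 * B) * (2 * B * exp (2 * B)).

Lemma prate_pos (B : R) : 0 <= B -> 0 <= prate B.
Proof.
  intros HB. unfold prate. pose proof (exp_pos (2 * B)).
  apply Rmult_le_pos; [lra|]. apply Rmult_le_pos; lra.
Qed.

Lemma pprod_rate (B : R) (f : nat -> C) (n m : nat) :
  0 <= B -> (n <= m)%nat -> near1 B f m ->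
  Cmod (pprod f m - pprod f n)%C <= prate B / (INR n + 1).
Proof.
  intros HB Hnm H. replace m with (n + (m - n))%nat in * by lia. set (k := (m - n)%nat) in *.
  rewrite pprod_add.
  replace (pprod f n * pprod (fun j => f (n + j)%nat) k - pprod f n)%C
    with (pprod f n * (pprod (fun j => f (n + j)%nat) k - 1))%C by ring.
  rewrite Cmod_mult.
  assert (Hn : near1 B f n) by (intros j Hj; apply H; lia).
  destruct (pprod_near1_bound B f n HB Hn) as [B1 _].
  pose proof (near1_tail_sum B f n k HB H) as T.
  pose proof (Cmod_pprod_le (fun j => f (n + j)%nat) k) as B2.
  pose proof (pos_INR n) as Pn.
  assert (X : 0 <= 2 * B / (INR n + 1)) by (apply Rmult_le_pos; [lra|left; apply Rinv_0_lt_compat; lra]).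
  assert (X2 : 2 * B / (INR n + 1) <= 2 * B).
  { apply Rmult_le_reg_r with (INR n + 1); [lra|]. unfold Rdiv. rewrite Rmult_assoc, Rinv_l by lra. nra. }
  pose proof (exp_le_mono _ _ T) as B3. pose proof (exp_sub_1_le _ X) as B4. pose proof (exp_le_mono _ _ X2) as B5.
  unfold prate. replace (exp (2 * B) * (2 * B * exp (2 * B)) / (INR n + 1))
    with (exp (2 * B) * (2 * B / (INR n + 1) * exp (2 * B))) by (field; lra).
  apply Rmult_le_compat; [apply Cmod_ge_0|apply Cmod_ge_0|exact B1|].
  apply Rle_trans with (2 * B / (INR n + 1) * exp (2 * B / (INR n + 1))); [lra|].
  apply Rmult_le_compat_l; assumption.
Qed.

Lemma inv_INR_small (K eps : R) : 0 <= K -> 0 < eps ->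
  exists N, forall n, (N <= n)%nat -> K / (INR n + 1) < eps.
Proof.
  intros HK He. destruct (nfloor_ex (K / eps)) as [N [_ HN]].
  { apply Rmult_le_pos; [exact HK|left; apply Rinv_0_lt_compat, He]. }
  exists N. intros n Hn. apply le_INR in Hn. pose proof (pos_INR n).
  apply Rmult_lt_reg_r with (INR n + 1); [lra|].
  replace (K / (INR n + 1) * (INR n + 1)) with (eps * (K / eps)) by (field; lra).
  apply Rmult_lt_compat_l; lra.
Qed.

Definition clim (u : nat -> C) : C := @lim C_CompleteNormedModule (filtermap u eventually).

(** The operator [lim] is total; what it returns is known through [complete_cauchy], so the sequence
    has to be shown to be Cauchy before its value can be identified. *)
Lemma clim_eq (u : nat -> C) (l : C) : cvg eventually u l -> clim u = l.
Proof.
  intros H. apply (cvg_unique eventually u); [|exact H].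
  assert (Hl : filterlim u eventually (locally l)) by (apply filterlim_cvg; [apply eventually_filter|exact H]).
  apply filterlim_cvg; [apply eventually_filter|].
  unfold clim. intros P [eps HP]. unfold filtermap.
  pose proof (@complete_cauchy C_CompleteNormedModule (filtermap u eventually)) as HC.
  assert (Hcau : cauchy (filtermap u eventually)).
  { intros e0. exists l. apply (Hl (fun w => ball l e0 w)). exists e0. auto. }
  destruct (HC _ Hcau eps) as [N HN]. exists N. intros n Hn. apply HP, HN, Hn.
Qed.

Lemma infprod_eq (f : nat -> C) (l : C) : cvg eventually (pprod f) l -> infprod f = l.
Proof. apply clim_eq. Qed.

Lemma infprod_cvg (B : R) (f : nat -> C) :
  0 <= B -> (forall n, near1 B f n) -> cvg eventually (pprod f) (infprod f).
Proof.
  intros HB H. destruct (C_cauchy_cvg (pprod f)) as [l Hl].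
  - intros eps He. destruct (inv_INR_small (prate B) eps (prate_pos B HB) He) as [N HN].
    exists N. intros n m Hn Hm. destruct (le_ge_dec n m) as [L|L].
    + rewrite Cmod_sub_comm. apply Rle_lt_trans with (1 := pprod_rate B f n m HB L (H m)). auto.
    + apply Rle_lt_trans with (1 := pprod_rate B f m n HB L (H n)). auto.
  - rewrite (infprod_eq _ _ Hl). exact Hl.
Qed.

Lemma infprod_rate (B : R) (f : nat -> C) (n : nat) :
  0 <= B -> (forall n, near1 B f n) -> Cmod (pprod f n - infprod f)%C <= prate B / (INR n + 1).
Proof.
  intros HB H. rewrite Cmod_sub_comm.
  apply (cvg_Cmod_le eventually (fun m => pprod f m - pprod f n)%C).
  - apply cvg_minus; [apply eventually_filter|apply (infprod_cvg B); assumption|apply cvg_const, eventually_filter].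
  - exists n. intros m Hm. apply pprod_rate; auto.
Qed.

Lemma infprod_bound (B : R) (f : nat -> C) :
  0 <= B -> (forall n, near1 B f n) -> Cmod (infprod f - 1)%C <= 2 * B * exp (2 * B).
Proof.
  intros HB H.
  apply (cvg_Cmod_le eventually (fun m => pprod f m - 1)%C).
  - apply cvg_minus; [apply eventually_filter|apply (infprod_cvg B); assumption|apply cvg_const, eventually_filter].
  - exists 0%nat. intros m _. apply pprod_near1_bound; auto.
Qed.

(** Beyond some n the tail products stay within 1/2 of 1, so the whole product differs from a
    nonzero partial product by at most half its modulus. *)
Lemma infprod_neq_0 (B : R) (f : nat -> C) :
  0 <= B -> (forall n, near1 B f n) -> (forall k, f k <> RtoC 0) -> infprod f <> RtoC 0.
Proof.
  intros HB H Hf.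
  destruct (inv_INR_small (2 * B * exp (2 * B)) (/ 2)) as [n Hn]; [|lra|].
  { pose proof (exp_pos (2 * B)). apply Rmult_le_pos; lra. }
  specialize (Hn n (Nat.le_refl n)). pose proof (pos_INR n) as Pn.
  assert (Pp : 0 < Cmod (pprod f n)) by (apply Cmod_gt_0, pprod_neq_0; auto).
  assert (L : forall m, (n <= m)%nat -> Cmod (pprod f m - pprod f n)%C <= Cmod (pprod f n) / 2).
  { intros m Hm. replace m with (n + (m - n))%nat by lia. set (k := (m - n)%nat). rewrite pprod_add.
    replace (pprod f n * pprod (fun j => f (n + j)%nat) k - pprod f n)%C
      with (pprod f n * (pprod (fun j => f (n + j)%nat) k - 1))%C by ring.
    rewrite Cmod_mult. apply Rmult_le_compat_l; [lra|].
    pose proof (near1_tail_sum B f n k HB (H _)) as T.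
    pose proof (Cmod_pprod_le (fun j => f (n + j)%nat) k) as B2.
    assert (X : 0 <= 2 * B / (INR n + 1)) by (apply Rmult_le_pos; [lra|left; apply Rinv_0_lt_compat; lra]).
    assert (X2 : 2 * B / (INR n + 1) <= 2 * B).
    { apply Rmult_le_reg_r with (INR n + 1); [lra|]. unfold Rdiv. rewrite Rmult_assoc, Rinv_l by lra. nra. }
    pose proof (exp_le_mono _ _ T) as B3. pose proof (exp_sub_1_le _ X) as B4. pose proof (exp_le_mono _ _ X2) as B5.
    replace (2 * B * exp (2 * B) / (INR n + 1)) with (2 * B / (INR n + 1) * exp (2 * B)) in Hn by (field; lra).
    pose proof (Rmult_le_compat_l _ _ _ X B5). lra. }
  assert (L' : Cmod (infprod f - pprod f n)%C <= Cmod (pprod f n) / 2).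
  { apply (cvg_Cmod_le eventually (fun m => pprod f m - pprod f n)%C).
    - apply cvg_minus; [apply eventually_filter|apply (infprod_cvg B); assumption|apply cvg_const, eventually_filter].
    - exists n. exact L. }
  intros E. rewrite E in L'. replace (0 - pprod f n)%C with (- pprod f n)%C in L' by ring.
  rewrite Cmod_opp in L'. lra.
Qed.

Lemma cvg_pprod {T} (F : (T -> Prop) -> Prop) {FF : Filter F} (f : T -> nat -> C) (g : nat -> C) (n : nat) :
  (forall k, (k < n)%nat -> cvg F (fun t => f t k) (g k)) -> cvg F (fun t => pprod (f t) n) (pprod g n).
Proof.
  induction n as [|n IH]; intros H; simpl; [apply cvg_const, FF|].
  apply cvg_mult; [exact FF|apply IH; intros; apply H; lia|apply H; lia].
Qed.

(** Dominated convergence for products: a head of fixed length converges factor by factor, and the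
    tails are uniformly small by [pprod_rate]. *)
Lemma tannery (B : R) (f : nat -> nat -> C) (g : nat -> C) (M : nat -> nat) :
  0 <= B -> (forall N, near1 B (f N) (M N)) -> (forall n, exists N0, forall N, (N0 <= N)%nat -> (n <= M N)%nat) ->
  (forall k, cvg eventually (fun N => f N k) (g k)) ->
  (forall n, near1 B g n) /\ cvg eventually (fun N => pprod (f N) (M N)) (infprod g).
Proof.
  intros HB Hf HM Hc.
  assert (Hg : forall n, near1 B g n).
  { intros n k _. apply (cvg_Cmod_le eventually (fun N => f N k - 1)%C).
    - apply cvg_minus; [apply eventually_filter|apply Hc|apply cvg_const, eventually_filter].
    - destruct (HM (S k)) as [N0 H0]. exists N0. intros N HN. apply Hf. specialize (H0 N HN). lia. }
  split; [exact Hg|]. apply cvg_eventually. intros eps He.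
  destruct (inv_INR_small (prate B) (eps / 3) (prate_pos B HB) ltac:(lra)) as [n Hn].
  specialize (Hn n (Nat.le_refl n)).
  assert (Hfin : cvg eventually (fun N => pprod (f N) n) (pprod g n)) by (apply cvg_pprod; [apply eventually_filter|auto]).
  destruct (proj1 (cvg_eventually _ _) Hfin (eps / 3) ltac:(lra)) as [N1 H1].
  destruct (HM n) as [N2 H2]. exists (max N1 N2). intros N HN.
  pose proof (pprod_rate B (f N) n (M N) HB (H2 N ltac:(lia)) (Hf N)) as R1.
  pose proof (infprod_rate B g n HB Hg) as R2. specialize (H1 N ltac:(lia)).
  pose proof (Cmod_triangle_sub (pprod (f N) (M N)) (pprod (f N) n) (infprod g)).
  pose proof (Cmod_triangle_sub (pprod (f N) n) (pprod g n) (infprod g)). lra.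
Qed.

(** * Double products over a lattice quadrant *)

Lemma infprod_ext (f g : nat -> C) : (forall k, f k = g k) -> infprod f = infprod g.
Proof. intros H. f_equal. apply functional_extensionality, H. Qed.

Lemma chol_infprod (Om : C * C -> Prop) (c : nat -> C -> C -> C) :
  open Om -> (forall k, chol Om (c k)) ->
  (forall p, Om p -> exists d B, 0 < d /\ 0 <= B /\ forall z t, Cmod (z - fst p)%C < d -> Cmod (t - snd p)%C < d ->
     forall n, near1 B (fun k => c k z t) n) ->
  chol Om (fun z t => infprod (fun k => c k z t)).
Proof.
  intros Hop Hc Hu. apply (chol_limit Om (fun n z t => pprod (fun k => c k z t) n)); [exact Hop| |].
  - intros n p Hp. induction n as [|n IH]; simpl; [apply chol_at_const|].
    apply chol_at_mult; [exact IH|apply Hc, Hp].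
  - intros p Hp. destruct (Hu p Hp) as (d & B & Hd & HB & H). exists d. split; [exact Hd|].
    intros eps He. destruct (inv_INR_small (prate B) eps (prate_pos B HB) He) as [N HN].
    exists N. intros n z t Hn Hz Ht.
    apply Rle_trans with (1 := infprod_rate B (fun k => c k z t) n HB (H z t Hz Ht)).
    left. apply HN, Hn.
Qed.

(** The exponent is 3 because the index set is two-dimensional: the product over one index then
    satisfies [near1] in the other. *)
Definition dominated (B : R) (a : nat -> nat -> C) : Prop :=
  forall m n, Cmod (a m n - 1)%C <= B * / (INR m + INR n + 2) ^ 3.

Definition rowB (B : R) : R := 2 * B * exp (2 * B).

Lemma rowB_pos (B : R) : 0 <= B -> 0 <= rowB B.
Proof. intros HB. pose proof (exp_pos (2 * B)). unfold rowB. apply Rmult_le_pos; lra. Qed.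

Lemma dominated_sym (B : R) (a : nat -> nat -> C) : dominated B a -> dominated B (fun m n => a n m).
Proof. intros H m n. rewrite (Rplus_comm (INR m)). apply H. Qed.

Section Double.
Variables (B : R) (a : nat -> nat -> C).
Hypotheses (HB : 0 <= B) (Ha : dominated B a).

Lemma dominated_row (n M : nat) : near1 B (fun m => a m n) M.
Proof.
  intros m _. apply Rle_trans with (1 := Ha m n).
  apply Rmult_le_compat_l; [exact HB|]. pose proof (pos_INR m). pose proof (pos_INR n).
  apply Rinv_le_contravar; [nra|].
  replace ((INR m + INR n + 2) ^ 3) with ((INR m + INR n + 2) ^ 2 * (INR m + INR n + 2)) by ring.
  assert ((INR m + 1) ^ 2 <= (INR m + INR n + 2) ^ 2) by (apply pow_incr; lra).
  assert (0 <= (INR m + 1) ^ 2) by (apply pow_le; lra). nra.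
Qed.

(** One factor m + n + 2 >= n + 1 is given up; the remaining sum of inverse squares starts at n + 2
    and contributes the second factor 1 / (n + 1). *)
Lemma dominated_row_bound (n M : nat) :
  Cmod (pprod (fun m => a m n) M - 1)%C <= rowB B * / (INR n + 1) ^ 2.
Proof.
  pose proof (pos_INR n) as Pn.
  assert (S : rsum (fun m => Cmod (a m n - 1)%C) M <= 2 * B * / (INR n + 1) ^ 2).
  { apply Rle_trans with (rsum (fun m => B / (INR n + 1) * / (INR (S n + m) + 1) ^ 2) M).
    - apply rsum_le. intros m _. apply Rle_trans with (1 := Ha m n).
      pose proof (pos_INR m). rewrite plus_INR, S_INR.
      replace (INR n + 1 + INR m + 1) with (INR m + INR n + 2) by ring.
      replace (B * / (INR m + INR n + 2) ^ 3) with (B * (/ (INR m + INR n + 2) ^ 2 * / (INR m + INR n + 2)))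
        by (field; lra).
      replace (B / (INR n + 1) * / (INR m + INR n + 2) ^ 2)
        with (B * (/ (INR m + INR n + 2) ^ 2 * / (INR n + 1))) by (field; lra).
      apply Rmult_le_compat_l; [exact HB|]. apply Rmult_le_compat_l.
      + left. apply Rinv_0_lt_compat, pow_lt. lra.
      + apply Rinv_le_contravar; lra.
    - rewrite rsum_scal. pose proof (rsum_inv_sq (S n) M) as H. rewrite S_INR in H.
      assert (Q : 0 <= B / (INR n + 1)) by (apply Rmult_le_pos; [exact HB|left; apply Rinv_0_lt_compat; lra]).
      apply Rle_trans with (1 := Rmult_le_compat_l _ _ _ Q H).
      replace (B / (INR n + 1) * (2 / (INR n + 1 + 1))) with (2 * B * / ((INR n + 1) * (INR n + 1 + 1)))
        by (field; lra).
      apply Rmult_le_compat_l; [lra|]. apply Rinv_le_contravar; nra. }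
  apply Rle_trans with (1 := Cmod_pprod_le (fun m => a m n) M).
  set (x := 2 * B * / (INR n + 1) ^ 2) in *.
  assert (X0 : 0 <= x).
  { apply Rmult_le_pos; [lra|]. left. apply Rinv_0_lt_compat, pow_lt. lra. }
  assert (X1 : x <= 2 * B).
  { unfold x. rewrite <- (Rmult_1_r (2 * B)) at 2. apply Rmult_le_compat_l; [lra|].
    rewrite <- Rinv_1. apply Rinv_le_contravar; nra. }
  pose proof (exp_le_mono _ _ S) as E1. pose proof (exp_sub_1_le x X0) as E2. pose proof (exp_le_mono _ _ X1) as E3.
  replace (rowB B * / (INR n + 1) ^ 2) with (x * exp (2 * B)) by (unfold rowB, x; field; lra).
  pose proof (Rmult_le_compat_l _ _ _ X0 E3). lra.
Qed.

Lemma dominated_row_inf (n : nat) :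
  Cmod (infprod (fun m => a m n) - 1)%C <= rowB B * / (INR n + 1) ^ 2.
Proof.
  apply (cvg_Cmod_le eventually (fun M => pprod (fun m => a m n) M - 1)%C).
  - apply cvg_minus; [apply eventually_filter| |apply cvg_const, eventually_filter].
    apply (infprod_cvg B); [exact HB|]. intros M. apply dominated_row.
  - exists 0%nat. intros M _. apply dominated_row_bound.
Qed.

Lemma dominated_square :
  cvg eventually (fun N => pprod (fun n => pprod (fun m => a m n) N) N)
    (infprod (fun n => infprod (fun m => a m n))).
Proof.
  apply (tannery (rowB B) (fun N n => pprod (fun m => a m n) N) _ (fun N => N)).
  - apply rowB_pos, HB.
  - intros N n _. apply dominated_row_bound.
  - intros n. exists n. auto.
  - intros n. apply (infprod_cvg B); [exact HB|]. intros M. apply dominated_row.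
Qed.

End Double.

(** Both iterated products are limits of the same products over squares of indices. *)
Lemma infprod_exchange (B : R) (a : nat -> nat -> C) :
  0 <= B -> dominated B a ->
  infprod (fun n => infprod (fun m => a m n)) = infprod (fun m => infprod (fun n => a m n)).
Proof.
  intros HB Ha. apply (cvg_unique eventually (fun N => pprod (fun n => pprod (fun m => a m n) N) N)).
  - apply (dominated_square B); assumption.
  - apply cvg_ext with (fun N => pprod (fun m => pprod (fun n => a m n) N) N); [apply eventually_filter| |].
    + intros N. apply pprod_exchange.
    + apply (dominated_square B (fun n m => a m n)); [exact HB|apply dominated_sym, Ha].
Qed.

(** * Weierstrass factors of genus two *)

Definition E2 (x : C) : C := ((1 - x) * Cexp (x + x * x / 2))%C.

Definition E2K (X : R) : R :=
  1 + (1 + X) * (/ 2 + X / 8) + (1 + X) * (8 * (1 + X / 2) ^ 3 * exp (X * (1 + X / 2))).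

Lemma E2K_pos (X : R) : 0 <= X -> 0 <= E2K X.
Proof.
  intros HX. unfold E2K. pose proof (exp_pos (X * (1 + X / 2))).
  assert (0 <= (1 + X / 2) ^ 3) by (apply pow_le; lra).
  assert (0 <= (1 + X) * (/ 2 + X / 8)) by (apply Rmult_le_pos; lra).
  assert (0 <= (1 + X) * (8 * (1 + X / 2) ^ 3 * exp (X * (1 + X / 2)))); [|lra].
  apply Rmult_le_pos; [lra|]. apply Rmult_le_pos; lra.
Qed.

(** The exponent x + x^2/2 is the Taylor polynomial of - log(1 - x), which makes the error cubic.
    [E2K] collects the constants of the estimate. *)
Lemma E2_bound (X : R) (x : C) : Cmod x <= X -> Cmod (E2 x - 1)%C <= E2K X * Cmod x ^ 3.
Proof.
  intros HX. pose proof (Cmod_ge_0 x) as P.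
  set (y := (x + x * x / 2)%C).
  assert (C2 : Cmod (RtoC 2) = 2) by (rewrite Cmod_R; apply Rabs_pos_eq; lra).
  assert (C8 : Cmod (RtoC 8) = 8) by (rewrite Cmod_R; apply Rabs_pos_eq; lra).
  assert (N2 : RtoC 2 <> RtoC 0) by (apply Cmod_gt_0; lra).
  assert (N8 : RtoC 8 <> RtoC 0) by (apply Cmod_gt_0; lra).
  assert (Hy : Cmod y <= Cmod x * (1 + X / 2)).
  { unfold y. apply Rle_trans with (1 := Cmod_triangle _ _).
    rewrite Cmod_div, Cmod_mult, C2 by exact N2. nra. }
  assert (Hy2 : Cmod y <= X * (1 + X / 2)) by (apply Rle_trans with (1 := Hy); nra).
  pose proof (Cexp_bound3 y) as B3. fold y. unfold E2. fold y.
  (* The second Taylor polynomial of exp at y, times 1 - x, is 1 plus a multiple of x^3; the rest is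
     the remainder of [Cexp_bound3]. *)
  replace ((1 - x) * Cexp y - 1)%C with
    (x * x * x * (- (1) + (1 - x) * (/ 2 + x / 8)) + (1 - x) * (Cexp y - 1 - y - y * y / 2))%C
    by (unfold y; field).
  apply Rle_trans with (1 := Cmod_triangle _ _). rewrite !Cmod_mult.
  assert (A1 : Cmod (1 - x)%C <= 1 + X).
  { unfold Cminus. apply Rle_trans with (1 := Cmod_triangle _ _). rewrite Cmod_opp, Cmod_1. lra. }
  assert (A2 : Cmod (- (1) + (1 - x) * (/ 2 + x / 8))%C <= 1 + (1 + X) * (/ 2 + X / 8)).
  { apply Rle_trans with (1 := Cmod_triangle _ _). rewrite Cmod_opp, Cmod_1, Cmod_mult.
    apply Rplus_le_compat_l. apply Rmult_le_compat; try apply Cmod_ge_0; [exact A1|].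
    apply Rle_trans with (1 := Cmod_triangle _ _).
    rewrite Cmod_inv, Cmod_div, C2, C8 by assumption. lra. }
  assert (A3 : Cmod (Cexp y - 1 - y - y * y / 2)%C <= 8 * (1 + X / 2) ^ 3 * exp (X * (1 + X / 2)) * Cmod x ^ 3).
  { apply Rle_trans with (1 := B3).
    replace (8 * (1 + X / 2) ^ 3 * exp (X * (1 + X / 2)) * Cmod x ^ 3)
      with (8 * (Cmod x * (1 + X / 2)) ^ 3 * exp (X * (1 + X / 2))) by ring.
    apply Rmult_le_compat.
    - apply Rmult_le_pos; [lra|apply pow_le, Cmod_ge_0].
    - left. apply exp_pos.
    - apply Rmult_le_compat_l; [lra|]. apply pow_incr. split; [apply Cmod_ge_0|exact Hy].
    - apply exp_le_mono, Hy2. }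
  assert (P3 : 0 <= Cmod x ^ 3) by (apply pow_le, P).
  unfold E2K. rewrite Rmult_plus_distr_r. apply Rplus_le_compat.
  - replace (Cmod x * Cmod x * Cmod x) with (Cmod x ^ 3) by ring. rewrite (Rmult_comm (_ + _)).
    apply Rmult_le_compat_l; assumption.
  - rewrite Rmult_assoc. apply Rmult_le_compat; try apply Cmod_ge_0; assumption.
Qed.

Lemma E2_neq_0 (x : C) : x <> RtoC 1 -> E2 x <> RtoC 0.
Proof.
  intros H. unfold E2. apply Cmult_neq_0; [|apply Cexp_neq_0]. apply C_sub_neq_0. auto.
Qed.

Lemma E2_0 : E2 (RtoC 0) = RtoC 1.
Proof. unfold E2. replace (0 + 0 * 0 / 2)%C with (RtoC 0) by field. rewrite Cexp_0. ring. Qed.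

Lemma cdiff_E2 (x : C) : cdiff E2 x.
Proof. unfold E2. holo. Qed.

(** Shifts the index, so that products over k >= 0 run over the positive integers. *)
Definition natS (k : nat) : C := RtoC (INR k + 1).

Lemma natS_neq_0 (k : nat) : natS k <> RtoC 0.
Proof.
  intros E. apply (f_equal Re) in E. unfold natS, Re in E. simpl in E. pose proof (pos_INR k). lra.
Qed.

Lemma Cmod_natS (k : nat) : Cmod (natS k) = INR k + 1.
Proof. unfold natS. rewrite Cmod_R. apply Rabs_pos_eq. pose proof (pos_INR k). lra. Qed.

(** Up to an exponential factor this is 1 / Gamma(1 - z), with zeros at the positive integers. Genus
    two is used here to match the factors of [Ffun]. *)
Definition bfun (z : C) : C := infprod (fun k => E2 (z / natS k)%C).

Lemma bfun_near1 (Z : R) (z : C) (n : nat) : Cmod z <= Z -> near1 (E2K Z * Z ^ 3) (fun k => E2 (z / natS k)%C) n.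
Proof.
  intros Hz k _. pose proof (Cmod_ge_0 z) as P. pose proof (pos_INR k) as Pk.
  assert (E : Cmod (z / natS k)%C = Cmod z / (INR k + 1)) by (rewrite Cmod_div, Cmod_natS by apply natS_neq_0; reflexivity).
  assert (L : Cmod z / (INR k + 1) <= Z).
  { apply Rmult_le_reg_r with (INR k + 1); [lra|]. unfold Rdiv. rewrite Rmult_assoc, Rinv_l by lra. nra. }
  apply Rle_trans with (1 := E2_bound Z _ ltac:(rewrite E; exact L)).
  rewrite Rmult_assoc. apply Rmult_le_compat_l; [apply E2K_pos; lra|]. rewrite E.
  unfold Rdiv. rewrite Rpow_mult_distr. apply Rmult_le_compat.
  - apply pow_le, P.
  - apply pow_le. left. apply Rinv_0_lt_compat. lra.
  - apply pow_incr. lra.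
  - rewrite pow_inv. apply Rinv_le_contravar; [apply pow_lt; lra|].
    assert (0 <= (INR k + 1) ^ 2) by (apply pow_le; lra).
    replace ((INR k + 1) ^ 3) with ((INR k + 1) ^ 2 * (INR k + 1)) by ring. nra.
Qed.

Lemma bfun_const_pos (Z : R) : 0 <= Z -> 0 <= E2K Z * Z ^ 3.
Proof. intros H. apply Rmult_le_pos; [apply E2K_pos, H|apply pow_le, H]. Qed.

Lemma open_true : open (fun _ : C * C => True).
Proof. apply open_true. Qed.

Lemma cdiff_bfun (z : C) : cdiff bfun z.
Proof.
  apply (chol_at_fix_snd (fun z _ => bfun z) z (RtoC 0)).
  apply (chol_infprod (fun _ => True) (fun k z _ => E2 (z / natS k)%C)); [apply open_true| | |exact I].
  - intros k p _. apply (chol_at_comp1 E2 (fun z _ => z / natS k)%C); [apply cdiff_E2|].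
    apply chol_at_mult; [apply chol_at_fst|apply chol_at_const].
  - intros [z0 t0] _. exists 1, (E2K (Cmod z0 + 1) * (Cmod z0 + 1) ^ 3).
    pose proof (Cmod_ge_0 z0).
    split; [lra|split; [apply bfun_const_pos; lra|]]. simpl. intros w t Hw _ n.
    apply bfun_near1. pose proof (Cmod_triangle_inv w z0). lra.
Qed.

Lemma bfun_0 : bfun (RtoC 0) = RtoC 1.
Proof.
  apply infprod_eq. apply cvg_ext with (fun _ => RtoC 1); [apply eventually_filter| |apply cvg_const, eventually_filter].
  intros n. rewrite <- (pprod_one n). apply pprod_ext. intros k _.
  replace (0 / natS k)%C with (RtoC 0) by (field; apply natS_neq_0). symmetry. apply E2_0.
Qed.

Lemma bfun_neq_0 (z : C) : (forall k, z <> natS k) -> bfun z <> RtoC 0.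
Proof.
  intros H. apply (infprod_neq_0 (E2K (Cmod z) * Cmod z ^ 3)).
  - apply bfun_const_pos, Cmod_ge_0.
  - intros n. apply bfun_near1. lra.
  - intros k. apply E2_neq_0. intros E. apply (H k).
    replace z with (z / natS k * natS k)%C by (field; apply natS_neq_0). rewrite E. ring.
Qed.

(** * The slit plane and the product over a lattice quadrant *)

Definition slit (t : C) : Prop := ~ (Im t = 0 /\ Re t <= 0).

(** For x, y >= 0 not both 0 the sum x + y t can vanish only when t is real and nonpositive. The
    linear lower bound is what reduces the quadrant to the terms (m + n + 2)^-3 of [dominated]. *)
Lemma slit_lower_at (t : C) : slit t ->
  exists d, 0 < d /\ forall x y, 0 <= x -> 0 <= y -> d * (x + y) <= Cmod (RtoC x + RtoC y * t)%C.
Proof.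
  intros Ht. destruct t as [u v]. unfold slit, Re, Im in Ht; simpl in Ht.
  assert (HRe : forall x y, Rabs (x + y * u) <= Cmod (RtoC x + RtoC y * ((u, v) : C))%C).
  { intros x y. apply Rle_trans with (2 := re_le_Cmod _). unfold Re; simpl.
    replace (x + (y * u - 0 * v)) with (x + y * u) by ring. lra. }
  assert (HIm : forall x y, Rabs (y * v) <= Cmod (RtoC x + RtoC y * ((u, v) : C))%C).
  { intros x y. apply Rle_trans with (2 := im_le_Cmod _). unfold Im; simpl.
    replace (0 + (y * v + 0 * u)) with (y * v) by ring. lra. }
  destruct (Rlt_le_dec 0 u) as [Hu|Hu].
  - exists (Rmin 1 u). split; [apply Rmin_glb_lt; lra|]. intros x y Hx Hy.
    apply Rle_trans with (2 := HRe x y). rewrite Rabs_pos_eq by nra.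
    pose proof (Rmin_l 1 u). pose proof (Rmin_r 1 u). nra.
  - assert (Hv : v <> 0) by (intros E; apply Ht; split; [exact E|exact Hu]).
    assert (Pv : 0 < Rabs v) by (apply Rabs_pos_lt, Hv).
    (* The modulus M bounds y |v| and x - y |u|; hence x + y <= M + (1 + |u|) y <= (1 + c / |v|)
       M. *)
    set (c := 1 + Rabs u). assert (Pc : 0 < c) by (unfold c; pose proof (Rabs_pos u); lra).
    exists (/ (1 + c / Rabs v)).
    assert (Q : 0 < c / Rabs v) by (apply Rdiv_lt_0_compat; assumption).
    split; [apply Rinv_0_lt_compat; lra|]. intros x y Hx Hy.
    apply Rmult_le_reg_l with (1 + c / Rabs v); [lra|]. rewrite <- Rmult_assoc, Rinv_r, Rmult_1_l by lra.
    set (M := Cmod (RtoC x + RtoC y * ((u, v) : C))%C) in *.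
    assert (M1 : y * Rabs v <= M) by (pose proof (HIm x y) as H; rewrite Rabs_mult, (Rabs_pos_eq y) in H by exact Hy; exact H).
    assert (M2 : x - y * Rabs u <= M).
    { apply Rle_trans with (2 := HRe x y). pose proof (Rle_abs (x + y * u)). pose proof (Rle_abs (- u)) as K. rewrite Rabs_Ropp in K. nra. }
    assert (M3 : c * y <= c / Rabs v * M).
    { replace (c * y) with (c / Rabs v * (y * Rabs v)) by (field; lra). apply Rmult_le_compat_l; lra. }
    unfold c in *. nra.
Qed.

Lemma slit_lower (t0 : C) : slit t0 ->
  exists d h, 0 < d /\ 0 < h /\ forall t x y, Cmod (t - t0)%C < h -> 0 <= x -> 0 <= y ->
    d * (x + y) <= Cmod (RtoC x + RtoC y * t)%C.
Proof.
  intros Ht. destruct (slit_lower_at t0 Ht) as (d & Hd & H). exists (d / 2), (d / 2).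
  split; [lra|split; [lra|]]. intros t x y Hh Hx Hy. specialize (H x y Hx Hy).
  pose proof (Cmod_triangle_inv (RtoC x + RtoC y * t0)%C (RtoC x + RtoC y * t)%C) as T.
  replace (RtoC x + RtoC y * t0 - (RtoC x + RtoC y * t))%C with (RtoC y * (t0 - t))%C in T by ring.
  rewrite Cmod_mult, Cmod_R, (Rabs_pos_eq y Hy), Cmod_sub_comm in T. nra.
Qed.

Lemma slit_open (t0 : C) : slit t0 -> locally t0 slit.
Proof.
  intros Ht. destruct (slit_lower t0 Ht) as (d & h & Hd & Hh & H).
  apply locally_Cmod. exists h. split; [exact Hh|]. intros t Hth [E1 E2'].
  (* For t on the cut the coefficients - Re t and 1 are nonnegative and combine to 0, against the
     lower bound. *)
  specialize (H t (- Re t) 1 Hth ltac:(lra) ltac:(lra)).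
  replace (RtoC (- Re t) + RtoC 1 * t)%C with (RtoC 0) in H.
  - rewrite Cmod_0 in H. nra.
  - apply C_eq; unfold Re, Im in *; simpl; lra.
Qed.

Definition slit2 (p : C * C) : Prop := slit (snd p).

Lemma open_snd (P : C -> Prop) : (forall t, P t -> locally t P) -> open (fun p : C * C => P (snd p)).
Proof.
  intros H [z t] Ht. specialize (H t Ht). apply locally_Cmod in H. destruct H as (d & Hd & H).
  apply locally_Cmod2. exists d. split; [exact Hd|]. intros w s _ Hs. apply H, Hs.
Qed.

Lemma slit2_open : open slit2.
Proof. apply (open_snd slit), slit_open. Qed.

Definition lat (m n : nat) (t : C) : C := (natS m + natS n * t)%C.

Lemma lat_lower (t0 : C) : slit t0 ->
  exists d h, 0 < d /\ 0 < h /\ forall t m n, Cmod (t - t0)%C < h -> d * (INR m + INR n + 2) <= Cmod (lat m n t).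
Proof.
  intros Ht. destruct (slit_lower t0 Ht) as (d & h & Hd & Hh & H). exists d, h.
  split; [exact Hd|split; [exact Hh|]]. intros t m n Hth.
  pose proof (pos_INR m). pose proof (pos_INR n).
  specialize (H t (INR m + 1) (INR n + 1) Hth ltac:(lra) ltac:(lra)).
  replace (INR m + 1 + (INR n + 1)) with (INR m + INR n + 2) in H by ring. exact H.
Qed.

Lemma lat_neq_0 (m n : nat) (t : C) : slit t -> lat m n t <> RtoC 0.
Proof.
  intros Ht. destruct (lat_lower t Ht) as (d & h & Hd & Hh & H).
  specialize (H t m n). replace (t - t)%C with (RtoC 0) in H by ring. rewrite Cmod_0 in H.
  specialize (H Hh). pose proof (pos_INR m). pose proof (pos_INR n). apply Cmod_gt_0. nra.
Qed.

Lemma lat_dominated (t0 : C) (Z : R) : slit t0 -> 0 <= Z -> exists h B, 0 < h /\ 0 <= B /\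
  forall z t, Cmod z <= Z -> Cmod (t - t0)%C < h -> dominated B (fun m n => E2 (z / lat m n t)%C).
Proof.
  intros Ht HZ. destruct (lat_lower t0 Ht) as (d & h & Hd & Hh & H).
  exists h, (E2K (Z / d) * (Z / d) ^ 3).
  assert (PZ : 0 <= Z / d) by (apply Rmult_le_pos; [exact HZ|left; apply Rinv_0_lt_compat, Hd]).
  split; [exact Hh|split; [apply bfun_const_pos, PZ|]]. intros z t Hz Hth m n.
  specialize (H t m n Hth). pose proof (pos_INR m) as Pm. pose proof (pos_INR n) as Pn. pose proof (Cmod_ge_0 z) as Pz.
  set (s := INR m + INR n + 2) in *. assert (Hs : 2 <= s) by (unfold s; lra).
  assert (L0 : 0 < Cmod (lat m n t)) by nra.
  assert (E : Cmod (z / lat m n t)%C = Cmod z / Cmod (lat m n t)) by (apply Cmod_div; apply Cmod_gt_0, L0).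
  assert (L : Cmod (z / lat m n t)%C <= Z / d * / s).
  { rewrite E. replace (Z / d * / s) with (Z * / (d * s)) by (field; lra).
    apply Rmult_le_compat; [exact Pz|left; apply Rinv_0_lt_compat, L0|exact Hz|].
    apply Rinv_le_contravar; nra. }
  assert (L2 : Z / d * / s <= Z / d).
  { rewrite <- (Rmult_1_r (Z / d)) at 2. apply Rmult_le_compat_l; [exact PZ|].
    rewrite <- Rinv_1. apply Rinv_le_contravar; lra. }
  apply Rle_trans with (1 := E2_bound (Z / d) _ (Rle_trans _ _ _ L L2)).
  rewrite Rmult_assoc. apply Rmult_le_compat_l; [apply E2K_pos, PZ|].
  rewrite <- pow_inv, <- Rpow_mult_distr. apply pow_incr. split; [apply Cmod_ge_0|exact L].
Qed.

(* Up to an exponential factor, the reciprocal of a double gamma function. *)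
Definition Ffun (z t : C) : C := infprod (fun n => infprod (fun m => E2 (z / lat m n t)%C)).

Lemma chol_lat_factor (m n : nat) : chol slit2 (fun z t => E2 (z / lat m n t)%C).
Proof.
  intros [z t] Ht. apply (chol_at_comp1 E2 (fun z t => z / lat m n t)%C); [apply cdiff_E2|].
  apply chol_at_div; [apply lat_neq_0, Ht|apply chol_at_fst|].
  apply chol_at_plus; [apply chol_at_const|].
  apply chol_at_mult; [apply chol_at_const|apply chol_at_snd].
Qed.

Lemma lat_dominated_at (p : C * C) : slit2 p -> exists d B, 0 < d /\ 0 <= B /\ forall z t,
  Cmod (z - fst p)%C < d -> Cmod (t - snd p)%C < d -> dominated B (fun m n => E2 (z / lat m n t)%C).
Proof.
  destruct p as [z0 t0]. intros Ht. simpl.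
  destruct (lat_dominated t0 (Cmod z0 + 1) Ht) as (h & B & Hh & HB & H).
  { pose proof (Cmod_ge_0 z0). lra. }
  exists (Rmin 1 h), B. split; [apply Rmin_glb_lt; lra|split; [exact HB|]].
  pose proof (Rmin_l 1 h). pose proof (Rmin_r 1 h).
  intros z t Hz Hth. apply H; [|lra]. pose proof (Cmod_triangle_inv z z0). lra.
Qed.

Lemma chol_Ffun : chol slit2 Ffun.
Proof.
  apply (chol_infprod slit2 (fun n z t => infprod (fun m => E2 (z / lat m n t)%C))); [apply slit2_open| |].
  - intros n. apply (chol_infprod slit2 (fun m z t => E2 (z / lat m n t)%C)); [apply slit2_open| |].
    + intros m. apply chol_lat_factor.
    + intros p Hp. destruct (lat_dominated_at p Hp) as (d & B & Hd & HB & H).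
      exists d, B. split; [exact Hd|split; [exact HB|]]. intros z t Hz Ht N.
      apply (dominated_row B (fun m n => E2 (z / lat m n t)%C)); auto.
  - intros p Hp. destruct (lat_dominated_at p Hp) as (d & B & Hd & HB & H).
    exists d, (rowB B). split; [exact Hd|split; [apply rowB_pos, HB|]]. intros z t Hz Ht N n _.
    apply (dominated_row_inf B (fun m n => E2 (z / lat m n t)%C)); auto.
Qed.

Lemma Ffun_dominated (z t : C) : slit t -> exists B, 0 <= B /\ dominated B (fun m n => E2 (z / lat m n t)%C).
Proof.
  intros Ht. destruct (lat_dominated_at (z, t) Ht) as (d & B & Hd & HB & H). exists B. split; [exact HB|].
  apply H; simpl; replace (z - z)%C with (RtoC 0) by ring; replace (t - t)%C with (RtoC 0) by ring;
    rewrite Cmod_0; exact Hd.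
Qed.

Lemma Ffun_neq_0 (z t : C) : slit t -> (forall m n, z <> lat m n t) -> Ffun z t <> RtoC 0.
Proof.
  intros Ht H. destruct (Ffun_dominated z t Ht) as (B & HB & HD).
  apply (infprod_neq_0 (rowB B)); [apply rowB_pos, HB| |].
  - intros N n _. apply (dominated_row_inf B (fun m n => E2 (z / lat m n t)%C)); assumption.
  - intros n. apply (infprod_neq_0 B); [exact HB| |].
    + intros M. apply (dominated_row B (fun m n => E2 (z / lat m n t)%C)); assumption.
    + intros m. apply E2_neq_0. intros E. apply (H m n).
      replace z with (z / lat m n t * lat m n t)%C by (field; apply lat_neq_0, Ht). rewrite E. ring.
Qed.

Lemma slit_neq_0 (t : C) : slit t -> t <> RtoC 0.
Proof. intros H E. apply H. rewrite E. simpl. lra. Qed.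

Lemma slit_inv (t : C) : slit t -> slit (/ t)%C.
Proof.
  intros H [E1 E2']. pose proof (slit_neq_0 t H) as H0. apply H.
  destruct t as [u v]. unfold Cinv, Re, Im in *; simpl in *.
  assert (P : 0 < u * (u * 1) + v * (v * 1)).
  { apply Rnot_le_lt. intros L. apply H0. assert (u = 0) by nra. assert (v = 0) by nra. subst. reflexivity. }
  unfold Rdiv in *. pose proof (Rinv_0_lt_compat _ P) as Pi.
  assert (Hv : v = 0).
  { destruct (Rmult_integral _ _ E1) as [E|E]; lra. }
  split; [exact Hv|]. apply Rnot_lt_le. intros L. nra.
Qed.

(** Multiplication by t maps the quadrant of lattice points for 1 / t to that for t with the two
    indices exchanged, and [infprod_exchange] permits the exchange. *)
Lemma Ffun_inv (z t : C) : slit t -> Ffun (z / t)%C (/ t)%C = Ffun z t.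
Proof.
  intros Ht. pose proof (slit_neq_0 t Ht) as H0.
  destruct (Ffun_dominated z t Ht) as (B & HB & HD).
  unfold Ffun. rewrite (infprod_exchange B (fun m n => E2 (z / lat m n t)%C)) by assumption.
  assert (E : forall m n, (z / t / lat m n (/ t))%C = (z / lat n m t)%C).
  { intros m n. pose proof (lat_neq_0 n m t Ht) as H1. unfold lat in *. field.
    repeat split; try assumption; intros E; apply H1; rewrite <- E; ring. }
  apply infprod_ext. intros n. apply infprod_ext. intros m. f_equal. apply E.
Qed.

(** * The sine product *)

Lemma e_half : e (/ 2)%C = (- (1))%C.
Proof.
  replace (/ 2)%C with (RtoC (/ 2)) by (rewrite RtoC_inv; [reflexivity|lra]).
  unfold e, RtoC, Re, Im; simpl. rewrite Rmult_0_r, Ropp_0, exp_0.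
  replace (2 * PI * / 2) with PI by field. rewrite cos_PI, sin_PI. apply C_eq; unfold Re, Im; simpl; ring.
Qed.

Lemma pprod_double (g : nat -> C) (n : nat) :
  pprod g (2 * n) = pprod (fun j => g (2 * j)%nat * g (2 * j + 1)%nat)%C n.
Proof.
  induction n as [|n IH]; [reflexivity|].
  replace (2 * S n)%nat with (S (S (2 * n))) by lia. cbn [pprod]. rewrite IH.
  replace (2 * n + 1)%nat with (S (2 * n)) by lia. ring.
Qed.

Lemma pprod_rev (f : nat -> C) (n : nat) : pprod f n = pprod (fun j => f (n - 1 - j)%nat) n.
Proof.
  induction n as [|n IH]; [reflexivity|].
  rewrite (pprod_S_first (fun j => f (S n - 1 - j)%nat)). cbn [pprod]. rewrite IH.
  replace (S n - 1 - 0)%nat with n by lia.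
  rewrite (pprod_ext (fun k => f (S n - 1 - S k)%nat) (fun j => f (n - 1 - j)%nat)); [ring|].
  intros k Hk. f_equal. lia.
Qed.

Lemma pprod_fold (g : nat -> C) (n : nat) :
  pprod g (2 * n) = pprod (fun j => g j * g (2 * n - 1 - j)%nat)%C n.
Proof.
  replace (2 * n)%nat with (n + n)%nat at 1 by lia. rewrite pprod_add, pprod_mult. f_equal.
  rewrite pprod_rev. apply pprod_ext. intros k Hk. f_equal. lia.
Qed.

Definition pow2 (k : nat) : R := 2 ^ k.

Lemma pow2_ge_1 (k : nat) : 1 <= pow2 k.
Proof. apply pow_R1_Rle. lra. Qed.

Lemma pow2_neq_0 (k : nat) : RtoC (pow2 k) <> RtoC 0.
Proof. apply RtoC_neq_0. pose proof (pow2_ge_1 k). lra. Qed.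

Lemma pow2_S (k : nat) : RtoC (pow2 (S k)) = (RtoC 2 * RtoC (pow2 k))%C.
Proof. unfold pow2. simpl. apply RtoC_mult. Qed.

(** The factorization of 1 - X^N over the N-th roots of unity for N = 2^k, by iterating 1 - Y^2 = (1
    - Y) (1 + Y), where 1 + Y is 1 - Y with its argument shifted by one half. *)
Lemma one_sub_e_prod (k : nat) (x : C) :
  (1 - e (RtoC (pow2 k) * x))%C = pprod (fun j => 1 - e (x + RtoC (INR j) / RtoC (pow2 k)))%C (2 ^ k).
Proof.
  revert x. induction k as [|k IH]; intros x.
  - simpl. replace (x + 0 / RtoC (pow2 0))%C with x by (field; apply pow2_neq_0).
    unfold pow2. simpl. rewrite !Cmult_1_l. reflexivity.
  - pose proof (pow2_neq_0 k) as N0.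
    replace (2 ^ S k)%nat with (2 * 2 ^ k)%nat by (simpl; lia). rewrite pprod_double, pprod_mult.
    assert (E : (1 - e (RtoC (pow2 (S k)) * x))%C =
      ((1 - e (RtoC (pow2 k) * x)) * (1 - e (RtoC (pow2 k) * (x + / (2 * RtoC (pow2 k))))))%C).
    { replace (RtoC (pow2 k) * (x + / (2 * RtoC (pow2 k))))%C with (RtoC (pow2 k) * x + / 2)%C by (field; exact N0).
      rewrite pow2_S. replace (RtoC 2 * RtoC (pow2 k) * x)%C with (RtoC (pow2 k) * x + RtoC (pow2 k) * x)%C by ring.
      rewrite !e_plus, e_half. ring. }
    rewrite E, !IH. f_equal; apply pprod_ext; intros j _; apply (f_equal (fun y => 1 - e y)%C).
    + rewrite pow2_S, mult_INR, RtoC_mult. replace (INR 2) with 2 by (simpl; ring). field. exact N0.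
    + rewrite pow2_S, plus_INR, mult_INR, RtoC_plus, RtoC_mult. replace (INR 2) with 2 by (simpl; ring). replace (INR 1) with 1 by reflexivity. field. exact N0.
Qed.

(** This is 2 i sin(pi x), the shape of numerator and denominator in the theorem. *)
Definition sn (x : C) : C := (e (x / 2) - e (- (x / 2)))%C.

Lemma sn_sq (y : C) : (sn y * sn y)%C = (e y - 2 + e (- y))%C.
Proof.
  unfold sn. replace (e y) with (e (y / 2) * e (y / 2))%C by (rewrite <- e_plus; f_equal; field).
  replace (e (- y)) with (e (- (y / 2)) * e (- (y / 2)))%C by (rewrite <- e_plus; f_equal; field).
  pose proof (e_opp (y / 2)%C) as H.
  transitivity (e (y / 2) * e (y / 2) - 2 * (e (y / 2) * e (- (y / 2))) + e (- (y / 2)) * e (- (y / 2)))%C; [ring|].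
  rewrite H. ring.
Qed.

Lemma one_sub_e_pair (y a : C) :
  ((1 - e (y + a)) * (1 - e (y - a)))%C = (e y * (sn y * sn y - sn a * sn a))%C.
Proof.
  rewrite !sn_sq. unfold Cminus. rewrite !e_plus.
  pose proof (e_opp y) as H1. pose proof (e_opp a) as H2.
  transitivity (e y * e y * (e a * e (- a)) - e y * e a - e y * e (- a) + 1)%C; [ring|].
  rewrite H2. transitivity (e y * e y - e y * e a - e y * e (- a) + e y * e (- y))%C; [rewrite H1; ring|ring].
Qed.

(** The positive half-integers, which are zeros of 1 + e z. *)
Definition hint (j : nat) : R := INR j + / 2.

(** [one_sub_e_prod] with N = 2^(k + 1), shifted by one half. The factors j and N - 1 - j belong to
    opposite half-integers modulo N and combine by [one_sub_e_pair]. *)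
Lemma one_add_e_prod (k : nat) (z : C) :
  (1 + e z)%C = pprod (fun j => e (z / RtoC (pow2 (S k))) *
    (sn (z / RtoC (pow2 (S k))) * sn (z / RtoC (pow2 (S k)))
     - sn (RtoC (hint j) / RtoC (pow2 (S k))) * sn (RtoC (hint j) / RtoC (pow2 (S k)))))%C (2 ^ k).
Proof.
  set (N := RtoC (pow2 (S k))). pose proof (pow2_neq_0 (S k)) as N0. fold N in N0.
  replace (1 + e z)%C with (1 - e (N * ((z + / 2) / N)))%C.
  2: { replace (N * ((z + / 2) / N))%C with (z + / 2)%C by (field; exact N0). rewrite e_plus, e_half. ring. }
  unfold N at 1. rewrite one_sub_e_prod. fold N.
  replace (2 ^ S k)%nat with (2 * 2 ^ k)%nat by (simpl; lia). rewrite pprod_fold.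
  apply pprod_ext. intros j Hj. rewrite <- one_sub_e_pair. f_equal.
  - apply (f_equal (fun y => 1 - e y)%C). unfold hint. rewrite RtoC_plus, RtoC_inv by lra. field. exact N0.
  - apply (f_equal (fun y => 1 - y)%C). transitivity (e (z / N - RtoC (hint j) / N + RtoC (IZR 1)))%C; [|rewrite e_plus_IZR; reflexivity].
    f_equal. unfold hint. rewrite RtoC_plus, RtoC_inv by lra.
    assert (EN : N = (RtoC 2 * RtoC (INR (2 ^ k)))%C).
    { unfold N. rewrite pow2_S. unfold pow2. rewrite pow_INR. reflexivity. }
    assert (E : RtoC (INR (2 * 2 ^ k - 1 - j)) = (N - 1 - RtoC (INR j))%C).
    { rewrite minus_INR, minus_INR, mult_INR by lia. replace (INR 2) with 2 by (simpl; ring). replace (INR 1) with 1 by reflexivity.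
      rewrite !RtoC_minus, RtoC_mult, EN. reflexivity. }
    rewrite E. field. exact N0.
Qed.

Lemma sn_0 : sn (RtoC 0) = RtoC 0.
Proof.
  unfold sn. replace (0 / 2)%C with (RtoC 0) by field. replace (- (0))%C with (RtoC 0) by ring. ring.
Qed.

Lemma pprod_scal_const (c : C) (f : nat -> C) (n : nat) :
  pprod (fun j => c * f j)%C n = (c ^ n * pprod f n)%C.
Proof. induction n as [|n IH]; simpl; [ring|rewrite IH; ring]. Qed.

Lemma e_pow (x : C) (n : nat) : (e x ^ n)%C = e (RtoC (INR n) * x)%C.
Proof.
  induction n as [|n IH].
  - simpl. rewrite Cmult_0_l, e_0. reflexivity.
  - rewrite S_INR, RtoC_plus. cbn [Cpow]. rewrite IH, <- e_plus. f_equal. ring.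
Qed.

Lemma sn_neq_0 (a : R) : 0 < a < 1 -> sn (RtoC a) <> RtoC 0.
Proof.
  intros Ha E.
  assert (H : e (RtoC a) = RtoC 1).
  { assert (E2 : e (RtoC a / 2)%C = e (- (RtoC a / 2))%C).
    { unfold sn in E. replace (e (RtoC a / 2))%C with (e (RtoC a / 2) - e (- (RtoC a / 2)) + e (- (RtoC a / 2)))%C by ring.
      rewrite E. ring. }
    replace (RtoC a) with (RtoC a / 2 + RtoC a / 2)%C by field. rewrite e_plus. rewrite E2 at 1.
    rewrite Cmult_comm. apply e_opp. }
  unfold e, RtoC, Re, Im in H; simpl in H. rewrite Rmult_0_r, Ropp_0, exp_0 in H.
  injection H as H1 H2. pose proof PI_RGT_0 as HP.
  destruct (Rlt_le_dec a (/ 2)) as [L|L].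
  - assert (0 < sin (2 * PI * a)) by (apply sin_gt_0; nra). lra.
  - destruct (Rle_lt_or_eq_dec _ _ L) as [L'|L'].
    + assert (sin (2 * PI * a) < 0) by (apply sin_lt_0; nra). lra.
    + subst a. replace (2 * PI * / 2) with PI in H1 by field. rewrite cos_PI in H1. lra.
Qed.

Lemma hint_range (k j : nat) : (j < 2 ^ k)%nat -> 0 < hint j / pow2 (S k) <= / 2.
Proof.
  intros Hj. pose proof (pos_INR j) as Pj. unfold hint.
  assert (Hp : 0 < pow2 k) by (pose proof (pow2_ge_1 k); lra).
  assert (E : pow2 (S k) = 2 * pow2 k) by reflexivity.
  assert (L : INR j + 1 <= pow2 k).
  { unfold pow2. rewrite <- S_INR. replace (2 ^ k) with (INR (2 ^ k)) by (rewrite pow_INR; reflexivity).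
    apply le_INR. lia. }
  split.
  - apply Rdiv_lt_0_compat; lra.
  - rewrite E. apply Rmult_le_reg_r with (2 * pow2 k); [lra|].
    replace ((INR j + / 2) / (2 * pow2 k) * (2 * pow2 k)) with (INR j + / 2) by (field; lra). lra.
Qed.

(** Division by the same formula at z = 0, where the value is 2. This is why the cosine is treated
    before the sine, whose product vanishes at 0. *)
Lemma one_add_e_prod_norm (k : nat) (z : C) :
  (1 + e z)%C = (2 * e (z / 2) * pprod (fun j => 1 -
    (sn (z / RtoC (pow2 (S k))) * sn (z / RtoC (pow2 (S k)))) /
    (sn (RtoC (hint j) / RtoC (pow2 (S k))) * sn (RtoC (hint j) / RtoC (pow2 (S k))))) (2 ^ k))%C.
Proof.
  set (N := RtoC (pow2 (S k))). pose proof (pow2_neq_0 (S k)) as N0. fold N in N0.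
  assert (Hs : forall j, (j < 2 ^ k)%nat -> sn (RtoC (hint j) / N)%C <> RtoC 0).
  { intros j Hj. unfold N. rewrite <- RtoC_div by (pose proof (pow2_ge_1 (S k)); lra).
    apply sn_neq_0. pose proof (hint_range k j Hj). lra. }
  pose proof (one_add_e_prod k (RtoC 0)) as H0. pose proof (one_add_e_prod k z) as Hz.
  fold N in H0, Hz. rewrite Hz.
  rewrite (pprod_ext _ (fun j => (e (RtoC 0 / N) * (sn (RtoC 0 / N) * sn (RtoC 0 / N) - sn (RtoC (hint j) / N) * sn (RtoC (hint j) / N)))
    * (e (z / N) * (1 - (sn (z / N) * sn (z / N)) / (sn (RtoC (hint j) / N) * sn (RtoC (hint j) / N)))))%C).
  - rewrite pprod_mult, <- H0, e_0, pprod_scal_const, e_pow.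
    replace (RtoC (INR (2 ^ k)) * (z / N))%C with (z / 2)%C.
    + ring.
    + assert (EN : N = (RtoC 2 * RtoC (INR (2 ^ k)))%C).
      { unfold N. rewrite pow2_S. unfold pow2. rewrite pow_INR. reflexivity. }
      rewrite EN. field. intros E. apply N0. rewrite EN, E. ring.
  - intros j Hj. replace (0 / N)%C with (RtoC 0) by (field; exact N0). rewrite sn_0, e_0.
    pose proof (Hs j Hj). field. assumption.
Qed.

(** Doubling the angle: on [0, PI / 4] the sine is at least y / 2 and the cosine at least 1/2, and
    sin x = 2 sin(x / 2) cos(x / 2). *)
Lemma sin_lower (x : R) : 0 <= x <= PI / 2 -> x / 4 <= sin x.
Proof.
  intros [H1 H2]. pose proof PI_RGT_0 as HP.
  assert (K : forall y, 0 <= y <= PI / 4 -> y / 2 <= sin y /\ / 2 <= cos y).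
  { intros y [Y1 Y2].
    assert (Cy : forall c, 0 <= c <= y -> / 2 <= cos c).
    { intros c Hc. replace (/ 2) with (cos (PI / 3)) by (rewrite cos_PI3; lra). apply cos_decr_1; lra. }
    split; [|apply Cy; lra].
    destruct (MVT_gen sin 0 y cos) as (c & Hc & E).
    - intros. apply is_derive_sin.
    - intros. apply continuity_sin.
    - rewrite Rmin_left, Rmax_right in Hc by lra. rewrite sin_0 in E. pose proof (Cy c Hc). nra. }
  destruct (K (x / 2) ltac:(lra)) as [K1 K2].
  replace x with (2 * (x / 2)) at 2 by field. rewrite sin_2a. nra.
Qed.

Lemma sn_lower (a : R) : 0 <= a <= / 2 -> a <= Cmod (sn (RtoC a)).
Proof.
  intros Ha. pose proof PI_RGT_0 as HP. pose proof PI2_1 as HP2.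
  apply Rle_trans with (2 := im_le_Cmod _).
  assert (E : Im (sn (RtoC a)) = 2 * sin (PI * a)).
  { unfold sn. replace (RtoC a / 2)%C with (RtoC (a / 2)) by (rewrite RtoC_div by lra; reflexivity).
    rewrite <- RtoC_opp. unfold e, RtoC, Re, Im; simpl.
    rewrite !Rmult_0_r, Ropp_0, exp_0. replace (2 * PI * (a / 2)) with (PI * a) by field.
    replace (2 * PI * - (a / 2)) with (- (PI * a)) by field. rewrite sin_neg. ring. }
  rewrite E. pose proof (sin_lower (PI * a) ltac:(split; nra)) as H.
  rewrite Rabs_pos_eq by nra. nra.
Qed.

Lemma cderiv_sn_0 : cderiv sn (RtoC 0) C2pi.
Proof.
  assert (H2 : cderiv (fun x => x / 2)%C (RtoC 0) (/ 2)%C).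
  { pose proof (cderiv_mult (fun x => x) (fun _ => / 2)%C (RtoC 0) _ _ (cderiv_id _) (cderiv_const _ _)) as H.
    cbv beta in H. replace (1 * / 2 + 0 * 0)%C with (/ 2)%C in H by ring. exact H. }
  assert (H3 := cderiv_opp _ _ _ H2).
  pose proof (cderiv_minus _ _ _ _ _ (cderiv_comp e (fun x => x / 2)%C (RtoC 0) _ _ (cderiv_e _) H2)
    (cderiv_comp e (fun x => - (x / 2))%C (RtoC 0) _ _ (cderiv_e _) H3)) as H.
  cbv beta in H. replace (0 / 2)%C with (RtoC 0) in H by field. replace (- (0))%C with (RtoC 0) in H by ring.
  rewrite e_0 in H. replace (/ 2 * (C2pi * 1) - - / 2 * (C2pi * 1))%C with C2pi in H by field. exact H.
Qed.

Lemma C2pi_neq_0 : C2pi <> RtoC 0.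
Proof. intros E. apply (f_equal Im) in E. unfold C2pi, Im in E; simpl in E. pose proof PI_RGT_0. lra. Qed.

Lemma pow2_large (A : R) : exists K, forall k, (K <= k)%nat -> A < pow2 k.
Proof.
  destruct (Pow_x_infinity 2 ltac:(rewrite Rabs_pos_eq; lra) (A + 1)) as [K HK].
  exists K. intros k Hk. specialize (HK k Hk). rewrite Rabs_pos_eq in HK by (apply pow_le; lra).
  unfold pow2. lra.
Qed.

Lemma sn_scaled_lim (z : C) :
  cvg eventually (fun k => RtoC (pow2 (S k)) * sn (z / RtoC (pow2 (S k))))%C (C2pi * z)%C.
Proof.
  apply cvg_eventually. intros eps He.
  set (C := Cmod z + 1). assert (HC : 0 < C) by (unfold C; pose proof (Cmod_ge_0 z); lra).
  pose proof (proj1 (cderiv_eps _ _ _) cderiv_sn_0 (eps / (2 * C)) ltac:(apply Rdiv_lt_0_compat; lra)) as H.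
  apply locally_Cmod in H. destruct H as (d & Hd & H).
  destruct (pow2_large (C / d)) as [K HK]. exists K. intros k Hk.
  specialize (HK (S k) ltac:(lia)). pose proof (pow2_ge_1 (S k)) as P. pose proof (pow2_neq_0 (S k)) as N0.
  set (N := pow2 (S k)) in *.
  assert (HN : Cmod (RtoC N) = N) by (rewrite Cmod_R; apply Rabs_pos_eq; lra).
  assert (E1 : Cmod (z / RtoC N - 0)%C = Cmod z / N).
  { replace (z / RtoC N - 0)%C with (z / RtoC N)%C by ring. rewrite Cmod_div, HN by exact N0. reflexivity. }
  assert (L : Cmod z / N < d).
  { apply Rmult_lt_reg_r with N; [lra|]. replace (Cmod z / N * N) with (Cmod z) by (field; lra).
    apply Rmult_lt_compat_l with (r := d) in HK; [|exact Hd].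
    replace (d * (C / d)) with C in HK by (field; lra). unfold C in HK. lra. }
  specialize (H (z / RtoC N)%C). rewrite E1, sn_0 in H. specialize (H L).
  replace (RtoC N * sn (z / RtoC N) - C2pi * z)%C with (RtoC N * (sn (z / RtoC N) - 0 - C2pi * (z / RtoC N - 0)))%C
    by (field; exact N0).
  rewrite Cmod_mult, HN.
  apply Rle_lt_trans with (N * (eps / (2 * C) * (Cmod z / N))).
  - apply Rmult_le_compat_l; [lra|exact H].
  - replace (N * (eps / (2 * C) * (Cmod z / N))) with (eps * (Cmod z / (2 * C))) by (field; lra).
    rewrite <- (Rmult_1_r eps) at 2. apply Rmult_lt_compat_l; [exact He|].
    apply Rmult_lt_reg_r with (2 * C); [lra|]. replace (Cmod z / (2 * C) * (2 * C)) with (Cmod z) by (field; lra).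
    unfold C. pose proof (Cmod_ge_0 z). lra.
Qed.

Lemma cvg_bounded (u : nat -> C) (l : C) : cvg eventually u l -> exists M, 0 <= M /\ forall n, Cmod (u n) <= M.
Proof.
  intros H. destruct (proj1 (cvg_eventually _ _) H 1 Rlt_0_1) as [N HN].
  assert (K : forall n, exists M, 0 <= M /\ forall k, (k < n)%nat -> Cmod (u k) <= M).
  { intros n. induction n as [|n (M & HM & IH)]; [exists 0; split; [lra|lia]|].
    exists (Rmax M (Cmod (u n))). split; [apply Rle_trans with (1 := HM), Rmax_l|]. intros k Hk.
    destruct (Nat.eq_dec k n) as [->|Hne]; [apply Rmax_r|].
    apply Rle_trans with (2 := Rmax_l _ _). apply IH. lia. }
  destruct (K N) as (M & HM & HK). exists (Rmax M (Cmod l + 1)).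
  split; [apply Rle_trans with (1 := HM), Rmax_l|]. intros n.
  destruct (le_lt_dec N n) as [L|L].
  - apply Rle_trans with (2 := Rmax_r _ _). specialize (HN n L). pose proof (Cmod_triangle_inv (u n) l). lra.
  - apply Rle_trans with (2 := Rmax_l _ _). apply HK, L.
Qed.

Lemma hint_pos (j : nat) : 0 < hint j.
Proof. unfold hint. pose proof (pos_INR j). lra. Qed.

Lemma hint_neq_0 (j : nat) : RtoC (hint j) <> RtoC 0.
Proof. apply RtoC_neq_0. pose proof (hint_pos j). lra. Qed.

(** The limit of [one_add_e_prod_norm]: each factor converges by [sn_scaled_lim], and [tannery]
    handles the growing length 2^k. *)
Theorem cosine_product (z : C) :
  cvg eventually (fun J => 2 * e (z / 2) * pprod (fun j => 1 - (z * z) / (RtoC (hint j) * RtoC (hint j))) J)%C (1 + e z)%C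
  /\ exists B, 0 <= B /\ forall n, near1 B (fun j => 1 - (z * z) / (RtoC (hint j) * RtoC (hint j)))%C n.
Proof.
  destruct (cvg_bounded _ _ (sn_scaled_lim z)) as (M & HM & HMb).
  set (f := fun k j => (1 - (sn (z / RtoC (pow2 (S k))) * sn (z / RtoC (pow2 (S k)))) /
    (sn (RtoC (hint j) / RtoC (pow2 (S k))) * sn (RtoC (hint j) / RtoC (pow2 (S k)))))%C).
  (* M bounds N |sn(z / N)|. Since |sn(h / N)| >= h / N and j + 1 <= 2 h, the quotient of the two is
     at most 2 M / (j + 1). *)
  assert (HB : 0 <= 4 * (M * M)) by nra.
  assert (T := tannery (4 * (M * M)) f (fun j => 1 - (z * z) / (RtoC (hint j) * RtoC (hint j)))%C (fun k => (2 ^ k)%nat) HB).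
  destruct T as [T1 T2].
  - intros k j Hj. unfold f.
    set (N := pow2 (S k)) in *. pose proof (pow2_ge_1 (S k)) as P. pose proof (pow2_neq_0 (S k)) as N0. fold N in P, N0.
    pose proof (hint_range k j Hj) as Hr. fold N in Hr. pose proof (hint_pos j) as Hh.
    pose proof (sn_lower (hint j / N) ltac:(lra)) as Hs. rewrite RtoC_div in Hs by lra.
    pose proof (HMb k) as Hm. fold N in Hm. rewrite Cmod_mult in Hm.
    assert (HN : Cmod (RtoC N) = N) by (rewrite Cmod_R; apply Rabs_pos_eq; lra). rewrite HN in Hm.
    set (s1 := sn (z / RtoC N)%C) in *. set (s2 := sn (RtoC (hint j) / RtoC N)%C) in *.
    assert (S2 : s2 <> RtoC 0) by (apply Cmod_gt_0; lra).
    replace (1 - s1 * s1 / (s2 * s2) - 1)%C with (- ((s1 / s2) * (s1 / s2)))%C by (field; exact S2).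
    rewrite Cmod_opp, Cmod_mult, Cmod_div by exact S2.
    pose proof (pos_INR j) as Pj.
    assert (Q : Cmod s1 / Cmod s2 <= 2 * M / (INR j + 1)).
    { apply Rmult_le_reg_r with (Cmod s2); [lra|]. replace (Cmod s1 / Cmod s2 * Cmod s2) with (Cmod s1) by (field; lra).
      apply Rmult_le_reg_l with N; [lra|]. apply Rle_trans with (1 := Hm).
      apply Rle_trans with (N * (2 * M / (INR j + 1) * (hint j / N))).
      - unfold hint. replace (N * (2 * M / (INR j + 1) * ((INR j + / 2) / N))) with (M * ((2 * INR j + 1) / (INR j + 1))) by (field; lra).
        rewrite <- (Rmult_1_r M) at 1. apply Rmult_le_compat_l; [exact HM|].
        apply Rmult_le_reg_r with (INR j + 1); [lra|]. replace ((2 * INR j + 1) / (INR j + 1) * (INR j + 1)) with (2 * INR j + 1) by (field; lra). lra.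
      - apply Rmult_le_compat_l; [lra|]. apply Rmult_le_compat_l; [|exact Hs].
        apply Rmult_le_pos; [lra|left; apply Rinv_0_lt_compat; lra]. }
    assert (Q0 : 0 <= Cmod s1 / Cmod s2) by (apply Rmult_le_pos; [apply Cmod_ge_0|left; apply Rinv_0_lt_compat; lra]).
    replace (4 * (M * M) * / (INR j + 1) ^ 2) with (2 * M / (INR j + 1) * (2 * M / (INR j + 1))) by (field; lra).
    apply Rmult_le_compat; assumption.
  - intros n. destruct (pow2_large (INR n)) as [K HK]. exists K. intros N HN. specialize (HK N HN).
    unfold pow2 in HK. replace (2 ^ N) with (INR (2 ^ N)) in HK by (rewrite pow_INR; reflexivity).
    apply INR_lt in HK. lia.
  - intros j. unfold f.
    pose proof (sn_scaled_lim z) as L1. pose proof (sn_scaled_lim (RtoC (hint j))) as L2.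
    pose proof C2pi_neq_0 as C0. pose proof (hint_neq_0 j) as H0.
    assert (D0 : (C2pi * RtoC (hint j) * (C2pi * RtoC (hint j)))%C <> RtoC 0) by (repeat apply Cmult_neq_0; assumption).
    pose proof (cvg_minus eventually _ _ _ _ (cvg_const eventually (RtoC 1))
      (cvg_div eventually _ _ _ _ D0 (cvg_mult eventually _ _ _ _ L1 L1) (cvg_mult eventually _ _ _ _ L2 L2))) as L.
    replace (1 - z * z / (RtoC (hint j) * RtoC (hint j)))%C
      with (1 - C2pi * z * (C2pi * z) / (C2pi * RtoC (hint j) * (C2pi * RtoC (hint j))))%C by (field; auto).
    generalize L. apply cvg_ext_loc; [apply eventually_filter|].
    destruct (pow2_large (2 * hint j)) as [K HK]. exists K. intros k Hk.
    specialize (HK (S k) ltac:(lia)). pose proof (pow2_neq_0 (S k)) as N0. set (N := RtoC (pow2 (S k))) in *.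
    assert (S2 : sn (RtoC (hint j) / N)%C <> RtoC 0).
    { unfold N. rewrite <- RtoC_div by (pose proof (pow2_ge_1 (S k)); lra). apply sn_neq_0.
      pose proof (hint_pos j). pose proof (pow2_ge_1 (S k)). split; [apply Rdiv_lt_0_compat; lra|].
      apply Rmult_lt_reg_r with (pow2 (S k)); [lra|].
      replace (hint j / pow2 (S k) * pow2 (S k)) with (hint j) by (field; lra). lra. }
    field. auto.
  - split; [|exists (4 * (M * M)); split; assumption].
    assert (E : (1 + e z)%C = (2 * e (z / 2) * infprod (fun j => 1 - z * z / (RtoC (hint j) * RtoC (hint j))))%C).
    { apply (cvg_unique eventually (fun k => 2 * e (z / 2) * pprod (f k) (2 ^ k))%C).
      - apply cvg_ext with (fun _ => 1 + e z)%C; [apply eventually_filter| |apply cvg_const, eventually_filter].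
        intros k. apply one_add_e_prod_norm.
      - apply cvg_mult; [apply eventually_filter|apply cvg_const, eventually_filter|exact T2]. }
    rewrite E. apply cvg_mult; [apply eventually_filter|apply cvg_const, eventually_filter|].
    apply (infprod_cvg (4 * (M * M))); assumption.
Qed.

Lemma cvg_shift (u : nat -> C) (l : C) : cvg eventually u l -> cvg eventually (fun n => u (S n)) l.
Proof.
  intros H. apply cvg_eventually. intros eps He.
  destruct (proj1 (cvg_eventually _ _) H eps He) as [N HN]. exists N. intros n Hn. apply HN. lia.
Qed.

Lemma csum_add (u v : nat -> C) (n : nat) : csum (fun k => u k + v k)%C n = (csum u n + csum v n)%C.
Proof. induction n as [|n IH]; simpl; [ring|rewrite IH; ring]. Qed.

Lemma csum_scal (c : C) (u : nat -> C) (n : nat) : csum (fun k => c * u k)%C n = (c * csum u n)%C.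
Proof. induction n as [|n IH]; simpl; [ring|rewrite IH; ring]. Qed.

Lemma Cmod_csum_le (u : nat -> C) (v : nat -> R) (n m : nat) :
  (forall k, Cmod (u (n + k)%nat) <= v k) -> Cmod (csum u (n + m) - csum u n)%C <= rsum v m.
Proof.
  intros H. induction m as [|m IH].
  - rewrite Nat.add_0_r. replace (csum u n - csum u n)%C with (RtoC 0) by ring. rewrite Cmod_0. simpl. lra.
  - rewrite Nat.add_succ_r. simpl.
    replace (csum u (n + m) + u (n + m)%nat - csum u n)%C with ((csum u (n + m) - csum u n) + u (n + m)%nat)%C by ring.
    apply Rle_trans with (1 := Cmod_triangle _ _). apply Rplus_le_compat; [exact IH|apply H].
Qed.

Lemma csum_rate (B : R) (u : nat -> C) (n m : nat) : 0 <= B ->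
  (forall k, Cmod (u k) <= B * / (INR k + 1) ^ 2) -> (n <= m)%nat ->
  Cmod (csum u m - csum u n)%C <= 2 * B / (INR n + 1).
Proof.
  intros HB Hu Hnm. replace m with (n + (m - n))%nat by lia.
  apply Rle_trans with (rsum (fun k => B * / (INR (n + k) + 1) ^ 2) (m - n)).
  - apply Cmod_csum_le. intros k. apply Hu.
  - rewrite rsum_scal. replace (2 * B / (INR n + 1)) with (B * (2 / (INR n + 1)))
      by (field; pose proof (pos_INR n); lra).
    apply Rmult_le_compat_l; [exact HB|apply rsum_inv_sq].
Qed.

Lemma csum_cvg (B : R) (u : nat -> C) : 0 <= B -> (forall k, Cmod (u k) <= B * / (INR k + 1) ^ 2) ->
  exists l, cvg eventually (csum u) l.
Proof.
  intros HB Hu. apply C_cauchy_cvg. intros eps He.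
  destruct (inv_INR_small (2 * B) eps ltac:(lra) He) as [N HN].
  exists N. intros n m Hn Hm. destruct (le_ge_dec n m) as [L|L].
  - rewrite Cmod_sub_comm. apply Rle_lt_trans with (1 := csum_rate B u n m HB Hu L). auto.
  - apply Rle_lt_trans with (1 := csum_rate B u m n HB Hu L). auto.
Qed.

Lemma pprod_Cexp (u : nat -> C) (n : nat) : pprod (fun k => Cexp (u k)) n = Cexp (csum u n).
Proof. induction n as [|n IH]; simpl; [symmetry; apply Cexp_0|rewrite IH, <- Cexp_plus; reflexivity]. Qed.

Lemma cvg_Cexp (u : nat -> C) (l : C) : cvg eventually u l -> cvg eventually (fun n => Cexp (u n)) (Cexp l).
Proof.
  intros H. apply (cvg_comp eventually u Cexp); [exact H|apply cdiff_ccont, cdiff_Cexp].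
Qed.

Lemma cvg_inv_natS : cvg eventually (fun n => / natS n)%C (RtoC 0).
Proof.
  apply cvg_eventually. intros eps He. destruct (inv_INR_small 1 eps ltac:(lra) He) as [N HN].
  exists N. intros n Hn. replace (/ natS n - 0)%C with (/ natS n)%C by ring.
  rewrite Cmod_inv, Cmod_natS by apply natS_neq_0. specialize (HN n Hn). unfold Rdiv in HN. lra.
Qed.

Lemma sq_factor_near1 (z : C) (n : nat) :
  near1 (Cmod z * Cmod z) (fun j => 1 - z * z / (natS j * natS j))%C n.
Proof.
  intros j _. pose proof (natS_neq_0 j) as H.
  replace (1 - z * z / (natS j * natS j) - 1)%C with (- (z * z / (natS j * natS j)))%C by (field; exact H).
  rewrite Cmod_opp, Cmod_div, !Cmod_mult, Cmod_natS by (apply Cmult_neq_0; exact H).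
  right. field. pose proof (pos_INR j). lra.
Qed.

Definition sq_prod (z : C) : C := infprod (fun j => 1 - z * z / (natS j * natS j))%C.

Lemma sq_prod_cvg (z : C) :
  cvg eventually (pprod (fun j => 1 - z * z / (natS j * natS j))%C) (sq_prod z).
Proof.
  apply (infprod_cvg (Cmod z * Cmod z)).
  - pose proof (Cmod_ge_0 z). nra.
  - apply sq_factor_near1.
Qed.

(** The part of the shifted cosine product that is free of z; essentially the partial products of
    Wallis. *)
Definition wallis (J : nat) : C :=
  (natS J * pprod (fun j => natS j * natS j) J / pprod (fun j => RtoC (hint j) * RtoC (hint j)) (S J))%C.

Lemma wallis_ne (J : nat) : pprod (fun j => RtoC (hint j) * RtoC (hint j))%C J <> RtoC 0.
Proof. apply pprod_neq_0. intros. apply Cmult_neq_0; apply hint_neq_0. Qed.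

(** With h = j + 1/2 the factor 1 - (z + 1/2)^2 / h^2 has the numerator (j - z) (j + 1 + z).
    Regrouping these gives - z, the pairs n^2 - z^2, and one leftover factor J + 1 + z. *)
Lemma hint_shift (z : C) (J : nat) :
  pprod (fun j => 1 - (z + / 2) * (z + / 2) / (RtoC (hint j) * RtoC (hint j)))%C (S J) =
  (- z * pprod (fun j => 1 - z * z / (natS j * natS j)) J * (1 + z * / natS J) * wallis J)%C.
Proof.
  induction J as [|J IH].
  - unfold wallis. simpl. unfold hint, natS. simpl INR. rewrite !RtoC_plus, RtoC_inv by lra. field.
  - cbn [pprod] in *. rewrite IH. unfold wallis. cbn [pprod].
    pose proof (wallis_ne J) as W. pose proof (hint_neq_0 J) as H1. pose proof (hint_neq_0 (S J)) as H2.
    pose proof (natS_neq_0 J) as N1. pose proof (natS_neq_0 (S J)) as N2.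
    assert (E1 : natS (S J) = (natS J + 1)%C) by (unfold natS; rewrite S_INR, !RtoC_plus; ring).
    assert (E2 : RtoC (hint (S J)) = (natS J + / 2)%C).
    { unfold hint, natS. rewrite S_INR, !RtoC_plus, RtoC_inv by lra. ring. }
    rewrite E1 in N2. rewrite E2 in H2. rewrite E1, E2.
    set (p := pprod (fun j => RtoC (hint j) * RtoC (hint j))%C J) in *.
    set (h := RtoC (hint J)) in *. set (x := natS J) in *.
    set (q := pprod (fun j => 1 - z * z / (natS j * natS j))%C J).
    set (r := pprod (fun j => natS j * natS j)%C J).
    assert (H3 : (2 * x + 1)%C <> RtoC 0).
    { intros E. apply H2. replace (x + / 2)%C with ((2 * x + 1) / 2)%C by field. rewrite E. field. }
    field. repeat split; try assumption. rewrite Cmult_comm. exact H3.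
Qed.

Lemma e_quarter_neq : (2 * e (/ 4))%C <> RtoC 0.
Proof. apply Cmult_neq_0; [apply RtoC_neq_0; lra|apply e_neq_0]. Qed.

(** The cosine product shifted by one half. The value of K is left open; later steps use only that
    it is a nonzero constant. *)
Theorem sine_product : exists K : C, K <> RtoC 0 /\ forall z, sn z = (K * z * sq_prod z)%C.
Proof.
  assert (L : forall z, cvg eventually (fun J => 2 * e ((z + / 2) / 2) *
    (- z * pprod (fun j => 1 - z * z / (natS j * natS j)) J * (1 + z * / natS J) * wallis J))%C (1 - e z)%C).
  { intros z. destruct (cosine_product (z + / 2)%C) as [H _].
    replace (1 + e (z + / 2))%C with (1 - e z)%C in H by (rewrite e_plus, e_half; ring).
    apply cvg_shift in H. generalize H. apply cvg_ext; [apply eventually_filter|].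
    intros J. rewrite <- hint_shift. reflexivity. }
  assert (Lf : forall z, cvg eventually (fun J => 1 + z * / natS J)%C (RtoC 1)).
  { intros z. pose proof (cvg_plus eventually _ _ _ _ (cvg_const eventually (RtoC 1))
      (cvg_mult eventually _ _ _ _ (cvg_const eventually z) cvg_inv_natS)) as H.
    replace (1 + z * 0)%C with (RtoC 1) in H by ring. exact H. }
  (* At z = - 1/2 the left side 1 - e z is 2 and the factors depending on z have nonzero limits,
     which forces [wallis] to converge to a nonzero limit. *)
  set (w := (- / 2)%C).
  assert (Pw : sq_prod w <> RtoC 0).
  { apply (infprod_neq_0 (Cmod w * Cmod w)).
    - pose proof (Cmod_ge_0 w). nra.
    - apply sq_factor_near1.
    - intros k E.
      assert (E' : (natS k * natS k - w * w)%C = RtoC 0).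
      { replace (natS k * natS k - w * w)%C with (natS k * natS k * (1 - w * w / (natS k * natS k)))%C
          by (field; apply natS_neq_0). rewrite E. ring. }
      unfold w, natS in E'. replace (- / 2)%C with (RtoC (- / 2)) in E' by (rewrite RtoC_opp, RtoC_inv by lra; reflexivity).
      rewrite <- !RtoC_mult, <- RtoC_minus in E'. apply (f_equal Re) in E'. unfold Re, RtoC in E'; simpl in E'.
      pose proof (pos_INR k). nra. }
  assert (W : exists W, W <> RtoC 0 /\ cvg eventually wallis W).
  { pose proof (L w) as Hw. replace (1 - e w)%C with (RtoC 2) in Hw.
    2: { unfold w. rewrite e_opp_inv, e_half. field. }
    replace ((w + / 2) / 2)%C with (RtoC 0) in Hw by (unfold w; field). rewrite e_0 in Hw.
    exists (2 / sq_prod w)%C. split.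
    - intros E. apply (RtoC_neq_0 2); [lra|]. replace (RtoC 2) with (2 / sq_prod w * sq_prod w)%C by (field; exact Pw).
      rewrite E. ring.
    - pose proof (cvg_mult eventually _ _ _ _ (sq_prod_cvg w) (Lf w)) as Hd.
      assert (Hd0 : (sq_prod w * 1)%C <> RtoC 0) by (rewrite Cmult_1_r; exact Pw).
      pose proof (cvg_div eventually _ _ _ _ Hd0 Hw Hd) as Hq.
      replace (2 / (sq_prod w * 1))%C with (2 / sq_prod w)%C in Hq by (field; exact Pw).
      generalize Hq. apply cvg_ext_loc; [apply eventually_filter|].
      generalize (cvg_near_neq eventually _ _ (RtoC 0) Hd Hd0). apply filter_imp. intros J HJ.
      set (x := pprod (fun j => 1 - w * w / (natS j * natS j))%C J) in *.
      set (y := (1 + w * / natS J)%C) in *.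
      replace (- w)%C with (/ 2)%C by (unfold w; ring).
      assert (Hx : x <> RtoC 0) by (intros E; apply HJ; rewrite E; ring).
      assert (Hy : y <> RtoC 0) by (intros E; apply HJ; rewrite E; ring).
      field. repeat split; assumption. }
  destruct W as (W & W0 & HW). exists (2 * e (/ 4) * W)%C. split; [apply Cmult_neq_0; [apply e_quarter_neq|exact W0]|].
  intros z.
  assert (E : (1 - e z)%C = (2 * e ((z + / 2) / 2) * (- z * sq_prod z * 1 * W))%C).
  { apply (cvg_unique eventually _ _ _ (L z)).
    apply cvg_mult; [apply eventually_filter|apply cvg_const, eventually_filter|].
    apply cvg_mult; [apply eventually_filter| |exact HW].
    apply cvg_mult; [apply eventually_filter| |apply Lf].
    apply cvg_mult; [apply eventually_filter|apply cvg_const, eventually_filter|apply sq_prod_cvg]. }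
  assert (S : sn z = (- e (- (z / 2)) * (1 - e z))%C).
  { unfold sn. replace (e z) with (e (z / 2) * e (z / 2))%C by (rewrite <- e_plus; f_equal; field).
    transitivity (e (z / 2) * (e (z / 2) * e (- (z / 2))) - e (- (z / 2)))%C; [rewrite e_opp|]; ring. }
  rewrite S, E. replace ((z + / 2) / 2)%C with (z / 2 + / 4)%C by field. rewrite e_plus.
  transitivity (2 * e (/ 4) * W * z * sq_prod z * (e (z / 2) * e (- (z / 2))))%C; [ring|rewrite e_opp; ring].
Qed.

(** [E2 x * E2 (- x)] equals (1 - x^2) exp(x^2), so beta is minus the sum of the inverse squares. *)
Lemma sq_prod_bfun : exists beta : C, forall z, sq_prod z = (Cexp (beta * (z * z)) * (bfun z * bfun (- z)))%C.
Proof.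
  destruct (csum_cvg 1 (fun k => / (natS k * natS k))%C) as [zeta Hz]; [lra| |].
  { intros k. rewrite Cmod_inv by (apply Cmult_neq_0; apply natS_neq_0). rewrite Cmod_mult, Cmod_natS.
    right. field. pose proof (pos_INR k). lra. }
  exists (- zeta)%C. intros z.
  assert (E : (bfun z * bfun (- z))%C = (sq_prod z * Cexp (z * z * zeta))%C).
  { apply (cvg_unique eventually (fun n => pprod (fun k => E2 (z / natS k)) n * pprod (fun k => E2 (- z / natS k)) n)%C).
    - apply cvg_mult; [apply eventually_filter| |].
      + apply (infprod_cvg (E2K (Cmod z) * Cmod z ^ 3)); [apply bfun_const_pos, Cmod_ge_0|intros; apply bfun_near1; lra].
      + apply (infprod_cvg (E2K (Cmod z) * Cmod z ^ 3)); [apply bfun_const_pos, Cmod_ge_0|].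
        intros; apply bfun_near1. rewrite Cmod_opp. lra.
    - apply cvg_ext with (fun n => pprod (fun j => 1 - z * z / (natS j * natS j)) n * Cexp (z * z * csum (fun k => / (natS k * natS k)) n))%C;
        [apply eventually_filter| |].
      + intros n. rewrite <- csum_scal, <- pprod_Cexp, <- !pprod_mult. apply pprod_ext. intros k _.
        pose proof (natS_neq_0 k) as H. unfold E2.
        set (x := (z / natS k)%C). replace (- z / natS k)%C with (- x)%C by (unfold x; field; exact H).
        transitivity ((1 - x * x) * (Cexp (x + x * x / 2) * Cexp (- x + - x * - x / 2)))%C; [|ring].
        rewrite <- Cexp_plus. f_equal.
        * unfold x. field. exact H.
        * f_equal. unfold x. field. exact H.
      + apply cvg_mult; [apply eventually_filter|apply sq_prod_cvg|]. apply cvg_Cexp.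
        apply cvg_mult; [apply eventually_filter|apply cvg_const, eventually_filter|exact Hz]. }
  rewrite E. transitivity (sq_prod z * (Cexp (z * z * zeta) * Cexp (- (z * z * zeta))))%C.
  - rewrite Cexp_opp. ring.
  - replace (- zeta * (z * z))%C with (- (z * z * zeta))%C by ring. ring.
Qed.

(** * Factorization of [1 - e (x + z)] and of [varpi] *)

(** One row of the quadrant: for x = (n + 1) t this is the factor of index n in [Ffun]. *)
Definition row (x z : C) : C := infprod (fun m => E2 (z / (natS m + x))%C).

Lemma slit_of_Im (x : C) : Im x <> 0 -> slit x /\ slit (- x)%C.
Proof.
  intros H. split; intros [E _]; [auto|]. apply H.
  change (Im (- x)%C) with (- Im x) in E. lra.
Qed.

Lemma natS_add_lower (x : C) : slit x -> exists d, 0 < d /\ forall m, d * (INR m + 1) <= Cmod (natS m + x)%C.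
Proof.
  intros Hx. destruct (slit_lower_at x Hx) as (d & Hd & H). exists d. split; [exact Hd|]. intros m.
  pose proof (pos_INR m). specialize (H (INR m + 1) 1 ltac:(lra) ltac:(lra)).
  rewrite Cmult_1_l in H. unfold natS. apply Rle_trans with (2 := H). nra.
Qed.

Lemma natS_add_neq_0 (x : C) (m : nat) : slit x -> (natS m + x)%C <> RtoC 0.
Proof.
  intros Hx. destruct (natS_add_lower x Hx) as (d & Hd & H). specialize (H m).
  pose proof (pos_INR m). apply Cmod_gt_0. nra.
Qed.

(** The constant keeps the factor |z|^3. It yields that [row] is 1 + O(z^3), from which the
    exponents are identified in [row_product]. *)
Lemma row_near1 (x : C) (Z : R) : slit x -> 0 <= Z -> exists B, 0 <= B /\
  forall z n, Cmod z <= Z -> near1 (B * Cmod z ^ 3) (fun m => E2 (z / (natS m + x))%C) n.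
Proof.
  intros Hx HZ. destruct (natS_add_lower x Hx) as (d & Hd & H).
  exists (E2K (Z / d) * (/ d) ^ 3).
  assert (PZ : 0 <= Z / d) by (apply Rmult_le_pos; [exact HZ|left; apply Rinv_0_lt_compat, Hd]).
  assert (Pd : 0 <= (/ d) ^ 3) by (apply pow_le; left; apply Rinv_0_lt_compat, Hd).
  split; [apply Rmult_le_pos; [apply E2K_pos, PZ|exact Pd]|].
  intros z n Hz m _. specialize (H m). pose proof (pos_INR m) as Pm. pose proof (Cmod_ge_0 z) as Pz.
  assert (L0 : 0 < Cmod (natS m + x)%C) by nra.
  assert (E : Cmod (z / (natS m + x))%C = Cmod z / Cmod (natS m + x)%C) by (apply Cmod_div; apply Cmod_gt_0, L0).
  assert (L : Cmod (z / (natS m + x))%C <= Cmod z * / d * / (INR m + 1)).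
  { rewrite E. replace (Cmod z * / d * / (INR m + 1)) with (Cmod z * / (d * (INR m + 1))) by (field; lra).
    apply Rmult_le_compat_l; [exact Pz|]. apply Rinv_le_contravar; [nra|exact H]. }
  assert (L2 : Cmod z * / d * / (INR m + 1) <= Z / d).
  { rewrite <- (Rmult_1_r (Z / d)). apply Rmult_le_compat.
    - apply Rmult_le_pos; [exact Pz|left; apply Rinv_0_lt_compat, Hd].
    - left; apply Rinv_0_lt_compat; lra.
    - apply Rmult_le_compat_r; [left; apply Rinv_0_lt_compat, Hd|exact Hz].
    - rewrite <- Rinv_1. apply Rinv_le_contravar; lra. }
  apply Rle_trans with (1 := E2_bound (Z / d) _ (Rle_trans _ _ _ L L2)).
  replace (E2K (Z / d) * (/ d) ^ 3 * Cmod z ^ 3 * / (INR m + 1) ^ 2)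
    with (E2K (Z / d) * ((Cmod z * / d) ^ 3 * / (INR m + 1) ^ 2)) by ring.
  apply Rmult_le_compat_l; [apply E2K_pos, PZ|].
  apply Rle_trans with ((Cmod z * / d * / (INR m + 1)) ^ 3).
  - apply pow_incr. split; [apply Cmod_ge_0|exact L].
  - rewrite Rpow_mult_distr. apply Rmult_le_compat_l.
    + apply pow_le, Rmult_le_pos; [exact Pz|left; apply Rinv_0_lt_compat, Hd].
    + rewrite pow_inv. apply Rinv_le_contravar; [apply pow_lt; lra|].
      assert (0 <= (INR m + 1) ^ 2) by (apply pow_le; lra).
      replace ((INR m + 1) ^ 3) with ((INR m + 1) ^ 2 * (INR m + 1)) by ring. nra.
Qed.

Lemma row_cvg (x z : C) : slit x -> cvg eventually (pprod (fun m => E2 (z / (natS m + x))%C)) (row x z).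
Proof.
  intros Hx. destruct (row_near1 x (Cmod z) Hx (Cmod_ge_0 z)) as (B & HB & H).
  apply (infprod_cvg (B * Cmod z ^ 3)).
  - apply Rmult_le_pos; [exact HB|apply pow_le, Cmod_ge_0].
  - intros n. apply H. lra.
Qed.

Lemma row_bound (x : C) : slit x -> exists K, 0 <= K /\ forall z, Cmod z <= 1 -> Cmod (row x z - 1)%C <= K * Cmod z ^ 3.
Proof.
  intros Hx. destruct (row_near1 x 1 Hx ltac:(lra)) as (B & HB & H).
  exists (2 * B * exp (2 * B)). pose proof (exp_pos (2 * B)).
  split; [apply Rmult_le_pos; lra|]. intros z Hz. pose proof (Cmod_ge_0 z) as Pz.
  assert (P3 : 0 <= Cmod z ^ 3) by (apply pow_le, Pz).
  assert (Q3 : Cmod z ^ 3 <= 1) by (rewrite <- (pow1 3); apply pow_incr; lra).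
  assert (HB' : 0 <= B * Cmod z ^ 3) by (apply Rmult_le_pos; assumption).
  apply Rle_trans with (1 := infprod_bound (B * Cmod z ^ 3) _ HB' (fun n => H z n Hz)).
  replace (2 * B * exp (2 * B) * Cmod z ^ 3) with (2 * (B * Cmod z ^ 3) * exp (2 * B)) by ring.
  apply Rmult_le_compat_l; [lra|]. apply exp_le_mono. nra.
Qed.

Lemma one_sub_E2 (y : C) : (1 - y)%C = (E2 y * Cexp (- (y + y * y / 2)))%C.
Proof.
  unfold E2. transitivity ((1 - y) * (Cexp (y + y * y / 2) * Cexp (- (y + y * y / 2))))%C; [rewrite Cexp_opp|]; ring.
Qed.

Lemma one_sub_e_sn (w : C) : (1 - e w)%C = (- e (w / 2) * sn w)%C.
Proof.
  unfold sn. replace (e w) with (e (w / 2) * e (w / 2))%C by (rewrite <- e_plus; f_equal; field).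
  transitivity (e (w / 2) * e (- (w / 2)) - e (w / 2) * e (w / 2))%C; [rewrite e_opp|]; ring.
Qed.

(** The sine product at x + z is divided by that at x, and the positive and negative integers are
    equipped separately with the exponentials of [E2]. These add up to the convergent sums A and Q;
    the resulting coefficients are only asserted to exist here. *)
Lemma row_factorization (x : C) : Im x <> 0 -> exists al be : C, forall z,
  (1 - e (x + z))%C =
  ((1 - e x) * Cexp (al * z + be * (z * z)) * (E2 (- z / x) * (row x (- z) * row (- x) z)))%C.
Proof.
  intros Hx. destruct (slit_of_Im x Hx) as [S1 S2].
  assert (X0 : x <> RtoC 0) by (apply slit_neq_0, S1).
  destruct (natS_add_lower x S1) as (d1 & D1 & L1). destruct (natS_add_lower (- x)%C S2) as (d2 & D2 & L2).
  assert (N1 : forall m, (natS m + x)%C <> RtoC 0) by (intros; apply natS_add_neq_0, S1).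
  assert (N2 : forall m, (natS m + - x)%C <> RtoC 0) by (intros; apply natS_add_neq_0, S2).
  assert (I1 : forall m, Cmod (/ (natS m + x))%C <= / d1 * / (INR m + 1)).
  { intros m. rewrite Cmod_inv by apply N1. rewrite <- Rinv_mult. apply Rinv_le_contravar; [|apply L1].
    pose proof (pos_INR m). nra. }
  assert (I2 : forall m, Cmod (/ (natS m + - x))%C <= / d2 * / (INR m + 1)).
  { intros m. rewrite Cmod_inv by apply N2. rewrite <- Rinv_mult. apply Rinv_le_contravar; [|apply L2].
    pose proof (pos_INR m). nra. }
  assert (P1 : 0 < / d1) by (apply Rinv_0_lt_compat, D1). assert (P2 : 0 < / d2) by (apply Rinv_0_lt_compat, D2).
  pose proof (Cmod_ge_0 x) as PX.
  (* The linear corrections of the two half rows diverge separately like the harmonic series; their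
     combination is O(1 / m^2). *)
  set (u1 := fun m => (/ (natS m + - x) - / (natS m + x))%C).
  set (u2 := fun m => (/ (natS m + - x) * / (natS m + - x) + / (natS m + x) * / (natS m + x))%C).
  destruct (csum_cvg (2 * Cmod x * (/ d1 * / d2)) u1) as [A HA].
  { apply Rmult_le_pos; [lra|]. apply Rmult_le_pos; lra. }
  { intros m. unfold u1.
    replace (/ (natS m + - x) - / (natS m + x))%C with (RtoC 2 * x * (/ (natS m + x) * / (natS m + - x)))%C
      by (field; repeat split; first [apply N1|apply N2]).
    rewrite !Cmod_mult, Cmod_R, Rabs_pos_eq by lra. rewrite (Rmult_assoc (2 * Cmod x)).
    apply Rmult_le_compat_l; [lra|].
    replace (/ d1 * / d2 * / (INR m + 1) ^ 2) with ((/ d1 * / (INR m + 1)) * (/ d2 * / (INR m + 1)))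
      by (field; pose proof (pos_INR m); lra).
    apply Rmult_le_compat; try apply Cmod_ge_0; [apply I1|apply I2]. }
  destruct (csum_cvg (/ d2 * / d2 + / d1 * / d1) u2) as [Q HQ].
  { apply Rplus_le_le_0_compat; apply Rmult_le_pos; lra. }
  { intros m. unfold u2. apply Rle_trans with (1 := Cmod_triangle _ _). rewrite !Cmod_mult, Rmult_plus_distr_r.
    replace (/ d1 * / d1 * / (INR m + 1) ^ 2) with ((/ d1 * / (INR m + 1)) * (/ d1 * / (INR m + 1)))
      by (field; pose proof (pos_INR m); lra).
    replace (/ d2 * / d2 * / (INR m + 1) ^ 2) with ((/ d2 * / (INR m + 1)) * (/ d2 * / (INR m + 1)))
      by (field; pose proof (pos_INR m); lra).
    apply Rplus_le_compat; apply Rmult_le_compat; try apply Cmod_ge_0; first [apply I1|apply I2]. }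
  destruct sine_product as (K & K0 & HK).
  exists (C2pi / 2 + / x - A)%C, (- / (2 * (x * x)) - Q / 2)%C. intros z.
  assert (SP : sq_prod (x + z)%C =
    (sq_prod x * (row (- x) z * row x (- z)) * Cexp (- (z * A + z * z / 2 * Q)))%C).
  { apply (cvg_unique eventually _ _ _ (sq_prod_cvg (x + z))).
    apply cvg_ext with (fun n => pprod (fun j => 1 - x * x / (natS j * natS j)) n *
      (pprod (fun m => E2 (z / (natS m + - x))) n * pprod (fun m => E2 (- z / (natS m + x))) n) *
      Cexp (- (z * csum u1 n + z * z / 2 * csum u2 n)))%C; [apply eventually_filter| |].
    - intros n.
      replace (- (z * csum u1 n + z * z / 2 * csum u2 n))%C with (- z * csum u1 n + - (z * z / 2) * csum u2 n)%C by ring.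
      rewrite <- !csum_scal, <- csum_add, <- pprod_Cexp, <- !pprod_mult. apply pprod_ext. intros m _.
      pose proof (N1 m) as M1. pose proof (N2 m) as M2. pose proof (natS_neq_0 m) as M0.
      transitivity ((1 - x * x / (natS m * natS m)) * ((1 - z / (natS m + - x)) * (1 - - z / (natS m + x))))%C.
      + rewrite (one_sub_E2 (z / (natS m + - x))%C), (one_sub_E2 (- z / (natS m + x))%C).
        replace (- z * u1 m + - (z * z / 2) * u2 m)%C with
          (- (z / (natS m + - x) + z / (natS m + - x) * (z / (natS m + - x)) / 2)
           + - (- z / (natS m + x) + - z / (natS m + x) * (- z / (natS m + x)) / 2))%C.
        * rewrite Cexp_plus. ring.
        * unfold u1, u2. field. split; assumption.
      + field. repeat split; assumption.
    - apply cvg_mult; [apply eventually_filter| |].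
      + apply cvg_mult; [apply eventually_filter|apply sq_prod_cvg|].
        apply cvg_mult; [apply eventually_filter|apply row_cvg, S2|apply row_cvg, S1].
      + apply cvg_Cexp, cvg_opp; [apply eventually_filter|].
        apply cvg_plus; [apply eventually_filter| |]; (apply cvg_mult;
          [apply eventually_filter|apply cvg_const, eventually_filter|assumption]). }
  rewrite !one_sub_e_sn, !HK, SP.
  replace ((x + z) / 2)%C with (x / 2 + z / 2)%C by field. rewrite e_plus, (e_Cexp (z / 2)%C).
  transitivity (- e (x / 2) * (K * x * sq_prod x) * ((1 - - z / x) * (row x (- z) * row (- x) z)) *
    (Cexp (C2pi * (z / 2)) * Cexp (- (z * A + z * z / 2 * Q))))%C.
  - field. exact X0.
  - rewrite (one_sub_E2 (- z / x)%C).
    transitivity (- e (x / 2) * (K * x * sq_prod x) * (E2 (- z / x) * (row x (- z) * row (- x) z)) *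
      (Cexp (- (- z / x + - z / x * (- z / x) / 2)) * (Cexp (C2pi * (z / 2)) * Cexp (- (z * A + z * z / 2 * Q)))))%C; [ring|].
    rewrite <- !Cexp_plus.
    replace (- (- z / x + - z / x * (- z / x) / 2) + (C2pi * (z / 2) + - (z * A + z * z / 2 * Q)))%C
      with ((C2pi / 2 + / x - A) * z + (- / (2 * (x * x)) - Q / 2) * (z * z))%C by (field; exact X0).
    ring.
Qed.

(** * Identification of the exponents modulo z^3 *)

Definition O3 (f : C -> C) : Prop := exists K d, 0 <= K /\ 0 < d /\ forall z, Cmod z <= d -> Cmod (f z) <= K * Cmod z ^ 3.

Lemma O3_plus (f g : C -> C) : O3 f -> O3 g -> O3 (fun z => f z + g z)%C.
Proof.
  intros (K1 & d1 & P1 & D1 & H1) (K2 & d2 & P2 & D2 & H2). exists (K1 + K2), (Rmin d1 d2).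
  split; [lra|split; [apply Rmin_glb_lt; assumption|]]. pose proof (Rmin_l d1 d2). pose proof (Rmin_r d1 d2).
  intros z Hz. apply Rle_trans with (1 := Cmod_triangle _ _). rewrite Rmult_plus_distr_r.
  apply Rplus_le_compat; [apply H1|apply H2]; lra.
Qed.

Lemma O3_ext (f g : C -> C) : (forall z, f z = g z) -> O3 f -> O3 g.
Proof.
  intros H (K & d & P & D & HK). exists K, d. split; [exact P|split; [exact D|]]. intros z Hz. rewrite <- H. auto.
Qed.

Lemma O3_mult (f g : C -> C) : O3 f -> cdiff g (RtoC 0) -> O3 (fun z => f z * g z)%C.
Proof.
  intros (K & d & P & D & HK) Hg.
  pose proof (cdiff_ccont _ _ Hg 1 Rlt_0_1) as H. apply locally_Cmod in H. destruct H as (d2 & D2 & H).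
  pose proof (Cmod_ge_0 (g (RtoC 0))) as P0.
  exists (K * (Cmod (g (RtoC 0)) + 1)), (Rmin d (d2 / 2)).
  split; [nra|split; [apply Rmin_glb_lt; lra|]]. pose proof (Rmin_l d (d2 / 2)). pose proof (Rmin_r d (d2 / 2)).
  intros z Hz. specialize (HK z ltac:(lra)). specialize (H z).
  replace (z - 0)%C with z in H by ring. specialize (H ltac:(lra)).
  rewrite Cmod_mult. pose proof (Cmod_triangle_inv (g z) (g (RtoC 0))).
  replace (K * (Cmod (g (RtoC 0)) + 1) * Cmod z ^ 3) with (K * Cmod z ^ 3 * (Cmod (g (RtoC 0)) + 1)) by ring.
  apply Rmult_le_compat; try apply Cmod_ge_0; lra.
Qed.

Lemma O3_cube (g : C -> C) : cdiff g (RtoC 0) -> O3 (fun z => z * z * z * g z)%C.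
Proof.
  intros Hg. apply (O3_mult (fun z => z * z * z)%C); [|exact Hg]. exists 1, 1. split; [lra|split; [lra|]].
  intros z _. rewrite !Cmod_mult. right. ring.
Qed.

Lemma O3_Cexp (y : C -> C) (L : R) : 0 <= L -> (forall z, Cmod z <= 1 -> Cmod (y z) <= L * Cmod z) ->
  O3 (fun z => Cexp (y z) - 1 - y z - y z * y z / 2)%C.
Proof.
  intros HL H. exists (8 * L ^ 3 * exp L), 1. pose proof (exp_pos L).
  assert (PL : 0 <= L ^ 3) by (apply pow_le, HL).
  split; [nra|split; [lra|]]. intros z Hz. specialize (H z Hz).
  pose proof (Cmod_ge_0 z) as Pz. pose proof (Cmod_ge_0 (y z)) as Py.
  apply Rle_trans with (1 := Cexp_bound3 _).
  replace (8 * L ^ 3 * exp L * Cmod z ^ 3) with (8 * (L * Cmod z) ^ 3 * exp L) by ring.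
  apply Rmult_le_compat.
  - apply Rmult_le_pos; [lra|apply pow_le, Py].
  - left. apply exp_pos.
  - apply Rmult_le_compat_l; [lra|]. apply pow_incr. lra.
  - apply exp_le_mono. nra.
Qed.

Lemma quadratic_O3 (p q : C) : O3 (fun z => p * z + q * (z * z))%C -> p = RtoC 0 /\ q = RtoC 0.
Proof.
  intros (K & d & P & D & H).
  assert (Hr : forall eps, 0 < eps -> eps < Rmin 1 d -> Cmod (p * RtoC eps + q * (RtoC eps * RtoC eps))%C <= K * eps ^ 3).
  { intros eps He He2. pose proof (Rmin_r 1 d).
    assert (E : Cmod (RtoC eps) = eps) by (rewrite Cmod_R; apply Rabs_pos_eq; lra).
    specialize (H (RtoC eps)). rewrite E in H. apply H. lra. }
  assert (Hd : 0 < Rmin 1 d) by (apply Rmin_glb_lt; lra).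
  pose proof (Cmod_ge_0 q) as Pq.
  assert (E1 : p = RtoC 0).
  { apply is_lim_zero with (K + Cmod q) (Rmin 1 d); [|exact Hd]. intros eps He He2. specialize (Hr eps He He2).
    pose proof (Rmin_l 1 d).
    assert (E : Cmod (RtoC eps) = eps) by (rewrite Cmod_R; apply Rabs_pos_eq; lra).
    apply Rmult_le_reg_r with eps; [exact He|]. rewrite <- E at 1. rewrite <- Cmod_mult.
    replace (p * RtoC eps)%C with ((p * RtoC eps + q * (RtoC eps * RtoC eps)) - q * (RtoC eps * RtoC eps))%C by ring.
    unfold Cminus. apply Rle_trans with (1 := Cmod_triangle _ _). rewrite Cmod_opp, (Cmod_mult q), Cmod_mult, E.
    assert (K * eps ^ 3 <= K * (eps * eps)).
    { apply Rmult_le_compat_l; [exact P|]. simpl. nra. }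
    nra. }
  split; [exact E1|]. subst p.
  apply is_lim_zero with K (Rmin 1 d); [|exact Hd]. intros eps He He2. specialize (Hr eps He He2).
  assert (E : Cmod (RtoC eps) = eps) by (rewrite Cmod_R; apply Rabs_pos_eq; lra).
  replace (0 * RtoC eps + q * (RtoC eps * RtoC eps))%C with (q * (RtoC eps * RtoC eps))%C in Hr by ring.
  rewrite !Cmod_mult, E in Hr. apply Rmult_le_reg_r with (eps * eps); [nra|]. simpl in Hr. nra.
Qed.

(* [C2pi * lam x] is the logarithmic derivative of [1 - e x]; note the derivative of [lam] is [C2pi * (lam - lam^2)]. *)
Definition lam (x : C) : C := (- e x / (1 - e x))%C.

Lemma one_sub_e_neq_0 (x : C) : Im x <> 0 -> (1 - e x)%C <> RtoC 0.
Proof. intros Hx. apply C_sub_neq_0. intros E. apply Hx, e_eq_1_Im. auto. Qed.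

(** The factors [E2] and [row] are 1 + O(z^3), so the exponent in [row_factorization] must be the
    second Taylor polynomial at z = 0 of the logarithm of (1 - e(x + z)) / (1 - e x). *)
Theorem row_product (x z : C) : Im x <> 0 ->
  (1 - e (x + z))%C =
  ((1 - e x) * Cexp (C2pi * lam x * z + C2pi * C2pi * (lam x - lam x * lam x) / 2 * (z * z)) *
    (E2 (- z / x) * (row x (- z) * row (- x) z)))%C.
Proof.
  intros Hx. destruct (row_factorization x Hx) as (al & be & H).
  destruct (slit_of_Im x Hx) as [S1 S2]. pose proof (slit_neq_0 x S1) as X0.
  pose proof (one_sub_e_neq_0 x Hx) as Hn. set (t := lam x) in *.
  set (Rz := fun z => (E2 (- z / x) * (row x (- z) * row (- x) z))%C).
  assert (OE : O3 (fun z => E2 (- z / x) - 1)%C).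
  { pose proof (E2K_pos (/ Cmod x)) as HK. assert (PX : 0 < Cmod x) by (apply Cmod_gt_0, X0).
    pose proof (Rinv_0_lt_compat _ PX) as PI'. specialize (HK ltac:(lra)).
    exists (E2K (/ Cmod x) * (/ Cmod x) ^ 3), 1. split; [apply Rmult_le_pos; [exact HK|apply pow_le; lra]|split; [lra|]].
    intros w Hw. pose proof (Cmod_ge_0 w).
    assert (E : Cmod (- w / x)%C = Cmod w * / Cmod x) by (rewrite Cmod_div, Cmod_opp by exact X0; reflexivity).
    assert (L : Cmod (- w / x)%C <= / Cmod x)
      by (rewrite E; apply Rle_trans with (1 * / Cmod x); [apply Rmult_le_compat_r; lra|lra]).
    apply Rle_trans with (1 := E2_bound (/ Cmod x) _ L).
    rewrite E, Rpow_mult_distr. right. ring. }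
  assert (OR1 : O3 (fun z => row x (- z) - 1)%C).
  { destruct (row_bound x S1) as (K & HK & HB). exists K, 1. split; [exact HK|split; [lra|]].
    intros w Hw. rewrite <- (Cmod_opp w). apply HB. rewrite Cmod_opp. exact Hw. }
  assert (OR2 : O3 (fun z => row (- x) z - 1)%C).
  { destruct (row_bound (- x)%C S2) as (K & HK & HB). exists K, 1. split; [exact HK|split; [lra|]]. exact HB. }
  assert (Obd : forall f g : C -> C, O3 (fun z => f z - 1)%C -> O3 (fun z => g z - 1)%C -> O3 (fun z => f z * g z - 1)%C).
  { intros f g Hf Hg.
    assert (Hfg : O3 (fun z => (f z - 1) * (g z - 1))%C).
    { destruct Hf as (K1 & d1 & P1 & D1 & H1). destruct Hg as (K2 & d2 & P2 & D2 & H2).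
      exists (K1 * K2), (Rmin 1 (Rmin d1 d2)). split; [nra|]. split; [repeat apply Rmin_glb_lt; lra|].
      pose proof (Rmin_l 1 (Rmin d1 d2)). pose proof (Rmin_r 1 (Rmin d1 d2)). pose proof (Rmin_l d1 d2). pose proof (Rmin_r d1 d2).
      intros w Hw. specialize (H1 w ltac:(lra)). specialize (H2 w ltac:(lra)). rewrite Cmod_mult.
      pose proof (Cmod_ge_0 w) as Pw. assert (P3 : 0 <= Cmod w ^ 3) by (apply pow_le, Pw).
      assert (Q3 : Cmod w ^ 3 <= 1) by (rewrite <- (pow1 3); apply pow_incr; lra).
      apply Rle_trans with ((K1 * Cmod w ^ 3) * (K2 * 1)).
      - apply Rmult_le_compat; try apply Cmod_ge_0; [exact H1|]. apply Rle_trans with (1 := H2). apply Rmult_le_compat_l; lra.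
      - right. ring. }
    apply O3_ext with (fun z => (f z - 1) * (g z - 1) + ((f z - 1) + (g z - 1)))%C; [intros; ring|].
    apply O3_plus; [exact Hfg|apply O3_plus; assumption]. }
  assert (OR : O3 (fun z => Rz z - 1)%C) by (apply Obd; [exact OE|apply Obd; assumption]).
  set (y := fun z => (al * z + be * (z * z))%C).
  assert (Dy : forall w, cdiff y w).
  { intros w. unfold y. holo. }
  assert (Oy : O3 (fun z => Cexp (y z) - 1 - y z - y z * y z / 2)%C).
  { apply (O3_Cexp y (Cmod al + Cmod be)).
    - pose proof (Cmod_ge_0 al). pose proof (Cmod_ge_0 be). lra.
    - intros w Hw. unfold y. apply Rle_trans with (1 := Cmod_triangle _ _). rewrite !Cmod_mult.
      rewrite Rmult_plus_distr_r. apply Rplus_le_compat_l, Rmult_le_compat_l; [apply Cmod_ge_0|].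
      pose proof (Cmod_ge_0 w). nra. }
  assert (Oe : O3 (fun z => Cexp (C2pi * z) - 1 - C2pi * z - (C2pi * z) * (C2pi * z) / 2)%C).
  { apply (O3_Cexp (fun z => C2pi * z)%C (Cmod C2pi)); [apply Cmod_ge_0|]. intros w _. rewrite Cmod_mult. lra. }
  assert (Main : forall z, (1 + t * (Cexp (C2pi * z) - 1) - Cexp (y z) * Rz z)%C = RtoC 0).
  { intros w. specialize (H w). fold (Rz w) in H. fold (y w) in H.
    rewrite e_plus in H. rewrite <- e_Cexp. unfold t, lam.
    replace (1 + - e x / (1 - e x) * (e w - 1) - Cexp (y w) * Rz w)%C with
      ((1 - e x * e w - (1 - e x) * Cexp (y w) * Rz w) / (1 - e x))%C by (field; exact Hn).
    rewrite H. field. exact Hn. }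
  (* [Main] is expanded modulo z^3: the quadratic polynomial equals a sum of four terms, each of
     third order. *)
  assert (Quad : O3 (fun z => (C2pi * t - al) * z + (C2pi * C2pi * t / 2 - be - al * al / 2) * (z * z))%C).
  { apply O3_ext with (fun z => (Cexp (C2pi * z) - 1 - C2pi * z - (C2pi * z) * (C2pi * z) / 2) * (- t)
      + ((Cexp (y z) - 1 - y z - y z * y z / 2)
      + ((Rz z - 1) * Cexp (y z)
      + z * z * z * (al * be + be * be * z / 2))))%C.
    - intros w. pose proof (Main w) as M.
      assert (E : (Cexp (y w) * Rz w)%C = (1 + t * (Cexp (C2pi * w) - 1))%C).
      { replace (Cexp (y w) * Rz w)%C with (1 + t * (Cexp (C2pi * w) - 1) - (1 + t * (Cexp (C2pi * w) - 1) - Cexp (y w) * Rz w))%C by ring.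
        rewrite M. ring. }
      replace ((Rz w - 1) * Cexp (y w))%C with (Cexp (y w) * Rz w - Cexp (y w))%C by ring. rewrite E.
      unfold y. field.
    - apply O3_plus; [apply (O3_mult _ (fun _ => - t)%C Oe), cdiff_const|].
      apply O3_plus; [exact Oy|]. apply O3_plus.
      + apply (O3_mult _ (fun z => Cexp (y z)) OR). holo.
      + apply O3_cube. holo. }
  apply quadratic_O3 in Quad. destruct Quad as [Q1 Q2].
  assert (Eal : al = (C2pi * t)%C) by (replace al with (C2pi * t - (C2pi * t - al))%C by ring; rewrite Q1; ring).
  assert (Ebe : be = (C2pi * C2pi * (t - t * t) / 2)%C).
  { replace be with (C2pi * C2pi * t / 2 - al * al / 2 - (C2pi * C2pi * t / 2 - be - al * al / 2))%C by field.
    rewrite Q2, Eal. field. }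
  rewrite H. rewrite Eal, Ebe. reflexivity.
Qed.

(** * The product varpi on the upper half plane *)

Lemma e_natS_bound (k : nat) (t : C) : inH t ->
  Cmod (e (natS k * t))%C <= / (Im t) ^ 2 * / (INR k + 1) ^ 2.
Proof.
  intros Ht. unfold inH in Ht. rewrite Cmod_e. pose proof (pos_INR k) as Pk. pose proof PI2_1 as HP.
  replace (Im (natS k * t)%C) with ((INR k + 1) * Im t) by (unfold natS, Im; simpl; ring).
  set (x := (INR k + 1) * Im t). assert (Hx : 0 < x) by (apply Rmult_lt_0_compat; lra).
  replace (/ (Im t) ^ 2 * / (INR k + 1) ^ 2) with (/ x ^ 2) by (unfold x; field; lra).
  rewrite exp_Ropp. apply Rinv_le_contravar; [apply pow_lt, Hx|].
  (* exp(2 pi x) is the square of exp(pi x) >= x. Exponential decay is weakened to the quadratic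
     decay required by [near1]. *)
  replace (2 * PI * x) with (PI * x + PI * x) by ring. rewrite exp_plus.
  pose proof (exp_ineq1_le (PI * x)) as E.
  assert (x <= exp (PI * x)) by nra. simpl. rewrite Rmult_1_r.
  apply Rmult_le_compat; lra.
Qed.

Lemma varpi_near1 (z t : C) (n : nat) : inH t ->
  near1 (Cmod (e (z - t)%C) * / (Im t) ^ 2) (fun k => 1 - e (z + RtoC (INR k) * t))%C n.
Proof.
  intros Ht k _. replace (1 - e (z + RtoC (INR k) * t) - 1)%C with (- e (z + RtoC (INR k) * t))%C by ring.
  rewrite Cmod_opp.
  replace (z + RtoC (INR k) * t)%C with ((z - t) + natS k * t)%C by (unfold natS; rewrite RtoC_plus; ring).
  rewrite e_plus, Cmod_mult, Rmult_assoc. apply Rmult_le_compat_l; [apply Cmod_ge_0|].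
  apply e_natS_bound, Ht.
Qed.

Lemma varpi_const_pos (z t : C) : inH t -> 0 <= Cmod (e (z - t)%C) * / (Im t) ^ 2.
Proof.
  intros Ht. apply Rmult_le_pos; [apply Cmod_ge_0|]. left. apply Rinv_0_lt_compat, pow_lt, Ht.
Qed.

Lemma varpi_cvg (z t : C) : inH t ->
  cvg eventually (pprod (fun k => 1 - e (z + RtoC (INR k) * t))%C) (varpi z t).
Proof.
  intros Ht. apply (infprod_cvg (Cmod (e (z - t)%C) * / (Im t) ^ 2)).
  - apply varpi_const_pos, Ht.
  - intros n. apply varpi_near1, Ht.
Qed.

Lemma varpi_step (z t : C) : inH t -> varpi z t = ((1 - e z) * varpi (z + t) t)%C.
Proof.
  intros Ht. apply infprod_eq.
  apply cvg_ext_loc with (fun n => (1 - e z) * pprod (fun k => 1 - e (z + t + RtoC (INR k) * t)) (n - 1))%C;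
    [apply eventually_filter| |].
  - exists 1%nat. intros n Hn. destruct n as [|n]; [lia|]. rewrite pprod_S_first.
    replace (S n - 1)%nat with n by lia. f_equal.
    + f_equal. f_equal. simpl. ring.
    + apply pprod_ext. intros k _. f_equal. f_equal. rewrite S_INR, RtoC_plus. ring.
  - apply cvg_mult; [apply eventually_filter|apply cvg_const, eventually_filter|].
    apply cvg_eventually. intros eps He.
    destruct (proj1 (cvg_eventually _ _) (varpi_cvg (z + t) t Ht) eps He) as [N HN].
    exists (S N). intros n Hn. apply HN. lia.
Qed.

Lemma varpi_add_1 (z t : C) : varpi (z + 1)%C t = varpi z t.
Proof.
  apply infprod_ext. intros k. f_equal.
  replace (z + 1 + RtoC (INR k) * t)%C with (z + RtoC (INR k) * t + RtoC (IZR 1))%C by ring.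
  apply e_plus_IZR.
Qed.

Lemma varpi_shift_tau (z t : C) (n : Z) : varpi z (t + RtoC (IZR n))%C = varpi z t.
Proof.
  apply infprod_ext. intros k. f_equal.
  replace (z + RtoC (INR k) * (t + RtoC (IZR n)))%C with (z + RtoC (INR k) * t + RtoC (IZR (Z.of_nat k * n)))%C.
  - apply e_plus_IZR.
  - rewrite mult_IZR, <- INR_IZR_INZ, RtoC_mult. ring.
Qed.

Lemma varpi_neq_0 (z t : C) : inH t -> (forall k : nat, e (z + RtoC (INR k) * t)%C <> RtoC 1) -> varpi z t <> RtoC 0.
Proof.
  intros Ht H. apply (infprod_neq_0 (Cmod (e (z - t)%C) * / (Im t) ^ 2)).
  - apply varpi_const_pos, Ht.
  - intros n. apply varpi_near1, Ht.
  - intros k. apply C_sub_neq_0. intros E. apply (H k). auto.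
Qed.

Definition upper2 (p : C * C) : Prop := inH (snd p).

Lemma inH_open (t0 : C) : inH t0 -> locally t0 inH.
Proof.
  intros Ht. apply locally_Cmod. exists (Im t0). split; [exact Ht|]. intros w Hw.
  pose proof (Im_diff_bound w t0). unfold inH. lra.
Qed.

Lemma upper2_open : open upper2.
Proof. apply (open_snd inH), inH_open. Qed.

Lemma chol_at_e (f : C -> C -> C) (p : C * C) : chol_at f p -> chol_at (fun z t => e (f z t)) p.
Proof. apply chol_at_comp1. eexists. apply cderiv_e. Qed.

Lemma chol_varpi : chol upper2 varpi.
Proof.
  apply (chol_infprod upper2 (fun k z t => 1 - e (z + RtoC (INR k) * t))%C); [apply upper2_open| |].
  - intros k p _. apply chol_at_minus; [apply chol_at_const|]. apply chol_at_e.
    apply chol_at_plus; [apply chol_at_fst|]. apply chol_at_mult; [apply chol_at_const|apply chol_at_snd].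
  - intros [z0 t0] Ht. unfold upper2, inH in Ht. simpl in Ht.
    assert (Hc : chol_at (fun z t => e (z - t))%C (z0, t0)).
    { apply chol_at_e. apply chol_at_minus; [apply chol_at_fst|apply chol_at_snd]. }
    destruct Hc as [Hc _]. specialize (Hc 1 Rlt_0_1). apply locally_Cmod2 in Hc. destruct Hc as (d & Hd & Hc).
    simpl in Hc. simpl. exists (Rmin d (Im t0 / 2)), ((Cmod (e (z0 - t0)%C) + 1) * / (Im t0 / 2) ^ 2).
    pose proof (Cmod_ge_0 (e (z0 - t0)%C)) as P.
    assert (Pt : 0 < (Im t0 / 2) ^ 2) by (apply pow_lt; lra).
    split; [apply Rmin_glb_lt; lra|split; [apply Rmult_le_pos; [lra|left; apply Rinv_0_lt_compat, Pt]|]].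
    pose proof (Rmin_l d (Im t0 / 2)). pose proof (Rmin_r d (Im t0 / 2)).
    intros z t Hz Hth n k Hk. specialize (Hc z t ltac:(lra) ltac:(lra)).
    pose proof (Im_diff_bound t t0) as HI.
    assert (Ht' : inH t) by (unfold inH; lra).
    apply Rle_trans with (1 := varpi_near1 z t (S k) Ht' k (Nat.lt_succ_diag_r k)).
    apply Rmult_le_compat_r; [left; apply Rinv_0_lt_compat, pow_lt; pose proof (pos_INR k); lra|].
    apply Rmult_le_compat; [apply Cmod_ge_0|left; apply Rinv_0_lt_compat, pow_lt, Ht'| |].
    + pose proof (Cmod_triangle_inv (e (z - t)%C) (e (z0 - t0)%C)). lra.
    + apply Rinv_le_contravar; [exact Pt|]. apply pow_incr. lra.
Qed.

Lemma cdiff_varpi (t z : C) : inH t -> cdiff (fun z => varpi z t) z.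
Proof. intros Ht. apply chol_at_fix_snd, chol_varpi, Ht. Qed.

Lemma inH_Im_neq (t : C) : inH t -> Im t <> 0.
Proof. unfold inH. lra. Qed.

Lemma inH_slit (t : C) : inH t -> slit t /\ slit (- t)%C.
Proof. intros H. apply slit_of_Im, inH_Im_neq, H. Qed.

Lemma inH_neq_0 (t : C) : inH t -> t <> RtoC 0.
Proof. intros H. apply slit_neq_0, inH_slit, H. Qed.

Lemma e_neq_1_Im (x : C) : Im x <> 0 -> e x <> RtoC 1.
Proof. intros H E. apply H, e_eq_1_Im, E. Qed.

Lemma e_half_neq : e (/ 2)%C <> RtoC 1.
Proof. rewrite e_half. intros E. apply (f_equal Re) in E. unfold Re in E; simpl in E. lra. Qed.

Lemma varpi_half_neq_0 (t : C) : inH t -> varpi (/ 2)%C t <> RtoC 0.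
Proof.
  intros Ht. apply varpi_neq_0; [exact Ht|]. intros k. destruct k as [|k].
  - replace (/ 2 + RtoC (INR 0) * t)%C with (/ 2)%C by (simpl; ring). apply e_half_neq.
  - apply e_neq_1_Im. replace (Im (/ 2 + RtoC (INR (S k)) * t)%C) with (INR (S k) * Im t).
    + rewrite S_INR. pose proof (pos_INR k). unfold inH in Ht. apply Rgt_not_eq. apply Rmult_lt_0_compat; lra.
    + replace (/ 2)%C with (RtoC (/ 2)) by (rewrite RtoC_inv by lra; reflexivity).
      unfold Im; simpl. ring.
Qed.

Lemma varpi_tau_neq_0 (t : C) : inH t -> varpi t t <> RtoC 0.
Proof.
  intros Ht. apply varpi_neq_0; [exact Ht|]. intros k. apply e_neq_1_Im.
  replace (Im (t + RtoC (INR k) * t)%C) with ((INR k + 1) * Im t) by (unfold Im; simpl; ring).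
  pose proof (pos_INR k). unfold inH in Ht. apply Rgt_not_eq, Rmult_lt_0_compat; lra.
Qed.

Lemma one_sub_e_natS_lower (k : nat) (t : C) : inH t ->
  1 - exp (- (2 * PI * Im t)) <= Cmod (1 - e (natS k * t))%C.
Proof.
  intros Ht. unfold inH in Ht. pose proof (Cmod_triangle_inv 1 (e (natS k * t)%C)) as H.
  rewrite Cmod_1, Cmod_e in H. apply Rle_trans with (2 := H).
  apply Rplus_le_compat_l, Ropp_le_contravar, exp_le_mono.
  replace (Im (natS k * t)%C) with ((INR k + 1) * Im t) by (unfold natS, Im; simpl; ring).
  pose proof PI_RGT_0. pose proof (pos_INR k). apply Ropp_le_contravar.
  apply Rmult_le_compat_l; [lra|]. nra.
Qed.

Lemma exp_neg_lt_1 (x : R) : 0 < x -> exp (- x) < 1.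
Proof. intros H. rewrite <- exp_0. apply exp_increasing. lra. Qed.

Lemma lam_bound (k : nat) (t : C) : inH t ->
  Cmod (lam (natS k * t))%C <= / (1 - exp (- (2 * PI * Im t))) * / (Im t) ^ 2 * / (INR k + 1) ^ 2.
Proof.
  intros Ht. pose proof (one_sub_e_natS_lower k t Ht) as L. unfold inH in Ht.
  assert (P : 0 < 1 - exp (- (2 * PI * Im t))).
  { pose proof (exp_neg_lt_1 (2 * PI * Im t)). pose proof PI_RGT_0. nra. }
  unfold lam. rewrite Cmod_div, Cmod_opp by (apply Cmod_gt_0; lra).
  unfold Rdiv. rewrite Rmult_comm, Rmult_assoc.
  apply Rmult_le_compat; [left; apply Rinv_0_lt_compat; lra|apply Cmod_ge_0| |apply e_natS_bound, Ht].
  apply Rinv_le_contravar; lra.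
Qed.

(** The coefficients of z and z^2 in the exponent of [row_product] at x = (k + 1) t; [lin] and
    [quad] are their sums over k. *)
Definition lin_term (k : nat) (t : C) : C := (C2pi * lam (natS k * t))%C.
Definition quad_term (k : nat) (t : C) : C := (C2pi * C2pi * (lam (natS k * t) - lam (natS k * t) * lam (natS k * t)) / 2)%C.
Definition lin (t : C) : C := clim (csum (fun k => lin_term k t)).
Definition quad (t : C) : C := clim (csum (fun k => quad_term k t)).

Lemma lam_const_pos (t : C) : inH t -> 0 < / (1 - exp (- (2 * PI * Im t))) * / (Im t) ^ 2.
Proof.
  intros Ht. unfold inH in Ht.
  assert (P : 0 < 1 - exp (- (2 * PI * Im t))).
  { pose proof (exp_neg_lt_1 (2 * PI * Im t)). pose proof PI_RGT_0. nra. }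
  apply Rmult_lt_0_compat; apply Rinv_0_lt_compat; [exact P|apply pow_lt, Ht].
Qed.

Lemma lin_cvg (t : C) : inH t -> cvg eventually (csum (fun k => lin_term k t)) (lin t).
Proof.
  intros Ht. pose proof (lam_const_pos t Ht) as P. pose proof (Cmod_ge_0 C2pi) as P2.
  set (B := / (1 - exp (- (2 * PI * Im t))) * / (Im t) ^ 2) in *.
  destruct (csum_cvg (Cmod C2pi * B) (fun k => lin_term k t)) as [l Hl].
  - nra.
  - intros k. unfold lin_term. rewrite Cmod_mult, Rmult_assoc. apply Rmult_le_compat_l; [exact P2|].
    apply lam_bound, Ht.
  - unfold lin. rewrite (clim_eq _ _ Hl). exact Hl.
Qed.

Lemma quad_cvg (t : C) : inH t -> cvg eventually (csum (fun k => quad_term k t)) (quad t).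
Proof.
  intros Ht. pose proof (lam_const_pos t Ht) as P. pose proof (Cmod_ge_0 C2pi) as P2.
  set (B := / (1 - exp (- (2 * PI * Im t))) * / (Im t) ^ 2) in *.
  destruct (csum_cvg (Cmod C2pi * Cmod C2pi * (1 + B) * B) (fun k => quad_term k t)) as [l Hl].
  - apply Rmult_le_pos; [apply Rmult_le_pos; [nra|lra]|lra].
  - intros k. unfold quad_term. pose proof (lam_bound k t Ht) as L. fold B in L.
    set (x := lam (natS k * t)%C) in *. pose proof (Cmod_ge_0 x) as Px.
    assert (C2 : Cmod (RtoC 2) = 2) by (rewrite Cmod_R; apply Rabs_pos_eq; lra).
    assert (Q : / (INR k + 1) ^ 2 <= 1).
    { rewrite <- Rinv_1. apply Rinv_le_contravar; [lra|]. pose proof (pos_INR k). simpl. nra. }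
    assert (Q0 : 0 < / (INR k + 1) ^ 2) by (apply Rinv_0_lt_compat, pow_lt; pose proof (pos_INR k); lra).
    assert (L1 : Cmod x <= B).
    { apply Rle_trans with (1 := L). rewrite <- (Rmult_1_r B) at 2. apply Rmult_le_compat_l; lra. }
    rewrite Cmod_div, C2 by (apply RtoC_neq_0; lra). rewrite !Cmod_mult.
    assert (L2 : Cmod (x - x * x)%C <= (1 + B) * (B * / (INR k + 1) ^ 2)).
    { replace (x - x * x)%C with ((1 - x) * x)%C by ring. rewrite Cmod_mult.
      apply Rmult_le_compat; try apply Cmod_ge_0; [|exact L].
      unfold Cminus. apply Rle_trans with (1 := Cmod_triangle _ _). rewrite Cmod_opp, Cmod_1. lra. }
    apply Rle_trans with (Cmod C2pi * Cmod C2pi * ((1 + B) * (B * / (INR k + 1) ^ 2)) / 2).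
    + apply Rmult_le_compat_r; [lra|]. apply Rmult_le_compat_l; [nra|exact L2].
    + assert (0 <= Cmod C2pi * Cmod C2pi * ((1 + B) * (B * / (INR k + 1) ^ 2)))
        by (apply Rmult_le_pos; [nra|apply Rmult_le_pos; [lra|apply Rmult_le_pos; lra]]).
      replace (Cmod C2pi * Cmod C2pi * (1 + B) * B * / (INR k + 1) ^ 2)
        with (Cmod C2pi * Cmod C2pi * ((1 + B) * (B * / (INR k + 1) ^ 2))) by ring. lra.
  - unfold quad. rewrite (clim_eq _ _ Hl). exact Hl.
Qed.

(** Needed because [q1_value] differentiates the linear exponent; the quadratic one receives an
    explicit formula in [quadratic_exponent]. *)
Lemma cdiff_lin (t0 : C) : inH t0 -> cdiff lin t0.
Proof.
  intros Ht. unfold inH in Ht.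
  set (y := Im t0 / 2). assert (Hy : 0 < y) by (unfold y; lra).
  set (B := / (1 - exp (- (2 * PI * y))) * / y ^ 2).
  assert (PP : 0 < 1 - exp (- (2 * PI * y))).
  { pose proof (exp_neg_lt_1 (2 * PI * y)). pose proof PI_RGT_0. nra. }
  assert (HB : 0 < B) by (apply Rmult_lt_0_compat; apply Rinv_0_lt_compat; [exact PP|apply pow_lt, Hy]).
  assert (Hnear : forall w, Cmod (w - t0)%C <= 2 * (y / 2) -> y <= Im w /\ inH w).
  { intros w Hw. pose proof (Im_diff_bound w t0). unfold inH, y in *. lra. }
  apply (weierstrass (fun n t => csum (fun k => lin_term k t) n) lin t0 (y / 2)); [lra| |].
  - intros n w Hw. destruct (Hnear w Hw) as [_ Hw']. induction n as [|n IH]; simpl; [apply cdiff_const|].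
    apply (cdiff_plus (fun t => csum (fun k => lin_term k t) n) (fun t => lin_term n t)); [exact IH|].
    unfold lin_term, lam.
    assert (He : cdiff (fun t => e (natS n * t)%C) w).
    { apply (cdiff_comp e (fun t => natS n * t)%C); [eexists; apply cderiv_e|].
      apply (cdiff_mult (fun _ => natS n) (fun t => t)); [apply cdiff_const|apply cdiff_id]. }
    apply (cdiff_mult (fun _ => C2pi) (fun t => - e (natS n * t) / (1 - e (natS n * t)))%C); [apply cdiff_const|].
    apply (cdiff_div (fun t => - e (natS n * t))%C (fun t => 1 - e (natS n * t))%C).
    + apply one_sub_e_neq_0. replace (Im (natS n * w)%C) with ((INR n + 1) * Im w) by (unfold natS, Im; simpl; ring).
      unfold inH in Hw'. pose proof (pos_INR n). apply Rgt_not_eq, Rmult_lt_0_compat; lra.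
    + apply cdiff_opp, He.
    + apply (cdiff_minus (fun _ => RtoC 1)); [apply cdiff_const|exact He].
  - intros eps He. pose proof (Cmod_ge_0 C2pi) as P2.
    assert (HC : 0 <= 2 * (Cmod C2pi * B)) by nra.
    destruct (inv_INR_small (2 * (Cmod C2pi * B)) eps HC He) as [N HN].
    exists N. intros n w Hn Hw. destruct (Hnear w Hw) as [Hw1 Hw2].
    rewrite Cmod_sub_comm.
    apply (cvg_Cmod_le eventually (fun m => csum (fun k => lin_term k w) m - csum (fun k => lin_term k w) n)%C).
    + apply cvg_minus; [apply eventually_filter|apply lin_cvg, Hw2|apply cvg_const, eventually_filter].
    + exists n. intros m Hm.
      apply Rle_trans with (2 * (Cmod C2pi * B) / (INR n + 1)); [|left; apply HN, Hn].
      apply csum_rate; [nra| |exact Hm]. intros k. unfold lin_term. rewrite Cmod_mult, Rmult_assoc.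
      apply Rmult_le_compat_l; [exact P2|]. apply Rle_trans with (1 := lam_bound k w Hw2).
      apply Rmult_le_compat_r; [left; apply Rinv_0_lt_compat, pow_lt; pose proof (pos_INR k); lra|].
      unfold B. pose proof PI_RGT_0.
      assert (X1 : exp (- (2 * PI * Im w)) <= exp (- (2 * PI * y))).
      { apply exp_le_mono, Ropp_le_contravar, Rmult_le_compat_l; lra. }
      apply Rmult_le_compat.
      * left; apply Rinv_0_lt_compat. lra.
      * left; apply Rinv_0_lt_compat, pow_lt. lra.
      * apply Rinv_le_contravar; lra.
      * apply Rinv_le_contravar; [apply pow_lt, Hy|apply pow_incr; lra].
Qed.

Lemma Ffun_cvg (z t : C) : slit t -> cvg eventually (pprod (fun n => row (natS n * t)%C z)) (Ffun z t).
Proof.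
  intros Ht. destruct (Ffun_dominated z t Ht) as (B & HB & HD).
  apply (infprod_cvg (rowB B)); [apply rowB_pos, HB|]. intros N n _.
  apply (dominated_row_inf B (fun m n => E2 (z / lat m n t)%C)); assumption.
Qed.

(** [row_product] is applied at x = (k + 1) t for every k. The factors with m = 0 multiply to [bfun]
    and the two halves of the rows to the two [Ffun], while the row n = 0 stays as [1 - e z]. *)
Theorem varpi_factorization (z t : C) : inH t ->
  varpi z t = ((1 - e z) * varpi t t * Cexp (lin t * z + quad t * (z * z)) *
    (bfun (- z / t) * (Ffun (- z) t * Ffun z (- t))))%C.
Proof.
  intros Ht. destruct (inH_slit t Ht) as [S1 S2]. pose proof (inH_neq_0 t Ht) as T0.
  rewrite (varpi_step z t Ht).
  assert (E : varpi (z + t)%C t = (varpi t t * Cexp (lin t * z + quad t * (z * z)) *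
    (bfun (- z / t) * (Ffun (- z) t * Ffun z (- t))))%C).
  { apply (cvg_unique eventually _ _ _ (varpi_cvg (z + t)%C t Ht)).
    apply cvg_ext with (fun n => pprod (fun k => 1 - e (t + RtoC (INR k) * t)) n *
      Cexp (csum (fun k => lin_term k t) n * z + csum (fun k => quad_term k t) n * (z * z)) *
      (pprod (fun k => E2 (- z / t / natS k)) n *
       (pprod (fun k => row (natS k * t) (- z)) n * pprod (fun k => row (natS k * - t) z) n)))%C;
      [apply eventually_filter| |].
    - intros n.
      replace (csum (fun k => lin_term k t) n * z + csum (fun k => quad_term k t) n * (z * z))%C
        with (z * csum (fun k => lin_term k t) n + z * z * csum (fun k => quad_term k t) n)%C by ring.
      rewrite <- !csum_scal, <- csum_add, <- pprod_Cexp, <- !pprod_mult. apply pprod_ext. intros k _.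
      pose proof (natS_neq_0 k) as Hk.
      replace (z + t + RtoC (INR k) * t)%C with (natS k * t + z)%C by (unfold natS; rewrite RtoC_plus; ring).
      replace (t + RtoC (INR k) * t)%C with (natS k * t)%C by (unfold natS; rewrite RtoC_plus; ring).
      rewrite (row_product (natS k * t)%C z).
      + unfold lin_term, quad_term. replace (- (natS k * t))%C with (natS k * - t)%C by ring.
        replace (- z / (natS k * t))%C with (- z / t / natS k)%C by (field; split; assumption).
        replace (C2pi * lam (natS k * t) * z)%C with (z * (C2pi * lam (natS k * t)))%C by ring.
        rewrite (Cmult_comm (C2pi * C2pi * (lam (natS k * t) - lam (natS k * t) * lam (natS k * t)) / 2) (z * z))%C.
        ring.
      + replace (Im (natS k * t)%C) with ((INR k + 1) * Im t) by (unfold natS, Im; simpl; ring).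
        unfold inH in Ht. pose proof (pos_INR k). apply Rgt_not_eq, Rmult_lt_0_compat; lra.
    - apply cvg_mult; [apply eventually_filter| |].
      + apply cvg_mult; [apply eventually_filter|apply varpi_cvg, Ht|].
        apply cvg_Cexp. apply cvg_plus; [apply eventually_filter| |];
          (apply cvg_mult; [apply eventually_filter|first [apply lin_cvg|apply quad_cvg]; exact Ht|apply cvg_const, eventually_filter]).
      + apply cvg_mult; [apply eventually_filter| |].
        * apply (infprod_cvg (E2K (Cmod (- z / t)%C) * Cmod (- z / t)%C ^ 3)).
          -- apply bfun_const_pos, Cmod_ge_0.
          -- intros n. apply bfun_near1. lra.
        * apply cvg_mult; [apply eventually_filter|apply Ffun_cvg, S1|apply Ffun_cvg, S2]. }
  rewrite E. ring.
Qed.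

(** * The inversion [tau -> - 1 / tau] *)

(** The principal square root by the half-angle formulas, with positive real part on the slit
    plane. *)
Definition csqrt (t : C) : C :=
  (sqrt ((Cmod t + Re t) / 2), Im t / (2 * sqrt ((Cmod t + Re t) / 2))).

Lemma slit_Cmod_Re (t : C) : slit t -> 0 < Cmod t + Re t.
Proof.
  intros Ht. apply Rnot_le_lt. intros L. apply Ht.
  pose proof (Cmod2_alt t) as E. pose proof (Cmod_ge_0 t) as P.
  assert (E1 : Im t ^ 2 <= 0) by nra.
  assert (E2 : Im t = 0) by nra. split; [exact E2|lra].
Qed.

Lemma csqrt_Re_pos (t : C) : slit t -> 0 < Re (csqrt t).
Proof. intros Ht. apply sqrt_lt_R0. pose proof (slit_Cmod_Re t Ht). lra. Qed.

Lemma csqrt_sq (t : C) : slit t -> (csqrt t * csqrt t)%C = t.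
Proof.
  intros Ht. pose proof (slit_Cmod_Re t Ht) as P. pose proof (csqrt_Re_pos t Ht) as Pa.
  unfold csqrt. set (a := sqrt ((Cmod t + Re t) / 2)) in *.
  change (0 < a) in Pa.
  assert (Ha : a * a = (Cmod t + Re t) / 2) by (apply sqrt_sqrt; lra).
  pose proof (Cmod2_alt t) as E. clear Ht.
  clearbody a. set (c := Cmod t) in *. clearbody c.
  apply C_eq; unfold Re, Im in *; simpl in *.
  - replace (snd t / (2 * a) * (snd t / (2 * a))) with (snd t * snd t / (4 * (a * a))) by (field; lra).
    rewrite Ha.
    replace (snd t * snd t) with ((c - fst t) * (c + fst t)) by nra.
    field. lra.
  - field. lra.
Qed.

Lemma csqrt_neq_0 (t : C) : slit t -> csqrt t <> RtoC 0.
Proof. intros Ht E. pose proof (csqrt_Re_pos t Ht) as P. rewrite E in P. simpl in P. lra. Qed.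

(** w - t is the product of the difference and the sum of the two roots, and the sum has real part
    at least that of the root of t. *)
Lemma cdiff_csqrt (t : C) : slit t -> cdiff csqrt t.
Proof.
  intros Ht. exists (/ (2 * csqrt t))%C. apply cderiv_eps. intros eps He.
  pose proof (csqrt_Re_pos t Ht) as P. pose proof (csqrt_neq_0 t Ht) as N0.
  set (a := Re (csqrt t)) in *. assert (Pm : 0 < Cmod (csqrt t)) by (apply Cmod_gt_0, N0).
  pose proof (slit_open t Ht) as Ho. apply locally_Cmod in Ho. destruct Ho as (d & Hd & Ho).
  set (M := a * a * (2 * Cmod (csqrt t))). assert (PM : 0 < M) by (unfold M; apply Rmult_lt_0_compat; nra).
  apply locally_Cmod. exists (Rmin d (eps * M)). split; [apply Rmin_glb_lt; [exact Hd|nra]|].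
  intros w Hw. pose proof (Rmin_l d (eps * M)). pose proof (Rmin_r d (eps * M)).
  assert (Sw : slit w) by (apply Ho; lra).
  pose proof (csqrt_Re_pos w Sw) as Pw.
  assert (E : (w - t)%C = ((csqrt w - csqrt t) * (csqrt w + csqrt t))%C).
  { rewrite <- (csqrt_sq w Sw) at 1. rewrite <- (csqrt_sq t Ht) at 1. ring. }
  assert (L : a * Cmod (csqrt w - csqrt t)%C <= Cmod (w - t)%C).
  { rewrite E, Cmod_mult, Rmult_comm. apply Rmult_le_compat_l; [apply Cmod_ge_0|].
    apply Rle_trans with (2 := re_le_Cmod _). change (Re (csqrt w + csqrt t)%C) with (Re (csqrt w) + a).
    rewrite Rabs_pos_eq; lra. }
  replace (csqrt w - csqrt t - / (2 * csqrt t) * (w - t))%C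
    with (- ((csqrt w - csqrt t) * (csqrt w - csqrt t) / (2 * csqrt t)))%C by (rewrite E; field; exact N0).
  assert (N2 : (2 * csqrt t)%C <> RtoC 0) by (apply Cmult_neq_0; [apply RtoC_neq_0; lra|exact N0]).
  rewrite Cmod_opp, Cmod_div, !Cmod_mult by exact N2. rewrite Cmod_R, Rabs_pos_eq by lra.
  set (x := Cmod (csqrt w - csqrt t)%C) in *. set (y := Cmod (w - t)%C) in *.
  assert (Px : 0 <= x) by apply Cmod_ge_0. assert (Py : 0 <= y) by apply Cmod_ge_0.
  apply Rmult_le_reg_r with M; [exact PM|].
  replace (x * x / (2 * Cmod (csqrt t)) * M) with ((a * x) * (a * x)) by (unfold M; field; lra).
  apply Rle_trans with (y * y); [apply Rmult_le_compat; nra|]. nra.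
Qed.

Lemma sn_bfun : exists K beta : C, K <> RtoC 0 /\
  forall z, sn z = (K * z * (Cexp (beta * (z * z)) * (bfun z * bfun (- z))))%C.
Proof.
  destruct sine_product as (K & HK & H). destruct sq_prod_bfun as (beta & Hb).
  exists K, beta. split; [exact HK|]. intros z. rewrite H, Hb. reflexivity.
Qed.

Lemma inH_neg_inv (t : C) : inH t -> inH (- / t)%C.
Proof.
  intros Ht. pose proof (inH_neq_0 t Ht) as T0. unfold inH in *.
  destruct t as [u v]. unfold Im, Cinv in *; simpl in *.
  assert (P : 0 < u * (u * 1) + v * (v * 1)) by nra.
  replace (- (- v / (u * (u * 1) + v * (v * 1)))) with (v / (u * (u * 1) + v * (v * 1))) by (field; lra).
  apply Rdiv_lt_0_compat; assumption.
Qed.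

Lemma cdiff_lin_neg_inv (t : C) : inH t -> cdiff (fun t => lin (- / t)%C) t.
Proof.
  intros Ht. pose proof (inH_neq_0 t Ht). pose proof (cdiff_lin _ (inH_neg_inv t Ht)). holo.
Qed.

Lemma cdiff_sn (w : C) : cdiff sn w.
Proof. unfold sn. holo. Qed.

#[export] Hint Resolve cdiff_sn cdiff_bfun cdiff_varpi : holo.

Lemma sn_opp (z : C) : sn (- z)%C = (- sn z)%C.
Proof.
  unfold sn. replace (- z / 2)%C with (- (z / 2))%C by field.
  replace (- - (z / 2))%C with (z / 2)%C by field. ring.
Qed.

Lemma sn_add_1 (z : C) : sn (z + 1)%C = (- sn z)%C.
Proof.
  unfold sn. replace ((z + 1) / 2)%C with (z / 2 + / 2)%C by field.
  replace (- (z / 2 + / 2))%C with (- (z / 2) + / 2 - 1)%C by field.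
  unfold Cminus. rewrite !e_plus, e_half. rewrite (e_opp_inv (RtoC 1)), (e_IZR 1). field.
Qed.

Lemma sn_half_neq_0 : sn (/ 2)%C <> RtoC 0.
Proof.
  replace (/ 2)%C with (RtoC (/ 2)) by (rewrite RtoC_inv by lra; reflexivity). apply sn_neq_0. lra.
Qed.

Lemma bfun_half_neq_0 : bfun (/ 2)%C <> RtoC 0 /\ bfun (- / 2)%C <> RtoC 0.
Proof.
  assert (E : (/ 2)%C = RtoC (/ 2)) by (rewrite RtoC_inv by lra; reflexivity).
  rewrite E, <- RtoC_opp.
  split; apply bfun_neq_0; intros k H; apply (f_equal Re) in H; unfold natS, Re in H; simpl in H;
    pose proof (pos_INR k); lra.
Qed.

Lemma Ffun_half_neq_0 (t : C) : slit t -> Ffun (/ 2)%C t <> RtoC 0 /\ Ffun (- / 2)%C t <> RtoC 0.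
Proof.
  intros Ht. assert (E : (/ 2)%C = RtoC (/ 2)) by (rewrite RtoC_inv by lra; reflexivity).
  rewrite E, <- RtoC_opp.
  assert (K : forall s, -1 < s < 1 -> forall m n, RtoC s <> lat m n t).
  { intros s Hs m n H. apply Ht. unfold lat, natS in H.
    pose proof (pos_INR m) as Pm. pose proof (pos_INR n) as Pn.
    pose proof (f_equal Re H) as H1. pose proof (f_equal Im H) as H2. unfold Re, Im in *; simpl in *.
    split; nra. }
  split; apply Ffun_neq_0; try exact Ht; apply K; lra.
Qed.

Lemma Ffun_half_tau_neq_0 (t : C) : slit t -> Ffun (t / 2)%C t <> RtoC 0 /\ Ffun (- (t / 2))%C t <> RtoC 0.
Proof.
  intros Ht. pose proof (slit_neq_0 t Ht) as T0.
  destruct (Ffun_half_neq_0 (/ t)%C (slit_inv t Ht)) as [H1 H2]. split.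
  - rewrite <- (Ffun_inv (t / 2)%C t Ht). replace (t / 2 / t)%C with (/ 2)%C by (field; exact T0). exact H1.
  - rewrite <- (Ffun_inv (- (t / 2))%C t Ht). replace (- (t / 2) / t)%C with (- / 2)%C by (field; exact T0). exact H2.
Qed.

Lemma bfun_neg_ray (s : R) (t : C) : 0 < s -> slit t -> bfun (- (RtoC s * t))%C <> RtoC 0.
Proof.
  intros Hs Ht. apply bfun_neq_0. intros k H. apply Ht. unfold natS in H.
  pose proof (pos_INR k). pose proof (f_equal Re H) as H1. pose proof (f_equal Im H) as H2.
  unfold Re, Im in *; simpl in *. split; nra.
Qed.

Lemma cdiff_Ffun_z (t z : C) : slit t -> cdiff (fun z => Ffun z t) z.
Proof. intros Ht. apply chol_at_fix_snd, chol_Ffun, Ht. Qed.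

#[export] Hint Resolve cdiff_Ffun_z : holo.

Lemma Ffun_0 (t : C) : Ffun (RtoC 0) t = RtoC 1.
Proof.
  assert (E : forall n, infprod (fun m => E2 (RtoC 0 / lat m n t)%C) = RtoC 1).
  { intros n. apply infprod_eq. apply cvg_ext with (fun _ => RtoC 1); [apply eventually_filter| |apply cvg_const, eventually_filter].
    intros N. rewrite <- (pprod_one N). apply pprod_ext. intros m _.
    unfold Cdiv. rewrite Cmult_0_l. symmetry. apply E2_0. }
  apply infprod_eq. apply cvg_ext with (fun _ => RtoC 1); [apply eventually_filter| |apply cvg_const, eventually_filter].
  intros N. rewrite <- (pprod_one N). apply pprod_ext. intros n _. symmetry. apply E.
Qed.

(** * The inversion on the upper half plane *)

Section InversionOnH.
Variables (K beta : C).
Hypothesis K0 : K <> RtoC 0.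
Hypothesis Hsn : forall z, sn z = (K * z * (Cexp (beta * (z * z)) * (bfun z * bfun (- z))))%C.

Lemma one_sub_e_bfun (w : C) :
  (1 - e w)%C = (- (K * w * (Cexp (C2pi * (w / 2)) * Cexp (beta * (w * w)) * (bfun w * bfun (- w)))))%C.
Proof. rewrite one_sub_e_sn, Hsn, e_Cexp. ring. Qed.

(* [lin] and [quad] are the exponents in [varpi_factorization]; [q1H] and [q2H] collect those of the quotient
   [varpi (z / t) (- / t) / varpi z t] together with the exponents of the two factors [sn]. *)
Definition q1H (t : C) : C := (C2pi / (2 * t) + lin (- / t) / t - C2pi / 2 - lin t)%C.
Definition q2H (t : C) : C := (beta / (t * t) + quad (- / t) / (t * t) - beta - quad t)%C.
Definition u0 (t : C) : C := (varpi (- / t) (- / t) / (t * varpi t t))%C.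

(** Both values of [varpi] are factored. By [Ffun_inv] the factor [Ffun z (- t)], which cannot be
    continued across the positive reals, appears on both sides; the other factors make sense on the
    slit plane. *)
Lemma inversion_relation (t z : C) : inH t ->
  (varpi (z / t) (- / t) * (bfun (- z) * Ffun (- z) t))%C =
  (u0 t * (Cexp (q1H t * z + q2H t * (z * z)) * bfun (z / t) * Ffun z t) * varpi z t)%C.
Proof.
  intros Ht. pose proof (inH_neq_0 t Ht) as T0. pose proof (varpi_tau_neq_0 t Ht) as V0.
  destruct (inH_slit t Ht) as [S1 S2].
  rewrite (varpi_factorization z t Ht), (varpi_factorization (z / t)%C (- / t)%C (inH_neg_inv t Ht)).
  replace (- (z / t) / - / t)%C with z by (field; exact T0).
  assert (F1 : Ffun (z / t) (- (- / t)) = Ffun z t).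
  { replace (- (- / t))%C with (/ t)%C by ring. apply Ffun_inv, S1. }
  assert (F2 : Ffun (- (z / t)) (- / t) = Ffun z (- t)).
  { rewrite <- (Ffun_inv z (- t)%C S2). f_equal; field; exact T0. }
  rewrite F1, F2.
  rewrite (one_sub_e_bfun z), (one_sub_e_bfun (z / t)%C). unfold u0.
  set (P' := varpi (- / t) (- / t)). set (P := varpi t t) in *.
  transitivity (- (P' * K * (z / t)) * (bfun (z / t) * bfun (- (z / t)) * bfun z * bfun (- z) * (Ffun z t * Ffun z (- t) * Ffun (- z) t)) *
    (Cexp (C2pi * (z / t / 2)) * Cexp (beta * (z / t * (z / t))) * Cexp (lin (- / t) * (z / t) + quad (- / t) * (z / t * (z / t)))))%C.
  { replace (- (z / t))%C with (z / - t)%C by (field; exact T0). ring. }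
  rewrite <- !Cexp_plus.
  replace (C2pi * (z / t / 2) + beta * (z / t * (z / t)) + (lin (- / t) * (z / t) + quad (- / t) * (z / t * (z / t))))%C
    with ((q1H t * z + q2H t * (z * z)) + (C2pi * (z / 2) + beta * (z * z) + (lin t * z + quad t * (z * z))))%C
    by (unfold q1H, q2H; field; exact T0).
  rewrite !Cexp_plus. replace (- (z / t))%C with (- z / t)%C by (field; exact T0).
  field. split; assumption.
Qed.

Lemma u0_neq_0 (t : C) : inH t -> u0 t <> RtoC 0.
Proof.
  intros Ht. unfold u0. pose proof (varpi_tau_neq_0 _ (inH_neg_inv t Ht)) as H1.
  pose proof (varpi_tau_neq_0 t Ht) as H2. pose proof (inH_neq_0 t Ht) as H3.
  intros E. apply H1. replace (varpi (- / t) (- / t)) with (varpi (- / t) (- / t) / (t * varpi t t) * (t * varpi t t))%C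
    by (field; split; assumption). rewrite E. ring.
Qed.

(** Multiplying the relation at z by that at - z removes the odd exponent [q1H], and the factors
    [Ffun] cancel. Up to a factor free of z, varpi(z) varpi(- z) / sn z is a Jacobi theta function,
    and this is its inversion formula with the Gaussian exponent still unknown. *)
Lemma theta_relation (t z : C) : inH t ->
  (varpi (z / t) (- / t) * varpi (- (z / t)) (- / t) * sn z)%C =
  (u0 t * u0 t * t * Cexp ((2 * q2H t + beta - beta / (t * t)) * (z * z)) * sn (z / t) * (varpi z t * varpi (- z) t))%C.
Proof.
  intros Ht. pose proof (inH_neq_0 t Ht) as T0. destruct (inH_slit t Ht) as [S1 S2].
  assert (DF : dense_neq0 (fun z => Ffun z t)).
  { apply entire_dense_neq0 with (RtoC 0); [intros; apply cdiff_Ffun_z, S1|]. rewrite Ffun_0. apply C1_nz. }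
  assert (DF' : dense_neq0 (fun z => Ffun (- z) t)).
  { apply entire_dense_neq0 with (RtoC 0).
    - intros w. holo.
    - replace (- (0))%C with (RtoC 0) by ring. rewrite Ffun_0. apply C1_nz. }
  pose proof (inH_neg_inv t Ht) as Ht'.
  apply (dense_eq (fun z => Ffun z t * Ffun (- z) t)%C
    (fun z => varpi (z / t) (- / t) * varpi (- (z / t)) (- / t) * sn z)%C
    (fun z => u0 t * u0 t * t * Cexp ((2 * q2H t + beta - beta / (t * t)) * (z * z)) * sn (z / t) * (varpi z t * varpi (- z) t))%C).
  - apply dense_neq0_mult; [|exact DF|exact DF']. intros w. cont.
  - cont.
  - cont.
  - apply filter_forall. clear z. match goal with |- forall x, @?P x => change (forall x : C, P x) end.
    cbv beta. intros z.
    pose proof (inversion_relation t z Ht) as R1. pose proof (inversion_relation t (- z)%C Ht) as R2.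
    replace (- - z)%C with z in R2 by ring. replace (- z / t)%C with (- (z / t))%C in R2 by (field; exact T0).
    rewrite (Hsn z), (Hsn (z / t)%C).
    transitivity (K * z * Cexp (beta * (z * z)) *
      ((varpi (z / t) (- / t) * (bfun (- z) * Ffun (- z) t)) * (varpi (- (z / t)) (- / t) * (bfun z * Ffun z t))))%C; [ring|].
    rewrite R1, R2.
    transitivity (u0 t * u0 t * (K * z) * (Ffun z t * Ffun (- z) t) * (bfun (z / t) * bfun (- (z / t))) * (varpi z t * varpi (- z) t) *
      (Cexp (beta * (z * z)) * (Cexp (q1H t * z + q2H t * (z * z)) * Cexp (q1H t * - z + q2H t * (- z * - z)))))%C; [ring|].
    transitivity (u0 t * u0 t * (K * z) * (Ffun z t * Ffun (- z) t) * (bfun (z / t) * bfun (- (z / t))) * (varpi z t * varpi (- z) t) *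
      (Cexp ((2 * q2H t + beta - beta / (t * t)) * (z * z)) * Cexp (beta * (z / t * (z / t)))))%C.
    + f_equal. rewrite <- !Cexp_plus. f_equal. field. exact T0.
    + field. exact T0.
Qed.

Lemma Cexp_affine_const (a b : C) : (forall z, Cexp (a * z + b) = RtoC 1) -> a = RtoC 0.
Proof.
  intros H. destruct (Ceq_dec a (RtoC 0)) as [E|E]; [exact E|exfalso].
  pose proof (H (RtoC 0)) as H0. pose proof (H (/ a)%C) as H1.
  replace (a * 0 + b)%C with b in H0 by ring.
  rewrite Cexp_plus, H0 in H1. replace (a * / a)%C with (RtoC 1) in H1 by (field; exact E).
  rewrite Cmult_1_r in H1. pose proof (Cmod_Cexp (RtoC 1)) as M. rewrite H1, Cmod_1 in M.
  simpl in M. pose proof (exp_ineq1_le 1). lra.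
Qed.

(** Replacing z by z + t shifts [z / t] by 1, a period of the left side of [theta_relation] up to
    [sn], so the change of the Gaussian has to compensate the factors produced by [varpi_step]. This
    determines its coefficient. *)
Lemma quadratic_exponent (t : C) : inH t -> (2 * q2H t + beta - beta / (t * t))%C = (C2pi / (2 * t))%C.
Proof.
  intros Ht. pose proof (inH_neq_0 t Ht) as T0. set (nu := (2 * q2H t + beta - beta / (t * t))%C).
  pose proof (u0_neq_0 t Ht) as U0.
  assert (Key : forall z, Cexp (nu * (z * z) + C2pi * (z / 2)) = Cexp (nu * ((z + t) * (z + t)) + C2pi * (- ((z + t) / 2)))%C).
  { intros z.
    apply (dense_eq (fun z => sn (z + t) * sn (z / t) * (varpi z t * varpi (- z) t))%C
      (fun z => Cexp (nu * (z * z) + C2pi * (z / 2))) (fun z => Cexp (nu * ((z + t) * (z + t)) + C2pi * (- ((z + t) / 2))))).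
    - assert (C1 : forall w, cdiff (fun z => sn (z + t))%C w) by (intros; holo).
      assert (C2 : forall w, cdiff (fun z => sn (z / t))%C w) by (intros; holo).
      apply (dense_neq0_mult (fun z => sn (z + t) * sn (z / t))%C (fun z => varpi z t * varpi (- z) t)%C).
      + intros w. cont.
      + apply (dense_neq0_mult (fun z => sn (z + t))%C (fun z => sn (z / t))%C).
        * intros w. cont.
        * apply (entire_dense_neq0 (fun z => sn (z + t))%C (/ 2 - t)%C C1).
          replace (/ 2 - t + t)%C with (/ 2)%C by ring. apply sn_half_neq_0.
        * apply (entire_dense_neq0 (fun z => sn (z / t))%C (t / 2)%C C2).
          replace (t / 2 / t)%C with (/ 2)%C by (field; exact T0). apply sn_half_neq_0.
      + assert (C3 : forall w, cdiff (fun z => varpi (- z) t) w) by (intros; holo).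
        apply dense_neq0_mult.
        * intros w. cont.
        * apply entire_dense_neq0 with (/ 2)%C; [intros; apply cdiff_varpi, Ht|apply varpi_half_neq_0, Ht].
        * apply (entire_dense_neq0 (fun z => varpi (- z) t) (- / 2)%C C3).
          replace (- - / 2)%C with (/ 2)%C by ring. apply varpi_half_neq_0, Ht.
    - cont.
    - cont.
    - apply filter_forall. clear z. match goal with |- forall x, @?P x => change (forall x : C, P x) end.
    cbv beta. intros z.
      pose proof (theta_relation t z Ht) as R1. pose proof (theta_relation t (z + t)%C Ht) as R2. fold nu in R1, R2.
      replace ((z + t) / t)%C with (z / t + 1)%C in R2 by (field; exact T0).
      rewrite varpi_add_1, sn_add_1 in R2.
      assert (E1 : varpi (- (z / t + 1)) (- / t) = varpi (- (z / t)) (- / t)).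
      { rewrite <- (varpi_add_1 (- (z / t + 1))%C). f_equal. ring. }
      rewrite E1 in R2.
      pose proof (varpi_step z t Ht) as St1. pose proof (varpi_step (- (z + t))%C t Ht) as St2.
      replace (- (z + t) + t)%C with (- z)%C in St2 by ring.
      rewrite one_sub_e_sn in St1. rewrite one_sub_e_sn, sn_opp in St2.
      replace (- (z + t) / 2)%C with (- ((z + t) / 2))%C in St2 by field.
      rewrite !Cexp_plus, <- !e_Cexp.
      set (A := varpi (z / t) (- / t)) in *. set (A' := varpi (- (z / t)) (- / t)) in *.
      set (X := Cexp (nu * (z * z))) in *. set (X' := Cexp (nu * ((z + t) * (z + t)))%C) in *.
      rewrite St2 in R2.
      assert (M : (u0 t * u0 t * t * ((sn (z + t) * sn (z / t) * (varpi z t * varpi (- z) t)) * (X * e (z / 2))))%C =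
        (u0 t * u0 t * t * ((sn (z + t) * sn (z / t) * (varpi z t * varpi (- z) t)) * (X' * e (- ((z + t) / 2)))))%C).
      { transitivity ((u0 t * u0 t * t * X * sn (z / t) * (varpi z t * varpi (- z) t)) * (sn (z + t) * e (z / 2)))%C; [ring|].
        rewrite <- R1.
        transitivity ((A * A' * sn (z + t)) * (e (z / 2) * sn z))%C; [ring|]. rewrite R2.
        transitivity (u0 t * u0 t * t * (sn (z + t) * sn (z / t) * ((- e (z / 2) * sn z * varpi (z + t) t) * varpi (- z) t) * (X' * e (- ((z + t) / 2)))))%C; [ring|].
        rewrite <- St1. ring. }
      assert (N : (u0 t * u0 t * t)%C <> RtoC 0) by (apply Cmult_neq_0; [apply Cmult_neq_0|]; assumption).
      set (L := (sn (z + t) * sn (z / t) * (varpi z t * varpi (- z) t))%C) in *.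
      replace (L * (X * e (z / 2)))%C with (u0 t * u0 t * t * (L * (X * e (z / 2))) / (u0 t * u0 t * t))%C by (field; split; assumption).
      rewrite M. field. split; assumption. }
  (* Division of [Key] by its left side leaves an exponential of an affine function of z that is
     identically 1; its slope must be 0. *)
  assert (A0 : (2 * nu * t - C2pi)%C = RtoC 0).
  { apply Cexp_affine_const with (nu * (t * t) - C2pi * (t / 2))%C. intros z.
    specialize (Key z).
    replace (nu * ((z + t) * (z + t)) + C2pi * - ((z + t) / 2))%C with
      ((nu * (z * z) + C2pi * (z / 2)) + ((2 * nu * t - C2pi) * z + (nu * (t * t) - C2pi * (t / 2))))%C in Key by field.
    rewrite (Cexp_plus (nu * (z * z) + C2pi * (z / 2))%C ((2 * nu * t - C2pi) * z + (nu * (t * t) - C2pi * (t / 2)))%C) in Key.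
    pose proof (Cexp_neq_0 (nu * (z * z) + C2pi * (z / 2))%C) as N.
    set (X := Cexp (nu * (z * z) + C2pi * (z / 2))%C) in *.
    set (Y := Cexp ((2 * nu * t - C2pi) * z + (nu * (t * t) - C2pi * (t / 2)))%C) in *.
    assert (EY : Y = (X * Y / X)%C) by (field; exact N). rewrite <- Key in EY. rewrite EY. field. exact N. }
  replace nu with ((2 * nu * t - C2pi + C2pi) / (2 * t))%C by (field; exact T0). rewrite A0. field. exact T0.
Qed.

End InversionOnH.

Lemma bfun_Im_neq_0 (z : C) : Im z <> 0 -> bfun z <> RtoC 0.
Proof. intros H. apply bfun_neq_0. intros k E. apply H. rewrite E. reflexivity. Qed.

Lemma half_RtoC : (/ 2)%C = RtoC (/ 2).
Proof. rewrite RtoC_inv by lra. reflexivity. Qed.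

Lemma varpi_half_tau_neq_0 (t : C) : inH t -> varpi (t / 2)%C t <> RtoC 0.
Proof.
  intros Ht. apply varpi_neq_0; [exact Ht|]. intros k. apply e_neq_1_Im.
  replace (Im (t / 2 + RtoC (INR k) * t)%C) with ((/ 2 + INR k) * Im t).
  - pose proof (pos_INR k). unfold inH in Ht. apply Rgt_not_eq, Rmult_lt_0_compat; lra.
  - replace (t / 2 + RtoC (INR k) * t)%C with ((/ 2 + RtoC (INR k)) * t)%C by field.
    rewrite half_RtoC. unfold Im; simpl. ring.
Qed.

(** * Continuation of the inversion to the slit plane *)

Section InversionOnSlit.
Variables (K beta : C).
Hypothesis K0 : K <> RtoC 0.
Hypothesis Hsn : forall z, sn z = (K * z * (Cexp (beta * (z * z)) * (bfun z * bfun (- z))))%C.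

(** [1 - e x] without its zeros at the nonzero integers, which the two [bfun] carry; it vanishes at
    0 only. *)
Definition gauss (x : C) : C := (- (K * x * (Cexp (C2pi * (x / 2)) * Cexp (beta * (x * x)))))%C.

Lemma one_sub_e_gauss (x : C) : (1 - e x)%C = (gauss x * (bfun x * bfun (- x)))%C.
Proof. rewrite (one_sub_e_bfun K beta Hsn). unfold gauss. ring. Qed.

Lemma gauss_neq_0 (x : C) : x <> RtoC 0 -> gauss x <> RtoC 0.
Proof.
  intros Hx E. apply (Cmult_neq_0 (K * x) (Cexp (C2pi * (x / 2)) * Cexp (beta * (x * x)))%C).
  - apply Cmult_neq_0; assumption.
  - apply Cmult_neq_0; apply Cexp_neq_0.
  - replace (K * x * (Cexp (C2pi * (x / 2)) * Cexp (beta * (x * x))))%C with (- gauss x)%C by (unfold gauss; ring).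
    rewrite E. ring.
Qed.

Lemma cdiff_gauss (x : C) : cdiff gauss x.
Proof. unfold gauss. holo. Qed.

(* On the upper half plane [expq = exp q1H] and [expq_t = exp (t q1H)]; both formulas make sense, and do not
   vanish, on the whole slit plane, where [q1] recovers the exponent without choosing a logarithm. *)
Definition expq (t : C) : C :=
  (gauss (/ 2 / t) * (bfun (- (/ 2 / t)) * bfun (- (/ 2 / t))) * (bfun (- / 2) * (Ffun (- / 2) t * Ffun (- / 2) t))
   / (bfun (/ 2) * (Ffun (/ 2) t * Ffun (/ 2) t)))%C.

Definition expq_t (t : C) : C :=
  (gauss (- (t / 2)) * (bfun (- (t / 2)) * bfun (- (t / 2))) * (bfun (- / 2) * (Ffun (- (t / 2)) t * Ffun (- (t / 2)) t))
   / (bfun (/ 2) * (Ffun (t / 2) t * Ffun (t / 2) t)))%C.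

Definition q1 (t : C) : C := (C_derive expq_t t / expq_t t - t * (C_derive expq t / expq t))%C.

(** At z = 1/2 and z = - 1/2 the values of [varpi z t] agree by periodicity; on the other side x = 1
    / (2 t) satisfies x - 1 / t = - x, so [varpi_step] links them. The even quadratic term drops out
    of the quotient of the two relations, and exp(q1H) remains. *)
Lemma expq_value (t : C) : inH t -> expq t = Cexp (q1H t).
Proof.
  intros Ht. pose proof (inH_neq_0 t Ht) as T0. destruct (inH_slit t Ht) as [S1 S2].
  destruct bfun_half_neq_0 as [B1 B2]. destruct (Ffun_half_neq_0 t S1) as [F1 F2].
  pose proof (varpi_half_neq_0 t Ht) as V0. pose proof (u0_neq_0 t Ht) as U0.
  pose proof (inversion_relation K beta Hsn t (/ 2)%C Ht) as R1.
  pose proof (inversion_relation K beta Hsn t (- / 2)%C Ht) as R2.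
  replace (- - / 2)%C with (/ 2)%C in R2 by ring.
  replace (- / 2 / t)%C with (- (/ 2 / t))%C in R2 by (field; exact T0).
  assert (V1 : varpi (- / 2) t = varpi (/ 2) t).
  { rewrite <- (varpi_add_1 (- / 2)%C). f_equal. field. }
  rewrite V1 in R2. unfold expq. set (x := (/ 2 / t)%C) in *.
  pose proof (varpi_step x (- / t)%C (inH_neg_inv t Ht)) as St.
  replace (x + - / t)%C with (- x)%C in St by (unfold x; field; exact T0).
  assert (Bx : bfun x <> RtoC 0).
  { apply bfun_Im_neq_0. unfold x. replace (/ 2 / t)%C with (RtoC (- / 2) * (- / t))%C.
    - pose proof (inH_neg_inv t Ht) as H. unfold inH in H. replace (Im (RtoC (- / 2) * - / t)%C) with (- / 2 * Im (- / t)%C)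
        by (unfold Im; simpl; ring). lra.
    - rewrite RtoC_opp, <- half_RtoC. field. exact T0. }
  rewrite St, one_sub_e_gauss in R1.
  set (q1' := q1H t) in *. set (q2' := q2H beta t) in *.
  replace (q1' * / 2 + q2' * (/ 2 * / 2))%C with (q1' + (q1' * - / 2 + q2' * (- / 2 * - / 2)))%C in R1 by field.
  rewrite Cexp_plus in R1.
  set (X := Cexp (q1' * - / 2 + q2' * (- / 2 * - / 2))%C) in *.
  assert (X0 : X <> RtoC 0) by apply Cexp_neq_0.
  set (V := varpi (- x) (- / t)) in *. set (P := varpi (/ 2) t) in *. set (U := u0 t) in *.
  assert (M : (U * P * X * bfun x * (gauss x * (bfun (- x) * bfun (- x)) * (bfun (- / 2) * (Ffun (- / 2) t * Ffun (- / 2) t))))%C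
    = (U * P * X * bfun x * (Cexp q1' * (bfun (/ 2) * (Ffun (/ 2) t * Ffun (/ 2) t))))%C).
  { transitivity ((gauss x * (bfun x * bfun (- x))) * (bfun (- / 2) * Ffun (- / 2) t) * (U * (X * bfun (- x) * Ffun (- / 2) t) * P))%C; [ring|].
    rewrite <- R2.
    transitivity ((gauss x * (bfun x * bfun (- x)) * V * (bfun (- / 2) * Ffun (- / 2) t)) * (bfun (/ 2) * Ffun (/ 2) t))%C; [ring|].
    rewrite R1. ring. }
  assert (N : (U * P * X * bfun x)%C <> RtoC 0) by (apply Cmult_neq_0; [apply Cmult_neq_0; [apply Cmult_neq_0|]|]; assumption).
  assert (D : (bfun (/ 2) * (Ffun (/ 2) t * Ffun (/ 2) t))%C <> RtoC 0) by (apply Cmult_neq_0; [|apply Cmult_neq_0]; assumption).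
  set (A := (gauss x * (bfun (- x) * bfun (- x)) * (bfun (- / 2) * (Ffun (- / 2) t * Ffun (- / 2) t)))%C) in *.
  set (B := (bfun (/ 2) * (Ffun (/ 2) t * Ffun (/ 2) t))%C) in *. set (W := (U * P * X * bfun x)%C) in *.
  replace A with (W * A / W)%C by (field; exact N). rewrite M. field. split; assumption.
Qed.

(** As in [expq_value] with the two moduli exchanged: at z = t/2 and z = - t/2 the values of
    [varpi (z / t) (- / t)] agree, and [varpi_step] links those of [varpi z t]. *)
Lemma expq_t_value (t : C) : inH t -> expq_t t = Cexp (q1H t * t).
Proof.
  intros Ht. pose proof (inH_neq_0 t Ht) as T0. destruct (inH_slit t Ht) as [S1 S2].
  destruct bfun_half_neq_0 as [B1 B2]. destruct (Ffun_half_tau_neq_0 t S1) as [F1 F2].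
  pose proof (varpi_half_tau_neq_0 t Ht) as V0. pose proof (u0_neq_0 t Ht) as U0.
  pose proof (inversion_relation K beta Hsn t (t / 2)%C Ht) as R1.
  pose proof (inversion_relation K beta Hsn t (- (t / 2))%C Ht) as R2.
  replace (- - (t / 2))%C with (t / 2)%C in R2 by ring.
  replace (- (t / 2) / t)%C with (- / 2)%C in R2 by (field; exact T0).
  replace (t / 2 / t)%C with (/ 2)%C in R1 by (field; exact T0).
  assert (V1 : varpi (- / 2) (- / t) = varpi (/ 2) (- / t)).
  { rewrite <- (varpi_add_1 (- / 2)%C). f_equal. field. }
  rewrite V1 in R2. unfold expq_t.
  pose proof (varpi_step (- (t / 2))%C t Ht) as St.
  replace (- (t / 2) + t)%C with (t / 2)%C in St by field.
  rewrite one_sub_e_gauss in St. replace (- - (t / 2))%C with (t / 2)%C in St by ring.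
  assert (Bx : bfun (t / 2)%C <> RtoC 0).
  { apply bfun_Im_neq_0. replace (t / 2)%C with (RtoC (/ 2) * t)%C by (rewrite <- half_RtoC; field).
    replace (Im (RtoC (/ 2) * t)%C) with (/ 2 * Im t) by (unfold Im; simpl; ring). unfold inH in Ht. lra. }
  rewrite St in R2. set (y := (t / 2)%C) in *.
  set (q1' := q1H t) in *. set (q2' := q2H beta t) in *.
  replace (q1' * y + q2' * (y * y))%C with (q1' * t + (q1' * - y + q2' * (- y * - y)))%C in R1 by (unfold y; field).
  rewrite Cexp_plus in R1.
  set (X := Cexp (q1' * - y + q2' * (- y * - y))%C) in *.
  assert (X0 : X <> RtoC 0) by apply Cexp_neq_0.
  set (V := varpi (/ 2) (- / t)) in *. set (P := varpi y t) in *. set (U := u0 t) in *.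
  assert (M : (U * P * X * bfun y * (gauss (- y) * (bfun (- y) * bfun (- y)) * (bfun (- / 2) * (Ffun (- y) t * Ffun (- y) t))))%C
    = (U * P * X * bfun y * (Cexp (q1' * t) * (bfun (/ 2) * (Ffun y t * Ffun y t))))%C).
  { transitivity ((U * (X * bfun (- / 2) * Ffun (- y) t) * (gauss (- y) * (bfun (- y) * bfun y) * P)) * (bfun (- y) * Ffun (- y) t))%C; [ring|].
    rewrite <- R2.
    transitivity ((V * (bfun (- y) * Ffun (- y) t)) * (bfun y * Ffun y t))%C; [ring|].
    rewrite R1. ring. }
  assert (N : (U * P * X * bfun y)%C <> RtoC 0) by (apply Cmult_neq_0; [apply Cmult_neq_0; [apply Cmult_neq_0|]|]; assumption).
  assert (D : (bfun (/ 2) * (Ffun y t * Ffun y t))%C <> RtoC 0) by (apply Cmult_neq_0; [|apply Cmult_neq_0]; assumption).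
  set (A := (gauss (- y) * (bfun (- y) * bfun (- y)) * (bfun (- / 2) * (Ffun (- y) t * Ffun (- y) t)))%C) in *.
  set (B := (bfun (/ 2) * (Ffun y t * Ffun y t))%C) in *. set (W := (U * P * X * bfun y)%C) in *.
  replace A with (W * A / W)%C by (field; exact N). rewrite M. field. split; assumption.
Qed.

Lemma expq_neq_0 (t : C) : slit t -> expq t <> RtoC 0.
Proof.
  intros Ht. pose proof (slit_neq_0 t Ht) as T0.
  destruct bfun_half_neq_0 as [B1 B2]. destruct (Ffun_half_neq_0 t Ht) as [F1 F2].
  assert (G : gauss (/ 2 / t)%C <> RtoC 0).
  { apply gauss_neq_0. intros E. apply C1_nz. replace (RtoC 1) with (2 * t * (/ 2 / t))%C by (field; exact T0). rewrite E. ring. }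
  assert (B : bfun (- (/ 2 / t))%C <> RtoC 0).
  { unfold Cdiv. rewrite half_RtoC. apply bfun_neg_ray; [lra|apply slit_inv, Ht]. }
  unfold expq. intros E.
  assert (N : (bfun (/ 2) * (Ffun (/ 2) t * Ffun (/ 2) t))%C <> RtoC 0) by (apply Cmult_neq_0; [|apply Cmult_neq_0]; assumption).
  assert (N2 : (gauss (/ 2 / t) * (bfun (- (/ 2 / t)) * bfun (- (/ 2 / t))) * (bfun (- / 2) * (Ffun (- / 2) t * Ffun (- / 2) t)))%C <> RtoC 0).
  { apply Cmult_neq_0; [apply Cmult_neq_0; [exact G|apply Cmult_neq_0; exact B]|].
    apply Cmult_neq_0; [exact B2|apply Cmult_neq_0; exact F2]. }
  apply N2. set (A := (gauss (/ 2 / t) * _ * _)%C) in *. set (D := (bfun (/ 2) * _)%C) in *.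
  replace A with (A / D * D)%C by (field; exact N). rewrite E. ring.
Qed.

Lemma expq_t_neq_0 (t : C) : slit t -> expq_t t <> RtoC 0.
Proof.
  intros Ht. pose proof (slit_neq_0 t Ht) as T0.
  destruct bfun_half_neq_0 as [B1 B2]. destruct (Ffun_half_tau_neq_0 t Ht) as [F1 F2].
  assert (G : gauss (- (t / 2))%C <> RtoC 0).
  { apply gauss_neq_0. intros E. apply T0. replace t with (- 2 * (- (t / 2)))%C by field. rewrite E. ring. }
  assert (B : bfun (- (t / 2))%C <> RtoC 0).
  { replace (t / 2)%C with (RtoC (/ 2) * t)%C by (rewrite <- half_RtoC; field). apply bfun_neg_ray; [lra|exact Ht]. }
  unfold expq_t. intros E.
  assert (N : (bfun (/ 2) * (Ffun (t / 2) t * Ffun (t / 2) t))%C <> RtoC 0) by (apply Cmult_neq_0; [|apply Cmult_neq_0]; assumption).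
  assert (N2 : (gauss (- (t / 2)) * (bfun (- (t / 2)) * bfun (- (t / 2))) * (bfun (- / 2) * (Ffun (- (t / 2)) t * Ffun (- (t / 2)) t)))%C <> RtoC 0).
  { apply Cmult_neq_0; [apply Cmult_neq_0; [exact G|apply Cmult_neq_0; exact B]|].
    apply Cmult_neq_0; [exact B2|apply Cmult_neq_0; exact F2]. }
  apply N2. set (A := (gauss (- (t / 2)) * _ * _)%C) in *. set (D := (bfun (/ 2) * _)%C) in *.
  replace A with (A / D * D)%C by (field; exact N). rewrite E. ring.
Qed.

(** Here z moves along with t, which is what the clause on curves in [chol_at] provides for. *)
Lemma cdiff_Ffun_curve (phi : C -> C) (t : C) : slit t -> locally t (fun w => cdiff phi w) -> cdiff (fun t => Ffun (phi t) t) t.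
Proof.
  intros Ht H. apply (proj2 (chol_Ffun (phi t, t) Ht) phi (fun t => t) t eq_refl eq_refl).
  generalize H. apply filter_imp. intros w Hw. split; [exact Hw|apply cdiff_id].
Qed.

Lemma cdiff_quotient_shape (g b p q : C -> C) (c c' t : C) : (c' * (q t * q t))%C <> RtoC 0 ->
  cdiff g t -> cdiff b t -> cdiff p t -> cdiff q t ->
  cdiff (fun t => g t * (b t * b t) * (c * (p t * p t)) / (c' * (q t * q t)))%C t.
Proof. intros. holo. Qed.

Lemma cdiff_expq (t : C) : slit t -> cdiff expq t.
Proof.
  intros Ht. pose proof (slit_neq_0 t Ht) as T0.
  destruct bfun_half_neq_0 as [B1 B2]. destruct (Ffun_half_neq_0 t Ht) as [F1 F2].
  assert (DF1 : cdiff (fun t => Ffun (/ 2) t) t) by (apply (cdiff_Ffun_curve (fun _ => / 2)%C); [exact Ht|apply filter_forall; intros; holo]).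
  assert (DF2 : cdiff (fun t => Ffun (- / 2) t) t) by (apply (cdiff_Ffun_curve (fun _ => - / 2)%C); [exact Ht|apply filter_forall; intros; holo]).
  pose proof cdiff_gauss.
  apply (cdiff_quotient_shape (fun t => gauss (/ 2 / t)) (fun t => bfun (- (/ 2 / t)))%C (Ffun (- / 2)) (Ffun (/ 2))); [| |holo|exact DF2|exact DF1].
  - auto with holo.
  - holo.
Qed.

Lemma cdiff_expq_t (t : C) : slit t -> cdiff expq_t t.
Proof.
  intros Ht.
  destruct bfun_half_neq_0 as [B1 B2]. destruct (Ffun_half_tau_neq_0 t Ht) as [F1 F2].
  assert (DF1 : cdiff (fun t => Ffun (t / 2) t) t) by (apply (cdiff_Ffun_curve (fun t => t / 2)%C); [exact Ht|apply filter_forall; intros; holo]).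
  assert (DF2 : cdiff (fun t => Ffun (- (t / 2)) t) t) by (apply (cdiff_Ffun_curve (fun t => - (t / 2))%C); [exact Ht|apply filter_forall; intros; holo]).
  apply (cdiff_quotient_shape (fun t => gauss (- (t / 2))) (fun t => bfun (- (t / 2)))%C (fun t => Ffun (- (t / 2)) t) (fun t => Ffun (t / 2) t));
    [| | |exact DF2|exact DF1]; clear DF1 DF2.
  - apply Cmult_neq_0; [exact B1|apply Cmult_neq_0; exact F1].
  - pose proof cdiff_gauss. holo.
  - holo.
Qed.

Lemma cdiff_q1 (t : C) : slit t -> cdiff q1 t.
Proof.
  intros Ht. pose proof (slit_open t Ht) as Ho.
  assert (D1 : cdiff (C_derive expq) t).
  { apply C_derive_cdiff. generalize Ho. apply filter_imp. intros w Hw. apply cdiff_expq, Hw. }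
  assert (D2 : cdiff (C_derive expq_t) t).
  { apply C_derive_cdiff. generalize Ho. apply filter_imp. intros w Hw. apply cdiff_expq_t, Hw. }
  apply (cdiff_minus (fun t => C_derive expq_t t / expq_t t)%C (fun t => t * (C_derive expq t / expq t))%C).
  - apply cdiff_div; [apply expq_t_neq_0, Ht|exact D2|apply cdiff_expq_t, Ht].
  - apply (cdiff_mult (fun t => t) (fun t => C_derive expq t / expq t)%C); [apply cdiff_id|].
    apply cdiff_div; [apply expq_neq_0, Ht|exact D1|apply cdiff_expq, Ht].
Qed.

Lemma cdiff_q1H (t : C) : inH t -> cdiff q1H t.
Proof.
  intros Ht. pose proof (inH_neq_0 t Ht) as T0. unfold q1H.
  pose proof (cdiff_lin t Ht). pose proof (cdiff_lin_neg_inv t Ht). holo.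
Qed.

(** The logarithmic derivatives of exp(q1H) and exp(t q1H) are q1H' and q1H + t q1H', so subtracting
    t times the first from the second leaves q1H. *)
Lemma q1_value (t : C) : inH t -> q1 t = q1H t.
Proof.
  intros Ht. destruct (cdiff_q1H t Ht) as [l Hl]. pose proof (inH_open t Ht) as Ho.
  assert (D1 : cderiv expq t (l * Cexp (q1H t))%C).
  { apply cderiv_ext_loc with (fun w => Cexp (q1H w)).
    - generalize Ho. apply filter_imp. intros w Hw. symmetry. apply expq_value, Hw.
    - apply (cderiv_comp Cexp q1H); [apply cderiv_Cexp|exact Hl]. }
  assert (D2 : cderiv expq_t t ((l * t + q1H t * 1) * Cexp (q1H t * t))%C).
  { apply cderiv_ext_loc with (fun w => Cexp (q1H w * w)%C).
    - generalize Ho. apply filter_imp. intros w Hw. symmetry. apply expq_t_value, Hw.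
    - apply (cderiv_comp Cexp (fun w => q1H w * w)%C); [apply cderiv_Cexp|].
      apply (cderiv_mult q1H (fun w => w)); [exact Hl|apply cderiv_id]. }
  unfold q1. rewrite (is_C_derive_unique _ _ _ D1), (is_C_derive_unique _ _ _ D2), expq_value, expq_t_value by exact Ht.
  pose proof (Cexp_neq_0 (q1H t)). pose proof (Cexp_neq_0 (q1H t * t)%C).
  change (NormedModule.sort C_AbsRing C_NormedModule) with C in l.
  transitivity ((l * t + q1H t * 1) - t * l)%C; [|ring].
  f_equal; [|f_equal]; field; assumption.
Qed.

(** The solution of [quadratic_exponent] for [q2H]; being an explicit formula, it extends to the
    slit plane. *)
Definition q2 (t : C) : C := ((beta / (t * t) - beta + C2pi / (2 * t)) / 2)%C.

Lemma q2_value (t : C) : inH t -> q2 t = q2H beta t.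
Proof.
  intros Ht. unfold q2. rewrite <- (quadratic_exponent K beta Hsn t Ht). field. apply inH_neq_0, Ht.
Qed.

(** The square root absorbs the factor 1 / t by which [sn (z / t)] differs from [sn z] near 0, so
    that the identity between F(z) F(- z) and G(z) G(- z) has no stray factor. *)
Definition FS (z t : C) : C := (Cexp (q1 t * z + q2 t * (z * z)) * bfun (z / t) * Ffun z t / csqrt t)%C.
Definition GS (z t : C) : C := (bfun (- z) * Ffun (- z) t)%C.

Lemma chol_FS : chol slit2 FS.
Proof.
  intros [z t] Ht. unfold slit2 in Ht; simpl in Ht. pose proof (slit_neq_0 t Ht) as T0.
  pose proof (csqrt_neq_0 t Ht). pose proof (cdiff_csqrt t Ht). pose proof (cdiff_q1 t Ht). pose proof (chol_Ffun (z, t) Ht).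
  unfold FS, q2. holo2.
Qed.

Lemma chol_GS : chol slit2 GS.
Proof.
  intros [z t] Ht. unfold slit2 in Ht; simpl in Ht.
  apply (chol_at_mult (fun z _ => bfun (- z))%C (fun z t => Ffun (- z) t)); [holo2|].
  apply (chol_at_comp2 Ffun (fun z _ => - z)%C (fun _ t => t)); [apply chol_Ffun, Ht| |]; apply filter_forall; intros; holo2.
Qed.

End InversionOnSlit.

(** The identity under z -> - z holds on the whole slit plane by algebra: both sides contain the
    same factors [Ffun], and the linear exponent cancels. The upper half plane enters only through
    the relation with [varpi]. *)
Theorem inversion_continuation : exists F G : C -> C -> C, chol slit2 F /\ chol slit2 G /\
  (forall t, slit t -> F (RtoC 0) t <> RtoC 0 /\ G (RtoC 0) t <> RtoC 0) /\
  (forall z t, slit t -> (F z t * F (- z) t * sn z)%C =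
     (G z t * G (- z) t * (sn (z / t) * Cexp (C2pi * (z * z / (2 * t)))))%C) /\
  exists u : C -> C, forall t, inH t -> u t <> RtoC 0 /\
    forall z, (varpi (z / t) (- / t) * G z t)%C = (u t * F z t * varpi z t)%C.
Proof.
  destruct sn_bfun as (K & beta & K0 & Hsn).
  exists (FS K beta), GS. split; [exact (chol_FS K beta K0)|split; [apply chol_GS|split; [|split]]].
  - intros t Ht. unfold FS, GS. pose proof (slit_neq_0 t Ht) as T0. pose proof (csqrt_neq_0 t Ht) as R0.
    replace (- (0))%C with (RtoC 0) by ring. replace (0 / t)%C with (RtoC 0) by (field; exact T0).
    replace (q1 K beta t * 0 + q2 beta t * (0 * 0))%C with (RtoC 0) by ring.
    rewrite Cexp_0, bfun_0, Ffun_0. split.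
    + intros E. apply C1_nz. replace (RtoC 1) with (1 * 1 * 1 / csqrt t * csqrt t)%C by (field; exact R0).
      rewrite E. ring.
    + rewrite Cmult_1_l. apply C1_nz.
  - intros z t Ht. unfold FS, GS. pose proof (slit_neq_0 t Ht) as T0. pose proof (csqrt_neq_0 t Ht) as R0.
    rewrite (Hsn z), (Hsn (z / t)%C). replace (- - z)%C with z by ring.
    replace (- z / t)%C with (- (z / t))%C by (field; exact T0).
    transitivity ((K * z * (bfun z * bfun (- z)) * (bfun (z / t) * bfun (- (z / t))) * (Ffun z t * Ffun (- z) t) / (csqrt t * csqrt t)) *
      (Cexp (q1 K beta t * z + q2 beta t * (z * z)) * Cexp (q1 K beta t * - z + q2 beta t * (- z * - z)) * Cexp (beta * (z * z))))%C.
    { field. exact R0. }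
    rewrite (csqrt_sq t Ht).
    transitivity ((K * z * (bfun z * bfun (- z)) * (bfun (z / t) * bfun (- (z / t))) * (Ffun z t * Ffun (- z) t) / t) *
      (Cexp (beta * (z / t * (z / t))) * Cexp (C2pi * (z * z / (2 * t)))))%C.
    + f_equal. rewrite <- !Cexp_plus. f_equal. unfold q2. field. exact T0.
    + field. exact T0.
  - exists (fun t => u0 t * csqrt t)%C. intros t Ht. destruct (inH_slit t Ht) as [S1 _].
    split; [apply Cmult_neq_0; [apply u0_neq_0, Ht|apply csqrt_neq_0, S1]|].
    intros z. unfold FS, GS. rewrite (inversion_relation K beta Hsn t z Ht), (q1_value K beta Hsn t Ht), (q2_value K beta Hsn t Ht).
    pose proof (csqrt_neq_0 t S1). field. assumption.
Qed.

(** * Continuation for a general matrix *)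

Lemma Re_jac (c d : Z) (t : C) : Re (jac c d t) = IZR c * Re t + IZR d.
Proof. unfold jac. destruct t. simpl. ring. Qed.
Lemma Im_jac (c d : Z) (t : C) : Im (jac c d t) = IZR c * Im t.
Proof. unfold jac. destruct t. simpl. ring. Qed.

(** For c <> 0 the cases of both signs merge into the single condition that c tau + d avoids the
    nonpositive reals. *)
Lemma inD_slit (c d : Z) (t : C) : (c <> 0)%Z -> inD c d t <-> slit (jac c d t).
Proof.
  intros Hc. unfold inD, slit. rewrite Re_jac, Im_jac.
  assert (H1 : IZR d = IZR c * (IZR d / IZR c)) by (field; apply not_0_IZR, Hc).
  assert (H2 : - IZR d / IZR c = - (IZR d / IZR c)) by (field; apply not_0_IZR, Hc).
  rewrite H2. set (q := IZR d / IZR c) in *. rewrite H1.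
  destruct (Z_lt_le_dec 0 c) as [Hp|Hn].
  - assert (Hs : 0 < IZR c) by (apply IZR_lt; lia). split.
    + intros [[_ H]|[H|[H|H]]]; try lia. intros [H3 H4]. apply H. split; nra.
    + intros H. left. split; [lia|]. intros [H3 H4]. apply H. split; nra.
  - assert (Hs : IZR c < 0) by (apply IZR_lt; lia). split.
    + intros [H|[H|[H|[_ H]]]]; try lia. intros [H3 H4]. apply H. split; nra.
    + intros H. right; right; right. split; [lia|]. intros [H3 H4]. apply H. split; nra.
Qed.

Lemma jac_0 (d : Z) (t : C) : jac 0 d t = RtoC (IZR d).
Proof. unfold jac. ring. Qed.

Lemma inD_jac_neq_0 (c d : Z) (t : C) : inD c d t -> jac c d t <> RtoC 0.
Proof.
  destruct (Z.eq_dec c 0) as [->|Hc].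
  - intros H. rewrite jac_0. apply RtoC_neq_0, not_0_IZR. destruct H as [H|[H|[H|H]]]; lia.
  - intros H. apply slit_neq_0, inD_slit; assumption.
Qed.

Lemma inH_inD (a b c d : Z) (t : C) : (a * d - b * c = 1)%Z -> inH t -> inD c d t.
Proof.
  intros Hdet Ht. unfold inH in Ht. destruct (Z.eq_dec c 0) as [->|Hc].
  - destruct (Z_lt_le_dec 0 d) as [Hd|Hd]; unfold inD; [right; left; lia|].
    right; right; left. assert (d <> 0)%Z by (intros ->; lia). repeat split; [lia|exact Ht].
  - apply inD_slit; [exact Hc|]. intros [H _]. rewrite Im_jac in H.
    apply Rmult_integral in H. destruct H as [H|H]; [|lra]. apply (not_0_IZR _ Hc), H.
Qed.

Lemma Im_div (x y : C) : y <> RtoC 0 ->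
  Im (x / y)%C = (Im x * Re y - Re x * Im y) / (Re y ^ 2 + Im y ^ 2).
Proof.
  intros Hy. destruct x as [x1 x2], y as [y1 y2]. simpl. field. intros H. apply Hy.
  apply C_eq; simpl; nra.
Qed.

Lemma inH_mobius (a b c d : Z) (t : C) : (a * d - b * c = 1)%Z -> inH t -> inH (mobius a b c d t).
Proof.
  intros Hdet Ht. pose proof (inD_jac_neq_0 c d t (inH_inD a b c d t Hdet Ht)) as Hj.
  unfold inH in *. change (mobius a b c d t) with (jac a b t / jac c d t)%C.
  rewrite Im_div by exact Hj. rewrite !Re_jac, !Im_jac.
  apply Rdiv_lt_0_compat.
  - replace (IZR a * Im t * (IZR c * Re t + IZR d) - (IZR a * Re t + IZR b) * (IZR c * Im t))
      with (IZR (a * d - b * c) * Im t) by (rewrite minus_IZR, !mult_IZR; ring).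
    rewrite Hdet. lra.
  - destruct (Req_dec (IZR c * Im t) 0) as [H0|H0].
    + assert (H1 : IZR c * Re t + IZR d <> 0).
      { intros H1. apply Hj. apply C_eq; [rewrite Re_jac; exact H1|rewrite Im_jac; exact H0]. }
      pose proof (pow2_gt_0 _ H1). pose proof (pow2_ge_0 (IZR c * Im t)). lra.
    + pose proof (pow2_gt_0 _ H0). pose proof (pow2_ge_0 (IZR c * Re t + IZR d)). lra.
Qed.

Lemma cdiff_jac (c d : Z) (t : C) : cdiff (jac c d) t.
Proof.
  unfold jac. holo.
Qed.

Lemma jac_neq_0_open (c d : Z) (t : C) : jac c d t <> RtoC 0 -> locally t (fun w => jac c d w <> RtoC 0).
Proof.
  intros H. apply (cvg_near_neq (locally t) (jac c d) (jac c d t)); [|exact H].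
  apply (cdiff_ccont (jac c d)), cdiff_jac.
Qed.

Lemma cdiff_mobius (a b c d : Z) (t : C) : jac c d t <> RtoC 0 -> cdiff (mobius a b c d) t.
Proof. intros H. apply (cdiff_div (jac a b) (jac c d)); [exact H|apply cdiff_jac|apply cdiff_jac]. Qed.

Lemma locally_snd (p : C * C) (P : C -> Prop) : locally (snd p) P -> locally p (fun q => P (snd q)).
Proof. destruct p as [z t]. intros H. exact (continuous_snd z t P H). Qed.

(** With j the automorphy factor and m the action on tau, this substitution is the action of a
    matrix on pairs (z, tau). *)
Lemma chol_at_scale_comp (f : C -> C -> C) (j m : C -> C) (p : C * C) :
  j (snd p) <> RtoC 0 -> locally (snd p) (fun t => cdiff j t /\ cdiff m t) ->
  chol_at f (fst p / j (snd p), m (snd p))%C ->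
  chol_at (fun z t => f (z / j t) (m t))%C p.
Proof.
  intros Hj Hd Hf. apply (chol_at_comp2 f (fun z t => z / j t)%C (fun _ t => m t)); [exact Hf| |].
  - assert (H : locally (snd p) (fun t => j t <> RtoC 0)).
    { apply (cvg_near_neq (locally (snd p)) j (j (snd p))); [|exact Hj].
      apply (cdiff_ccont j). apply (locally_singleton _ _ Hd). }
    pose proof (locally_snd p _ (filter_and _ _ H Hd)) as HH. generalize HH. apply filter_imp.
    intros q (H1 & H2 & _). apply chol_at_div; [exact H1|apply chol_at_fst|].
    apply (chol_at_comp1 j (fun _ t => t)); [exact H2|apply chol_at_snd].
  - pose proof (locally_snd p _ Hd) as HH. generalize HH. apply filter_imp.
    intros q (_ & H2). apply (chol_at_comp1 m (fun _ t => t)); [exact H2|apply chol_at_snd].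
Qed.

(* The quotient [F / G] stands for [sigma_A] up to a factor depending on [tau] only.  Unlike the [Om] of the theorem,
   the domain C times D_A is invariant under [z -> - z]. *)
Definition sigma_data (a b c d : Z) : Prop := exists F G : C -> C -> C,
  chol (fun p => inD c d (snd p)) F /\ chol (fun p => inD c d (snd p)) G /\
  (forall t, inD c d t -> (exists z, F z t <> RtoC 0) /\ (exists z, G z t <> RtoC 0)) /\
  (forall z t, inD c d t -> (F z t * F (- z) t * sn z)%C =
     (G z t * G (- z) t * (sn (z / jac c d t) * e (RtoC (IZR c) * (z * z) / (2 * jac c d t))))%C) /\
  exists u : C -> C, forall t, inH t -> u t <> RtoC 0 /\
    forall z, (varpi (z / jac c d t) (mobius a b c d t) * G z t)%C = (u t * F z t * varpi z t)%C.

Lemma sigma_data_shift (b : Z) : sigma_data 1 b 0 1.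
Proof.
  exists (fun _ _ => RtoC 1), (fun _ _ => RtoC 1). split; [|split; [|split; [|split]]].
  - intros p _. apply chol_at_const.
  - intros p _. apply chol_at_const.
  - intros t _. split; exists (RtoC 0); apply C1_nz.
  - intros z t _. rewrite jac_0. replace (z / 1)%C with z by (field; apply C1_nz).
    replace (0 * (z * z) / (2 * 1))%C with (RtoC 0) by (unfold Cdiv; ring). rewrite e_0. ring.
  - exists (fun _ => RtoC 1). intros t Ht. split; [apply C1_nz|]. intros z. rewrite jac_0.
    replace (z / 1)%C with z by (field; apply C1_nz).
    replace (mobius 1 b 0 1 t) with (t + RtoC (IZR b))%C by (unfold mobius; field; apply C1_nz).
    rewrite varpi_shift_tau. ring.
Qed.

Lemma Ci_sq : (Ci * Ci)%C = RtoC (-1).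
Proof. apply C_eq; simpl; ring. Qed.

Lemma varpi_not_zero (t : C) : inH t -> exists z, varpi z t <> RtoC 0.
Proof. intros Ht. exists t. apply varpi_tau_neq_0, Ht. Qed.

(** Here D_A is the upper half plane, where [varpi] itself is holomorphic. The factor [Ci] occurs
    squared in F(z) F(- z) and supplies the sign of sn(- z) = - sn z. *)
Lemma sigma_data_neg_shift (b : Z) : sigma_data (-1) b 0 (-1).
Proof.
  assert (HD : forall t, inD 0 (-1) t -> inH t).
  { intros t H. destruct H as [H|[H|[H|H]]]; try lia. exact (proj2 (proj2 H)). }
  assert (N1 : RtoC (-1) <> RtoC 0) by (apply RtoC_neq_0; lra).
  assert (E1 : RtoC (IZR (-1)) = (- (1))%C) by (apply C_eq; simpl; ring).
  exists (fun z t => Ci * varpi (- z) t)%C, varpi. split; [|split; [|split; [|split]]].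
  - intros p Hp. apply HD in Hp.
    apply (chol_at_mult (fun _ _ => Ci) (fun z t => varpi (- z) t)); [apply chol_at_const|].
    apply (chol_at_comp2 varpi (fun z _ => - z)%C (fun _ t => t)).
    + apply chol_varpi, Hp.
    + apply filter_forall. intros q. apply chol_at_opp, chol_at_fst.
    + apply filter_forall. intros q. apply chol_at_snd.
  - intros p Hp. apply chol_varpi, HD, Hp.
  - intros t Ht. apply HD in Ht. destruct (varpi_not_zero t Ht) as [z Hz]. split; [|exists z; exact Hz].
    exists (- z)%C. replace (- - z)%C with z by ring. apply Cmult_neq_0; [|exact Hz].
    intros H. apply N1. rewrite <- Ci_sq, H. ring.
  - intros z t _. rewrite jac_0. replace (z / (IZR (-1)))%C with (- z)%C by (rewrite E1; field; apply C1_nz).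
    rewrite sn_opp. replace (0 * (z * z) / (2 * IZR (-1)))%C with (RtoC 0) by (unfold Cdiv; ring).
    rewrite e_0. replace (- - z)%C with z by ring.
    transitivity ((Ci * Ci) * (varpi (- z) t * varpi z t * sn z))%C; [ring|]. rewrite Ci_sq, E1. ring.
  - exists (fun _ => - Ci)%C. intros t Ht. split.
    + intros H. apply N1. rewrite <- Ci_sq. transitivity ((- - Ci) * Ci)%C; [ring|]. rewrite H. ring.
    + intros z. rewrite jac_0. replace (z / (IZR (-1)))%C with (- z)%C by (rewrite E1; field; apply C1_nz).
      replace (mobius (-1) b 0 (-1) t) with (t + RtoC (IZR (- b)))%C
        by (unfold mobius; rewrite E1, opp_IZR, RtoC_opp; field; apply C1_nz).
      rewrite varpi_shift_tau. transitivity (- (Ci * Ci) * (varpi (- z) t * varpi z t))%C; [|ring].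
      rewrite Ci_sq, E1. ring.
Qed.

Lemma inD_open (c d : Z) (t : C) : inD c d t -> locally t (inD c d).
Proof.
  intros Ht. destruct (Z.eq_dec c 0) as [->|Hc].
  - destruct Ht as [H|[H|[H|H]]]; try lia.
    + apply filter_forall. intros w. right; left. exact H.
    + destruct H as (H1 & H2 & H3). pose proof (inH_open t H3) as Ho. generalize Ho. apply filter_imp.
      intros w Hw. right; right; left. repeat split; assumption.
  - assert (Hs : slit (jac c d t)) by (apply inD_slit; assumption).
    pose proof (cdiff_ccont (jac c d) t (cdiff_jac c d t)) as Hct. apply (proj2 (filterlim_cvg (locally t) (jac c d) _)) in Hct.
    pose proof (Hct _ (slit_open _ Hs)) as Ho. unfold filtermap in Ho. generalize Ho. apply filter_imp.
    intros w Hw. apply inD_slit; assumption.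
Qed.

Lemma Cinv_neq_0 (x : C) : x <> RtoC 0 -> (/ x)%C <> RtoC 0.
Proof.
  intros Hx H. apply C1_nz. transitivity (x * / x)%C; [symmetry; apply Cinv_r, Hx|]. rewrite H. ring.
Qed.

(* [sigma_A] is the inverse of [sigma_{A^-1}] evaluated at [(z / (c tau + d), A tau)]. *)
Lemma sigma_data_neg (a b c d : Z) : (a * d - b * c = 1)%Z -> (c < 0)%Z ->
  sigma_data d (- b) (- c) a -> sigma_data a b c d.
Proof.
  intros Hdet Hc (F & G & HF & HG & Hne & Hi & u & Hu).
  assert (Hcz : (c <> 0)%Z) by lia.
  assert (Hc1 : (RtoC (IZR a) * RtoC (IZR d) - RtoC (IZR b) * RtoC (IZR c))%C = RtoC 1).
  { rewrite <- !RtoC_mult, <- RtoC_minus, <- !mult_IZR, <- minus_IZR, Hdet. reflexivity. }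
  assert (J1 : forall t, jac c d t <> RtoC 0 -> jac (- c) a (mobius a b c d t) = (/ jac c d t)%C).
  { intros t Ht. transitivity ((RtoC (IZR a) * RtoC (IZR d) - RtoC (IZR b) * RtoC (IZR c)) / jac c d t)%C.
    - unfold jac, mobius in *. rewrite opp_IZR, RtoC_opp. field. exact Ht.
    - rewrite Hc1. unfold Cdiv. ring. }
  assert (M1 : forall t, jac c d t <> RtoC 0 -> mobius d (- b) (- c) a (mobius a b c d t) = t).
  { intros t Ht. unfold mobius at 1.
    change (IZR (- c) * mobius a b c d t + IZR a)%C with (jac (- c) a (mobius a b c d t)). rewrite (J1 t Ht).
    transitivity ((RtoC (IZR a) * RtoC (IZR d) - RtoC (IZR b) * RtoC (IZR c)) * t)%C.
    - unfold jac, mobius in *. rewrite opp_IZR, RtoC_opp. field. exact Ht.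
    - rewrite Hc1. ring. }
  assert (D1 : forall t, inD c d t -> inD (- c) a (mobius a b c d t)).
  { intros t Ht. apply inD_slit; [lia|]. rewrite J1 by (apply inD_jac_neq_0, Ht).
    apply slit_inv, inD_slit; assumption. }
  assert (HC : forall K, chol (fun p => inD (- c) a (snd p)) K ->
    chol (fun p => inD c d (snd p)) (fun z t => K (z / jac c d t) (mobius a b c d t))%C).
  { intros K HK p Hp. pose proof (inD_jac_neq_0 _ _ _ Hp) as Hj.
    apply (chol_at_scale_comp K (jac c d) (mobius a b c d)); [exact Hj| |apply HK, D1, Hp].
    pose proof (jac_neq_0_open _ _ _ Hj) as Ho. generalize Ho. apply filter_imp.
    intros w Hw. split; [apply cdiff_jac|apply cdiff_mobius, Hw]. }
  exists (fun z t => G (z / jac c d t) (mobius a b c d t))%C, (fun z t => F (z / jac c d t) (mobius a b c d t))%C.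
  split; [apply HC, HG|split; [apply HC, HF|split; [|split]]].
  - intros t Ht. pose proof (inD_jac_neq_0 _ _ _ Ht) as Hj. destruct (Hne _ (D1 t Ht)) as [[z1 H1] [z2 H2]].
    split; [exists (z2 * jac c d t)%C|exists (z1 * jac c d t)%C].
    + replace (z2 * jac c d t / jac c d t)%C with z2 by (field; exact Hj). exact H2.
    + replace (z1 * jac c d t / jac c d t)%C with z1 by (field; exact Hj). exact H1.
  - intros z t Ht. pose proof (inD_jac_neq_0 _ _ _ Ht) as Hj.
    pose proof (Hi (z / jac c d t)%C _ (D1 t Ht)) as H. rewrite (J1 t Hj) in H.
    replace (- z / jac c d t)%C with (- (z / jac c d t))%C by (field; exact Hj).
    replace (z / jac c d t / / jac c d t)%C with z in H by (field; exact Hj).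
    match type of H with context [e ?x] => replace x with (- (IZR c * (z * z) / (2 * jac c d t)))%C in H
      by (rewrite opp_IZR, RtoC_opp; field; exact Hj) end.
    set (E := (IZR c * (z * z) / (2 * jac c d t))%C) in *.
    transitivity ((F (z / jac c d t) (mobius a b c d t) * F (- (z / jac c d t)) (mobius a b c d t) * sn (z / jac c d t)) * e E)%C; [|ring].
    rewrite H. transitivity (G (z / jac c d t) (mobius a b c d t) * G (- (z / jac c d t)) (mobius a b c d t) * sn z * (e E * e (- E)))%C; [|ring].
    rewrite e_opp. ring.
  - exists (fun t => / u (mobius a b c d t))%C. intros t Ht.
    pose proof (inD_jac_neq_0 c d t (inH_inD a b c d t Hdet Ht)) as Hj.
    destruct (Hu (mobius a b c d t) (inH_mobius a b c d t Hdet Ht)) as [U0 U].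
    split; [apply Cinv_neq_0, U0|]. intros z. pose proof (U (z / jac c d t)%C) as H.
    rewrite (J1 t Hj), (M1 t Hj) in H.
    replace (z / jac c d t / / jac c d t)%C with z in H by (field; exact Hj).
    set (X := G (z / jac c d t)%C (mobius a b c d t)) in *.
    transitivity (/ u (mobius a b c d t) * (u (mobius a b c d t) * F (z / jac c d t) (mobius a b c d t) * varpi (z / jac c d t) (mobius a b c d t)))%C.
    + field. exact U0.
    + rewrite <- H. ring.
Qed.

(* The cocycle relation for [A = A' S T^k], where [T^k] leaves [varpi] unchanged. *)
Lemma sigma_data_step (a b c d k : Z) : (a * d - b * c = 1)%Z -> (0 < c)%Z -> (0 <= c * k - d)%Z ->
  sigma_data (a * k - b) a (c * k - d) c -> sigma_data a b c d.
Proof.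
  intros Hdet Hc Hk (F' & G' & HF' & HG' & Hne & Hi & u' & Hu').
  destruct inversion_continuation as (F & G & HF & HG & H0 & HS & us & Hus).
  (* s is T^k tau, so that A tau is A' applied to - 1 / s. *)
  set (s := fun t : C => (t + RtoC (IZR k))%C).
  assert (Cp : 0 < IZR c) by (apply IZR_lt, Hc).
  assert (Hcz : (c <> 0)%Z) by lia.
  set (c1 := (c * k - d)%Z) in *.
  assert (Kp : 0 <= IZR c1) by (apply IZR_le, Hk).
  assert (Hw : forall t, jac c d t = (RtoC (IZR c) * s t - RtoC (IZR c1))%C).
  { intros t. unfold jac, s, c1. rewrite minus_IZR, mult_IZR, RtoC_minus, RtoC_mult. ring. }
  assert (S1 : forall t, inD c d t -> slit (s t)).
  { intros t Ht. apply inD_slit in Ht; [|exact Hcz]. rewrite Hw in Ht. intros [A1 A2]. apply Ht.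
    destruct (s t) as [s1 s2]. simpl in *. subst s2. split; [ring|nra]. }
  assert (S0 : forall t, inD c d t -> s t <> RtoC 0) by (intros; apply slit_neq_0, S1; assumption).
  assert (J1 : forall t, s t <> RtoC 0 -> jac c1 c (- / s t)%C = (jac c d t / s t)%C).
  { intros t Ht. rewrite Hw. unfold jac. field. exact Ht. }
  assert (M1 : forall t, s t <> RtoC 0 -> jac c d t <> RtoC 0 -> mobius (a * k - b) a c1 c (- / s t)%C = mobius a b c d t).
  { intros t Ht Hj. unfold mobius at 1.
    change (IZR c1 * - / s t + IZR c)%C with (jac c1 c (- / s t)%C). rewrite (J1 t Ht). unfold mobius.
    change (IZR c * t + IZR d)%C with (jac c d t).
    replace (IZR a * t + IZR b)%C with (RtoC (IZR a) * s t - RtoC (IZR (a * k - b)))%C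
      by (unfold s; rewrite minus_IZR, mult_IZR, RtoC_minus, RtoC_mult; ring).
    field. split; assumption. }
  assert (D1 : forall t, inD c d t -> inD c1 c (- / s t)%C).
  { intros t Ht. destruct (Z.eq_dec c1 0) as [E|E].
    - right; left. lia.
    - apply inD_slit; [exact E|]. rewrite J1 by (apply S0, Ht). intros [A1 A2].
      pose proof (S0 t Ht) as Hs. pose proof (inD_jac_neq_0 _ _ _ Ht) as Hj. apply inD_slit in Ht; [|exact Hcz].
      (* If r were real and nonpositive, (c - r) s = c1 >= 0 would make s real and nonnegative, and
         c tau + d = r s would lie on the cut. *)
      set (r := (jac c d t / s t)%C) in *.
      assert (E1 : jac c d t = (r * s t)%C) by (unfold r; field; exact Hs).
      assert (E2 : ((RtoC (IZR c) - r) * s t)%C = RtoC (IZR c1)) by (replace ((RtoC (IZR c) - r) * s t)%C with (RtoC (IZR c) * s t - r * s t)%C by ring; rewrite <- E1, Hw; ring).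
      apply Ht. rewrite E1. clearbody r. clear E1. destruct r as [r1 r2], (s t) as [s1 s2]. simpl in *. subst r2.
      pose proof (f_equal fst E2) as E3. pose proof (f_equal snd E2) as E4. simpl in E3, E4.
      assert (s2 = 0) by nra. subst s2. split; [ring|nra]. }
  assert (Ds : forall t, cdiff s t) by (intros t; unfold s; holo).
  assert (HC : forall K L, chol (fun p => inD c1 c (snd p)) K -> chol slit2 L ->
    chol (fun p => inD c d (snd p)) (fun z t => K (z / s t) (- / s t) * L z (s t))%C).
  { intros K L HK HL p Hp.
    apply (chol_at_mult (fun z t => K (z / s t) (- / s t))%C (fun z t => L z (s t))).
    - apply (chol_at_scale_comp K s (fun t => - / s t)%C); [apply S0, Hp| |apply HK, D1, Hp].
      pose proof (inD_open _ _ _ Hp) as Ho. generalize Ho. apply filter_imp.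
      intros w Hww. split; [apply Ds|]. pose proof (S0 _ Hww). holo.
    - apply (chol_at_comp2 L (fun z _ => z) (fun _ t => s t)).
      + apply HL. exact (S1 _ Hp).
      + apply filter_forall. intros q. apply chol_at_fst.
      + apply filter_forall. intros q. apply (chol_at_comp1 s (fun _ t => t)); [apply Ds|apply chol_at_snd]. }
  exists (fun z t => F' (z / s t) (- / s t) * F z (s t))%C, (fun z t => G' (z / s t) (- / s t) * G z (s t))%C.
  split; [apply HC; assumption|split; [apply HC; assumption|split; [|split]]].
  - assert (HN : forall K L t, inD c d t -> chol (fun p => inD c1 c (snd p)) K -> chol slit2 L ->
      (exists z, K z (- / s t)%C <> RtoC 0) -> L (RtoC 0) (s t) <> RtoC 0 ->
      exists z, (K (z / s t) (- / s t) * L z (s t))%C <> RtoC 0).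
    { intros K L t Ht HK HL [z1 H1] H2. pose proof (S0 t Ht) as Hs.
      assert (DK : forall z, cdiff (fun z => K (z / s t) (- / s t))%C z).
      { intros z. apply (cdiff_comp (fun y => K y (- / s t)%C) (fun z => z / s t)%C).
        - apply chol_at_fix_snd, HK, D1, Ht.
        - apply cdiff_div; [exact Hs|apply cdiff_id|apply cdiff_const]. }
      assert (DL : forall z, cdiff (fun z => L z (s t)) z) by (intros z; apply chol_at_fix_snd, HL, S1, Ht).
      assert (N : dense_neq0 (fun z => K (z / s t) (- / s t) * L z (s t))%C).
      { apply (dense_neq0_mult (fun z => K (z / s t) (- / s t))%C (fun z => L z (s t))).
        - intros z. apply (cdiff_ccont (fun z => K (z / s t) (- / s t))%C), DK.
        - apply entire_dense_neq0 with (z1 * s t)%C; [exact DK|]. replace (z1 * s t / s t)%C with z1 by (field; exact Hs). exact H1.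
        - apply entire_dense_neq0 with (RtoC 0); [exact DL|exact H2]. }
      destruct (N (RtoC 0) 1 Rlt_0_1) as (z & _ & Hz). exists z. exact Hz. }
    intros t Ht. destruct (Hne _ (D1 t Ht)) as [N1 N2]. destruct (H0 _ (S1 t Ht)) as [N3 N4].
    split; apply HN; assumption.
  - intros z t Ht. pose proof (S0 t Ht) as Hs. pose proof (inD_jac_neq_0 _ _ _ Ht) as Hj.
    pose proof (Hi (z / s t)%C _ (D1 t Ht)) as E1. rewrite (J1 t Hs) in E1.
    pose proof (HS z _ (S1 t Ht)) as E2.
    replace (z / s t / (jac c d t / s t))%C with (z / jac c d t)%C in E1 by (field; split; assumption).
    replace (- z / s t)%C with (- (z / s t))%C by (field; exact Hs).
    transitivity ((F' (z / s t) (- / s t) * F' (- (z / s t)) (- / s t)) * (F z (s t) * F (- z) (s t) * sn z))%C; [ring|].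
    rewrite E2, <- e_Cexp.
    transitivity ((F' (z / s t) (- / s t) * F' (- (z / s t)) (- / s t) * sn (z / s t)) * (G z (s t) * G (- z) (s t) * e (z * z / (2 * s t))))%C; [ring|].
    rewrite E1.
    (* The quadratic exponents of the two steps add up because c1 + (c tau + d) = c s. *)
    replace (IZR c * (z * z) / (2 * jac c d t))%C with (IZR c1 * (z / s t * (z / s t)) / (2 * (jac c d t / s t)) + z * z / (2 * s t))%C.
    + rewrite e_plus. ring.
    + transitivity ((RtoC (IZR c1) + jac c d t) * (z * z) / (2 * jac c d t * s t))%C.
      * field. split; assumption.
      * rewrite (Hw t) at 1. field. split; assumption.
  - exists (fun t => u' (- / s t) * us (s t))%C. intros t Ht.
    pose proof (inH_inD a b c d t Hdet Ht) as HD. pose proof (S0 t HD) as Hs. pose proof (inD_jac_neq_0 _ _ _ HD) as Hj.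
    assert (Hst : inH (s t)) by (unfold inH, s in *; destruct t; simpl in *; lra).
    destruct (Hus _ Hst) as [U0 U]. destruct (Hu' _ (inH_neg_inv _ Hst)) as [V0 V].
    split; [apply Cmult_neq_0; assumption|]. intros z.
    pose proof (V (z / s t)%C) as V1. pose proof (U z) as U1. rewrite (J1 t Hs), (M1 t Hs Hj) in V1.
    replace (z / s t / (jac c d t / s t))%C with (z / jac c d t)%C in V1 by (field; split; assumption).
    rewrite (varpi_shift_tau z t k : varpi z (s t) = varpi z t) in U1.
    transitivity ((varpi (z / jac c d t) (mobius a b c d t) * G' (z / s t) (- / s t)) * G z (s t))%C; [ring|].
    rewrite V1. transitivity (u' (- / s t) * F' (z / s t) (- / s t) * (varpi (z / s t) (- / s t) * G z (s t)))%C; [ring|].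
    rewrite U1. ring.
Qed.

(** Descent on the lower left entry. For c = 0 the condition on d selects the translations; it
    persists because the next lower right entry is c > 0, which divides 1 once the next lower left
    entry is 0. *)
Lemma sigma_data_nonneg (c : Z) : (0 <= c)%Z -> forall a b d, (a * d - b * c = 1)%Z -> (c = 0 -> d = 1)%Z -> sigma_data a b c d.
Proof.
  revert c. refine (Zlt_0_ind (fun c => forall a b d, (a * d - b * c = 1)%Z -> (c = 0 -> d = 1)%Z -> sigma_data a b c d) _).
  intros c IH Hc0 a b d Hdet Hd. destruct (Z.eq_dec c 0) as [->|Hc].
  - rewrite (Hd eq_refl) in *. replace a with 1%Z by lia. apply sigma_data_shift.
  (* The ceiling of d / c, which places c * k - d between 0 and c - 1. *)
  - set (k := (- ((- d) / c))%Z).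
    assert (Hk : (0 <= c * k - d < c)%Z).
    { pose proof (Z_div_mod_eq_full (- d) c). pose proof (Z.mod_pos_bound (- d) c). unfold k. lia. }
    apply (sigma_data_step a b c d k Hdet ltac:(lia) (proj1 Hk)). apply IH; [exact Hk|lia|].
    intros E. assert (E1 : (c * (a * k - b) = 1)%Z) by (rewrite <- Hdet; replace d with (c * k)%Z by lia; ring).
    destruct (Z.eq_mul_1 _ _ E1); lia.
Qed.

Theorem sigma_data_all (a b c d : Z) : (a * d - b * c = 1)%Z -> sigma_data a b c d.
Proof.
  intros Hdet. destruct (Z_lt_le_dec c 0) as [Hn|Hn].
  - apply sigma_data_neg; [exact Hdet|exact Hn|]. apply sigma_data_nonneg; lia.
  - destruct (Z.eq_dec c 0) as [->|Hc]; [|apply sigma_data_nonneg; [exact Hn|exact Hdet|lia]].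
    destruct (Z.eq_dec d 1) as [->|Hd]; [apply sigma_data_nonneg; [lia|exact Hdet|lia]|].
    assert (d = -1)%Z.
    { assert (a * d = 1)%Z by lia. destruct (Z.eq_mul_1 d a ltac:(lia)); lia. }
    subst d. replace a with (-1)%Z by lia. apply sigma_data_neg_shift.
Qed.

(** * The multiplier and the theorem *)

Lemma eta_varpi (t : C) : eta t = (e (t / 24) * varpi t t)%C.
Proof.
  unfold eta, varpi. f_equal. apply infprod_ext. intros k. f_equal. f_equal.
  rewrite S_INR, RtoC_plus. ring.
Qed.

Lemma Cmult_cancel (k x y : C) : k <> RtoC 0 -> (k * x)%C = (k * y)%C -> x = y.
Proof.
  intros Hk H. transitivity (/ k * (k * x))%C; [field; exact Hk|]. rewrite H. field. exact Hk.
Qed.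

(** Extracts the double zero at z = 0, since (1 - e z) (1 - e(- z)) = - (sn z)^2. *)
Lemma varpi_refl (z t : C) : inH t ->
  (varpi z t * varpi (- z) t)%C = (- (sn z * sn z) * (varpi (z + t) t * varpi (- z + t) t))%C.
Proof.
  intros Ht. rewrite (varpi_step z t Ht), (varpi_step (- z) t Ht).
  assert (E : ((1 - e z) * (1 - e (- z)))%C = (- (sn z * sn z))%C).
  { unfold sn. pose proof (e_opp z) as E1. pose proof (e_opp (z / 2)) as E2.
    assert (E3 : (e (z / 2) * e (z / 2))%C = e z) by (rewrite <- e_plus; f_equal; field; apply RtoC_neq_0; lra).
    assert (E4 : (e (- (z / 2)) * e (- (z / 2)))%C = e (- z)) by (rewrite <- e_plus; f_equal; field; apply RtoC_neq_0; lra).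
    transitivity (1 - e z - e (- z) + e z * e (- z))%C; [ring|]. rewrite E1, <- E3, <- E4.
    transitivity (1 + 1 - e (z / 2) * e (z / 2) - e (- (z / 2)) * e (- (z / 2)))%C; [ring|].
    rewrite <- E2 at 1. rewrite <- E2 at 1. ring. }
  rewrite <- E. ring.
Qed.

Lemma dense_opp (f : C -> C) : dense_neq0 f -> dense_neq0 (fun z => f (- z)%C).
Proof.
  intros Hf z0 d Hd. destruct (Hf (- z0)%C d Hd) as (z & H1 & H2). exists (- z)%C. split.
  - replace (- z - z0)%C with (- (z - - z0))%C by ring. rewrite Cmod_opp. exact H1.
  - replace (- - z)%C with z by ring. exact H2.
Qed.

Lemma dense_sn (w : C) : w <> RtoC 0 -> dense_neq0 (fun z => sn (z / w))%C.
Proof.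
  intros Hw. apply entire_dense_neq0 with (w / 2)%C.
  - intros z. holo.
  - replace (w / 2 / w)%C with (/ 2)%C by (field; repeat split; try exact Hw; apply RtoC_neq_0; lra). apply sn_half_neq_0.
Qed.

(** By [varpi_refl] and the sine product both sides contain z sn(z / w) sn z. Once this is cancelled
    by [dense_eq], the remaining functions are continuous at 0 and are evaluated there, which
    replaces a limit. *)
Lemma quotient_limit (t A w q m : C) : inH t -> inH A -> w <> RtoC 0 ->
  (forall z, (varpi (z / w) A * varpi (- (z / w)) A * sn z)%C =
     (q * (sn (z / w) * e (m * (z * z) / (2 * w))) * (varpi z t * varpi (- z) t))%C) ->
  (varpi A A * varpi A A / w)%C = (q * (varpi t t * varpi t t))%C.
Proof.
  intros Ht HA Hw H. destruct sn_bfun as (K & beta & K0 & Hsn).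
  (* T z is sn z / (K z) with the singularity at 0 removed. *)
  set (T := fun z => (Cexp (beta * (z * z)) * (bfun z * bfun (- z)))%C).
  assert (DT : forall z, cdiff T z).
  { intros z. unfold T. holo. }
  assert (T0 : T (RtoC 0) = RtoC 1).
  { unfold T. replace (- (0))%C with (RtoC 0) by ring. replace (beta * (0 * 0))%C with (RtoC 0) by ring.
    rewrite bfun_0, Cexp_0. ring. }
  set (R := fun s z => (varpi (z + s) s * varpi (- z + s) s)%C).
  assert (DR : forall s z, inH s -> cdiff (R s) z).
  { intros s z Hs. unfold R. holo. }
  assert (E : (T (0 / w) * R A (0 / w) / w)%C = (q * (e (m * (0 * 0) / (2 * w)) * (T (RtoC 0) * R t (RtoC 0))))%C).
  { apply (dense_eq (fun z => z * (sn (z / w) * sn z))%C (fun z => T (z / w) * R A (z / w) / w)%C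
      (fun z => q * (e (m * (z * z) / (2 * w)) * (T z * R t z)))%C).
    - apply (dense_neq0_mult (fun z => z) (fun z => sn (z / w) * sn z)%C).
      + intros z. cont.
      + apply entire_dense_neq0 with (RtoC 1); [intros; holo|apply C1_nz].
      + apply (dense_neq0_mult (fun z => sn (z / w))%C sn).
        * intros z. cont.
        * apply dense_sn, Hw.
        * apply entire_dense_neq0 with (/ 2)%C; [intros; apply cdiff_sn|apply sn_half_neq_0].
    - pose proof (fun z => DR A z HA). cont.
    - pose proof (fun z => DR t z Ht). cont.
    - apply filter_forall. match goal with |- forall x, @?P x => change (forall x : C, P x) end. cbv beta. intros z.
      pose proof (H z) as E. rewrite (varpi_refl (z / w) A HA), (varpi_refl z t Ht) in E.
      fold (R A (z / w)%C) in E. fold (R t z) in E.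
      pose proof (Hsn z) as H1. pose proof (Hsn (z / w)%C) as H2. fold (T z) in H1. fold (T (z / w)%C) in H2.
      assert (C1 : (K * (z * (sn (z / w) * sn z) * (T (z / w) * R A (z / w) / w)))%C =
        (- (- (sn (z / w) * sn (z / w)) * R A (z / w) * sn z))%C).
      { transitivity (K * (z / w) * T (z / w) * (sn (z / w) * sn z * R A (z / w)))%C; [field; exact Hw|].
        rewrite <- H2. ring. }
      assert (C2 : (K * (z * (sn (z / w) * sn z) * (q * (e (m * (z * z) / (2 * w)) * (T z * R t z)))))%C =
        (- (q * (sn (z / w) * e (m * (z * z) / (2 * w))) * (- (sn z * sn z) * R t z)))%C).
      { transitivity (K * z * T z * (q * sn (z / w) * sn z * e (m * (z * z) / (2 * w)) * R t z))%C; [ring|].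
        rewrite <- H1. ring. }
      apply (Cmult_cancel K _ _ K0). rewrite C1, C2, E. reflexivity. }
  replace (0 / w)%C with (RtoC 0) in E by (field; exact Hw). rewrite T0 in E. unfold R in E.
  replace (m * (0 * 0) / (2 * w))%C with (RtoC 0) in E by (unfold Cdiv; ring). rewrite e_0 in E.
  replace (- (0) + A)%C with A in E by ring. replace (- (0) + t)%C with t in E by ring.
  rewrite !Cplus_0_l in E. rewrite !Cmult_1_l in E. exact E.
Qed.

(** By [eta_varpi], eta(t)^2 is e(t / 12) varpi(t, t)^2, so the value at z = 0 from [quotient_limit]
    is the transformation law of eta^2 up to the exponential in the conclusion. *)
Lemma multiplier_sq (a b c d : Z) (psi2 t q : C) (F G : C -> C) :
  (a * d - b * c = 1)%Z -> inH t ->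
  let w := jac c d t in let A := mobius a b c d t in
  (eta A * eta A)%C = (psi2 * w * (eta t * eta t))%C ->
  (forall z, cdiff F z) -> (forall z, cdiff G z) -> (exists z, G z <> RtoC 0) ->
  (forall z, (F z * F (- z) * sn z)%C =
     (G z * G (- z) * (sn (z / w) * e (RtoC (IZR c) * (z * z) / (2 * w))))%C) ->
  (forall z, (varpi (z / w) A * G z)%C = (q * F z * varpi z t)%C) ->
  (q * q)%C = (psi2 * e ((t - A) / 12))%C.
Proof.
  intros Hdet Ht w A Heta HF HG [zg Hzg] Hi Hii.
  assert (Hw : w <> RtoC 0) by (apply (inD_jac_neq_0 c d t), (inH_inD a b c d t Hdet Ht)).
  assert (HA : inH A) by (apply inH_mobius; assumption).
  assert (DV : forall z, cdiff (fun z => varpi (z / w) A) z).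
  { intros z. holo. }
  assert (Dn : forall f : C -> C, (forall z, cdiff f z) -> forall z, cdiff (fun z => f (- z)%C) z).
  { intros f Hf z. holo. }
  assert (DG : dense_neq0 G) by (apply entire_dense_neq0 with zg; assumption).
  assert (E : forall z, (varpi (z / w) A * varpi (- (z / w)) A * sn z)%C =
     (q * q * (sn (z / w) * e (IZR c * (z * z) / (2 * w))) * (varpi z t * varpi (- z) t))%C).
  { intros z0.
    apply (dense_eq (fun z => G z * G (- z))%C (fun z => varpi (z / w) A * varpi (- (z / w)) A * sn z)%C
      (fun z => q * q * (sn (z / w) * e (IZR c * (z * z) / (2 * w))) * (varpi z t * varpi (- z) t))%C z0).
    - apply (dense_neq0_mult G (fun z => G (- z)%C)); [intros z; cont|exact DG|apply dense_opp, DG].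
    - cont.
    - cont.
    - apply filter_forall. match goal with |- forall x, @?P x => change (forall x : C, P x) end. cbv beta. intros z.
      pose proof (Hii z) as E1. pose proof (Hii (- z)%C) as E2.
      replace (- z / w)%C with (- (z / w))%C in E2 by (field; exact Hw).
      transitivity ((varpi (z / w) A * G z) * (varpi (- (z / w)) A * G (- z)) * sn z)%C; [ring|].
      rewrite E1, E2.
      transitivity (q * q * (F z * F (- z) * sn z) * (varpi z t * varpi (- z) t))%C; [ring|].
      rewrite Hi. ring. }
  pose proof (quotient_limit t A w (q * q)%C (RtoC (IZR c)) Ht HA Hw E) as L.
  rewrite !eta_varpi in Heta. pose proof (varpi_tau_neq_0 t Ht) as P0.
  assert (E12 : forall x, (e (x / 24) * e (x / 24))%C = e (x / 12)).
  { intros x. rewrite <- e_plus. f_equal. field. }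
  assert (H1 : (e (A / 12) * (varpi A A * varpi A A / w))%C = (psi2 * (e (t / 12) * (varpi t t * varpi t t)))%C).
  { rewrite <- !E12.
    transitivity (e (A / 24) * varpi A A * (e (A / 24) * varpi A A) / w)%C; [field; exact Hw|].
    rewrite Heta. field. exact Hw. }
  rewrite L in H1.
  apply (Cmult_cancel (varpi t t * varpi t t * e (A / 12))).
  - apply Cmult_neq_0; [apply Cmult_neq_0; exact P0|apply e_neq_0].
  - transitivity (e (A / 12) * (q * q * (varpi t t * varpi t t)))%C; [ring|]. rewrite H1.
    replace (e (t / 12)) with (e (A / 12) * e ((t - A) / 12))%C.
    + ring.
    + rewrite <- e_plus. f_equal. field.
Qed.

(** Where the squares agree, v t is v t0 or - v t0; near t0 the sum v t + v t0 stays away from 0,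
    which excludes the second value. *)
Lemma sq_eq_locally (v : C -> C) (t0 k : C) :
  ccont v t0 -> v t0 <> RtoC 0 -> locally t0 (fun t => (v t * v t)%C = k) ->
  locally t0 (fun t => v t = v t0).
Proof.
  intros Hc H0 Hk. pose proof (locally_singleton _ _ Hk) as Hk0. cbv beta in Hk0.
  assert (Hs : cvg (locally t0) (fun t => v t + v t0)%C (v t0 + v t0)%C) by (apply (ccont_plus v (fun _ => v t0) t0 Hc), ccont_const).
  assert (H2 : (v t0 + v t0)%C <> RtoC 0).
  { replace (v t0 + v t0)%C with (2 * v t0)%C by ring. apply Cmult_neq_0; [apply RtoC_neq_0; lra|exact H0]. }
  pose proof (cvg_near_neq _ _ _ _ Hs H2) as Hn. generalize (filter_and _ _ Hk Hn). apply filter_imp.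
  intros t [E1 E2]. apply NNPP. intros Hne. apply (Cmult_neq_0 _ _ (C_sub_neq_0 _ _ Hne) E2).
  transitivity (v t * v t - v t0 * v t0)%C; [ring|]. rewrite E1, Hk0. ring.
Qed.

Lemma locally_slice (Om : C * C -> Prop) (z t : C) : open Om -> Om (z, t) -> locally z (fun w => Om (w, t)).
Proof.
  intros Ho Hz. pose proof (Ho _ Hz) as H. apply locally_Cmod2 in H. destruct H as (d & Hd & H).
  apply locally_Cmod. exists d. split; [exact Hd|]. intros w Hw. apply H; simpl; [exact Hw|].
  replace (t - t)%C with (RtoC 0) by ring. rewrite Cmod_0. exact Hd.
Qed.

Lemma cdiff_twist (a b c d : Z) (n t : C) : n <> RtoC 0 -> jac c d t <> RtoC 0 ->
  cdiff (fun t => e ((t - mobius a b c d t) / n))%C t.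
Proof. intros Hn Hj. pose proof (cdiff_mobius a b c d t Hj). holo. Qed.

Theorem theorem4p31 (a b c d : Z) (hdet : (a * d - b * c = 1)%Z)
  (psi2 : C)
  (hpsi2 : forall tau : C, inH tau ->
     Cmult (eta (mobius a b c d tau)) (eta (mobius a b c d tau)) =
     Cmult (Cmult psi2 (jac c d tau)) (Cmult (eta tau) (eta tau)))
  (Om : C * C -> Prop) (S : C -> C -> C)
  (hS : sigma_continuation a b c d Om S)
  (z tau : C)
  (hz : Om (z, tau)) (hmz : Om (Copp z, tau))
  (hden : e (Cdiv z (RtoC 2)) <> e (Copp (Cdiv z (RtoC 2)))) :
  Cmult (S z tau) (S (Copp z) tau) =
  Cmult (Cmult psi2
    (Cdiv (Cminus (e (Cdiv z (Cmult (RtoC 2) (jac c d tau))))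
                  (e (Copp (Cdiv z (Cmult (RtoC 2) (jac c d tau))))))
          (Cminus (e (Cdiv z (RtoC 2))) (e (Copp (Cdiv z (RtoC 2)))))))
    (e (Cplus (Cdiv (Cminus tau (mobius a b c d tau)) (RtoC 12))
              (Cdiv (Cmult (RtoC (IZR c)) (Cmult z z)) (Cmult (RtoC 2) (jac c d tau))))).
Proof.
  destruct hS as (HD & Hconn & [Hopen Hholo] & [p0 [Hp0 Hp0H]] & Hdef).
  destruct (sigma_data_all a b c d hdet) as (F & G & HF & HG & Hne & Hi & u & Hu).
  assert (N24 : RtoC 24 <> RtoC 0) by (apply RtoC_neq_0; lra).
  assert (DFz : forall t, inD c d t -> forall z, cdiff (fun z => F z t) z) by (intros t Ht y; apply chol_at_fix_snd, HF, Ht).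
  assert (DGz : forall t, inD c d t -> forall z, cdiff (fun z => G z t) z) by (intros t Ht y; apply chol_at_fix_snd, HG, Ht).
  assert (DG : forall t, inD c d t -> dense_neq0 (fun z => G z t)).
  { intros t Ht. destruct (proj2 (Hne t Ht)) as [z1 Hz1]. apply entire_dense_neq0 with z1; [apply DGz, Ht|exact Hz1]. }
  assert (HHD : forall t, inH t -> inD c d t) by (intros t; apply (inH_inD a b c d t hdet)).
  (* Dividing u by a square root of e((t - A t) / 12) leaves a function whose square is the constant
     psi2, so that only its sign can vary. *)
  set (v := fun t => (u t / e ((t - mobius a b c d t) / 24))%C).
  assert (Hv : forall t, inH t -> (v t * v t)%C = psi2).
  { intros t Ht. pose proof (HHD t Ht) as HDt. destruct (Hu t Ht) as [_ U].
    pose proof (multiplier_sq a b c d psi2 t (u t) (fun z => F z t) (fun z => G z t) hdet Ht (hpsi2 t Ht)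
      (DFz t HDt) (DGz t HDt) (proj2 (Hne t HDt)) (fun z => Hi z t HDt) U) as E.
    unfold v. pose proof (e_neq_0 ((t - mobius a b c d t) / 24)%C) as N.
    transitivity (u t * u t / (e ((t - mobius a b c d t) / 24) * e ((t - mobius a b c d t) / 24)))%C; [field; exact N|].
    rewrite E. replace ((t - mobius a b c d t) / 12)%C with ((t - mobius a b c d t) / 24 + (t - mobius a b c d t) / 24)%C by field.
    rewrite e_plus. field. exact N. }
  set (t0 := snd p0) in *. pose proof (HHD t0 Hp0H) as HD0.
  (* Nothing is known about u as a function of t. At a point z1 where F and [varpi] do not vanish,
     its defining relation exhibits it near t0 as a quotient of functions differentiable in t. *)
  assert (Hvc : ccont v t0).
  { assert (N1 : dense_neq0 (fun z => F z t0 * varpi z t0)%C).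
    { apply (dense_neq0_mult (fun z => F z t0) (fun z => varpi z t0)).
      - intros y. apply (cdiff_ccont (fun z => F z t0)), DFz, HD0.
      - destruct (proj1 (Hne t0 HD0)) as [z1 Hz1]. apply entire_dense_neq0 with z1; [apply DFz, HD0|exact Hz1].
      - destruct (varpi_not_zero t0 Hp0H) as [z1 Hz1]. apply entire_dense_neq0 with z1; [intros y; apply cdiff_varpi, Hp0H|exact Hz1]. }
    destruct (N1 (RtoC 0) 1 Rlt_0_1) as (z1 & _ & Hz1).
    set (D := fun t => (F z1 t * varpi z1 t)%C).
    assert (DD : cdiff D t0).
    { apply (cdiff_mult (fun t => F z1 t) (fun t => varpi z1 t)); [apply chol_at_fix_fst, HF, HD0|apply chol_at_fix_fst, chol_varpi, Hp0H]. }
    assert (Hl : locally t0 (fun t => ((varpi (z1 / jac c d t) (mobius a b c d t) * G z1 t) / D t / e ((t - mobius a b c d t) / 24))%C = v t)).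
    { pose proof (cvg_near_neq _ D (D t0) (RtoC 0) (cdiff_ccont D t0 DD) Hz1) as H1.
      generalize (filter_and _ _ H1 (inH_open t0 Hp0H)). apply filter_imp. intros t [H2 H3].
      unfold v. f_equal. destruct (Hu t H3) as [_ U]. rewrite U. unfold D in *. field.
      split; intros E; apply H2; rewrite E; ring. }
    assert (Dv : cdiff v t0).
    { apply (cdiff_ext_loc _ v t0 Hl).
      pose proof (inD_jac_neq_0 _ _ _ HD0) as Hj.
      apply (cdiff_div (fun t => varpi (z1 / jac c d t) (mobius a b c d t) * G z1 t / D t)%C (fun t => e ((t - mobius a b c d t) / 24))%C);
        [apply e_neq_0| |apply cdiff_twist; assumption].
      apply (cdiff_div (fun t => varpi (z1 / jac c d t) (mobius a b c d t) * G z1 t)%C D); [exact Hz1| |exact DD].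
      apply (cdiff_mult (fun t => varpi (z1 / jac c d t) (mobius a b c d t))%C (fun t => G z1 t)); [|apply chol_at_fix_fst, HG, HD0].
      apply (chol_at_fix_fst (fun z t => varpi (z / jac c d t) (mobius a b c d t))%C z1 t0).
      apply (chol_at_scale_comp varpi (jac c d) (mobius a b c d) (z1, t0)); [exact Hj| |].
      - generalize (jac_neq_0_open _ _ _ Hj). apply filter_imp. intros w Hw. split; [apply cdiff_jac|apply cdiff_mobius, Hw].
      - apply chol_varpi. exact (inH_mobius a b c d t0 hdet Hp0H). }
    apply cdiff_ccont, Dv. }
  set (v0 := v t0) in *.
  (* The sign is constant near t0; the identity theorem asks for the relation only near the point
     [p0] of Om. *)
  assert (Hloc : locally t0 (fun t => v t = v0)).
  { apply sq_eq_locally with psi2; [exact Hvc| |].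
    - unfold v0, v. unfold Cdiv. apply Cmult_neq_0; [apply (Hu t0 Hp0H)|apply Cinv_neq_0, e_neq_0].
    - generalize (inH_open t0 Hp0H). apply filter_imp. exact Hv. }
  (* This coincides with u near t0 and makes sense on all of D_A. *)
  set (T := fun t => (v0 * e ((t - mobius a b c d t) / 24))%C).
  assert (HSG : forall z t, Om (z, t) -> (S z t * G z t - T t * F z t)%C = RtoC 0).
  { apply (identity_domain Om (fun z t => S z t * G z t - T t * F z t)%C Hopen Hconn).
    - intros y t Hyt. pose proof (HD _ Hyt) as HDt. simpl in HDt. destruct (Hholo _ Hyt) as (_ & Dz & Dt). simpl in Dz, Dt. split.
      + apply (cdiff_minus (fun w => S w t * G w t)%C (fun w => T t * F w t)%C).
        * apply (cdiff_mult (fun w => S w t) (fun w => G w t)); [exact Dz|apply DGz, HDt].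
        * apply (cdiff_mult (fun _ => T t) (fun w => F w t)); [apply cdiff_const|apply DFz, HDt].
      + apply (cdiff_minus (fun w => S y w * G y w)%C (fun w => T w * F y w)%C).
        * apply (cdiff_mult (fun w => S y w) (fun w => G y w)); [exact Dt|apply chol_at_fix_fst, HG, HDt].
        * apply (cdiff_mult T (fun w => F y w)); [|apply chol_at_fix_fst, HF, HDt].
          apply (cdiff_mult (fun _ => v0) (fun t => e ((t - mobius a b c d t) / 24))%C); [apply cdiff_const|].
          apply cdiff_twist; [exact N24|apply inD_jac_neq_0, HDt].
    - exists p0. split; [exact Hp0|].
      pose proof (locally_snd p0 _ (filter_and _ _ (inH_open t0 Hp0H) Hloc)) as H1.
      generalize (filter_and _ _ (Hopen p0 Hp0) H1). apply filter_imp.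
      intros [y t] (H2 & H3 & H4). simpl in H3, H4 |- *. pose proof (HHD t H3) as HDt.
      destruct (Hu t H3) as [_ U]. assert (Tu : T t = u t).
      { unfold T. rewrite <- H4. unfold v. field. apply e_neq_0. }
      rewrite Tu. assert (E : (S y t * G y t)%C = (u t * F y t)%C); [|rewrite E; ring].
      (* S is prescribed only where [varpi] does not vanish, so the relation is multiplied by
         [varpi] and the factor is cancelled by density. *)
      apply (dense_eq (fun z => varpi z t) (fun z => S z t * G z t)%C (fun z => u t * F z t)%C y).
      + destruct (varpi_not_zero t H3) as [z1 Hz1]. apply entire_dense_neq0 with z1; [intros w; apply cdiff_varpi, H3|exact Hz1].
      + apply (cdiff_ccont (fun z => S z t * G z t)%C).
        apply (cdiff_mult (fun z => S z t) (fun z => G z t)); [exact (proj1 (proj2 (Hholo _ H2)))|apply DGz, HDt].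
      + apply (cdiff_ccont (fun z => u t * F z t)%C).
        apply (cdiff_mult (fun _ => u t) (fun z => F z t)); [apply cdiff_const|apply DFz, HDt].
      + generalize (locally_slice Om y t Hopen H2). apply filter_imp. intros w Hw.
        destruct (classic (varpi w t = RtoC 0)) as [E|E]; [rewrite E; ring|].
        rewrite (Hdef w t Hw H3 E).
        transitivity (varpi (w / jac c d t) (mobius a b c d t) * G w t)%C; [field; exact E|].
        rewrite U. ring. }
  pose proof (HD _ hz) as HDt. simpl in HDt. pose proof (inD_jac_neq_0 _ _ _ HDt) as Hj.
  set (w := jac c d tau) in *. set (A := mobius a b c d tau) in *.
  assert (E : (S z tau * S (- z) tau * sn z)%C =
    (v0 * v0 * (e ((tau - A) / 12)) * (sn (z / w) * e (IZR c * (z * z) / (2 * w))))%C).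
  (* Both (y, tau) and (- y, tau) belong to Om for y near z, because Om is open; there the relation
     for S holds at y and at - y. The factor G(z) G(- z) may vanish at z itself and is cancelled by
     density. *)
  { apply (dense_eq (fun z => G z tau * G (- z) tau)%C (fun z => S z tau * S (- z) tau * sn z)%C
      (fun z => v0 * v0 * (e ((tau - A) / 12)) * (sn (z / w) * e (IZR c * (z * z) / (2 * w))))%C z).
    - apply (dense_neq0_mult (fun z => G z tau) (fun z => G (- z)%C tau)).
      + intros y. apply (cdiff_ccont (fun z => G z tau)), DGz, HDt.
      + apply DG, HDt.
      + apply (dense_opp (fun z => G z tau)), DG, HDt.
    - pose proof (proj1 (proj2 (Hholo _ hz))). pose proof (proj1 (proj2 (Hholo _ hmz))). cont.
    - cont.
    - assert (Hneg : locally z (fun y => Om (- y, tau)%C)).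
      { pose proof (cdiff_ccont (fun y => - y)%C z (cdiff_opp (fun y => y) z (cdiff_id z))) as Hc.
        apply (proj2 (filterlim_cvg (locally z) (fun y => - y)%C _)) in Hc.
        exact (Hc _ (locally_slice Om _ _ Hopen hmz)). }
      generalize (filter_and _ _ (locally_slice Om _ _ Hopen hz) Hneg). apply filter_imp. intros y [Y1 Y2].
      assert (K1 : (S y tau * G y tau)%C = (T tau * F y tau)%C).
      { transitivity (S y tau * G y tau - T tau * F y tau + T tau * F y tau)%C; [ring|]. rewrite (HSG _ _ Y1). ring. }
      assert (K2 : (S (- y) tau * G (- y) tau)%C = (T tau * F (- y) tau)%C).
      { transitivity (S (- y) tau * G (- y) tau - T tau * F (- y) tau + T tau * F (- y) tau)%C; [ring|]. rewrite (HSG _ _ Y2). ring. }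
      transitivity ((S y tau * G y tau) * (S (- y) tau * G (- y) tau) * sn y)%C; [ring|]. rewrite K1, K2.
      transitivity (T tau * T tau * (F y tau * F (- y) tau * sn y))%C; [ring|]. rewrite (Hi y tau HDt). fold w. unfold T. fold A.
      replace ((tau - A) / 12)%C with ((tau - A) / 24 + (tau - A) / 24)%C by field.
      rewrite e_plus. ring. }
  unfold v0 in E. rewrite (Hv t0 Hp0H) in E. rewrite e_plus.
  assert (Hsn0 : sn z <> RtoC 0) by (apply C_sub_neq_0, hden).
  apply (Cmult_cancel (sn z)); [exact Hsn0|].
  transitivity (S z tau * S (- z) tau * sn z)%C; [ring|]. rewrite E.
  replace (z / (2 * w))%C with (z / w / 2)%C by (field; exact Hj).
  change (e (z / w / 2) - e (- (z / w / 2)))%C with (sn (z / w)).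
  change (e (z / 2) - e (- (z / 2)))%C with (sn z). field. exact Hsn0.
Qed.
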